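(* The $\epsilon$-SPE threshold problem for mean-payoff games is decidable, and can be solved in doubly exponential time.
   Context: A mean-payoff game is $G=(\Pi,V,(V_i)_{i\in\Pi},E,\mu)$ with finite player set $\Pi$, finite directed graph $(V,E)$ in which every vertex has an outgoing edge, partition $(V_i)$ of $V$ ($V_i$ = vertices controlled by player $i$), and reward functions $r_j:E\to\mathbb{Q}$ with $\mu_j(\rho)=\liminf_n\frac1n\sum_{k=0}^{n-1}r_j(\rho_k\rho_{k+1})$ for every play (infinite path) $\rho$. A strategy for player $i$ from $v_0$ maps each history (finite path) $hv$ from $v_0$ with $v\in V_i$ to a successor of $v$; a complete profile $\bar\sigma$ has outcome $\langle\bar\sigma\rangle$; for a history $hv$, $\bar\sigma_{\|hv}$ is the profile from $v$ with $\sigma_{j\|hv}(h')=\sigma_j(hh')$; $-i=\Pi\setminus\{i\}$. For $\epsilon\ge0$, $\bar\sigma$ from $v_0$ is an $\epsilon$-SPE if for every history $hv$ from $v_0$, every player $i$ and every strategy $\sigma'_i$ from $v$, $\mu_i(\langle\bar\sigma_{-i\|hv},\sigma'_i\rangle)\le\mu_i(\langle\bar\sigma_{\|hv}\rangle)+\epsilon$. The $\epsilon$-SPE threshold problem: given a rational $\epsilon\ge0$, a mean-payoff game $G$ with initial vertex $v_0$, and $\bar x,\bar y\in\mathbb{Q}^\Pi$, decide whether there is an $\epsilon$-SPE $\bar\sigma$ from $v_0$ with $\bar x\le\mu(\langle\bar\sigma\rangle)\le\bar y$ componentwise. *)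

(* Defs.v *)
From HB Require Import structures.
From mathcomp Require Import all_boot all_order all_algebra.
From mathcomp Require Import all_classical all_reals all_analysis.
From mathcomp Require Import Rstruct.

Set Implicit Arguments.
Unset Strict Implicit.
Unset Printing Implicit Defensive.

Import Order.TTheory GRing.Theory Num.Theory.

(* Players are 'I_np, vertices are 'I_nv, edges a boolean relation,     *)
(* the owner function gives the partition (V_i), rewards r_j on edges.  *)

Record game := Game {
  np : nat;
  nv : nat;
  own : 'I_nv -> 'I_np;
  edge : rel 'I_nv;
  rew : 'I_np -> 'I_nv -> 'I_nv -> rat  (* only used on edges *)
}.
Arguments own : clear implicits.
Arguments edge : clear implicits.
Arguments rew : clear implicits.

Section Semantics.
Variable G : game.
Local Notation V := 'I_(nv G).
Local Notation P := 'I_(np G).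

Definition no_deadlock : Prop := forall v : V, exists w : V, edge G v w.

Definition is_hist (v : V) (h : seq V) : bool :=
  if h is u :: t then (u == v) && path (edge G) u t else false.

Definition is_play (rho : nat -> V) : Prop := forall k, edge G (rho k) (rho k.+1).

Definition strategy := seq V -> V.
Definition profile := P -> strategy.

Definition strategy_from (i : P) (v : V) (s : strategy) : Prop :=
  forall h, is_hist v h -> own G (last v h) = i -> edge G (last v h) (s h).

Definition profile_from (v : V) (sg : profile) : Prop :=
  forall i, strategy_from i v (sg i).

Fixpoint out_prefix (sg : profile) (v : V) (n : nat) : seq V :=
  match n with
  | 0 => [:: v]
  | n'.+1 => let h := out_prefix sg v n' in
             rcons h (sg (own G (last v h)) h)
  end.

Definition outcome (sg : profile) (v : V) : nat -> V :=
  fun k => last v (out_prefix sg v k).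

Definition mean_payoff (j : P) (rho : nat -> V) : \bar Rdefinitions.R :=
  limn_einf (fun n : nat =>
    ((\sum_(k < n) ratr (rew G j (rho k) (rho k.+1))) / n%:R)%:E).

(* for a history hv = h v, the profile sigma_{|hv} with
   sigma_{j|hv}(h') = sigma_j(h h') *)
Definition hist_prefix (hv : seq V) : seq V :=
  if hv is u :: t then belast u t else [::].

Definition subprofile (sg : profile) (hv : seq V) : profile :=
  fun j h' => sg j (hist_prefix hv ++ h').

Definition deviate (sg : profile) (i : P) (tau : strategy) : profile :=
  fun j => if j == i then tau else sg j.

Definition eps_SPE (eps : rat) (v0 : V) (sg : profile) : Prop :=
  profile_from v0 sg /\
  forall hv, is_hist v0 hv ->
    forall (i : P) (tau : strategy), strategy_from i (last v0 hv) tau ->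
      (mean_payoff i (outcome (deviate (subprofile sg hv) i tau) (last v0 hv))
       <= mean_payoff i (outcome (subprofile sg hv) (last v0 hv)) + (ratr eps)%:E)%E.

End Semantics.

Record instance := Instance {
  igame : game;
  ieps : rat;
  iv0 : 'I_(nv igame);
  ix : 'I_(np igame) -> rat;
  iy : 'I_(np igame) -> rat
}.
Arguments ieps : clear implicits.
Arguments iv0 : clear implicits.
Arguments ix : clear implicits.
Arguments iy : clear implicits.

Definition valid_instance (I : instance) : Prop :=
  (0 <= ieps I)%R /\ no_deadlock (igame I).

Definition threshold_yes (I : instance) : Prop :=
  exists sg : profile (igame I),
    eps_SPE (ieps I) (iv0 I) sg /\
    forall j, ((ratr (ix I j))%:E <= mean_payoff j (outcome sg (iv0 I)))%E /\
              (mean_payoff j (outcome sg (iv0 I)) <= (ratr (iy I j))%:E)%E.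

Fixpoint binrec (fuel n : nat) : seq bool :=
  match fuel with
  | 0 => [::]
  | f.+1 => if n is 0 then [::] else odd n :: binrec f n./2
  end.

Definition bin (n : nat) : seq bool := binrec n n.

(* self-delimiting: each bit b as [true; b], terminator [false; false] *)
Definition encN (n : nat) : seq bool :=
  flatten [seq [:: true; b] | b <- bin n] ++ [:: false; false].

Definition encZ (z : int) : seq bool := (z < 0)%R :: encN `|z|%N.

Definition encQ (q : rat) : seq bool := encZ (numq q) ++ encZ (denq q).

Definition enc (I : instance) : seq bool :=
  let G := igame I in
  encN (np G) ++ encN (nv G) ++ encN (iv0 I) ++ encQ (ieps I) ++
  flatten [seq encN (own G v) | v <- enum 'I_(nv G)] ++
  [seq edge G v w | v <- enum 'I_(nv G), w <- enum 'I_(nv G)] ++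
  flatten [seq (if edge G v w then flatten [seq encQ (rew G j v w) | j <- enum 'I_(np G)]
                else [::]) | v <- enum 'I_(nv G), w <- enum 'I_(nv G)] ++
  flatten [seq encQ (ix I j) ++ encQ (iy I j) | j <- enum 'I_(np G)].

(* Deterministic single-tape Turing machines, tape alphabet            *)
(* {blank, 0, 1} (blank = None), finitely many states.                  *)

Record TM := MkTM {
  nstates : nat;
  start : 'I_nstates;
  (* None = halt; Some (q', written symbol, move right?) *)
  delta : 'I_nstates -> option bool -> option ('I_nstates * option bool * bool);
  accepting : 'I_nstates -> bool
}.
Arguments delta : clear implicits.
Arguments accepting : clear implicits.

Section TMrun.
Variable M : TM.

(* state, tape left of head (nearest first), scanned symbol, tape right *)
Record config := Config {
  cstate : 'I_(nstates M);
  cleft : seq (option bool);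
  chead : option bool;
  cright : seq (option bool)
}.

Definition init_config (w : seq bool) : config :=
  match w with
  | [::] => Config (start M) [::] None [::]
  | b :: t => Config (start M) [::] (Some b) (map Some t)
  end.

Definition step (c : config) : option config :=
  match delta M (cstate c) (chead c) with
  | None => None
  | Some (q, b, true) =>
      Some (Config q (b :: cleft c) (head None (cright c)) (behead (cright c)))
  | Some (q, b, false) =>
      Some (Config q (behead (cleft c)) (head None (cleft c)) (b :: cright c))
  end.

Fixpoint exec (n : nat) (c : config) : option config :=
  match n with
  | 0 => Some c
  | n'.+1 => if step c is Some c' then exec n' c' else None
  end.

Definition decides_within (w : seq bool) (t : nat) (Pr : Prop) : Prop :=
  exists n c, n <= t /\ exec n (init_config w) = Some c /\ step c = None /\
              (accepting M (cstate c) <-> Pr).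

End TMrun.

(* Main.v *)
Require Import Defs.
From mathcomp Require Import all_boot all_order all_algebra.
From mathcomp Require Import all_classical all_reals all_analysis.
From mathcomp Require Import Rstruct perm.
From mathcomp Require Import zify ring lra.

Set Implicit Arguments.
Unset Strict Implicit.
Unset Printing Implicit Defensive.

Import Order.TTheory GRing.Theory Num.Theory.

(** Give every vertex [v] a requirement, the infimum over the histories ending in [v] of what its
    owner may still obtain there up to epsilon.  Equilibria exist exactly when there are
    requirements that can be enforced by a negotiation game at each vertex: a protagonist
    proposes a play together with a promise on the set of vertices it stays in, an
    opponent controlling one player may deviate, and the protagonist wins when the deviator
    never exceeds his requirement and, unless he deviates infinitely often, all requirements of the
    promised vertices are met.  The objective is stable under shuffling of plays, so the
    opponent may be assumed memoryless.  Against a memoryless opponent a winning play is a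
    circulation in a finite graph, and all circulations together with the requirements solve a
    linear system with exponentially many rows, hence by Cramer's rule have a solution with
    exponentially many bits.  The existence of such a certificate is a formula of arithmetic with all
    quantifiers below a doubly exponential bound, and is evaluated by brute force on a counter machine
    whose registers are written in unary on the Turing tape. *)

(** * Counter machines on a Turing tape *)

(** Limit inferiors explain the detour through memoryless opponents. An upper bound on a limit
    inferior does not survive shuffling, so [Win] keeps the limit superior of the deviator's payoff
    below his requirement, whereas an equilibrium only bounds the limit inferior. Against a fixed
    memoryless opponent the gap closes: good averages at a recurrent position yield a circulation,
    and repeating it makes the averages converge.

    Memoryless opponents are doubly exponentially many, too many for one block of unknowns each.
    Where deviations stop, an opponent matters only through the pairs of vertices usable under the
    final promise, which leaves exponentially many blocks; where they recur, he merely bounds a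
    requirement from below by the average of a short closed walk, and the largest bound per vertex
    is kept as a single row.

    Requirements are infima that need not be attained, so the linear system is known to be solvable
    only up to every positive slack; the slack is sent to zero after fixing a basis. *)

Inductive instr :=
  | IInc of nat & nat
  | IDec of nat & nat & nat
  | IRead of nat & nat & nat
  | IHalt of bool.

Definition upd (s : nat -> nat) r v : nat -> nat := fun k => if k == r then v else s k.

Record fconf := FConf { fpc : nat; finp : seq bool; freg : nat -> nat }.

Definition fstep (p : seq instr) (c : fconf) : option fconf :=
  match nth (IHalt false) p (fpc c) with
  | IInc r a => Some (FConf a (finp c) (upd (freg c) r (freg c r).+1))
  | IDec r az anz =>
      Some (if freg c r == 0 then FConf az (finp c) (freg c)
            else FConf anz (finp c) (upd (freg c) r (freg c r).-1))
  | IRead a0 a1 ae =>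
      Some (match finp c with
            | [::] => FConf ae [::] (freg c)
            | b :: u => FConf (if b then a1 else a0) u (freg c)
            end)
  | IHalt _ => None
  end.

Fixpoint frun (p : seq instr) n (c : fconf) : option fconf :=
  if n is n'.+1 then (if fstep p c is Some c' then frun p n' c' else None) else Some c.

(* Right of the home cell (a blank) the tape is cut into blocks of [K.+1] cells; the value of
   register [r] is the number of [true] cells whose position is [r] modulo [K.+1].  Left of
   the home cell is the unread part of the input, erased from its left end.  In phase [PH] the
   head walks left to the home cell and then starts the instruction; in phase [PW c] it walks
   right over a cell of track [c]. *)
Section Compile.
Variables (p : seq instr) (K : nat).
Let L := size p.
Local Notation Q := ('I_L.+1 * ('I_6 + 'I_K.+1))%type.

Definition PH : 'I_6 + 'I_K.+1 := inl (inord 0).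
(** The phases [P1] to [P5] carry out [IRead]: look left of home for unread input, walk to its left
    end, erase one bit there, return to home, and step back onto home from its right neighbour in
    phase [PH]. *)
Definition P1 : 'I_6 + 'I_K.+1 := inl (inord 1).
Definition P2 : 'I_6 + 'I_K.+1 := inl (inord 2).
Definition P3 : 'I_6 + 'I_K.+1 := inl (inord 3).
Definition P4 : 'I_6 + 'I_K.+1 := inl (inord 4).
Definition P5 : 'I_6 + 'I_K.+1 := inl (inord 5).
Definition PW (c : nat) : 'I_6 + 'I_K.+1 := inr (inord (c %% K.+1)).

Definition dl (q : Q) (x : option bool) : option (Q * option bool * bool) :=
  let: (pc, ph) := q in
  let ins := nth (IHalt false) p pc in
  match ph with
  | inr c =>
      match ins with
      | IInc r a =>
          if (c == r :> nat) && (x != Some true) then Some ((inord a, PH), Some true, false)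
          else Some ((pc, PW c.+1), Some (odflt false x), true)
      | IDec r az anz =>
          if x is Some b then
            if (c == r :> nat) && b then Some ((inord anz, PH), Some false, false)
            else Some ((pc, PW c.+1), x, true)
          else Some ((inord az, PH), None, false)
      | _ => None
      end
  | inl k =>
      match val k with
      | 0 => if x is Some _ then Some (q, x, false)
             else match ins with
                  | IInc _ _ | IDec _ _ _ => Some ((pc, PW 0), None, true)
                  | IRead _ _ _ => Some ((pc, P1), None, false)
                  | IHalt _ => None
                  end
      | 1 => if ins is IRead _ _ ae then
               if x is Some _ then Some ((pc, P2), x, false) else Some ((inord ae, PH), None, true)
             else None
      | 2 => if x is Some _ then Some (q, x, false) else Some ((pc, P3), None, true)
      | 3 => if ins is IRead a0 a1 _ then
               if x is Some b then Some ((inord (if b then a1 else a0), P4), None, true) else None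
             else None
      | 4 => if x is Some _ then Some (q, x, true) else Some ((pc, P5), None, true)
      | _ => Some ((pc, PH), Some (odflt false x), false)
      end
  end.

(** Starting in [P4] makes the head walk over the whole input; the blank behind it becomes the home
    cell. *)
Definition tmof : TM :=
  @MkTM #|{: Q}| (enum_rank (inord 0, P4))
    (fun q x => omap (fun t => (enum_rank t.1.1, t.1.2, t.2)) (dl (enum_val q) x))
    (fun q => if nth (IHalt false) p (enum_val q).1 is IHalt b then b else false).

Local Notation tape := (seq (option bool)).
Definition cf (q : Q) (l : tape) h (r : tape) : config tmof := @Config tmof (enum_rank q) l h r.
Definition cfz q l (z : tape) := cf q l (head None z) (behead z).
Definition cfl q (l r : tape) := cf q (behead l) (head None l) r.

Lemma cstepR q l z q' b : dl q (head None z) = Some (q', b, true) ->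
  step (cfz q l z) = Some (cfz q' (b :: l) (behead z)).
Proof. by move=> E; rewrite /step /= enum_rankK E. Qed.

Lemma cstepL q l h r q' b : dl q h = Some (q', b, false) ->
  step (cf q l h r) = Some (cfl q' l (b :: r)).
Proof. by move=> E; rewrite /step /= enum_rankK E. Qed.

Lemma exec_cat m n (c c' : config tmof) : exec m c = Some c' -> exec (m + n) c = exec n c'.
Proof. by elim: m c => [|m IH] c /=; [case=> -> | case: step => // c1; apply: IH]. Qed.

Lemma exec_step n (c c' : config tmof) : step c = Some c' -> exec n.+1 c = exec n c'.
Proof. by move=> /= ->. Qed.

Definition blank (e : tape) := all (pred1 None) e.

Lemma blank_head e : blank e -> head None e = None.
Proof. by case: e => //= x e /andP[/eqP]. Qed.

Lemma blank_behead e : blank e -> blank (behead e).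
Proof. by case: e => //= x e /andP[]. Qed.

Fixpoint cnt r pos (w : seq bool) :=
  if w is b :: w' then (b && (pos %% K.+1 == r)) + cnt r pos.+1 w' else 0.

Lemma dlW pc c x : dl (pc, PW c) x =
  match nth (IHalt false) p pc with
  | IInc r a =>
      if (c %% K.+1 == r :> nat) && (x != Some true) then Some ((inord a, PH), Some true, false)
      else Some ((pc, PW c.+1), Some (odflt false x), true)
  | IDec r az anz =>
      if x is Some b then
        if (c %% K.+1 == r :> nat) && b then Some ((inord anz, PH), Some false, false)
        else Some ((pc, PW c.+1), x, true)
      else Some ((inord az, PH), None, false)
  | _ => None
  end.
Proof.
rewrite /= inordK ?ltn_mod //.
by have -> : PW (c %% K.+1).+1 = PW c.+1
  by rewrite /PW -[(c %% _).+1]addn1 modnDml addn1.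
Qed.

Lemma dlH pc x : dl (pc, PH) x = if x is Some _ then Some ((pc, PH), x, false)
  else match nth (IHalt false) p pc with
       | IInc _ _ | IDec _ _ _ => Some ((pc, PW 0), None, true)
       | IRead _ _ _ => Some ((pc, P1), None, false)
       | IHalt _ => None
       end.
Proof. by rewrite /= inordK. Qed.

Lemma step_home pc b l r : step (cfl (pc, PH) (Some b :: l) r) = Some (cfl (pc, PH) l (Some b :: r)).
Proof. by apply: cstepL; rewrite dlH. Qed.

Lemma inc_blank pc r a l d pos e : nth (IHalt false) p (val pc) = IInc r a ->
  blank e -> (pos + d) %% K.+1 = r ->
  exists m w' e', [/\ exec m (cfz (pc, PW pos) l e) = Some (cfl (inord a, PH) l (map Some w' ++ e')),
    blank e', forall r', cnt r' pos w' = (r' == r), size w' <= d.+1 & m <= 2 * d.+1].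
Proof.
move=> Ei; elim: d pos l e => [|d IH] pos l e be.
all: move=> Er; case: (pos %% K.+1 =P r) => Ep.
1,3: exists 1, [:: true], (behead e); split=> //=; first (rewrite (@cstepL _ _ _ _ (inord a, PH) (Some true)) //).
1,4: by rewrite dlW Ei Ep eqxx blank_head.
1,3: exact: blank_behead.
1,2: by move=> r'; rewrite Ep addn0 eq_sym.
- by rewrite addn0 in Er.
have [||m [w' [e' [E1 E2 E3 E4 E5]]]] := IH pos.+1 (Some false :: l) (behead e); first exact: blank_behead.
  by rewrite addSnnS.
exists m.+2, (false :: w'), e'; split=> //; last by lia.
rewrite (@exec_step _ _ (cfz (pc, PW pos.+1) (Some false :: l) (behead e))); last first.
  by apply: cstepR; rewrite dlW Ei blank_head //=; move/eqP/negbTE: Ep => ->.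
by rewrite -addn1 (exec_cat _ E1) /= step_home.
Qed.

(** Any cell of track [r] that is not yet [true] can take the new unit, so at most one block of
    [K.+1] cells is added. *)
Lemma inc_walk pc r a l w pos e : nth (IHalt false) p (val pc) = IInc r a -> r <= K ->
  blank e ->
  exists m w' e', [/\ exec m (cfz (pc, PW pos) l (map Some w ++ e)) =
                      Some (cfl (inord a, PH) l (map Some w' ++ e')),
    blank e', forall r', cnt r' pos w' = cnt r' pos w + (r' == r),
    size w' <= size w + K.+1 & m <= 2 * (size w + K.+1)].
Proof.
move=> Ei rK be; elim: w pos l => [|b w IH] pos l.
  (* The distance from [pos] to the next cell of track [r]. *)
  have [|m [w' [e' [E1 E2 E3 E4 E5]]]] := @inc_blank pc r a l ((r + (K.+1 - pos %% K.+1)) %% K.+1) pos e Ei be.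
    rewrite modnDmr -modnDml addnCA subnKC; last by rewrite ltnW // ltn_mod.
    by rewrite modnDr modn_small.
  have := ltn_pmod (r + (K.+1 - pos %% K.+1)) (ltn0Sn K).
  by exists m, w', e'; split=> //=; lia.
case: (boolP ((pos %% K.+1 == r) && ~~ b)) => Hb.
  exists 1, (true :: w), e; split=> //=.
  - rewrite (@cstepL _ _ _ _ (inord a, PH) (Some true)) //.
    by rewrite dlW Ei; case/andP: Hb => -> /negbTE ->.
  - move=> r'; case/andP: Hb => /eqP-> /negbTE-> /=; rewrite (eq_sym r r'); lia.
  - by rewrite leq_addr.
have [m [w' [e' [E1 E2 E3 E4 E5]]]] := IH pos.+1 (Some b :: l).
exists m.+2, (b :: w'), e'; split=> //=; last by lia.
- rewrite (@cstepR _ _ _ (pc, PW pos.+1) (Some b)); last first.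
    rewrite dlW Ei /=; case: b Hb {E1} => /=; rewrite ?andbT ?andbF // => /negbTE-> //.
  by rewrite -/(exec m.+1 _) -addn1 (exec_cat _ E1) /= step_home.
- by move=> r'; rewrite E3; lia.
Qed.

Lemma dec_walk pc r az anz l w pos e : nth (IHalt false) p (val pc) = IDec r az anz ->
  blank e ->
  exists m w' e', [/\ exec m (cfz (pc, PW pos) l (map Some w ++ e)) =
       Some (cfl (inord (if cnt r pos w == 0 then az else anz), PH) l (map Some w' ++ e')),
    blank e', forall r', cnt r' pos w' = cnt r' pos w - (r' == r),
    size w' = size w & m <= 2 * (size w + 1)].
Proof.
move=> Ei be; elim: w pos l => [|b w IH] pos l.
  exists 1, [::], (None :: behead e); split=> //=; last exact: blank_behead.
  rewrite (@cstepL _ _ _ _ (inord az, PH) (None)) //.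
  by rewrite dlW Ei blank_head.
case: (boolP ((pos %% K.+1 == r) && b)) => Hb.
  exists 1, (false :: w), e; split=> //=.
  - rewrite (@cstepL _ _ _ _ (inord anz, PH) (Some false)); last by rewrite dlW Ei /= Hb.
    by rewrite andbC Hb.
  - by move=> r'; case/andP: Hb => /eqP-> -> /=; rewrite (eq_sym r r'); case: eqP => _; lia.
have [m [w' [e' [E1 E2 E3 E4 E5]]]] := IH pos.+1 (Some b :: l).
exists m.+2, (b :: w'), e'; split=> //=; last by lia.
- rewrite (@cstepR _ _ _ (pc, PW pos.+1) (Some b)); last by rewrite dlW Ei /= (negbTE Hb).
  by rewrite -/(exec m.+1 _) -addn1 (exec_cat _ E1) /= step_home andbC (negbTE Hb) add0n.
- move=> r'; rewrite E3; case: (r' =P r) => [->|_]; last by lia.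
  by rewrite andbC (negbTE Hb); lia.
- by rewrite E4.
Qed.

Lemma read_left pc (u : seq bool) e r :
  exec (size u) (cfl (pc, P2) (map Some u ++ e) r) = Some (cfl (pc, P2) e (map Some (rev u) ++ r)).
Proof.
elim: u r => [|b u IH] r //=.
rewrite (@cstepL _ _ _ _ (pc, P2) (Some b)); last by rewrite /= inordK.
by rewrite IH rev_cons map_rcons cat_rcons.
Qed.

Lemma read_right pc (u : seq bool) l z w e : head None z = None -> behead z = map Some w ++ e ->
  blank e ->
  exists w' e', [/\ exec (size u).+2 (cfz (pc, P4) l (map Some u ++ z)) =
     Some (cf (pc, PH) (map Some (rev u) ++ l) None (map Some w' ++ e')),
     blank e', forall r, cnt r 0 w' = cnt r 0 w & size w' <= (size w).+1].
Proof.
move=> Hz1 Hz2 be; elim: u l => [|b u IH] l; last first.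
  have [w' [e' [E1 E2 E3 E4]]] := IH (Some b :: l).
  exists w', e'; split=> //.
  rewrite (@exec_step _ _ (cfz (pc, P4) (Some b :: l) (map Some u ++ z))).
    by rewrite E1 rev_cons map_rcons cat_rcons.
  by rewrite (@cstepR _ _ _ (pc, P4) (Some b)) //= inordK.
exists (if w is [::] then [:: false] else w), (if w is [::] then behead e else e).
split; [| by case: w {Hz2} => [|? ?] //; exact: blank_behead | by case: w {Hz2} | by case: w {Hz2}].
rewrite (@exec_step _ _ (cfz (pc, P5) (None :: l) (map Some w ++ e))); last first.
  by rewrite -Hz2 (@cstepR _ _ _ (pc, P5) None) //= Hz1 inordK.
rewrite (@exec_step _ _ (cfl (pc, PH) (None :: l) (Some (odflt false (head None (map Some w ++ e)))
   :: behead (map Some w ++ e)))); last first.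
  by apply: cstepL; rewrite /= inordK.
by case: w {Hz2} => [|b w] //=; rewrite blank_head.
Qed.

Definition goodprog := all (fun i => match i with
  | IInc r a => (r <= K) && (a <= L)
  | IDec r a b => (r <= K) && (a <= L) && (b <= L)
  | IRead a b c => (a <= L) && (b <= L) && (c <= L)
  | IHalt _ => true end) p.

(** The written part gains at most one block per instruction, so [t] counts the instructions
    executed, plus one for the initial walk over the input. *)
Definition match_conf (c : fconf) t (C : config tmof) (n : nat) := exists w e e',
  [/\ fpc c <= L, C = cf (inord (fpc c), PH) (map Some (rev (finp c)) ++ e) None (map Some w ++ e'),
   blank e, blank e' & [/\ forall r, r <= K -> cnt r 0 w = freg c r, size w <= K.+1 * t & size (finp c) <= n]].

Lemma sim_step c c' t C n : goodprog -> match_conf c t C n -> fstep p c = Some c' ->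
  exists m C', [/\ exec m C = Some C', match_conf c' t.+1 C' n & m <= 2 * (K.+1 * t.+1) + 2 * n + 10].
Proof.
move=> gp [w [e [e' [Hpc -> be be' [Hr Hw Hn]]]]].
rewrite /fstep; set pc := inord (fpc c) : 'I_L.+1.
have Epc : val pc = fpc c by rewrite /= inordK.
have := @dlH pc None; rewrite /= Epc.
case Ei : (nth (IHalt false) p (fpc c)) => [r a|r az anz|a0 a1 ae|b] //= Ed; rewrite inordK // in Ed.
- have pL : fpc c < size p by rewrite ltnNge; apply/negP => H; rewrite nth_default in Ei.
  have /andP[rK aL] : (r <= K) && (a <= L) by have /(all_nthP (IHalt false)) /(_ _ pL) := gp; rewrite Ei.
  rewrite -Epc in Ei.
  have [m [w' [e1 [E1 E2 E3 E4 E5]]]] := @inc_walk pc r a (None :: map Some (rev (finp c)) ++ e) w 0 e' Ei rK be'.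
  case=> <-; exists m.+1, (cfl (inord a, PH) (None :: map Some (rev (finp c)) ++ e) (map Some w' ++ e1)).
  split; last by lia.
  - rewrite (@exec_step _ _ (cfz (pc, PW 0) (None :: map Some (rev (finp c)) ++ e) (map Some w ++ e'))) //.
    by apply: (@cstepR _ _ (None :: map Some w ++ e')); rewrite dlH Ei.
  exists w', e, e1; split=> //=; split=> //; last by lia.
  by move=> r' Hr'; rewrite E3 Hr // /upd; case: eqP => [->|_]; rewrite ?addn1 ?addn0.
- have pL : fpc c < size p by rewrite ltnNge; apply/negP => H; rewrite nth_default in Ei.
  have /andP[/andP[rK aL] bL] : (r <= K) && (az <= L) && (anz <= L)
    by have /(all_nthP (IHalt false)) /(_ _ pL) := gp; rewrite Ei.
  rewrite -Epc in Ei.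
  have [m [w' [e1 [E1 E2 E3 E4 E5]]]] := @dec_walk pc r az anz (None :: map Some (rev (finp c)) ++ e) w 0 e' Ei be'.
  rewrite Hr // in E1.
  case=> <-; exists m.+1, (cfl (inord (if freg c r == 0 then az else anz), PH)
     (None :: map Some (rev (finp c)) ++ e) (map Some w' ++ e1)).
  split; last by lia.
  - rewrite (@exec_step _ _ (cfz (pc, PW 0) (None :: map Some (rev (finp c)) ++ e) (map Some w ++ e'))) //.
    by apply: (@cstepR _ _ (None :: map Some w ++ e')); rewrite dlH Ei.
  exists w', e, e1; split=> //=; try by case: ifP.
  split; [| by lia | by case: ifP].
  move=> r' Hr'; rewrite E3 Hr //; case: ifP => /= H0; rewrite /upd; case: eqP => [->|_]; rewrite ?subn0 ?subn1 //.
  by rewrite (eqP H0).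
- have pL : fpc c < size p by rewrite ltnNge; apply/negP => H; rewrite nth_default in Ei.
  have /andP[/andP[aL bL] cL] : (a0 <= L) && (a1 <= L) && (ae <= L)
    by have /(all_nthP (IHalt false)) /(_ _ pL) := gp; rewrite Ei.
  rewrite -Epc in Ei.
  case=> <-.
  have S1 : step (cf (pc, PH) (map Some (rev (finp c)) ++ e) None (map Some w ++ e')) =
     Some (cfl (pc, P1) (map Some (rev (finp c)) ++ e) (None :: map Some w ++ e')).
    by apply: cstepL; rewrite dlH Ei.
  case Einp: (finp c) => [|b u] in Hn S1 *.
    exists 2, (cf (inord ae, PH) (None :: behead e) None (map Some w ++ e')); split; last by lia.
    - rewrite (exec_step _ S1) /=.
      have := @cstepR (pc, P1) (behead e) (None :: None :: map Some w ++ e') (inord ae, PH) None.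
      rewrite /cfz /cfl /= blank_head // => ->//.
      by rewrite !inordK // -Epc Ei.
    exists w, (None :: behead e), e'; split=> //=; last by split=> //; lia.
    exact: blank_behead.
  (* Seen from home the input appears reversed, so the bit to be consumed is the farthest one. *)
  case Erev: (rev (b :: u)) => [|b' u']; first by move: (congr1 size Erev); rewrite size_rev.
  rewrite Erev in S1.
  have S2 : step (cfl (pc, P1) (map Some (b' :: u') ++ e) (None :: map Some w ++ e')) =
     Some (cfl (pc, P2) (map Some u' ++ e) (Some b' :: None :: map Some w ++ e')).
    by apply: cstepL; rewrite /= inordK // Ei.
  have S3 := @read_left pc u' e (Some b' :: None :: map Some w ++ e').
  have Hr4 : map Some (rev u') ++ Some b' :: None :: map Some w ++ e' =
     Some b :: map Some u ++ None :: map Some w ++ e'.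
    rewrite -cat_rcons -map_rcons -rev_cons -Erev revK //.
  rewrite Hr4 in S3.
  pose tg := (inord (if b then a1 else a0) : 'I_L.+1).
  have S4 : step (cfl (pc, P2) e (Some b :: map Some u ++ None :: map Some w ++ e')) =
       Some (cf (pc, P3) (None :: behead e) (Some b) (map Some u ++ None :: map Some w ++ e')).
    have := @cstepR (pc, P2) (behead e) (None :: Some b :: map Some u ++ None :: map Some w ++ e') (pc, P3) None.
    by rewrite /cfz /cfl /= blank_head // => -> //; rewrite inordK.
  have S5 : step (cf (pc, P3) (None :: behead e) (Some b) (map Some u ++ None :: map Some w ++ e')) =
      Some (cfz (tg, P4) (None :: None :: behead e) (map Some u ++ None :: map Some w ++ e')).
    have := @cstepR (pc, P3) (None :: behead e) (Some b :: map Some u ++ None :: map Some w ++ e') (tg, P4) None.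
    by rewrite /cfz /= => -> //; rewrite inordK // Ei.
  have [w' [e1 [E1 E2 E3 E4]]] := @read_right tg u (None :: None :: behead e) (None :: map Some w ++ e') w e' erefl erefl be'.
  exists ((size u').+2 + (size u).+2.+2), (cf (tg, PH) (map Some (rev u) ++ None :: None :: behead e) None (map Some w' ++ e1)).
  split; last first.
  - by move: (congr1 size Erev) Hn; rewrite size_rev /= => [[->]]; lia.
  - exists w', (None :: None :: behead e), e1; split=> //=; first by case: ifP.
      exact: blank_behead.
    split; [by move=> r rK; rewrite E3 Hr | lia | by move: Hn => /=; lia].
  rewrite (@exec_cat _ _ _ (cfl (pc, P2) e (Some b :: map Some u ++ None :: map Some w ++ e'))).
    by rewrite (exec_step _ S4) (exec_step _ S5).
  by rewrite (exec_step _ S1) (exec_step _ S2).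
Qed.

Lemma sim_run N c c' t C n : goodprog -> match_conf c t C n -> frun p N c = Some c' ->
  exists m C', [/\ exec m C = Some C', match_conf c' (t + N) C' n &
    m <= N * (2 * (K.+1 * (t + N)) + 2 * n + 10)].
Proof.
move=> gp; elim: N c t C => [|N IH] c t C HC /=.
  by case=> <-; exists 0, C; rewrite addn0.
case E: fstep => [c1|] // H.
have [m [C1 [E1 E2 E3]]] := sim_step gp HC E.
have [m' [C2 [E4 E5 E6]]] := IH _ _ _ E2 H.
exists (m + m'), C2; split; [by rewrite (exec_cat _ E1) | by rewrite addnS | ].
move: E6 E3; rewrite addSnnS; set X := K.+1 * _; set Z := K.+1 * _; have: Z <= X by rewrite leq_mul2l; lia.
nia.
Qed.

(** Each of the [N] instructions costs one sweep back and forth over at most [K.+1 * N.+1] register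
    cells or over the input, whence the quadratic overhead. *)
Lemma tm_decides N inp c' b (Pr : Prop) : goodprog ->
  frun p N (FConf 0 inp (fun=> 0)) = Some c' ->
  nth (IHalt false) p (fpc c') = IHalt b -> (b <-> Pr) ->
  decides_within tmof inp (N.+1 * (2 * (K.+1 * N.+1) + 2 * size inp + 10)) Pr.
Proof.
move=> gp Hrun Hb HP.
have [w' [e' [E1 E2 E3 E4]]] := @read_right (inord 0) inp [::] [::] [::] [::] erefl erefl isT.
have I0 : exec (size inp).+2 (init_config tmof inp) =
    Some (cf (inord 0, PH) (map Some (rev inp) ++ [::]) None (map Some w' ++ e')).
  by rewrite -E1 cats0; case: inp {Hrun E1}.
have M0 : match_conf (FConf 0 inp (fun=> 0)) 1 (cf (inord 0, PH) (map Some (rev inp) ++ [::]) None (map Some w' ++ e')) (size inp).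
  by exists w', [::], e'; split=> //; split=> //=; rewrite muln1; apply: leq_trans E4 _.
have [m [C' [E5 E6 E7]]] := sim_run gp M0 Hrun.
exists ((size inp).+2 + m), C'; split; first by move: E7; rewrite add1n; nia.
split; first by rewrite (exec_cat _ I0).
have [w [e [e1 [Hpc -> _ _ _]]]] := E6.
have Epc : (inord (fpc c') : 'I_L.+1) = fpc c' :> nat by rewrite inordK.
split; first by rewrite /step /= enum_rankK dlH Epc Hb.
by rewrite /= enum_rankK /= Epc Hb.
Qed.

End Compile.

(** * Functions computable in unary in polynomial time *)

(* [CLoop r c] decrements [r] and runs [c] as long as [r] is positive; [CRead c0 c1] runs
   [c0] or [c1] for each remaining input bit. *)
Inductive com :=
  | CInc of nat
  | CClr of nat
  | CSeq of com & com
  | CLoop of nat & com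
  | CRead of com & com.

Notation "a ;; b" := (CSeq a b) (at level 61, right associativity).

Inductive ex : com -> seq bool -> (nat -> nat) -> nat -> seq bool -> (nat -> nat) -> Prop :=
  | ExInc r i s : ex (CInc r) i s 1 i (upd s r (s r).+1)
  | ExClr r i s : ex (CClr r) i s (s r).+1 i (upd s r 0)
  | ExSeq c1 c2 i s t1 i1 s1 t2 i2 s2 : ex c1 i s t1 i1 s1 -> ex c2 i1 s1 t2 i2 s2 ->
      ex (c1 ;; c2) i s (t1 + t2) i2 s2
  | ExLoop0 r c i s : s r = 0 -> ex (CLoop r c) i s 1 i s
  | ExLoopS r c i s t1 i1 s1 t2 i2 s2 : s r <> 0 -> ex c i (upd s r (s r).-1) t1 i1 s1 ->
      ex (CLoop r c) i1 s1 t2 i2 s2 -> ex (CLoop r c) i s (t1 + t2).+1 i2 s2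
  | ExRead0 c0 c1 s : ex (CRead c0 c1) [::] s 1 [::] s
  | ExReadS (b : bool) c0 c1 i s t1 i1 s1 t2 i2 s2 : ex (if b then c1 else c0) i s t1 i1 s1 ->
      ex (CRead c0 c1) i1 s1 t2 i2 s2 -> ex (CRead c0 c1) (b :: i) s (t1 + t2).+1 i2 s2.

Fixpoint clen c := match c with
  | CInc _ | CClr _ => 1
  | CSeq c1 c2 => clen c1 + clen c2
  | CLoop _ c => (clen c).+1
  | CRead c0 c1 => (clen c0 + clen c1).+1
  end.

Fixpoint cmax c := match c with
  | CInc r | CClr r => r
  | CSeq c1 c2 | CRead c1 c2 => maxn (cmax c1) (cmax c2)
  | CLoop r c => maxn r (cmax c)
  end.

(** Code for address [a] that continues at [k]; the bodies of loops return to their own test, and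
    clearing a register is a decrement that jumps to itself. *)
Fixpoint cgen c a k : seq instr := match c with
  | CInc r => [:: IInc r k]
  | CClr r => [:: IDec r k a]
  | CSeq c1 c2 => cgen c1 a (a + clen c1) ++ cgen c2 (a + clen c1) k
  | CLoop r c => IDec r k a.+1 :: cgen c a.+1 a
  | CRead c0 c1 => IRead a.+1 (a.+1 + clen c0) k :: cgen c0 a.+1 a ++ cgen c1 (a.+1 + clen c0) a
  end.

Lemma size_cgen c a k : size (cgen c a k) = clen c.
Proof. by elim: c a k => //= *; rewrite ?size_cat; congruence. Qed.

Definition code_at (p : seq instr) a l := exists p1 p2, p = p1 ++ l ++ p2 /\ size p1 = a.

Lemma code_at_cat p a l1 l2 : code_at p a (l1 ++ l2) -> code_at p a l1 /\ code_at p (a + size l1) l2.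
Proof.
move=> [p1 [p2 [-> <-]]]; split; first by exists p1, (l2 ++ p2); rewrite -!catA.
by exists (p1 ++ l1), p2; rewrite size_cat -!catA.
Qed.

Lemma code_at_nth p a x l : code_at p a (x :: l) -> nth (IHalt false) p a = x.
Proof. by move=> [p1 [p2 [-> <-]]]; rewrite nth_cat ltnn subnn. Qed.

Lemma frun_cat p m n c c1 : frun p m c = Some c1 -> frun p (m + n) c = frun p n c1.
Proof. by elim: m c => [|m IH] c /=; [case=> -> | case: fstep => // c2; apply: IH]. Qed.

Lemma cgen_correct p c i s t i' s' : ex c i s t i' s' -> forall a k, code_at p a (cgen c a k) ->
  frun p t (FConf a i s) = Some (FConf k i' s').
Proof.
elim=> {c i s t i' s'}.
- by move=> r i s a k H; rewrite /= /fstep /= (code_at_nth H).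
- move=> r i s a k H; move Er : (s r) => v.
  elim: v s Er => [|v IH] s Er; rewrite /= /fstep /= (code_at_nth H) Er /=.
    by congr (Some (FConf _ _ _)); apply/funext => x; rewrite /upd; case: eqP => [->|].
  have := IH (upd s r v); rewrite /= {1}/upd eqxx => -> //.
  by congr (Some (FConf _ _ _)); apply/funext => x; rewrite /upd; case: eqP.
- move=> c1 c2 i s t1 i1 s1 t2 i2 s2 _ IH1 _ IH2 a k /= H.
  have [H1 H2] := code_at_cat H; rewrite size_cgen in H2.
  by rewrite (frun_cat _ (IH1 _ _ H1)) (IH2 _ _ H2).
- by move=> r c i s E a k H; rewrite /= /fstep /= (code_at_nth H) E.
- move=> r c i s t1 i1 s1 t2 i2 s2 /eqP/negbTE E _ IH1 _ IH2 a k H.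
  have [_] := @code_at_cat p a [:: IDec r k a.+1] _ H; rewrite addn1 => H1.
  by rewrite /= /fstep /= (code_at_nth H) E (frun_cat _ (IH1 _ _ H1)) (IH2 _ _ H).
- by move=> c0 c1 s a k H; rewrite /= /fstep /= (code_at_nth H).
- move=> b c0 c1 i s t1 i1 s1 t2 i2 s2 _ IH1 _ IH2 a k H.
  have [_ /=] := @code_at_cat p a [:: IRead a.+1 (a.+1 + clen c0) k] _ H.
  rewrite addn1 => /code_at_cat[H0]; rewrite size_cgen => H1.
  rewrite /= /fstep /= (code_at_nth H).
  by case: b IH1 => IH1; [rewrite (frun_cat _ (IH1 _ _ H1)) | rewrite (frun_cat _ (IH1 _ _ H0))]; rewrite (IH2 _ _ H).
Qed.

Lemma cgen_good c a k L K : cmax c <= K -> a + clen c <= L -> k <= L ->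
  all (fun i => match i with
  | IInc r a => (r <= K) && (a <= L)
  | IDec r a b => (r <= K) && (a <= L) && (b <= L)
  | IRead a b c => (a <= L) && (b <= L) && (c <= L)
  | IHalt _ => true end) (cgen c a k).
Proof.
elim: c a k => [r|r|c1 IH1 c2 IH2|r c IH|c0 IH0 c1 IH1] a k /= H1 H2 H3.
- by rewrite H1 H3.
- by rewrite H1 H3 /=; lia.
- by rewrite all_cat IH1 ?IH2; lia.
- by rewrite IH; lia.
- by rewrite all_cat IH0 ?IH1; lia.
Qed.

(** Acceptance is read off the halting instruction, so a last test of register [r] selects one of
    two of them. *)
Definition prog_of c r : seq instr :=
  cgen c 0 (clen c) ++ [:: IDec r (clen c).+1 (clen c).+2; IHalt false; IHalt true].

Lemma com_decides c r inp t i' s' (Pr : Prop) :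
  ex c inp (fun=> 0) t i' s' -> (s' r != 0 <-> Pr) ->
  decides_within (tmof (prog_of c r) (maxn r (cmax c))) inp
    (t.+2 * (2 * ((maxn r (cmax c)).+1 * t.+2) + 2 * size inp + 10)) Pr.
Proof.
move=> H HP.
have Hc : code_at (prog_of c r) 0 (cgen c 0 (clen c)) by exists [::]; eexists.
have Hn : code_at (prog_of c r) (clen c) [:: IDec r (clen c).+1 (clen c).+2; IHalt false; IHalt true].
  by exists (cgen c 0 (clen c)), [::]; rewrite cats0 size_cgen.
have R1 : frun (prog_of c r) t.+1 (FConf 0 inp (fun=> 0)) =
  Some (if s' r == 0 then FConf (clen c).+1 i' s' else FConf (clen c).+2 i' (upd s' r (s' r).-1)).
  by rewrite -addn1 (frun_cat _ (cgen_correct H Hc)) /= /fstep /= (code_at_nth Hn).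
apply: (tm_decides (b := s' r != 0) _ R1) => //.
- rewrite /goodprog all_cat cgen_good ?size_cat ?size_cgen /= ?leq_maxr; lia.
- rewrite /prog_of; case: eqP => _ /=; rewrite nth_cat size_cgen ltnNge.
    by rewrite leqnSn /= subSnn.
  by rewrite leqW //= -[(clen c).+2]addn2 addKn.
Qed.

(** * Environments and the class of computable functions *)

Fixpoint Env k : Type := if k is k'.+1 then (Env k' * nat)%type else unit.

(** One type holds both the registers assigned to the variables and the values of the variables;
    [Emap s] passes from the first to the second. Variables are de Bruijn indices, [get 0] being the
    latest. *)
Fixpoint Emap (s : nat -> nat) k : Env k -> Env k :=
  if k is k'.+1 then fun e : Env k'.+1 => (Emap s e.1, s e.2) else fun e => e.

Fixpoint Eall (P : pred nat) k : Env k -> bool :=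
  if k is k'.+1 then fun e : Env k'.+1 => Eall P e.1 && P e.2 else fun _ => true.

Fixpoint Emax k : Env k -> nat :=
  if k is k'.+1 then fun e : Env k'.+1 => maxn (Emax e.1) e.2 else fun _ => 0.

Fixpoint get j k : Env k -> nat :=
  if k is k'.+1 then fun e : Env k'.+1 => if j is j'.+1 then get j' e.1 else e.2 else fun _ => 0.

(** A single power stands for a polynomial, since the measures in use are at least 2. The measure is
    a parameter because the last step also computes a search bound [2 ^ 2 ^ a], which no power of
    [mu0] dominates. *)
Definition pb k (mu T : Env k -> nat) := exists C, forall e, T e <= mu e ^ C.

Definition mu0 k (e : Env k) := (Emax e).+2.

Lemma pb_const k (mu : Env k -> nat) c : (forall e, mu0 e <= mu e) -> pb mu (fun=> c).
Proof.
move=> H; exists c => e; apply: (@leq_trans (2 ^ c)); first by rewrite ltnW // ltn_expl.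
by case: c => [|c] //; rewrite leq_exp2r //; apply: leq_trans (H e).
Qed.

Lemma pb_add k (mu T1 T2 : Env k -> nat) : (forall e, mu0 e <= mu e) ->
  pb mu T1 -> pb mu T2 -> pb mu (fun e => T1 e + T2 e).
Proof.
move=> H [C1 H1] [C2 H2]; exists (C1 + C2).+1 => e.
have m2 : 2 <= mu e by apply: leq_trans (H e).
apply: (@leq_trans (mu e ^ (C1 + C2) + mu e ^ (C1 + C2))).
  by apply: leq_add; [apply: leq_trans (H1 e) _ | apply: leq_trans (H2 e) _]; rewrite leq_pexp2l; lia.
by rewrite addnn -mul2n expnS leq_mul2r m2 orbT.
Qed.

Lemma pb_mul k (mu T1 T2 : Env k -> nat) : pb mu T1 -> pb mu T2 -> pb mu (fun e => T1 e * T2 e).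
Proof. by move=> [C1 H1] [C2 H2]; exists (C1 + C2) => e; rewrite expnD leq_mul. Qed.

Lemma pb_exp k (mu T1 : Env k -> nat) c : pb mu T1 -> pb mu (fun e => T1 e ^ c).
Proof.
move=> [C1 H1]; exists (C1 * c) => e; rewrite expnM.
by case: c => // c; rewrite leq_exp2r.
Qed.

Lemma pb_le k (mu T1 T2 : Env k -> nat) : (forall e, T1 e <= T2 e) -> pb mu T2 -> pb mu T1.
Proof. by move=> H [C HC]; exists C => e; apply: leq_trans (HC e). Qed.

Lemma pb_max k (mu : Env k -> nat) : (forall e, mu0 e <= mu e) -> pb mu (@Emax k).
Proof. by move=> H; exists 1 => e; rewrite expn1; apply: leq_trans (H e); rewrite /mu0; lia. Qed.

Ltac pbs := lazymatch goal with
  | |- pb _ (fun e => _ + _) => refine (@pb_add _ _ _ _ _ _ _); [assumption | pbs | pbs]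
  | |- pb _ (fun e => _ * _) => refine (@pb_mul _ _ _ _ _ _); pbs
  | _ => first [assumption | apply: pb_const; assumption | apply: pb_max; assumption]
  end.

(* The environment lives in registers [rho]; registers from [d] on are free, and the result
   goes to register [d]. *)
Definition compm k (mu f : Env k -> nat) := exists T, [/\ pb mu T, pb mu f &
  forall rho d, Eall (fun r => r < d) rho -> exists c, forall i s, (forall r, d <= r -> s r = 0) ->
    exists t, ex c i s t i (upd s d (f (Emap s rho))) /\ t <= T (Emap s rho)].

Definition comp k (f : Env k -> nat) := compm (@mu0 k) f.

(** Invariant rule: [S j] is the state after [j] rounds, whose register [r] holds the number of
    rounds left. *)
Lemma ex_loop r c i (S : nat -> nat -> nat) n tau :
  (forall j, j <= n -> S j r = n - j) ->
  (forall j, j < n -> exists t, ex c i (upd (S j) r (n - j).-1) t i (S j.+1) /\ t <= tau) ->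
  exists t, ex (CLoop r c) i (S 0) t i (S n) /\ t <= n * tau.+1 + 1.
Proof.
elim: n S => [|n IH] S H1 H2; first by exists 1; split=> //; apply: ExLoop0; rewrite H1.
have [t1 [E1 L1]] := H2 0 isT.
have [|j Hj|t2 [E2 L2]] := IH (fun j => S j.+1); first by move=> j Hj; rewrite H1.
  by have [t [E L]] := H2 j.+1 Hj; exists t; rewrite subSS in E.
exists (t1 + t2).+1; split; last by rewrite mulSn; lia.
by apply: (ExLoopS _ _ E2); rewrite H1.
Qed.

Ltac updv := rewrite /upd; repeat (case: eqP => ? //=); try lia; try congruence;
  try (match goal with H : forall r : nat, is_true (_ <= r) -> _ = 0 |- _ =>
         first [by rewrite H //; lia | by rewrite [RHS]H //; lia] end).
Ltac updeq := let x := fresh "x" in apply/funext => x; updv.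

Lemma ex_move r d i s : r != d -> s d = 0 ->
  exists t, ex (CLoop r (CInc d)) i s t i (upd (upd s d (s r)) r 0) /\ t <= 2 * s r + 1.
Proof.
move=> rd sd.
have [||t [E L]] := @ex_loop r (CInc d) i (fun j => upd (upd s d j) r (s r - j)) (s r) 1.
- by move=> j _; rewrite /upd eqxx.
- move=> j Hj; exists 1; split=> //.
  have -> : upd (upd s d j.+1) r (s r - j.+1) =
     upd (upd (upd (upd s d j) r (s r - j)) r (s r - j).-1) d
       ((upd (upd (upd s d j) r (s r - j)) r (s r - j).-1) d).+1.
    apply/funext => x; rewrite /upd eqxx (eq_sym d r) (negbTE rd).
    by case: (x =P r) => [->|_]; [rewrite (negbTE rd) subnS | case: eqP].
  exact: ExInc.
exists t; split; last by lia.
have E0 : upd (upd s d 0) r (s r - 0) = s by rewrite subn0; updeq.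
by rewrite E0 subnn in E.
Qed.

Lemma Emap_upd k (rho : Env k) s d v : Eall (fun r => r < d) rho -> Emap (upd s d v) rho = Emap s rho.
Proof.
elim: k rho => [|k IH] //= [e r] /= /andP[H1 H2]; rewrite IH //.
by rewrite /upd ltn_eqF.
Qed.

Lemma Eall_mono k (rho : Env k) d d' : d <= d' -> Eall (fun r => r < d) rho -> Eall (fun r => r < d') rho.
Proof.
by move=> dd; elim: k rho => [|k IH] //= [e r] /= /andP[/IH-> H]; rewrite (leq_trans H).
Qed.

Lemma get_map k j (rho : Env k) s : j < k -> get j (Emap s rho) = s (get j rho).
Proof. by elim: k j rho => [|k IH] [|j] //= [e r] H; rewrite IH. Qed.

Lemma get_all k j (rho : Env k) d : j < k -> Eall (fun r => r < d) rho -> get j rho < d.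
Proof. by elim: k j rho => [|k IH] [|j] //= [e r] H /= /andP[H1 H2] //; apply: IH. Qed.

Lemma get_max k j (e : Env k) : get j e <= Emax e.
Proof. by elim: k j e => [|k IH] [|j] //= [e r] /=; rewrite leq_max ?leqnn ?orbT // IH. Qed.

Lemma mu0_le k (e : Env k) : mu0 e <= mu0 e. Proof. by []. Qed.
#[local] Hint Resolve mu0_le : core.

Lemma comp_get k j : j < k -> comp (fun e : Env k => get j e).
Proof.
move=> jk; exists (fun e => 6 * Emax e + 2); split.
- by apply: pb_add => //; [apply: pb_mul; [exact: pb_const | exact: pb_max] | exact: pb_const].
- by apply: (@pb_le _ _ _ (@Emax k)) => [e|]; [apply: get_max | apply: pb_max].
move=> rho d Hd; set r := get j rho; have rd : r < d by apply: get_all.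
(* Moving the contents of [r] empties it, so a second copy in [d.+1] serves to restore it. *)
exists (CLoop r (CInc d ;; CInc d.+1) ;; CLoop d.+1 (CInc r)) => i s Hs.
rewrite get_map // -/r.
have [||t [E L]] := @ex_loop r (CInc d ;; CInc d.+1) i
   (fun j => upd (upd (upd s d j) d.+1 j) r (s r - j)) (s r) 2.
- by move=> m _; rewrite /upd eqxx.
- move=> m Hm; exists (1 + 1); split=> //.
  set s1 := upd _ r _.
  have E1 : upd (upd (upd s d m.+1) d.+1 m.+1) r (s r - m.+1) =
     upd (upd s1 d (s1 d).+1) d.+1 ((upd s1 d (s1 d).+1) d.+1).+1.
    rewrite /s1; updeq.
  by rewrite E1; apply: ExSeq; apply: ExInc.
have [||t2 [E2 L2]] := @ex_move d.+1 r i (upd (upd (upd s d (s r)) d.+1 (s r)) r (s r - s r)).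
- by apply/eqP => ?; lia.
- by rewrite subnn /upd eqxx.
exists (t + t2); split.
  have Es : upd (upd (upd s d 0) d.+1 0) r (s r - 0) = s by rewrite subn0; updeq.
  rewrite Es in E; apply: ExSeq E _.
  by apply: (@eq_ind _ _ (fun z => ex _ _ _ _ _ z) E2); updeq.
move: L2; rewrite {1}/upd; case: eqP => [?|_]; first by lia.
rewrite {1}/upd eqxx => L2.
have : s r <= Emax (Emap s rho) by rewrite -(get_map rho s jk) get_max.
lia.
Qed.

Lemma comp_zero k : comp (fun _ : Env k => 0).
Proof.
exists (fun=> 1); split; try exact: pb_const.
move=> rho d Hd; exists (CClr d) => i s Hs; exists (s d).+1; split; last by rewrite Hs.
exact: ExClr.
Qed.

Lemma compm_succ k (mu f : Env k -> nat) : (forall e, mu0 e <= mu e) ->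
  compm mu f -> compm mu (fun e => (f e).+1).
Proof.
move=> Hmu [T [HT Hf H]]; exists (fun e => T e + 1); split.
- by apply: pb_add => //; apply: pb_const.
- by apply: (@pb_le _ _ _ (fun e => f e + 1)) => [e|]; [rewrite addn1 | apply: pb_add => //; apply: pb_const].
move=> rho d Hd; have [c Hc] := H rho d Hd; exists (c ;; CInc d) => i s Hs.
have [t [E L]] := Hc i s Hs; exists (t + 1); split; last by rewrite leq_add2r.
apply: ExSeq E _.
have -> : upd s d (f (Emap s rho)).+1 = upd (upd s d (f (Emap s rho))) d ((upd s d (f (Emap s rho))) d).+1.
  by updeq.
exact: ExInc.
Qed.

(* A variable renaming commutes with [Emap], so code for [f] serves for [f \o phi]. *)
Lemma comp_re k k' (phi : Env k -> Env k') (f : Env k' -> nat) :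
  (forall s e, Emap s (phi e) = phi (Emap s e)) ->
  (forall d e, Eall (fun r => r < d) e -> Eall (fun r => r < d) (phi e)) ->
  (forall e, Emax (phi e) <= Emax e) ->
  comp f -> comp (fun e => f (phi e)).
Proof.
move=> H1 H2 H3 [T [[C HT] [C' Hf] H]].
have H4 e : mu0 (phi e) <= mu0 e by rewrite /mu0 !ltnS.
exists (fun e => T (phi e)); split.
- exists C => e; apply: leq_trans (HT _) _; case: C {HT} => // C; rewrite leq_exp2r //.
- exists C' => e; apply: leq_trans (Hf _) _; case: C' {Hf} => // C'; rewrite leq_exp2r //.
move=> rho d Hd; have [c Hc] := H (phi rho) d (H2 _ _ Hd); exists c => i s Hs.
by have [t [E L]] := Hc i s Hs; exists t; rewrite -H1.
Qed.

Lemma comp_fst k (f : Env k -> nat) : comp f -> comp (fun e : Env k.+1 => f e.1).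
Proof.
apply: (@comp_re k.+1 k (fun e => e.1)) => //.
- by move=> d e /= /andP[].
- by move=> e /=; apply: leq_maxl.
Qed.

(** The value of [g] in register [d] becomes the newest variable of [f]; the result of [f] in [d.+1]
    is then moved down to [d]. *)
Lemma compm_let k (mu g : Env k -> nat) (f : Env k.+1 -> nat) : (forall e, mu0 e <= mu e) ->
  compm mu g -> comp f -> compm mu (fun e => f (e, g e)).
Proof.
move=> Hmu [T1 [HT1 Hg H1]] [T2 [[C2 HT2] [C3 Hf] H2]].
have Hm : pb mu (fun e => Emax e + g e + 2).
  by apply: pb_add => //; [apply: pb_add => //; apply: pb_max | apply: pb_const].
have Hle e C : mu0 ((e, g e) : Env k.+1) ^ C <= (Emax e + g e + 2) ^ C.
  by case: C => // C; rewrite leq_exp2r // /mu0 /=; lia.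
have pT2 : pb mu (fun e => T2 (e, g e)).
  apply: (pb_le _ (pb_exp C2 Hm)) => e; exact: leq_trans (HT2 _) (Hle _ _).
have pf : pb mu (fun e => f (e, g e)).
  apply: (pb_le _ (pb_exp C3 Hm)) => e; exact: leq_trans (Hf _) (Hle _ _).
exists (fun e => T1 e + T2 (e, g e) + (g e + 1) + (2 * f (e, g e) + 1)); split=> //.
- pbs.
move=> rho d Hd; have [c1 Hc1] := H1 rho d Hd.
have Hd' : Eall (fun r => r < d.+1) ((rho, d) : Env k.+1).
  by rewrite /= ltnSn andbT; apply: Eall_mono Hd.
have [c2 Hc2] := H2 _ _ Hd'.
exists (c1 ;; c2 ;; CClr d ;; CLoop d.+1 (CInc d)) => i s Hs.
have [t1 [E1 L1]] := Hc1 i s Hs.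
set s1 := upd s d _ in E1.
have Hs1 r : d.+1 <= r -> s1 r = 0 by move=> Hr; rewrite /s1 /upd gtn_eqF // Hs // ltnW.
have [t2 [E2 L2]] := Hc2 i s1 Hs1.
have Ee : Emap s1 ((rho, d) : Env k.+1) = (Emap s rho, g (Emap s rho)).
  by rewrite /= Emap_upd // /s1 /upd eqxx.
rewrite Ee in E2 L2; set s2 := upd s1 d.+1 _ in E2.
have s2d : s2 d = g (Emap s rho) by rewrite /s2 /upd ltn_eqF // /s1 /upd eqxx.
have E3 := ExClr d i s2; set s3 := upd s2 d 0 in E3.
have [||t4 [E4 L4]] := @ex_move d.+1 d i s3; [by rewrite gtn_eqF | by rewrite /s3 /upd eqxx | ].
exists (t1 + (t2 + ((s2 d).+1 + t4))); split.
  apply: ExSeq E1 _; apply: ExSeq E2 _; apply: ExSeq E3 _.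
  have -> : upd s d (f (Emap s rho, g (Emap s rho))) = upd (upd s3 d (s3 d.+1)) d.+1 0; last exact: E4.
  rewrite /s3 /s2 /s1; updeq.
rewrite s2d; have : s3 d.+1 = f (Emap s rho, g (Emap s rho)).
  by rewrite /s3 /s2 /upd gtn_eqF // eqxx.
lia.
Qed.

Fixpoint rc n (a : nat) (F : nat -> nat -> nat) := if n is n'.+1 then F n' (rc n' a F) else a.

(** Limited recursion: the bound [bd] on all intermediate values keeps every round polynomial,
    whereas unrestricted iteration could build exponentials. *)
Lemma compm_rec k (mu cn it bd : Env k -> nat) (F : Env k.+2 -> nat) : (forall e, mu0 e <= mu e) ->
  compm mu cn -> compm mu it -> comp F -> pb mu bd ->
  (forall e j, j <= cn e -> rc j (it e) (fun x a => F (e, x, a)) <= bd e) ->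
  compm mu (fun e => rc (cn e) (it e) (fun x a => F (e, x, a))).
Proof.
move=> Hmu [T1 [HT1 Hc H1]] [T2 [HT2 Hi H2]] [T3 [[C3 HT3] _ H3]] Hb Hbd.
pose W e := (Emax e + cn e + bd e + 2) ^ C3.
have HW : pb mu W.
  by apply: pb_exp; pbs.
pose B e := W e + (bd e + 1) + (2 * bd e + 1) + 1.
have HB : pb mu B.
  by rewrite /B; pbs.
exists (fun e => T1 e + T2 e + (cn e * (B e + 1) + 1) + (cn e + 1) + (2 * bd e + 1)); split.
- pbs.
- by apply: (pb_le _ Hb) => e; apply: Hbd.
move=> rho d Hd; have [c1 Hc1] := H1 rho d Hd.
have [c2 Hc2] := H2 rho d.+1 (Eall_mono (leqnSn d) Hd).
have Hd' : Eall (fun r => r < d.+3) ((rho, d.+2, d.+1) : Env k.+2).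
  by rewrite /= ltnSn (ltnW (ltnSn _)) !andbT; apply: Eall_mono Hd; lia.
have [c3 Hc3] := H3 _ _ Hd'.
(* Register [d] holds the rounds left, [d.+1] the accumulator, [d.+2] the index of the round and
   [d.+3] the new value of [F]. *)
exists (c1 ;; c2 ;; CLoop d (c3 ;; CClr d.+1 ;; CLoop d.+3 (CInc d.+1) ;; CInc d.+2) ;; CClr d.+2 ;;
  CLoop d.+1 (CInc d)) => i s Hs.
have [t1 [E1 L1]] := Hc1 i s Hs.
set e := Emap s rho in E1 L1 *; set n := cn e in E1 *.
set s1 := upd s d _ in E1.
have Hs1 r : d.+1 <= r -> s1 r = 0 by move=> Hr; rewrite /s1 /upd gtn_eqF // Hs // ltnW.
have [t2 [E2 L2]] := Hc2 i s1 Hs1.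
have Ee : Emap s1 rho = e by rewrite Emap_upd.
rewrite Ee in E2 L2.
pose R j := rc j (it e) (fun x a => F (e, x, a)).
have RB j : j <= n -> R j <= bd e by apply: Hbd.
pose S j := upd (upd (upd s d (n - j)) d.+1 (R j)) d.+2 j.
have S0 : upd s1 d.+1 (it e) = S 0.
  by rewrite /S /s1 subn0; updeq.
rewrite S0 in E2.
have [||t3 [E3 L3]] := @ex_loop d (c3 ;; CClr d.+1 ;; CLoop d.+3 (CInc d.+1) ;; CInc d.+2) i S n (B e).
- by move=> j Hj; rewrite /S; updv.
- move=> j Hj; set s4 := upd (S j) d _.
  have Hs4 r : d.+3 <= r -> s4 r = 0.
    by move=> Hr; rewrite /s4 /S; updv.
  have [t4 [E4 L4]] := Hc3 i s4 Hs4.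
  have Ee4 : Emap s4 ((rho, d.+2, d.+1) : Env k.+2) = (e, j, R j).
    have -> : s4 = upd (upd (upd s d (n - j).-1) d.+1 (R j)) d.+2 j by rewrite /s4 /S; updeq.
    rewrite /= !Emap_upd //; try by apply: Eall_mono Hd; lia.
    by congr (_, _, _); rewrite /upd ?eqxx // ltn_eqF // eqxx.
  rewrite Ee4 in E4 L4; set s5 := upd s4 d.+3 _ in E4.
  have E5 := ExClr d.+1 i s5; set s6 := upd s5 d.+1 0 in E5.
  have [||t7 [E7 L7]] := @ex_move d.+3 d.+1 i s6; [by rewrite gtn_eqF // ltnW | by rewrite /s6 /upd eqxx | ].
  set s7 := upd _ d.+3 0 in E7.
  have E8 := ExInc d.+2 i s7.
  have s6d : s6 d.+3 = R j.+1.
    by rewrite /s6 /s5; updv.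
  have s5d : s5 d.+1 = R j.
    by rewrite /s5 /s4 /S; updv.
  exists (t4 + ((s5 d.+1).+1 + (t7 + 1))); split.
    apply: ExSeq E4 _; apply: ExSeq E5 _; apply: ExSeq E7 _.
    have -> : S j.+1 = upd s7 d.+2 (s7 d.+2).+1; last exact: E8.
    by rewrite /s7 s6d /s6 /s5 /s4 /S; updeq.
  have HW4 : t4 <= W e.
    apply: leq_trans L4 _; apply: leq_trans (HT3 _) _; rewrite /W; case: C3 {HT3 W HW B HB} => // C3.
    rewrite leq_exp2r // /mu0 /=; have := RB j (ltnW Hj); lia.
  rewrite s5d /B; rewrite s6d in L7.
  have := RB j (ltnW Hj); have := RB _ Hj; lia.
have E4 := ExClr d.+2 i (S n); set s4 := upd (S n) d.+2 0 in E4.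
have [||t5 [E5 L5]] := @ex_move d.+1 d i s4.
- by rewrite gtn_eqF.
- by rewrite /s4 /S; updv.
have s4d : s4 d.+1 = R n by rewrite /s4 /S; updv.
have Snd : S n d.+2 = n by rewrite /S /upd eqxx.
exists (t1 + (t2 + (t3 + ((S n d.+2).+1 + t5)))); split.
  apply: ExSeq E1 _; apply: ExSeq E2 _; apply: ExSeq E3 _; apply: ExSeq E4 _.
  have -> : upd s d (rc n (it e) (fun x a => F (e, x, a))) = upd (upd s4 d (s4 d.+1)) d.+1 0; last exact: E5.
  by rewrite s4d /s4 /S -/(R n); updeq.
have := RB n (leqnn n); rewrite Snd s4d in L5 *; lia.
Qed.

Lemma comp_pb k (f : Env k -> nat) : comp f -> pb (@mu0 k) f.
Proof. by case=> T []. Qed.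

Lemma comp_let k (g : Env k -> nat) (f : Env k.+1 -> nat) :
  comp g -> comp f -> comp (fun e => f (e, g e)).
Proof. exact: compm_let. Qed.

Lemma comp_rec k (cn it bd : Env k -> nat) (F : Env k.+2 -> nat) :
  comp cn -> comp it -> comp F -> pb (@mu0 k) bd ->
  (forall e j, j <= cn e -> rc j (it e) (fun x a => F (e, x, a)) <= bd e) ->
  comp (fun e => rc (cn e) (it e) (fun x a => F (e, x, a))).
Proof. exact: compm_rec. Qed.

Lemma comp_eq k (f g : Env k -> nat) : (forall e, f e = g e) -> comp f -> comp g.
Proof. by move=> /funext ->. Qed.

Lemma comp_succ k (f : Env k -> nat) : comp f -> comp (fun e => (f e).+1).
Proof. exact: compm_succ. Qed.

Lemma comp_const k c : comp (fun _ : Env k => c).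
Proof. by elim: c => [|c IH]; [exact: comp_zero | exact: comp_succ]. Qed.

(** A numerical function is programmed on its own variables only; [comp_let] and a renaming carry it
    to arbitrary arguments in any environment. *)
Lemma comp_op1 (h : nat -> nat) : comp (fun e : Env 1 => h e.2) ->
  forall k (f : Env k -> nat), comp f -> comp (fun e => h (f e)).
Proof.
move=> Hh k f Hf; apply: (@comp_let k f (fun e => h e.2)) => //.
apply: (@comp_re k.+1 1 (fun e => (tt, e.2))) Hh => //.
- by move=> d e /= /andP[_ ->].
- by move=> e /=; rewrite max0n leq_maxr.
Qed.

Lemma comp_op2 (h : nat -> nat -> nat) : comp (fun e : Env 2 => h e.1.2 e.2) ->
  forall k (f g : Env k -> nat), comp f -> comp g -> comp (fun e => h (f e) (g e)).
Proof.
move=> Hh k f g Hf Hg.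
apply: (@comp_let k f (fun e => h e.2 (g e.1))) => //.
apply: (@comp_let k.+1 (fun e => g e.1) (fun e => h e.1.2 e.2)); first exact: comp_fst.
apply: (@comp_re k.+2 2 (fun e => (tt, e.1.2, e.2))) Hh => //.
- by move=> d e /= /andP[/andP[_ ->] ->].
- by move=> e /=; rewrite max0n -maxnA leq_maxr.
Qed.

Lemma pb_get k j : pb (@mu0 k) (fun e => get j e).
Proof. by apply: (@pb_le _ _ _ (@Emax k)) => [e|]; [apply: get_max | apply: pb_max]. Qed.

Ltac cget n := match goal with |- @comp ?k _ => exact (@comp_get k n isT) end.

Lemma comp_add k (f g : Env k -> nat) : comp f -> comp g -> comp (fun e => f e + g e).
Proof.
apply: comp_op2; pose F (e : Env 4) := e.2.+1.
have E (e : Env 2) j : rc j e.1.2 (fun x a => F (e, x, a)) = e.1.2 + j.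
  by elim: j => [|j IH] /=; rewrite ?addn0 // IH /F addnS.
apply: (@comp_eq 2 (fun e => rc e.2 e.1.2 (fun x a => F (e, x, a)))); first by move=> e; rewrite E.
apply: (@comp_rec 2 (fun e => e.2) (fun e => e.1.2) (fun e => e.1.2 + e.2) F);
  [cget 0 | cget 1 | apply: comp_succ; cget 0 | apply: pb_add => //; [exact: (@pb_get 2 1) | exact: (@pb_get 2 0)] |].
by move=> e j Hj; rewrite E leq_add2l.
Qed.

Lemma comp_mul k (f g : Env k -> nat) : comp f -> comp g -> comp (fun e => f e * g e).
Proof.
apply: comp_op2; pose F (e : Env 4) := e.2 + e.1.1.1.2.
have E (e : Env 2) j : rc j 0 (fun x a => F (e, x, a)) = e.1.2 * j.
  by elim: j => [|j IH] /=; rewrite ?muln0 // IH /F mulnS addnC.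
apply: (@comp_eq 2 (fun e => rc e.2 0 (fun x a => F (e, x, a)))); first by move=> e; rewrite E.
apply: (@comp_rec 2 (fun e => e.2) (fun e => 0) (fun e => e.1.2 * e.2) F);
  [cget 0 | exact: comp_zero | apply: comp_add; [cget 0 | cget 3]
  | apply: pb_mul => //; [exact: (@pb_get 2 1) | exact: (@pb_get 2 0)] |].
by move=> e j Hj; rewrite E leq_mul2l Hj orbT.
Qed.

Lemma comp_pred k (f : Env k -> nat) : comp f -> comp (fun e => (f e).-1).
Proof.
apply: (@comp_op1 predn); pose F (e : Env 3) := e.1.2.
have E (e : Env 1) j : rc j 0 (fun x a => F (e, x, a)) = j.-1 by case: j.
apply: (@comp_eq 1 (fun e => rc e.2 0 (fun x a => F (e, x, a)))); first by move=> e; rewrite E.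
apply: (@comp_rec 1 (fun e => e.2) (fun e => 0) (fun e => e.2) F);
  [cget 0 | exact: comp_zero | cget 1 | exact: (@pb_get 1 0) |].
by move=> e j Hj; rewrite E; lia.
Qed.

Lemma comp_sub k (f g : Env k -> nat) : comp f -> comp g -> comp (fun e => f e - g e).
Proof.
apply: comp_op2; pose F (e : Env 4) := e.2.-1.
have E (e : Env 2) j : rc j e.1.2 (fun x a => F (e, x, a)) = e.1.2 - j.
  by elim: j => [|j IH] /=; rewrite ?subn0 // IH /F subnS.
apply: (@comp_eq 2 (fun e => rc e.2 e.1.2 (fun x a => F (e, x, a)))); first by move=> e; rewrite E.
apply: (@comp_rec 2 (fun e => e.2) (fun e => e.1.2) (fun e => e.1.2) F);
  [cget 0 | cget 1 | apply: comp_pred; cget 0 | exact: (@pb_get 2 1) |].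
by move=> e j Hj; rewrite E leq_subr.
Qed.

Lemma comp_leq k (f g : Env k -> nat) : comp f -> comp g -> comp (fun e => f e <= g e : nat).
Proof.
move=> Hf Hg; apply: (@comp_eq _ (fun e => 1 - (f e - g e))).
  by move=> e; rewrite /leq; case: (f e - g e) => [|[]].
by apply: comp_sub; [exact: comp_const | exact: comp_sub].
Qed.

Lemma comp_eqn k (f g : Env k -> nat) : comp f -> comp g -> comp (fun e => f e == g e : nat).
Proof.
move=> Hf Hg; apply: (@comp_eq _ (fun e => (f e <= g e) * (g e <= f e))).
  by move=> e; rewrite eqn_leq mulnb.
by apply: comp_mul; exact: comp_leq.
Qed.

Lemma comp_sum k (c : Env k -> nat) (h : Env k.+1 -> nat) : comp c -> comp h ->
  comp (fun e => \sum_(x < c e) h (e, val x)).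
Proof.
move=> Hc Hh; pose F (e : Env k.+2) := e.2 + h e.1.
have E (e : Env k) j : rc j 0 (fun x a => F (e, x, a)) = \sum_(x < j) h (e, val x).
  by elim: j => [|j IH] /=; rewrite ?big_ord0 // IH /F big_ord_recr.
apply: (@comp_eq k (fun e => rc (c e) 0 (fun x a => F (e, x, a)))); first by move=> e; rewrite E.
have [C HC] := comp_pb Hh.
apply: (@comp_rec k c (fun=> 0) (fun e => c e * (Emax e + c e + 2) ^ C) F) => //.
- exact: comp_zero.
- by apply: comp_add; [cget 0 | exact: comp_fst].
- apply: pb_mul; first exact: comp_pb.
  by apply: pb_exp; apply: pb_add => //; [apply: pb_add => //; [exact: pb_max | exact: comp_pb] | exact: pb_const].
move=> e j Hj; rewrite E; apply: (@leq_trans (\sum_(x < j) (Emax e + c e + 2) ^ C)).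
  apply: leq_sum => x _; apply: leq_trans (HC _) _; case: (C) => // C'.
  by rewrite leq_exp2r // /mu0 /=; have := ltn_ord x; lia.
by rewrite sum_nat_const card_ord leq_mul2r Hj orbT.
Qed.

(** * Decidable bounded predicates *)

(** Classical logic gives every proposition a truth value, so connectives become arithmetic and
    bounded quantifiers become sums. *)
Definition cdec k (P : Env k -> Prop) := comp (fun e => `[< P e >] : nat).

Lemma cdec_eq k (P Q : Env k -> Prop) : (forall e, P e <-> Q e) -> cdec P -> cdec Q.
Proof. by move=> H; apply: comp_eq => e; congr (nat_of_bool _); apply: asbool_equiv_eq. Qed.

Lemma cdec_bool k (b : Env k -> bool) : comp (fun e => b e : nat) -> cdec (fun e => b e).
Proof. by apply: comp_eq => e; rewrite asboolb. Qed.

Lemma cdec_leq k (f g : Env k -> nat) : comp f -> comp g -> cdec (fun e => f e <= g e).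
Proof. by move=> Hf Hg; apply: cdec_bool; exact: comp_leq. Qed.

Lemma cdec_nateq k (f g : Env k -> nat) : comp f -> comp g -> cdec (fun e => f e = g e).
Proof.
move=> Hf Hg; apply: (@cdec_eq _ (fun e => f e == g e)); first by move=> e; split=> /eqP.
by apply: cdec_bool; exact: comp_eqn.
Qed.

Lemma cdec_not k (P : Env k -> Prop) : cdec P -> cdec (fun e => ~ P e).
Proof.
move=> HP; apply: (@comp_eq _ (fun e => 1 - `[< P e >])).
  by move=> e; rewrite asbool_neg; case: asboolP.
by apply: comp_sub => //; exact: comp_const.
Qed.

Lemma cdec_and k (P Q : Env k -> Prop) : cdec P -> cdec Q -> cdec (fun e => P e /\ Q e).
Proof.
move=> HP HQ; apply: (@comp_eq _ (fun e => `[< P e >] * `[< Q e >])).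
  by move=> e; rewrite asbool_and mulnb.
exact: comp_mul.
Qed.

Lemma cdec_or k (P Q : Env k -> Prop) : cdec P -> cdec Q -> cdec (fun e => P e \/ Q e).
Proof.
move=> HP HQ; apply: (@cdec_eq _ (fun e => ~ (~ P e /\ ~ Q e))); last first.
  by apply: cdec_not; apply: cdec_and; exact: cdec_not.
move=> e; split; last by tauto.
by move=> H; have [|] := pselect (P e); [left | have [|] := pselect (Q e); [right | tauto]].
Qed.

Lemma cdec_imp k (P Q : Env k -> Prop) : cdec P -> cdec Q -> cdec (fun e => P e -> Q e).
Proof.
move=> HP HQ; apply: (@cdec_eq _ (fun e => ~ P e \/ Q e)); last first.
  by apply: cdec_or => //; exact: cdec_not.
move=> e; split; first by tauto.
by move=> H; have [|] := pselect (P e); tauto.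
Qed.

Lemma cdec_ex k (c : Env k -> nat) (P : Env k -> nat -> Prop) : comp c ->
  cdec (fun e : Env k.+1 => P e.1 e.2) -> cdec (fun e => exists x, x < c e /\ P e x).
Proof.
move=> Hc HP.
apply: (@cdec_eq _ (fun e => 0 < \sum_(x < c e) `[< P e x >])); last first.
  apply: cdec_leq; first exact: comp_const.
  exact: (@comp_sum k c (fun e => `[< P e.1 e.2 >])).
move=> e; rewrite lt0n sum_nat_eq0 negb_forall; split.
  move=> /existsP[x]; rewrite implyTb eqb0 negbK => /asboolP Hx.
  by exists x; split=> //.
move=> [x [Hx Px]]; apply/existsP; exists (Ordinal Hx).
by rewrite implyTb eqb0 negbK; apply/asboolP.
Qed.

Lemma cdec_all k (c : Env k -> nat) (P : Env k -> nat -> Prop) : comp c ->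
  cdec (fun e : Env k.+1 => P e.1 e.2) -> cdec (fun e => forall x, x < c e -> P e x).
Proof.
move=> Hc HP; apply: (@cdec_eq _ (fun e => ~ exists x, x < c e /\ ~ P e x)); last first.
  by apply: cdec_not; apply: (@cdec_ex _ c (fun e x => ~ P e x)) => //; exact: cdec_not.
move=> e; split; last by move=> H [x [Hx]]; apply; exact: H.
by move=> H x Hx; have [//|nP] := pselect (P e x); case: H; exists x.
Qed.

Lemma comp_if k (P : Env k -> bool) (f g : Env k -> nat) :
  comp (fun e => P e : nat) -> comp f -> comp g -> comp (fun e => if P e then f e else g e).
Proof.
move=> HP Hf Hg; apply: (@comp_eq _ (fun e => P e * f e + (1 - P e) * g e)).
  by move=> e; case: (P e); rewrite ?mul1n ?mul0n ?addn0 ?add0n.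
by apply: comp_add; apply: comp_mul => //; apply: comp_sub => //; exact: comp_const.
Qed.

Lemma comp_min k (f g : Env k -> nat) : comp f -> comp g -> comp (fun e => minn (f e) (g e)).
Proof.
move=> Hf Hg; apply: (@comp_eq _ (fun e => if f e <= g e then f e else g e)).
  by move=> e; case: leqP.
by apply: comp_if => //; exact: comp_leq.
Qed.

Lemma comp_div k (f g : Env k -> nat) : comp f -> comp g -> comp (fun e => f e %/ g e).
Proof.
apply: comp_op2.
(* The quotient counts the positive multiples of the divisor up to the dividend; the factor
   [0 < e.2] gives the value 0 for the divisor 0. *)
apply: (@comp_eq 2 (fun e => \sum_(x < e.1.2) ((0 < e.2) * (x.+1 * e.2 <= e.1.2)))).
  move=> [[u a] b] /=; case: b => [|b]; first by rewrite divn0 big1.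
  have E m : \sum_(x < m) ((0 < b.+1) * (x.+1 * b.+1 <= a)) = minn m (a %/ b.+1).
    elim: m => [|m IH]; first by rewrite big_ord0 min0n.
    rewrite big_ord_recr IH /= mul1n -leq_divRL //; case: leqP; lia.
  by rewrite E; apply/minn_idPr; exact: leq_div.
apply: (@comp_sum 2 (fun e => e.1.2) (fun e => (0 < e.1.2) * (e.2.+1 * e.1.2 <= e.1.1.2))); first cget 1.
apply: comp_mul; apply: comp_leq; [exact: comp_const | cget 1 | | cget 2].
by apply: comp_mul; [apply: comp_succ; cget 0 | cget 1].
Qed.

Lemma comp_mod k (f g : Env k -> nat) : comp f -> comp g -> comp (fun e => f e %% g e).
Proof.
move=> Hf Hg; apply: (@comp_eq _ (fun e => f e - f e %/ g e * g e)).
  by move=> e; rewrite {1}(divn_eq (f e) (g e)) addKn.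
by apply: comp_sub => //; apply: comp_mul => //; exact: comp_div.
Qed.

Lemma comp_op3 (h : nat -> nat -> nat -> nat) : comp (fun e : Env 3 => h e.1.1.2 e.1.2 e.2) ->
  forall k (f g l : Env k -> nat), comp f -> comp g -> comp l -> comp (fun e => h (f e) (g e) (l e)).
Proof.
move=> Hh k f g l Hf Hg Hl.
apply: (@comp_let k f (fun e => h e.2 (g e.1) (l e.1))) => //.
apply: (@comp_let k.+1 (fun e => g e.1) (fun e => h e.1.2 e.2 (l e.1.1))); first exact: comp_fst.
apply: (@comp_let k.+2 (fun e => l e.1.1) (fun e => h e.1.1.2 e.1.2 e.2)).
  exact: (comp_fst (comp_fst Hl)).
apply: (@comp_re k.+3 3 (fun e => (tt, e.1.1.2, e.1.2, e.2))) Hh => //.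
- by move=> d e /= /andP[/andP[/andP[_ ->] ->] ->].
- by move=> e /=; lia.
Qed.

(* [a ^ n] truncated at [B], which keeps values polynomially bounded in the environment. *)
Lemma comp_tpow k (B f g : Env k -> nat) : comp B -> comp f -> comp g ->
  comp (fun e => minn (f e ^ g e) (B e)).
Proof.
move=> HB Hf Hg; move: k B f g HB Hf Hg.
suff H k (B f g : Env k -> nat) : comp B -> comp f -> comp g -> comp (fun e => minn (f e ^ g e) (B e)) by [].
apply: (@comp_op3 (fun b a n => minn (a ^ n) b)).
pose F (e : Env 5) := minn (e.2 * e.1.1.1.2) e.1.1.1.1.2.
have E (e : Env 3) j : rc j (minn 1 e.1.1.2) (fun x a => F (e, x, a)) = minn (e.1.2 ^ j) e.1.1.2.
  elim: j => [|j IH] //=; rewrite IH /F /=.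
  move: (e.1.2) (e.1.1.2) => a b; rewrite expnSr; move: (a ^ j) => c.
  case: (posnP a) => [->|a0]; first by rewrite !muln0.
  by rewrite minnMl -minnA; congr minn; apply/minn_idPr; rewrite leq_pmulr.
apply: (@comp_eq 3 (fun e => rc e.2 (minn 1 e.1.1.2) (fun x a => F (e, x, a)))); first by move=> e; rewrite E.
apply: (@comp_rec 3 (fun e => e.2) (fun e => minn 1 e.1.1.2) (fun e => e.1.1.2) F).
- cget 0.
- by apply: comp_min; [exact: comp_const | cget 2].
- by apply: comp_min; [apply: comp_mul; [cget 0 | cget 3] | cget 4].
- exact: (@pb_get 3 2).
- by move=> e j _; rewrite E geq_minr.
Qed.

Definition dig b c i := c %/ b ^ i %% b.

(** Truncating the power at [c.+1] keeps it small and changes nothing, because the quotient is 0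
    beyond that. *)
Lemma comp_dig k (b c i : Env k -> nat) : comp b -> comp c -> comp i ->
  comp (fun e => dig (b e) (c e) (i e)).
Proof.
move=> Hb Hc Hi.
apply: (@comp_eq _ (fun e => c e %/ minn (b e ^ i e) (c e).+1 %% b e)).
  move=> e; rewrite /dig; case: (leqP (b e ^ i e) (c e).+1) => H //.
  by rewrite !divn_small // ltnW.
by apply: comp_mod => //; apply: comp_div => //; apply: comp_tpow => //; exact: comp_succ.
Qed.

Lemma compm_comp k (mu f : Env k -> nat) : (forall e, mu0 e <= mu e) -> comp f -> compm mu f.
Proof.
move=> Hmu [T [[C1 H1] [C2 H2] H]]; exists T; split=> //; [exists C1 | exists C2] => e.
  by apply: leq_trans (H1 e) _; case: C1 {H1} => // C; rewrite leq_exp2r.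
by apply: leq_trans (H2 e) _; case: C2 {H2} => // C; rewrite leq_exp2r.
Qed.

(** Repeated doubling is a limited recursion as soon as the measure dominates its result. *)
Lemma compm_exp2 k (mu f : Env k -> nat) : (forall e, mu0 e <= mu e) -> compm mu f ->
  (forall e, 2 ^ f e <= mu e) -> compm mu (fun e => 2 ^ f e).
Proof.
move=> Hmu Hf Hle; pose F (e : Env k.+2) := e.2 + e.2.
have E (e : Env k) j : rc j 1 (fun x a => F (e, x, a)) = 2 ^ j.
  by elim: j => [|j IH] //=; rewrite IH /F addnn -mul2n -expnS.
have -> : (fun e => 2 ^ f e) = (fun e => rc (f e) 1 (fun x a => F (e, x, a))).
  by apply/funext => e; rewrite E.
apply: (@compm_rec k mu f (fun=> 1) (fun e => 2 ^ f e) F) => //.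
- by apply: compm_comp => //; exact: comp_const.
- by apply: comp_add; cget 0.
- by exists 1 => e; rewrite expn1.
- by move=> e j Hj; rewrite E leq_pexp2l.
Qed.

(** * Reading the input and the resulting Turing machine *)

Definition wval (x : nat) (w : seq bool) := foldl (fun x (b : bool) => 2 * x + b) x w.

(** Consumes one bit: register 0 accumulates the value and register 1 the length. [CClr 2] is an
    idle step, register 2 being empty at that point, so that both branches take the same time. *)
Definition rdc (b : bool) := CLoop 0 (CInc 2 ;; CInc 2) ;; CLoop 2 (CInc 0) ;;
  (if b then CInc 0 else CClr 2) ;; CInc 1.

Definition rst x m : nat -> nat := upd (upd (fun=> 0) 0 x) 1 m.

Lemma ex_rdc (b : bool) i x m : exists t,
  ex (rdc b) i (rst x m) t i (rst (2 * x + b) m.+1) /\ t <= 7 * x + 4.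
Proof.
have [||t1 [E1 L1]] := @ex_loop 0 (CInc 2 ;; CInc 2) i
  (fun j => upd (upd (rst x m) 2 (2 * j)) 0 (x - j)) x 2.
- by move=> j _; rewrite /upd.
- move=> j Hj; exists (1 + 1); split=> //.
  set s1 := upd _ 0 (x - j).-1.
  have -> : upd (upd (rst x m) 2 (2 * j.+1)) 0 (x - j.+1) =
     upd (upd s1 2 (s1 2).+1) 2 (upd s1 2 (s1 2).+1 2).+1.
    by rewrite /s1 /rst; updeq.
  by apply: ExSeq; exact: ExInc.
rewrite /= in E1.
have Es : upd (upd (rst x m) 2 (2 * 0)) 0 (x - 0) = rst x m by rewrite /rst; updeq.
rewrite Es in E1; set s1 := upd _ 0 (x - x) in E1.
have s12 : s1 2 = 2 * x by [].
have [||t2 [E2 L2]] := @ex_move 2 0 i s1; rewrite ?s12 //; first by rewrite /s1 /upd /= subnn.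
set s2 := upd _ 2 0 in E2.
have s20 : s2 = rst (2 * x) m by rewrite /s2 s12 /s1 /rst; updeq.
rewrite s20 in E2.
have E3 : ex (if b then CInc 0 else CClr 2) i (rst (2 * x) m) 1 i (rst (2 * x + b) m).
  case: (b).
    have -> : rst (2 * x + true) m = upd (rst (2 * x) m) 0 (rst (2 * x) m 0).+1.
      by rewrite /rst; updeq.
    exact: ExInc.
  have -> : rst (2 * x + false) m = upd (rst (2 * x) m) 2 0 by rewrite /rst; updeq.
  exact: (ExClr 2 i (rst (2 * x) m)).
have E4 : ex (CInc 1) i (rst (2 * x + b) m) 1 i (rst (2 * x + b) m.+1).
  have -> : rst (2 * x + b) m.+1 = upd (rst (2 * x + b) m) 1 (rst (2 * x + b) m 1).+1.
    by rewrite /rst; updeq.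
  exact: ExInc.
exists (t1 + (t2 + (1 + 1))); split; first exact: ExSeq E1 (ExSeq E2 (ExSeq E3 E4)).
by rewrite s12 in L2; lia.
Qed.

Lemma ex_read w x m : exists t,
  ex (CRead (rdc false) (rdc true)) w (rst x m) t [::] (rst (wval x w) (m + size w)) /\
  t <= size w * (13 * (x.+1 * 2 ^ size w)) + 1.
Proof.
elim: w x m => [|b w IH] x m; first by exists 1; rewrite addn0; split=> //; exact: ExRead0.
have [t1 [E1 L1]] := ex_rdc b w x m; have [t2 [E2 L2]] := IH (2 * x + b) m.+1.
exists (t1 + t2).+1; split.
  by rewrite /= addnS -addSn; apply: (ExReadS (b := b) _ E2); move: E1; clear; case: b.
have H : (2 * x + b).+1 * 2 ^ size w <= x.+1 * 2 ^ (size w).+1.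
  by rewrite expnS mulnA leq_mul2r; case: (b); lia.
have H0 : x.+1 <= x.+1 * 2 ^ (size w).+1 by rewrite leq_pmulr // expn_gt0.
move: L2 H H0; rewrite /=; set A := (_ * 2 ^ size w); set A' := (x.+1 * _); move=> L2 H H0.
have : size w * (13 * A) <= size w * (13 * A') by rewrite leq_mul2l leq_mul2l H !orbT.
rewrite mulSn; lia.
Qed.

Lemma wval_lt w x : wval x w < x.+1 * 2 ^ size w.
Proof.
elim: w x => [|b w IH] x; first by rewrite /= muln1.
apply: leq_trans (IH _) _; rewrite /= expnS mulnA leq_mul2r; case: (b); lia.
Qed.

Lemma leq_powD x a b : 1 < x -> x ^ a + x ^ b <= x ^ (a + b).+1.
Proof.
move=> x1; apply: (@leq_trans (x ^ (a + b) + x ^ (a + b))).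
  by apply: leq_add; rewrite leq_pexp2l; lia.
by rewrite addnn -mul2n expnS leq_mul2r x1 orbT.
Qed.

Lemma ltn_exp2 n : n < 2 ^ n. Proof. exact: ltn_expl. Qed.

Lemma const_pow x c : 1 < x -> c <= x ^ c.
Proof. by move=> x1; apply: ltnW; exact: ltn_expl. Qed.

(** Length and value in base two determine the word. The time is polynomial in these two and in the
    search bound, and raising [2 ^ 2 ^ A] to a fixed power costs only a constant added to [A]. *)
Theorem cdec_tm (P : nat -> nat -> nat -> Prop) k :
  cdec (fun e : Env 3 => P e.1.1.2 e.1.2 e.2) ->
  exists (M : TM) k', forall w, 0 < size w ->
    decides_within M w (2 ^ (2 ^ ((size w).+1 ^ k')))
      (P (size w) (wval 0 w) (2 ^ (2 ^ ((size w).+2 ^ k)))).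
Proof.
move=> HP.
pose a (e : Env 2) := e.1.2.+2 ^ k.
(* The first summand makes the computation of the search bound itself polynomial in the measure. *)
pose mu (e : Env 2) := 2 ^ (2 ^ a e) + mu0 e.
have Hmu e : mu0 e <= mu e by rewrite leq_addl.
have ca : comp a.
  rewrite /a; elim: (k) => [|j IH]; first by apply: (@comp_eq _ (fun=> 1)) => //; exact: comp_const.
  apply: (@comp_eq _ (fun e : Env 2 => e.1.2.+2 * e.1.2.+2 ^ j)); first by move=> e; rewrite expnS.
  by apply: comp_mul => //; do 2! apply: comp_succ; cget 1.
have D e : 2 ^ 2 ^ a e <= mu e by rewrite leq_addr.
have c1 : compm mu (fun e => 2 ^ a e).
  by apply: compm_exp2 => //; [exact: compm_comp | move=> e; apply: leq_trans (D e); apply: ltnW; exact: ltn_exp2].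
have c2 : compm mu (fun e => 2 ^ 2 ^ a e) by apply: compm_exp2.
have [T [[C HT] _ H]] := @compm_let 2 mu _ (fun e => `[< P e.1.1.2 e.1.2 e.2 >] : nat) Hmu c2 HP.
have [c Hc] := H ((tt, 1), 0) 2 isT.
pose cc := CRead (rdc false) (rdc true) ;; c.
pose K := (maxn 2 (cmax cc)).+1.
pose c' := 4 * C + 2 * K + 20.
exists (tmof (prog_of cc 2) (maxn 2 (cmax cc))), (2 * k + c' + 20) => w w0.
set n := size w.
have [t1 [E1 L1]] := ex_read w 0 0; rewrite add0n -/n in E1 L1; set X := wval 0 w in E1 *.
have [|t2 [E2 L2]] := Hc [::] (rst X n); first by case=> [|[|r]].
have E3 : ex cc w (fun=> 0) (t1 + t2) [::] (upd (rst X n) 2 `[< P n X (2 ^ 2 ^ n.+2 ^ k) >]).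
  apply: ExSeq E2; suff -> : (fun=> 0) = rst 0 0 by exact: E1.
  by rewrite /rst; updeq.
have HPr : upd (rst X n) 2 `[< P n X (2 ^ 2 ^ n.+2 ^ k) >] 2 != 0 <-> P n X (2 ^ 2 ^ n.+2 ^ k).
  by rewrite /upd eqxx eqb0 negbK; split=> /asboolP.
have [N [cf0 [HN Hrest]]] := com_decides E3 HPr.
exists N, cf0; split=> //; apply: leq_trans HN _.
have Xn : X < 2 ^ n by have := wval_lt w 0; rewrite mul1n.
(* [E] dominates the search bound, the length and value of the word, and the time spent on reading
   it. *)
pose A := n.+2 ^ k + n + 2; pose E := 2 ^ 2 ^ A.
have nA : n + 2 <= A by rewrite /A; lia.
have E2n : 2 ^ (2 * n + 6) <= E.
  rewrite /E leq_exp2l //; apply: (@leq_trans (2 ^ (n + 2))); last by rewrite leq_exp2l.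
  rewrite expnD; have := ltn_exp2 n; move: (2 ^ n) => z; lia.
have E1' : 1 < E by apply: leq_trans E2n; rewrite -{1}[2]expn1 leq_exp2l; lia.
have nn : n < 2 ^ n := ltn_exp2 n.
have F1 : 16 * n * 2 ^ n + 2 * n + 10 <= E.
  apply: leq_trans E2n; have -> : 2 * n + 6 = n + n + 6 by lia.
  by rewrite !expnD; move: nn; move: (2 ^ n) => z; nia.
have F2 : mu (tt, n, X) <= E ^ 2.
  rewrite /mu /a /mu0 /=.
  have : 2 ^ 2 ^ n.+2 ^ k <= E by rewrite !leq_exp2l //; rewrite /A; lia.
  rewrite max0n expnS expn1; have : (maxn n X).+2 <= E.
    apply: leq_trans F1; have : maxn n X < 2 ^ n by rewrite gtn_max nn.
    by move: w0; rewrite -/n; move: (maxn n X) (2 ^ n) => u z; nia.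
  move: (maxn n X).+2 => u; move: E1'; clearbody E; move: (2 ^ 2 ^ n.+2 ^ k) => v; nia.
have F3 : t2 <= E ^ (2 * C).
  apply: leq_trans L2 _; apply: leq_trans (HT _) _.
  by rewrite expnM; case: (C) => // C0; rewrite leq_exp2r.
have F4 : (t1 + t2).+2 <= E ^ (2 * C).+2.
  have : t1.+2 <= E.
    apply: leq_trans F1; move: L1; rewrite mul1n; move: (2 ^ n) nn => z; nia.
  have G := expn_gt0 E (2 * C); move: F3 G; rewrite !expnS; move: (E ^ _) => u; clearbody E.
  rewrite (ltnW E1') /= => ? ?; nia.
have F5 : (t1 + t2).+2 * (2 * (K * (t1 + t2).+2) + 2 * size w + 10) <= E ^ (4 * C + 2 * K + 10).
  have -> : 4 * C + 2 * K + 10 = (2 * C).+2 + ((2 * K + (2 * C).+2) + 1 + 5) by lia.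
  rewrite [E ^ (_ + (_ + _))]expnD; apply: leq_mul => //.
  apply: (@leq_trans (E ^ (2 * K + (2 * C).+2) + E ^ 1)).
    rewrite -addnA; apply: leq_add; last by rewrite expn1; apply: leq_trans F1; rewrite /n; lia.
    by rewrite expnD mulnA; apply: leq_mul => //; exact: const_pow.
  by apply: leq_trans (leq_powD _ _ E1') _; rewrite leq_exp2l //; lia.
apply: leq_trans F5 _; rewrite -/n.
rewrite /E -expnM leq_exp2l //.
apply: (@leq_trans (2 ^ (A + (4 * C + 2 * K + 10)))); first by rewrite expnD leq_mul2l const_pow ?orbT.
rewrite leq_exp2l // /A.
have n2 : 1 < n.+1 by [].
have G1 : n.+2 ^ k <= n.+1 ^ (2 * k).
  by rewrite expnM; case: (k) => // k0; rewrite leq_exp2r // expnS expn1; nia.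
have G2 : n + 2 + (4 * C + 2 * K + 10) <= n.+1 ^ (1 + (4 * C + 2 * K + 12)).
  have := const_pow (4 * C + 2 * K + 12) n2; rewrite add1n expnS; move: (n.+1 ^ _) => u; nia.
rewrite -(addnA _ n 2) -(addnA (n.+2 ^ k)); apply: leq_trans (leq_add G1 G2) _.
apply: leq_trans (leq_powD _ _ n2) _; rewrite leq_exp2l // /c'; lia.
Qed.

(** * Memoryless opponents suffice for shuffle-closed objectives *)

(* A position [x] lets the protagonist choose a move [y] with [A x y]; the opponent answers with
   a response [t], leading to [nx y t].  Histories list the responses, the latest first. *)
Section Shuffle.
Variables (X Y T : finType) (A : X -> Y -> bool) (nx : Y -> T -> X) (x0 : X).
Variable Win : (nat -> Y * T) -> Prop.

Definition infoft (g : nat -> Prop) := forall N, exists2 k, N <= k & g k.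

Hypothesis win_shift : forall rho rho' a b,
  (forall k, rho (k + a) = rho' (k + b)) -> Win rho -> Win rho'.
(** Mixing is asked only of plays in which a common move recurs; in the arena this makes the
    promises of the two plays agree. *)
Hypothesis win_mix : forall y rho1 rho2 rho (g : nat -> bool) c1 c2,
  Win rho1 -> Win rho2 ->
  (forall k, c1 k.+1 = c1 k + g k) -> (forall k, c2 k.+1 = c2 k + ~~ g k) ->
  (forall k, rho k = if g k then rho1 (c1 k) else rho2 (c2 k)) ->
  infoft g -> infoft (fun k => ~~ g k) ->
  infoft (fun k => (rho1 k).1 = y) -> infoft (fun k => (rho2 k).1 = y) -> Win rho.

Fixpoint hs (t : nat -> T) k := if k is k'.+1 then t k' :: hs t k' else [::].

Definition hpos (s : seq T -> Y) H := if H is t :: H' then nx (s H') t else x0.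

Fixpoint hallowed (Ch : Y -> pred T) (s : seq T -> Y) H :=
  if H is t :: H' then Ch (s H') t && hallowed Ch s H' else true.

(** The answers of the opponent are restricted to [Ch]; when all these sets are singletons he has
    become memoryless. *)
Definition swin Ch s := (forall H, hallowed Ch s H -> A (hpos s H) (s H)) /\
  (forall t, (forall k, hallowed Ch s (hs t k)) -> Win (fun k => (s (hs t k), t k))).

Lemma hallowed_hs Ch s t m n : m <= n -> hallowed Ch s (hs t n) -> hallowed Ch s (hs t m).
Proof.
move=> mn; rewrite -(subnK mn) addnC; elim: (n - m) => [|d IH]; first by rewrite addn0.
by rewrite addnS /= => /andP[_ /IH].
Qed.

Lemma infoftN (g : nat -> bool) : ~ infoft g -> exists N, forall k, N <= k -> ~~ g k.
Proof.
move=> H; apply: contrapT => H'; apply: H => N; apply: contrapT => H2; apply: H'.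
by exists N => k Hk; apply/negP => gk; apply: H2; exists k.
Qed.

(** The share of a play handled by one of two interleaved strategies is a growing history; if it
    grows forever, its limit [t'] is a complete run of the opponent against that strategy. *)
Lemma history_limit (t : nat -> T) (H : nat -> seq T) (g : nat -> bool) :
  (forall k, H k.+1 = if g k then t k :: H k else H k) -> infoft g ->
  (forall N, exists2 k, N <= k & N <= size (H k)) /\
  exists t', forall k, hs t' (size (H k)) = H k /\ (g k -> t' (size (H k)) = t k).
Proof.
move=> HS gi.
have Hpre k d : exists u, H (k + d) = u ++ H k.
  elim: d => [|d [u Hu]]; first by exists [::]; rewrite addn0.
  rewrite addnS HS Hu; case: ifP => _; last by exists u.
  by exists (t (k + d) :: u).
have Hgrow N : exists2 k, N <= k & N <= size (H k).
  elim: N => [|N [k Hk Hs]]; first by exists 0.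
  have [k' Hk' gk] := gi k; exists k'.+1; first by rewrite ltnS (leq_trans Hk).
  rewrite HS gk /= ltnS; have [u] := Hpre k (k' - k); rewrite subnKC // => ->.
  by rewrite size_cat (leq_trans Hs) // leq_addl.
split=> //.
pose K m := projT1 (cid2 (Hgrow m.+1)).
have HK m : m < size (H (K m)) by rewrite /K; case: cid2.
pose t' m := nth (t 0) (rev (H (K m))) m.
have Hnth k k' m : m < size (H k) -> k <= k' -> nth (t 0) (rev (H k')) m = nth (t 0) (rev (H k)) m.
  move=> Hm kk; have [u] := Hpre k (k' - k); rewrite subnKC // => ->.
  by rewrite rev_cat nth_cat size_rev Hm.
have Ht' k m : m < size (H k) -> t' m = nth (t 0) (rev (H k)) m.
  move=> Hm; rewrite /t'; case: (leqP k (K m)) => kk; first exact: Hnth.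
  by rewrite -(Hnth (K m) k m) // ltnW.
have Hhs h : (forall m, m < size h -> t' m = nth (t 0) (rev h) m) -> hs t' (size h) = h.
  elim: h => [|x h IH] //= Hx; rewrite Hx ?ltnS // rev_cons nth_rcons size_rev ltnn eqxx IH //.
  by move=> m Hm; rewrite Hx ?rev_cons ?nth_rcons ?size_rev ?Hm // ltnW.
exists t' => k; split; first by apply: Hhs => m Hm; exact: Ht'.
move=> gk; rewrite (Ht' k.+1) HS gk //= rev_cons nth_rcons size_rev ltnn eqxx //.
Qed.

(** Induction on the number of answers. With one answer per move the opponent is a fixed map.
    Otherwise pick a move [ys] with two answers: one strategy wins when [ts] is the only answer at
    [ys], another when [ts] is excluded there. They are combined by letting the answer given at each
    visit of [ys] decide which of them continues. *)
Lemma shuffle_win n (Ch : Y -> pred T) :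
  (forall y, exists t, Ch y t) -> \sum_y #|Ch y| <= n ->
  (forall tau : Y -> T, (forall y, Ch y (tau y)) -> exists ys : nat -> Y,
     [/\ A x0 (ys 0), forall k, A (nx (ys k) (tau (ys k))) (ys k.+1) &
         Win (fun k => (ys k, tau (ys k)))]) ->
  exists s, swin Ch s.
Proof.
elim: n Ch => [|n IHn] Ch Hne Hn Htau.
  case: (pselect (exists y : Y, True)) => [[y _]|noY].
    have [t Ht] := Hne y; move: Hn; rewrite (bigD1 y) //= leqn0 addn_eq0 => /andP[/eqP/card0_eq/(_ t)].
    by rewrite inE /in_mem /= Ht.
  have [|ys _] := Htau (fun y => projT1 (cid (Hne y))); first by move=> y; case: cid.
  by case: noY; exists (ys 0).
case: (pselect (exists y t1 t2, [/\ Ch y t1, Ch y t2 & t1 != t2])) => [[ys [ts [t2 [Hts Ht2 ts2]]]]|Huniq];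
  last first.
  have [tau Htau1] : exists tau : Y -> T, forall y, Ch y (tau y).
    by exists (fun y => projT1 (cid (Hne y))) => y; case: cid.
  have [ys [y0 yS HW]] := Htau tau Htau1.
  have uni y t : Ch y t -> t = tau y.
    by move=> Hy; apply: contrapT => /eqP ne; apply: Huniq; exists y, t, (tau y).
  exists (fun H => ys (size H)); split.
    move=> [|t H] //= /andP[/uni-> _]; exact: yS.
  move=> t Ht.
  have sz k : size (hs t k) = k by elim: k => //= k ->.
  apply: (win_shift (a := 0) (b := 0) _ HW) => k; rewrite !addn0 sz; congr (_, _).
  by have := Ht k.+1; rewrite /= sz => /andP[/uni].
pose Ch1 y t := if y == ys then t == ts else Ch y t.
pose Ch2 y t := if y == ys then Ch y t && (t != ts) else Ch y t.
have lt (C' : Y -> pred T) t0 : (forall y t, C' y t -> Ch y t) -> Ch ys t0 -> ~~ C' ys t0 ->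
    \sum_y #|C' y| <= n.
  move=> sub Ht0 Hnt0; rewrite -ltnS; apply: leq_trans Hn.
  rewrite (bigD1 ys) // [X in _ < X](bigD1 ys) //= -addSn; apply: leq_add.
    apply: proper_card; apply/fintype.properP; split; first by apply/fintype.subsetP => t; exact: sub.
    by exists t0.
  by apply: leq_sum => y _; apply: subset_leq_card; apply/fintype.subsetP => t; exact: sub.
have sub1 y t : Ch1 y t -> Ch y t by rewrite /Ch1; case: eqP => // -> /eqP->.
have sub2 y t : Ch2 y t -> Ch y t by rewrite /Ch2; case: eqP => // _ /andP[].
have [s1 [s1A s1W]] : exists s, swin Ch1 s.
  apply: IHn.
  - by move=> y; rewrite /Ch1; case: eqP => _; [exists ts | exact: Hne].
  - by apply: (lt _ t2) => //; rewrite /Ch1 eqxx eq_sym.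
  - by move=> tau Ht; apply: Htau => y; exact: sub1.
have [s2 [s2A s2W]] : exists s, swin Ch2 s.
  apply: IHn.
  - move=> y; rewrite /Ch2; case: eqP => [->|_]; last exact: Hne.
    by exists t2; rewrite Ht2 eq_sym.
  - by apply: (lt _ ts) => //; rewrite /Ch2 eqxx Hts eqxx.
  - by move=> tau Ht; apply: Htau => y; exact: sub2.
(* if [ys] is never reached, the restriction at [ys] is vacuous *)
have nohit C' s : (forall y, y != ys -> C' y = Ch y) -> swin C' s ->
    ~ (exists2 H, hallowed C' s H & s H = ys) -> swin Ch s.
  move=> HC [sA sW] Hno.
  have sub H : hallowed Ch s H -> hallowed C' s H.
    elim: H => [|t H IH] //= /andP[Ht /IH HH]; rewrite HH andbT HC //.
    by apply/eqP => E; apply: Hno; exists H.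
  by split=> [H /sub/sA|t Ht] //; apply: sW => k; exact: sub.
case: (pselect (exists2 H, hallowed Ch1 s1 H & s1 H = ys)) => [[h1 _ _]|no1]; last first.
  by exists s1; apply: (nohit Ch1) => // y /negbTE yn; apply/funext => t; rewrite /Ch1 yn.
case: (pselect (exists2 H, hallowed Ch2 s2 H & s2 H = ys)) => [[h2 h2a h2y]|no2]; last first.
  by exists s2; apply: (nohit Ch2) => // y /negbTE yn; apply/funext => t; rewrite /Ch2 yn.
(* The state holds a private history for each strategy and a flag for the active one. The dormant
   strategy always waits where it would play [ys]; starting the second one from [h2] makes this true
   at the outset. *)
pose mv (z : seq T * seq T * bool) := if z.2 then s1 z.1.1 else s2 z.1.2.
pose up z t : seq T * seq T * bool :=
  let f := if mv z == ys then t == ts else z.2 in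
  (if f then t :: z.1.1 else z.1.1, if f then z.1.2 else t :: z.1.2, f).
pose st := fix st (H : seq T) := if H is t :: H' then up (st H') t else ([::], h2, true).
pose s H := mv (st H).
have inv H : hallowed Ch s H -> [/\ hallowed Ch1 s1 (st H).1.1, hallowed Ch2 s2 (st H).1.2,
    (st H).2 -> s2 (st H).1.2 = ys, ~~ (st H).2 -> s1 (st H).1.1 = ys &
    hpos s H = if (st H).2 then hpos s1 (st H).1.1 else hpos s2 (st H).1.2].
  elim: H => [|t H IH] //= /andP[Ht /IH[]].
  rewrite /s /up /= -/(s H) in Ht *; rewrite /s in Ht *; move: Ht; case: (st H) => [[H1 H2] f] /=.
  rewrite /mv /= => Ht a1 a2 i2 i1 _.
  case: eqP => Ey /=.
    have E1 : s1 H1 = ys by case: f Ey i1 {Ht i2} => // _; apply.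
    have E2 : s2 H2 = ys by case: f Ey i2 {Ht i1} => // _; apply.
    case: eqP => Et /=; split=> //=; rewrite ?a1 ?a2 ?andbT ?E1 ?E2 //.
    - by rewrite /Ch1 eqxx Et.
    - by case: (f).
    - by rewrite /Ch2 eqxx; rewrite Ey in Ht; rewrite Ht; apply/eqP.
    - by case: (f).
  case: f Ey Ht i1 i2 => /eqP/negbTE Ey Ht i1 i2 /=; split=> //=.
  - by rewrite a1 andbT /Ch1 Ey.
  - by rewrite a2 andbT /Ch2 Ey.
exists s; split.
  move=> H Hal; have [a1 a2 _ _ ->] := inv H Hal; rewrite /s /mv.
  by case: (st H).2; [exact: s1A | exact: s2A].
move=> t Ht; set rho := (fun k => _).
pose S k := st (hs t k); pose H1 k := (S k).1.1; pose H2 k := (S k).1.2; pose g k := (S k.+1).2.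
have SS k : S k.+1 = up (S k) (t k) by [].
have H1S k : H1 k.+1 = if g k then t k :: H1 k else H1 k by [].
have H2S k : H2 k.+1 = if ~~ g k then t k :: H2 k else H2 k.
  by rewrite /H2 /g SS /up /=; case: ifP; case: ifP.
have [Inv] : (forall k, [/\ hallowed Ch1 s1 (H1 k), hallowed Ch2 s2 (H2 k),
    g k -> s2 (H2 k.+1) = ys & ~~ g k -> s1 (H1 k.+1) = ys]) /\ True.
  split=> // k; have [b1 b2 _ _ _] := inv _ (Ht k); have [_ _ c1 c2 _] := inv _ (Ht k.+1).
  by split.
move=> _.
have mvS k : rho k = if g k then (s1 (H1 k), t k) else (s2 (H2 k), t k).
  have [_ _ i2 i1 _] := inv _ (Ht k).
  rewrite /rho /s -/(S k) /g SS /up /= /H1 /H2; move: i1 i2; rewrite -/(S k); case: (S k) => [[h h'] f] /= i1 i2.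
  rewrite /mv /=; case: eqP => Ey; last by case: (f).
  have E1 : s1 h = ys by case: f Ey i1 {i2} => // _; apply.
  have E2 : s2 h' = ys by case: f Ey i2 {i1} => // _; apply.
  by rewrite Ey E1 E2; case: ifP.
pose c1 k := size (H1 k); pose c2 k := size (H2 k).
have c1S k : c1 k.+1 = c1 k + g k by rewrite /c1 H1S; case: (g k); rewrite ?addn1 ?addn0.
have c2S k : c2 k.+1 = c2 k + ~~ g k by rewrite /c2 H2S; case: (g k); rewrite ?addn1 ?addn0.
have W1 : infoft g -> exists t1, [/\ Win (fun k => (s1 (hs t1 k), t1 k)),
    forall k, g k -> rho k = (s1 (hs t1 (c1 k)), t1 (c1 k)) &
    (infoft (fun k => ~~ g k) -> infoft (fun k => s1 (hs t1 k) = ys))].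
  move=> gi; have [grow [t1 Ht1]] := history_limit H1S gi.
  exists t1; split.
  - apply: s1W => m; have [k _ Hk] := grow m; apply: (hallowed_hs Hk).
    by have [-> _] := Ht1 k; have [] := Inv k.
  - by move=> k gk; have [E1 E2] := Ht1 k; rewrite mvS gk /c1 E1 E2.
  - move=> ngi N; have [k0 _ Hk0] := grow N; have [k Hk ngk] := ngi k0.
    exists (c1 k.+1); last by have [E1 _] := Ht1 k.+1; rewrite /c1 E1; have [_ _ _ /(_ ngk) ->] := Inv k.
    apply: leq_trans Hk0 _; rewrite -/(c1 k0).
    have : k0 <= k.+1 by rewrite ltnW.
    move=> /subnKC <-; elim: (k.+1 - k0) => [|d IH]; first by rewrite addn0.
    by rewrite addnS c1S (leq_trans IH) // leq_addr.
have W2 : infoft (fun k => ~~ g k) -> exists t1, [/\ Win (fun k => (s2 (hs t1 k), t1 k)),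
    forall k, ~~ g k -> rho k = (s2 (hs t1 (c2 k)), t1 (c2 k)) &
    (infoft g -> infoft (fun k => s2 (hs t1 k) = ys))].
  move=> gi; have [grow [t1 Ht1]] := history_limit H2S gi.
  exists t1; split.
  - apply: s2W => m; have [k _ Hk] := grow m; apply: (hallowed_hs Hk).
    by have [-> _] := Ht1 k; have [] := Inv k.
  - by move=> k gk; have [E1 E2] := Ht1 k; rewrite mvS (negbTE gk) /c2 E1 E2.
  - move=> ngi N; have [k0 _ Hk0] := grow N; have [k Hk ngk] := ngi k0.
    exists (c2 k.+1); last by have [E1 _] := Ht1 k.+1; rewrite /c2 E1; have [_ _ /(_ ngk) -> _] := Inv k.
    apply: leq_trans Hk0 _; rewrite -/(c2 k0).
    have : k0 <= k.+1 by rewrite ltnW.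
    move=> /subnKC <-; elim: (k.+1 - k0) => [|d IH]; first by rewrite addn0.
    by rewrite addnS c2S (leq_trans IH) // leq_addr.
(* If one strategy is abandoned for good, the play ends as a run of the other one and shift
   invariance suffices. *)
case: (pselect (infoft g)) => [gi|/infoftN[N HN]]; last first.
  have [N0|t2' [Wt2 E2 _]] := W2; first by exists (maxn N N0); [exact: leq_maxr | apply: HN; exact: leq_maxl].
  apply: (win_shift (a := c2 N) (b := N) _ Wt2) => k.
  have -> : k + c2 N = c2 (k + N); last by rewrite E2 // HN // leq_addl.
  by elim: k => [|k IH] //; rewrite !addSn c2S -IH HN ?addn1 // leq_addl.
have [t1 [Wt1 E1 Y1]] := W1 gi.
case: (pselect (infoft (fun k => ~~ g k))) => [ngi|/infoftN[N HN]]; last first.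
  have HN' k : N <= k -> g k by move=> /HN; rewrite negbK.
  apply: (win_shift (a := c1 N) (b := N) _ Wt1) => k.
  have -> : k + c1 N = c1 (k + N); last by rewrite E1 // HN' // leq_addl.
  by elim: k => [|k IH] //; rewrite !addSn c1S -IH HN' ?addn1 // leq_addl.
have [t2' [Wt2 E2 Y2]] := W2 ngi.
apply: (win_mix (y := ys) Wt1 Wt2 c1S c2S _ gi ngi (Y1 ngi) (Y2 gi)) => k.
by case: ifP => [/E1|/negbT/E2].
Qed.

End Shuffle.

(** * Small rational solutions of linear systems *)

Section LinearSystems.
Local Open Scope ring_scope.
Variable R : realFieldType.

(** Pigeonhole: among finitely many candidates one serves arbitrarily small [d]. *)
Lemma fin_small (C : finType) (P : C -> R -> Prop) :
  (forall e, 0 < e -> exists c d, [/\ 0 < d, d < e & P c d]) ->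
  exists c, forall e, 0 < e -> exists d, [/\ 0 < d, d < e & P c d].
Proof.
move=> H; apply: contrapT => Hn.
have He c : exists e, 0 < e /\ forall d, 0 < d -> d < e -> ~ P c d.
  apply: contrapT => Hc; apply: Hn; exists c => e e0.
  by apply: contrapT => Hd; apply: Hc; exists e; split=> // d d0 de Pd; apply: Hd; exists d.
pose ee c := projT1 (cid (He c)).
have ee0 c : 0 < ee c by rewrite /ee; case: cid => ? [].
have eeP c d : 0 < d -> d < ee c -> ~ P c d by rewrite /ee; case: cid => ? [? HH] /=; exact: HH.
have Hmin : exists e, 0 < e /\ forall c, e <= ee c.
  suff [e [e0 He']] : exists e, 0 < e /\ forall c, c \in enum C -> e <= ee c.
    by exists e; split=> // c; apply: He'; rewrite mem_enum.
  elim: (enum C) => [|c s [e [e0 IH]]]; first by exists 1.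
  exists (Num.min e (ee c)); split; first by rewrite lt_min e0 ee0.
  move=> c'; rewrite inE => /orP[/eqP->|/IH H']; first by rewrite ge_min lexx orbT.
  by rewrite ge_min H'.
have [e [e0 Hle]] := Hmin; have [c [d [d0 de Pd]]] := H e e0.
by apply: (eeP c d d0 _ Pd); apply: lt_le_trans (Hle c).
Qed.

Lemma small_ge0 (a c : R) : (forall e, 0 < e -> exists d, [/\ 0 < d, d < e & 0 <= a + d * c]) -> 0 <= a.
Proof.
move=> H; rewrite leNgt; apply/negP => a0.
have c1 : 0 < `|c| + 1 by rewrite ltr_pwDr // normr_ge0.
have [|d [d0 dl Hd]] := H (- a / (`|c| + 1)); first by rewrite divr_gt0 // oppr_gt0.
move: dl; rewrite ltr_pdivlMr // => dl.
have : d * c <= d * (`|c| + 1) by rewrite ler_pM2l // (le_trans (ler_norm _)) // lerDl.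
lra.
Qed.

(** Caratheodory's theorem for cones: while the rows in use are dependent, a multiple of the
    dependency is subtracted until a first coefficient reaches 0. *)
Lemma basic_solution n m (P : 'M[R]_(n, m)) (c : 'rV[R]_m) (J : {set 'I_n}) (x : 'I_n -> R) :
  (forall j, 0 <= x j) -> \sum_(j in J) x j *: row j P = c ->
  exists (J' : {set 'I_n}) (y : 'rV[R]_#|J'|), [/\ row_free (rowsub (@enum_val _ (mem J')) P),
     forall k, 0 <= y 0 k & y *m rowsub (@enum_val _ (mem J')) P = c].
Proof.
move En: #|J| => N; elim: N J En x => [|N IH] J En x x0 Ex.
all: case: (boolP (row_free (rowsub (@enum_val _ (mem J)) P))) => [Hf|].
1,3: exists J, (\row_k x (enum_val k)); split=> // [k|]; rewrite ?mxE //.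
1,2: rewrite -Ex big_enum_val /= mulmx_sum_row; apply: eq_bigr => k _; rewrite !mxE; congr (_ *: _).
1,2: by apply/rowP => i; rewrite !mxE.
all: rewrite -kermx_eq0 => /rowV0Pn[u /sub_kermxP uP u0].
  case/negP: u0; apply/eqP/rowP => k; exfalso.
  by have : (k < 0)%N by rewrite -En; exact: ltn_ord.
have [v [vP [k vk]]] : exists v : 'rV[R]_#|J|, v *m rowsub (@enum_val _ (mem J)) P = 0 /\ exists k, 0 < v 0 k.
  have [k uk] : exists k, u 0 k != 0.
    apply: contrapT => Hu; case/negP: u0; apply/eqP/rowP => k; rewrite !mxE.
    by apply/eqP; apply: contrapT => /negP ?; apply: Hu; exists k.
  case: (ltgtP 0 (u 0 k)) uk => // uk _; first by exists u; split=> //; exists k.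
  by exists (- u); split; [rewrite mulNmx uP oppr0 | exists k; rewrite mxE oppr_gt0].
pose ratio k := x (enum_val k) / v 0 k.
(* The least ratio over the positive entries of [v] is the largest step that keeps all coefficients
   nonnegative. *)
have [k0 vk0 Hmin] : exists2 k0, 0 < v 0 k0 & forall k', 0 < v 0 k' -> ratio k0 <= ratio k'.
  have [k0 H1 H2] := @Order.TotalTheory.arg_minP _ _ _ k (fun k => 0 < v 0 k) ratio vk.
  by exists k0.
pose t := ratio k0.
have t0 : 0 <= t by rewrite /t /ratio divr_ge0 // ltW.
pose w j := if [pick k | enum_val k == j :> 'I_n] is Some k then v 0 k else 0.
have wE k' : w (enum_val k') = v 0 k'.
  rewrite /w; case: pickP => [k1 /eqP/enum_val_inj->|/(_ k')] //.
  by rewrite eqxx.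
pose x' j := x j - t * w j.
have x'0 j : j \in J -> 0 <= x' j.
  move=> jJ; rewrite /x' -[j](enum_rankK_in jJ jJ) wE subr_ge0; set k' := enum_rank_in _ _.
  case: (ltP 0 (v 0 k')) => Hk; first by rewrite -ler_pdivlMr //; exact: Hmin.
  by apply: (@le_trans _ _ 0) => //; rewrite mulr_ge0_le0.
have sum0 : \sum_(j in J) w j *: row j P = 0.
  rewrite big_enum_val /= -[RHS]vP mulmx_sum_row; apply: eq_bigr => k' _; rewrite wE; congr (_ *: _).
  by apply/rowP => i; rewrite !mxE.
have k0J : enum_val k0 \in J by apply: enum_valP.
have x'k : x' (enum_val k0) = 0 by rewrite /x' wE /t /ratio divfK ?gt_eqF // subrr.
apply: (IH (J :\ enum_val k0) _ (fun j => if j \in J then x' j else 0)).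
- by move: En; rewrite (cardsD1 (enum_val k0) J) k0J => [[]].
- by move=> j; case: ifP => // /x'0.
transitivity (\sum_(j in J) x' j *: row j P).
  rewrite [RHS](big_setD1 _ k0J) /= x'k scale0r add0r; apply: eq_bigr => j; rewrite finset.in_setD1 => /andP[_ ->] //.
have -> : \sum_(j in J) x' j *: row j P =
    \sum_(j in J) x j *: row j P - t *: (\sum_(j in J) w j *: row j P).
  rewrite scaler_sumr -sumrB.
  by apply: eq_bigr => j _; rewrite /x' scalerBl scalerA.
by rewrite sum0 scaler0 subr0.
Qed.

End LinearSystems.

(** * Determinant bounds and integral solutions by Cramer's rule *)

Section DetBound.
Local Open Scope ring_scope.

Lemma det_bound n (A : 'M[int]_n) (M : nat) : (forall i j, `|A i j| <= M%:Z) ->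
  `|\det A| <= (n`! * M ^ n)%N%:Z.
Proof.
move=> HA; apply: le_trans (ler_norm_sum _ _ _) _.
apply: (@le_trans _ _ (\sum_(s : 'S_n) (M ^ n)%N%:Z)).
  apply: ler_sum => s _; rewrite normrM normrX normrN1 expr1n mul1r normr_prod.
  apply: (@le_trans _ _ (\prod_(i < n) M%:Z)); first by apply: ler_prod => i _; rewrite normr_ge0 HA.
  by rewrite prodr_const card_ord -[M%:Z]natz -natrX natz.
by rewrite sumr_const card_Sn -mulr_natl PoszM; rewrite natz.
Qed.

Lemma adj_bound n (A : 'M[int]_n) (M : nat) : (forall i j, `|A i j| <= M%:Z) ->
  forall i j, `|(\adj A) i j| <= (n.-1`! * M ^ n.-1)%N%:Z.
Proof.
move=> HA i j; rewrite mxE /cofactor normrM normrX normrN1 expr1n mul1r.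
by apply: det_bound => i' j'; rewrite !mxE.
Qed.

End DetBound.

Section LinearSystemsInt.
Local Open Scope ring_scope.
Variable R : realFieldType.

(** Solvability for every slack [e] is enough: one support [J] of basic solutions serves arbitrarily
    small slacks, and on it Cramer's rule makes the solution affine in the slack, so that signs and
    equations pass to slack 0. The bound is Leibniz's formula for a minor of size at most [m]. *)
Lemma bounded_solution_eq n m (P : 'M[int]_(n, m)) (b d : 'rV[int]_m) (M : nat) : (0 < M)%N ->
  (forall i j, `|P i j| <= M%:Z) -> (forall j, `|b 0 j| <= M%:Z) ->
  (forall e : R, 0 < e -> exists x : 'I_n -> R, (forall j, 0 <= x j) /\
     forall i, \sum_j x j * (P j i)%:~R = (b 0 i)%:~R + e * (d 0 i)%:~R) ->
  exists (q : nat) (z : 'I_n -> nat), [/\ (0 < q)%N, (q <= m`! * M ^ m)%N,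
     forall j, (z j <= m`! * M ^ m)%N &
     forall i, \sum_j (z j)%:Z * P j i = q%:Z * b 0 i].
Proof.
move=> M0 HP Hb H; pose PR := map_mx (intr : int -> R) P.
pose cR e := map_mx (intr : int -> R) b + e *: map_mx (intr : int -> R) d.
have [J HJ] : exists J : {set 'I_n}, forall e : R, 0 < e -> exists d, [/\ 0 < d, d < e &
    row_free (rowsub (@enum_val _ (mem J)) PR) /\ exists y : 'rV[R]_#|J|,
    (forall k, 0 <= y 0 k) /\ y *m rowsub (@enum_val _ (mem J)) PR = cR d].
  apply: fin_small => e e0; have e2 : 0 < e / 2 by rewrite divr_gt0.
  have [x [x0 Ex]] := H _ e2.
  have [|J [y [H1 H2 H3]]] := @basic_solution R n m PR (cR (e / 2)) [set: 'I_n] x x0.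
    apply/rowP => i; rewrite summxE !mxE -Ex; apply: eq_big => [j|j _]; first by rewrite finset.in_setT.
    by rewrite !mxE.
  exists J, (e / 2); split=> //; first by rewrite ltr_pdivrMr // mulrDr mulr1 ltrDl.
  by split=> //; exists y.
pose k := #|J|; pose ev := @enum_val _ (mem J).
have [_ [_ _ [Hfree _]]] := HJ 1 ltr01.
have Hfull : row_full (rowsub ev PR)^T by rewrite /row_full mxrank_tr.
(* The rows in [J] are independent, so suitable columns cut out an invertible square minor. *)
pose f := fullrankfun Hfull.
pose Q : 'M[int]_k := \matrix_(a, c) P (ev a) (f c).
have QR : map_mx (intr : int -> R) Q = (rowsub f (rowsub ev PR)^T)^T.
  by apply/matrixP => a c; rewrite !mxE.
have Qu : map_mx (intr : int -> R) Q \in unitmx by rewrite QR unitmx_tr; exact: fullrowsub_unit.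
pose D := \det Q.
have D0 : D != 0.
  apply/eqP => HD; move: Qu; rewrite unitmxE det_map_mx -/D HD rmorph0 unitr0 //.
pose bf : 'rV[int]_k := \row_c b 0 (f c); pose df : 'rV[int]_k := \row_c d 0 (f c).
pose zb := bf *m \adj Q; pose zd := df *m \adj Q.
have Hy e y : y *m rowsub ev PR = cR e ->
    forall a, D%:~R * y 0 a = (zb 0 a)%:~R + e * (zd 0 a)%:~R :> R.
  move=> Ey a.
  have Ey2 : y *m map_mx (intr : int -> R) Q = map_mx (intr : int -> R) bf + e *: map_mx (intr : int -> R) df.
    apply/rowP => c; have := congr1 (fun u : 'rV[R]_m => u 0 (f c)) Ey; rewrite !mxE => <-.
    by apply: eq_bigr => l _; rewrite !mxE.
  have := congr1 (fun u => (u *m \adj (map_mx (intr : int -> R) Q)) 0 a) Ey2.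
  rewrite -mulmxA mul_mx_adj mul_mx_scalar det_map_mx mxE -/D => ->.
  by rewrite mulmxDl -scalemxAl -map_mx_adj -!map_mxM !mxE.
have sz a : 0 <= (Num.sg D * zb 0 a).
  rewrite -(ler0z R) rmorphM /=; apply: (@small_ge0 R _ ((Num.sg D)%:~R * (zd 0 a)%:~R)) => e e0.
  have [d' [d0 de [_ [y [y0 Ey]]]]] := HJ e e0; exists d'; split=> //.
  rewrite mulrCA -mulrDr -(Hy _ _ Ey) mulrA -rmorphM /= -normrEsg.
  by rewrite mulr_ge0 // ler0z.
have eqz i : \sum_a zb 0 a * P (ev a) i = D * b 0 i.
  (* An affine function of the slack that vanishes at arbitrarily small values has constant term 0;
     the two signs [s] reduce this to [small_ge0]. *)
  have key (s : R) : s = 1 \/ s = -1 -> 0 <= s * (\sum_a zb 0 a * P (ev a) i - D * b 0 i)%:~R.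
    move=> Hs; apply: (@small_ge0 R _ (s * (\sum_a zd 0 a * P (ev a) i - D * d 0 i)%:~R)) => e e0.
    have [d' [d0 de [_ [y [y0 Ey]]]]] := HJ e e0; exists d'; split=> //.
    set sb := \sum_a zb 0 a * _; set sd := \sum_a zd 0 a * _.
    have E1 : \sum_a D%:~R * y 0 a * (P (ev a) i)%:~R = D%:~R * ((b 0 i)%:~R + d' * (d 0 i)%:~R) :> R.
      have := congr1 (fun u : 'rV[R]_m => u 0 i) Ey; rewrite !mxE => <-.
      by rewrite mulr_sumr; apply: eq_bigr => a _; rewrite !mxE mulrA.
    have E2 : \sum_a D%:~R * y 0 a * (P (ev a) i)%:~R = sb%:~R + d' * sd%:~R :> R.
      have -> : sb%:~R = \sum_a (zb 0 a * P (ev a) i)%:~R :> R by rewrite rmorph_sum.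
      have -> : sd%:~R = \sum_a (zd 0 a * P (ev a) i)%:~R :> R by rewrite rmorph_sum.
      by rewrite mulr_sumr -big_split; apply: eq_bigr => a _; rewrite (Hy _ _ Ey) !rmorphM /=; ring.
    suff -> : s * (sb - D * b 0 i)%:~R + d' * (s * (sd - D * d 0 i)%:~R) = 0 by [].
    rewrite mulrCA -mulrDr; apply/eqP; rewrite mulf_eq0; apply/orP; right; apply/eqP.
    move: E1; rewrite E2 => E1; rewrite (rmorphB _ sb) (rmorphB _ sd) (rmorphM _ D) (rmorphM _ D) /=.
    by move: (D%:~R) (sb%:~R) (sd%:~R) (b 0 i)%:~R (d 0 i)%:~R E1 => r1 r2 r3 r4 r5; lra.
  apply/eqP; rewrite -subr_eq0 -(intr_eq0 R) eq_le.
  have := key 1 (or_introl erefl); have := key (-1) (or_intror erefl).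
  by rewrite mul1r mulN1r oppr_ge0 => -> ->.
have km : (k <= m)%N by have := rank_leq_col (rowsub ev PR); rewrite (eqP Hfree).
have mono : (k`! * M ^ k <= m`! * M ^ m)%N.
  by apply: leq_mul; [exact: fact_mono_leq km || exact: (leq_fact km) | rewrite leq_pexp2l].
have HQ a c : `|Q a c| <= M%:Z by rewrite mxE.
exists (absz D), (fun j => if [pick a | ev a == j] is Some a then absz (zb 0 a) else 0%N); split.
- by rewrite absz_gt0.
- by apply: leq_trans mono; rewrite -lez_nat abszE; exact: det_bound.
- move=> j; case: pickP => [a _|//]; apply: leq_trans mono.
  rewrite -lez_nat abszE mxE; apply: le_trans (ler_norm_sum _ _ _) _.
  (* Each of the [k] summands is an entry times a cofactor of size [k.-1]; the factor [k] completes
     the factorial again. *)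
  apply: (@le_trans _ _ (\sum_(l < k) (M * (k.-1`! * M ^ k.-1))%N%:Z)).
    apply: ler_sum => l _; rewrite normrM PoszM; apply: ler_pM; rewrite ?normr_ge0 //; first by rewrite mxE.
    exact: adj_bound.
  rewrite sumr_const card_ord -mulr_natl natz -PoszM lez_nat.
  case: (k) => [|k']; first by rewrite mul0n.
  by rewrite /= factS expnS -mulnA leq_mul2l mulnCA leqnn orbT.
move=> i.
have -> : `|D|%N%:Z = Num.sg D * D by rewrite abszE normrEsg.
rewrite -mulrA -eqz mulr_sumr.
rewrite (bigID (mem J)) /= [X in _ + X]big1 ?addr0; last first.
  move=> j jJ; case: pickP => [a /eqP Ea|_]; last by rewrite mul0r.
  by case/negP: jJ; rewrite -Ea; exact: enum_valP.
rewrite big_enum_val /=; apply: eq_bigr => a _.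
case: pickP => [a' /eqP/enum_val_inj->|/(_ a)]; last by rewrite eqxx.
rewrite abszE mulrA; congr (_ * _).
by have := sz a; case: (sgrP D) D0 => // _ _; rewrite ?mul1r ?mulN1r; [move=> /ger0_norm | rewrite oppr_ge0 => /ler0_norm].
Qed.

(** One slack variable per row turns the inequalities into equations without adding rows, and rows
    alone enter the bound. *)
Lemma bounded_solution (I J : finType) (A : I -> J -> int) (b d : I -> int) (M : nat) : (0 < M)%N ->
  (forall i j, `|A i j| <= M%:Z) -> (forall i, `|b i| <= M%:Z) ->
  (forall e : R, 0 < e -> exists x : J -> R, (forall j, 0 <= x j) /\
     forall i, \sum_j (A i j)%:~R * x j <= (b i)%:~R + e * (d i)%:~R) ->
  exists (q : nat) (z : J -> nat), [/\ (0 < q)%N, (q <= (#|I|)`! * M ^ #|I|)%N,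
     forall j, (z j <= (#|I|)`! * M ^ #|I|)%N &
     forall i, \sum_j A i j * (z j)%:Z <= q%:Z * b i].
Proof.
move=> M0 HA Hb H; pose J' : finType := (J + I)%type.
pose Ae (i : I) (j : J') : int := match j with inl j => A i j | inr i' => (i == i')%:R end.
pose P : 'M[int]_(#|J'|, #|I|) := \matrix_(j, i) Ae (enum_val i) (enum_val j).
have bijJ := onW_bij (fun=> true) (enum_val_bij J').
have [||x|q [z [q0 qF zF Hz]]] := @bounded_solution_eq _ _ P (\row_i b (enum_val i)) (\row_i d (enum_val i)) M M0.
- move=> j i; rewrite mxE; case: (enum_val j) => [j'|i'] //=.
  by case: eqP => _; rewrite ?normr1 ?normr0.
- by move=> i; rewrite mxE.
- move=> e0; have [y [y0 Hy]] := H x e0.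
  pose y' (j : J') := match j with inl j => y j
    | inr i => (b i)%:~R + x * (d i)%:~R - \sum_j (A i j)%:~R * y j end.
  exists (fun j => y' (enum_val j)); split.
    by move=> j; case: (enum_val j) => [j'|i] //=; rewrite subr_ge0.
  move=> i; rewrite !mxE; set i' := enum_val i.
  transitivity (\sum_(j : J') y' j * (Ae i' j)%:~R).
    by rewrite (reindex _ bijJ) /=; apply: eq_bigr => j _; rewrite mxE.
  rewrite big_sumType /= (bigD1 i') //= eqxx mulr1 [X in _ + (_ + X)]big1 ?addr0; last first.
    by move=> i2 /negbTE ne; rewrite eq_sym ne mulr0.
  rewrite (eq_bigr (fun j => (A i' j)%:~R * y j)); first by rewrite addrC subrK.
  by move=> j _; rewrite mulrC.
exists q, (fun j => z (enum_rank (inl j : J'))); split=> // i.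
have := Hz (enum_rank i); rewrite mxE enum_rankK => <-.
have -> : \sum_j (z j)%:Z * P j (enum_rank i) = \sum_(j : J') (z (enum_rank j))%:Z * Ae i j.
  by rewrite [RHS](reindex _ bijJ) /=; apply: eq_bigr => j _; rewrite mxE enum_rankK enum_valK.
rewrite big_sumType /= (eq_bigr (fun j => (z (enum_rank (inl j : J')))%:Z * A i j)); last by move=> j _; rewrite mulrC.
by rewrite lerDl; apply: sumr_ge0 => i' _; rewrite mulr_ge0 //; case: eqP.
Qed.

End LinearSystemsInt.

(** * Walks, circulations and averages in finite graphs *)

Section Walks.
Local Open Scope ring_scope.
Variables (R : realType) (X : finType).
Implicit Types (w : X -> X -> R) (p q : seq X).

Fixpoint wsum w x p : R := if p is y :: p' then w x y + wsum w y p' else 0.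

Definition psum w (rho : nat -> X) n : R := \sum_(k < n) w (rho k) (rho k.+1).

Lemma wsum_cat w x p q : wsum w x (p ++ q) = wsum w x p + wsum w (last x p) q.
Proof. by elim: p x => [|y p IH] x /=; rewrite ?add0r // IH addrA. Qed.

Lemma wsum_shift w a x p : wsum (fun u v => w u v - a) x p = wsum w x p - a * (size p)%:R.
Proof.
elim: p x => [|y p IH] x /=; first by rewrite mulr0 subr0.
by rewrite IH -natr1; ring.
Qed.

Lemma wsum_le w w' x p : (forall u v, w u v <= w' u v) -> wsum w x p <= wsum w' x p.
Proof. by move=> H; elim: p x => [|y p IH] x //=; rewrite lerD. Qed.

Lemma wsum_const (c : R) x p : wsum (fun _ _ => c) x p = c * (size p)%:R.
Proof.
elim: p x => [|y p IH] x /=; first by rewrite mulr0.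
by rewrite IH -natr1; ring.
Qed.

Lemma wsum_ge w (c : R) x p : (forall u v, c <= w u v) -> c * (size p)%:R <= wsum w x p.
Proof. by move=> H; rewrite -(wsum_const c x); exact: wsum_le. Qed.

Lemma wsum_leC w (c : R) x p : (forall u v, w u v <= c) -> wsum w x p <= c * (size p)%:R.
Proof. by move=> H; rewrite -(wsum_const c x); exact: wsum_le. Qed.

Lemma weight_bound w : exists2 C : R, 0 < C & forall u v, `|w u v| <= C.
Proof.
exists (1 + \sum_u \sum_v `|w u v|).
  by rewrite ltr_pwDl // sumr_ge0 // => u _; rewrite sumr_ge0.
move=> u v; apply: (@le_trans _ _ (\sum_v `|w u v|)).
  by rewrite (bigD1 v) //= lerDl sumr_ge0.
apply: (@le_trans _ _ (\sum_u \sum_v `|w u v|)); last by rewrite lerDr ler01.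
by rewrite [leRHS](bigD1 u) //= lerDl sumr_ge0 // => ? _; rewrite sumr_ge0.
Qed.

Lemma psum_shift w a rho n : psum (fun u v => w u v - a) rho n = psum w rho n - a * n%:R.
Proof. by rewrite /psum sumrB sumr_const card_ord mulr_natr. Qed.

Definition nseg (rho : nat -> X) s d := [seq rho (s + i).+1 | i <- iota 0 d].

Lemma nsegS rho s d : nseg rho s d.+1 = rho s.+1 :: nseg rho s.+1 d.
Proof.
rewrite /nseg /= addn0; congr (_ :: _); rewrite (iotaDl 1 0 d) -map_comp.
by apply: eq_map => i /=; rewrite add1n addnS addSn.
Qed.

Lemma nseg_last rho s d : last (rho s) (nseg rho s d) = rho (s + d)%N.
Proof. by elim: d s => [|d IH] s; rewrite ?addn0 // nsegS /= IH addSnnS. Qed.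

Lemma nseg_path (E : rel X) rho s d : (forall k, E (rho k) (rho k.+1)) -> path E (rho s) (nseg rho s d).
Proof. by move=> H; elim: d s => [|d IH] s //; rewrite nsegS /= H IH. Qed.

Lemma nseg_size rho s d : size (nseg rho s d) = d.
Proof. by rewrite size_map size_iota. Qed.

Lemma nseg_wsum w rho s d : wsum w (rho s) (nseg rho s d) = psum w rho (s + d) - psum w rho s.
Proof.
elim: d => [|d IH]; first by rewrite addn0 subrr.
have -> : nseg rho s d.+1 = nseg rho s d ++ [:: rho (s + d).+1].
  by rewrite /nseg -addn1 iotaD map_cat.
rewrite wsum_cat IH nseg_last addnS /psum big_ord_recr /=; ring.
Qed.

(** * Plays assembled from ever more repetitions of closed walks *)

Section Blocks.
Variables (E : rel X) (x : X) (P : nat -> seq X).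
Hypothesis Ppath : forall k, path E x (P k).
Hypothesis Plast : forall k, last x (P k) = x.
Hypothesis Pn0 : forall k, (0 < size (P k))%N.

Definition rep n p : seq X := flatten (nseq n p).

Lemma rep_path n k : path E x (rep n (P k)) /\ last x (rep n (P k)) = x.
Proof. by elim: n => [|n [IH1 IH2]] //=; rewrite cat_path last_cat Ppath Plast IH1 IH2. Qed.

Lemma rep_size n p : size (rep n p) = (n * size p)%N.
Proof. by rewrite /rep size_flatten /shape map_nseq sumn_nseq mulnC. Qed.

Lemma rep_wsum w n k : wsum w x (rep n (P k)) = n%:R * wsum w x (P k).
Proof.
elim: n => [|n IH] /=; first by rewrite mul0r.
by rewrite wsum_cat Plast -/(rep _ _) IH -natr1; ring.
Qed.

(** Each walk is repeated so often that everything before it, together with one round of the next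
    walk, is a vanishing fraction of the length. Averages along the play therefore follow those of
    the walks. *)
Fixpoint bl k : seq X := if k is k'.+1 then
  bl k' ++ rep (k * (size (bl k') + size (P k) + 1))%N (P k') else [::].

Lemma bl_path k : path E x (bl k) /\ last x (bl k) = x.
Proof.
elim: k => [|k [IH1 IH2]] //=; rewrite cat_path last_cat IH1 IH2.
by have [-> ->] := rep_path (k.+1 * (size (bl k) + size (P k.+1) + 1))%N k.
Qed.

Lemma bl_size k : (k.+1 * (size (bl k) + size (P k.+1) + 1) <= size (bl k.+1))%N.
Proof. by rewrite /= size_cat rep_size; have := Pn0 k; nia. Qed.

Lemma bl_ge k : (k <= size (bl k))%N.
Proof. by elim: k => [|k IH] //; have := bl_size k; nia. Qed.

Lemma bl_mono k k' : (k <= k')%N -> (size (bl k) <= size (bl k'))%N.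
Proof.
move=> H; rewrite -(subnK H); elim: (k' - k)%N => [|d IH] //.
by rewrite addSn /= size_cat (leq_trans IH) // leq_addr.
Qed.

Lemma bl_pre k d : exists u, bl (k + d) = bl k ++ u.
Proof.
elim: d => [|d [u Hu]]; first by exists [::]; rewrite addn0 cats0.
by rewrite addnS /= Hu; eexists; rewrite -catA.
Qed.

(** The limit of the prefixes [bl]: the prefix [bl n] has at least [n] steps, which fixes position
    [n]. *)
Definition brho n := nth x (x :: bl n) n.

Lemma brhoE k n : (n <= size (bl k))%N -> brho n = nth x (x :: bl k) n.
Proof.
move=> H; rewrite /brho; case: (leqP k n) => kn.
  have [u] := bl_pre k (n - k); rewrite subnKC // => ->.
  by rewrite -cat_cons nth_cat /= ltnS H.
have [u] := bl_pre n (k - n); rewrite subnKC ?(ltnW kn) // => ->.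
by rewrite -cat_cons nth_cat /= ltnS bl_ge.
Qed.

Lemma brho_step n : E (brho n) (brho n.+1).
Proof.
have [Hp _] := bl_path n.+1.
have H1 := bl_ge n.+1; rewrite (brhoE H1) (@brhoE n.+1 n) ?(ltnW H1) //.
by have /(pathP x) /(_ n H1) := Hp.
Qed.

Lemma wsum_take w y p n : (n <= size p)%N ->
  wsum w y (take n p) = \sum_(k < n) w (nth x (y :: p) k) (nth x (y :: p) k.+1).
Proof.
elim: n y p => [|n IH] y [|z p] //= H; first by rewrite big_ord0.
  by rewrite big_ord0.
by rewrite big_ord_recl /= IH.
Qed.

Lemma brho_psum w k n : (n <= size (bl k))%N -> psum w brho n = wsum w x (take n (bl k)).
Proof.
move=> H; rewrite wsum_take //; apply: eq_bigr => i _.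
by rewrite -!brhoE // (leq_trans _ H) // ltnW.
Qed.

Lemma bl_find n : exists k, (size (bl k) <= n < size (bl k.+1))%N.
Proof.
have ex : exists k, (n < size (bl k))%N by exists n.+1; exact: bl_ge.
case: (ex_minnP ex) => -[|k] Hk Hmin //; exists k.
rewrite Hk andbT leqNgt; apply/negP => H.
by have := Hmin _ H; rewrite ltnn.
Qed.

(** Complete rounds lose nothing, so only the last, unfinished round can contribute a loss. *)
Lemma rep_take w (C : R) n N k : 0 <= wsum w x (P k) -> (forall u v, - C <= w u v) -> 0 <= C ->
  - C * (size (P k))%:R <= wsum w x (take n (rep N (P k))).
Proof.
move=> H0 HC C0; elim: N n => [|N IH] n /=.
  by rewrite /= mulNr oppr_le0 mulr_ge0.
rewrite take_cat; case: ifP => Hn.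
  apply: le_trans (wsum_ge _ _ HC); rewrite size_take Hn !mulNr lerN2 ler_wpM2l // ler_nat ltnW //.
by rewrite wsum_cat Plast -[leLHS]add0r lerD.
Qed.

Lemma blocks_low w l : (forall d, 0 < d -> exists K, forall k, (K <= k)%N ->
     (l - d) * (size (P k))%:R <= wsum w x (P k)) ->
  forall d, 0 < d -> exists N, forall n, (N <= n)%N -> (l - d) * n%:R <= psum w brho n.
Proof.
move=> H d d0; have d2 : 0 < d / 2 by rewrite divr_gt0.
have [K HK] := H _ d2; set a := l - d / 2 in HK.
pose w' u v := w u v - a.
have [C C0 HC] := weight_bound w'.
have HC' u v : - C <= w' u v by have := HC u v; rewrite ler_norml => /andP[].
(* From block [K2] on, a loss of [C] per step of the negligible part amounts to at most half the
   tolerance. *)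
pose K2 := (Num.truncn (2 * C / d)).+1.
exists (size (bl (K + K2).+1)) => n Hn.
have [k /andP[k1 k2]] := bl_find n.
have Kk : (K + K2 < k)%N.
  rewrite ltnNge; apply/negP => Hk; have := bl_mono Hk => Hk'.
  have : (k < (K + K2).+1)%N by [].
  move=> /bl_mono; lia.
case: k Kk k1 k2 => // k Kk k1 k2.
have E1 : psum w' brho n = wsum w' x (take n (bl k.+2)) by rewrite (brho_psum _ (ltnW k2)).
have key : - C * (size (bl k) + size (P k.+1))%:R <= psum w' brho n.
  rewrite E1 /= take_cat -/(bl k.+1); case: ifP => [|_]; first by rewrite ltnNge k1.
  have [_ L1] := bl_path k.+1; rewrite wsum_cat L1 natrD mulrDr; apply: lerD; last first.
    by apply: rep_take; rewrite ?(ltW C0) // wsum_shift subr_ge0 HK //; lia.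
  have [_ L0] := bl_path k; rewrite /= wsum_cat L0 rep_wsum -[leLHS]addr0; apply: lerD; first exact: wsum_ge.
  by rewrite mulr_ge0 // wsum_shift subr_ge0 HK //; lia.
have Hs := bl_size k.
have K2C : 2 * C / d < K2%:R by rewrite /K2; have := truncnS_gt (2 * C / d).
rewrite psum_shift in key.
have n0 : (k.+1 * (size (bl k) + size (P k.+1)))%:R <= n%:R :> R.
  by rewrite ler_nat; nia.
rewrite natrM in n0; set m := (size (bl k) + _)%:R in key n0.
have m0 : 0 <= m by rewrite /m.
have K2k : K2%:R <= k.+1%:R :> R by rewrite ler_nat; lia.
rewrite ltr_pdivrMr // in K2C.
have : C * m <= d / 2 * n%:R.
  apply: (@le_trans _ _ (d / 2 * (k.+1%:R * m))); last by rewrite ler_wpM2l // ltW.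
  rewrite mulrA ler_wpM2r //; nra.
rewrite /a in key; lra.
Qed.

(** An upper bound on a limit inferior needs good averages only infinitely often: the ends of the
    good blocks witness it. Different players can thus be served by different walks. *)
Lemma blocks_high w l : (forall d K, 0 < d -> exists2 k, (K <= k)%N &
     wsum w x (P k) <= (l + d) * (size (P k))%:R) ->
  forall d N, 0 < d -> exists2 n, (N <= n)%N & psum w brho n <= (l + d) * n%:R.
Proof.
move=> H d N d0; have d2 : 0 < d / 2 by rewrite divr_gt0.
set a := l + d / 2; pose w' u v := w u v - a.
have [C C0 HC] := weight_bound w'.
have HC' u v : w' u v <= C by have := HC u v; rewrite ler_norml => /andP[].
pose K2 := (Num.truncn (2 * C / d)).+1.
have [k Hk Hw] := H _ (N + K2)%N d2.
exists (size (bl k.+1)); first by apply: leq_trans (bl_ge _); lia.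
have key : psum w' brho (size (bl k.+1)) <= C * (size (bl k))%:R.
  rewrite (brho_psum _ (leqnn _)) take_size /= wsum_cat; have [_ ->] := bl_path k.
  rewrite rep_wsum -[leRHS]addr0; apply: lerD; first exact: wsum_leC.
  by rewrite mulr_ge0_le0 // wsum_shift subr_le0.
have Hs := bl_size k.
have K2C : 2 * C / d < K2%:R by rewrite /K2; have := truncnS_gt (2 * C / d).
rewrite psum_shift in key; set n := size (bl k.+1) in key Hs *.
have n0 : (k.+1 * size (bl k))%:R <= n%:R :> R by rewrite ler_nat; nia.
rewrite natrM in n0; set m := (size (bl k))%:R in key n0.
have m0 : 0 <= m by rewrite /m.
have K2k : K2%:R <= k.+1%:R :> R by rewrite ler_nat; lia.
rewrite ltr_pdivrMr // in K2C.
have : C * m <= d / 2 * n%:R.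
  apply: (@le_trans _ _ (d / 2 * (k.+1%:R * m))); last by rewrite ler_wpM2l // ltW.
  rewrite mulrA ler_wpM2r //; nra.
rewrite /a in key; lra.
Qed.

Lemma brho_has (a : pred X) : (forall k, has a (P k)) -> infoft (fun n => a (brho n)).
Proof.
move=> H N.
have Hb : has a (drop (size (bl N)) (bl N.+1)).
  rewrite /= drop_size_cat // addn1 mulnS addSn /=; apply/hasP.
  by have /hasP[y yP ay] := H N; exists y; rewrite // mem_cat yP.
have /(has_nthP x)[i Hi Hai] := Hb; rewrite size_drop in Hi; rewrite nth_drop in Hai.
exists (size (bl N) + i).+1; first by have := bl_ge N; lia.
have Hi' : ((size (bl N) + i).+1 <= size (bl N.+1))%N by lia.
by rewrite (brhoE Hi').
Qed.

Lemma brho_all (a : pred X) : a x -> (forall k, all a (P k)) -> forall n, a (brho n).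
Proof.
move=> ax H n; rewrite /brho; apply: (@allP _ a (x :: bl n)); last first.
  by apply: mem_nth; rewrite /= ltnS bl_ge.
rewrite /= ax /=; elim: n => [|n IH] //=; rewrite all_cat IH.
by rewrite /rep; elim: (n.+1 * _)%N => //= m IHm; rewrite all_cat H.
Qed.

End Blocks.

(** * Edge multiplicities and the cycles of a circulation *)

Fixpoint ecnt x p (a b : X) : nat := if p is y :: p' then
  (((a == x) && (b == y)) + ecnt y p' a b)%N else 0%N.

Lemma ecnt_wsum w x p : wsum w x p = \sum_a \sum_b (ecnt x p a b)%:R * w a b.
Proof.
elim: p x => [|y p IH] x /=; first by rewrite big1 // => a _; rewrite big1 // => b _; rewrite mul0r.
rewrite IH; transitivity (\sum_a \sum_b (((a == x) && (b == y))%:R * w a b + (ecnt y p a b)%:R * w a b)).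
  rewrite [RHS](eq_bigr (fun a => \sum_b ((a == x) && (b == y))%:R * w a b + \sum_b (ecnt y p a b)%:R * w a b)).
    rewrite big_split /=; congr (_ + _); rewrite (bigD1 x) //= (bigD1 y) //= !eqxx mul1r.
    rewrite [X in _ + X]big1 ?addr0; last by move=> a /negbTE-> /=; rewrite big1 // => b _; rewrite mul0r.
    by rewrite big1 ?addr0 // => b /negbTE-> /=; rewrite mul0r.
  by move=> a _; rewrite big_split.
by apply: eq_bigr => a _; apply: eq_bigr => b _; rewrite natrD mulrDl.
Qed.

Lemma ecnt_out x p a : (\sum_b ecnt x p a b)%N = count_mem a (belast x p).
Proof.
elim: p x => [|y p IH] x /=; first by rewrite big1.
rewrite big_split /= IH eq_sym; congr (_ + _)%N; rewrite (bigD1 y) //= eqxx andbT big1 ?addn0 //.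
by move=> b /negbTE->; rewrite andbF.
Qed.

Lemma ecnt_in x p a : (\sum_b ecnt x p b a)%N = count_mem a p.
Proof.
elim: p x => [|y p IH] x /=; first by rewrite big1.
rewrite big_split /= IH (eq_sym y); congr (_ + _)%N; rewrite (bigD1 x) //= eqxx /= big1 ?addn0 //.
by move=> b /negbTE->.
Qed.

Definition balanced (f : X -> X -> nat) := forall a, (\sum_b f a b)%N = (\sum_b f b a)%N.

Lemma ecnt_balanced x p : last x p = x -> balanced (ecnt x p).
Proof.
move=> Hl a; rewrite ecnt_out ecnt_in.
have := lastI x p; rewrite Hl => /(congr1 (count_mem a)); rewrite /= -cats1 count_cat /= addn0; lia.
Qed.

Lemma ecnt_gt0 (E : rel X) x p a b : path E x p -> (0 < ecnt x p a b)%N -> E a b.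
Proof.
elim: p x => [|y p IH] x //= /andP[Exy Hp]; rewrite addn_gt0 => /orP[|/IH]; last exact.
by rewrite lt0b => /andP[/eqP-> /eqP->].
Qed.

Lemma ecnt_conn (E : rel X) x p a b : path E x p -> (0 < ecnt x p a b)%N ->
  connect E x a /\ connect E b (last x p).
Proof.
elim: p x => [|y p IH] x //= /andP[Exy Hp]; rewrite addn_gt0 => /orP[|/(IH _ Hp)[H1 H2]].
  rewrite lt0b => /andP[/eqP-> /eqP->]; split=> //; apply/connectP; by exists p.
by split=> //; apply: connect_trans H1; exact: connect1.
Qed.

Lemma ecnt_size x p : (\sum_a \sum_b ecnt x p a b)%N = size p.
Proof.
elim: p x => [|y p IH] x /=; first by rewrite big1 // => a _; rewrite big1.
rewrite -(IH y) -[in RHS]add1n; under eq_bigr do rewrite big_split /=.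
rewrite big_split /=; congr (_ + _)%N; rewrite (bigD1 x) //= (bigD1 y) //= !eqxx.
rewrite big1 ?addn0 /=; last by move=> b /negbTE->.
by rewrite big1 ?addn0 // => a /negbTE->; rewrite big1.
Qed.

Lemma ecnt_cat x p q a b : ecnt x (p ++ q) a b = (ecnt x p a b + ecnt (last x p) q a b)%N.
Proof. by elim: p x => [|y p IH] x //=; rewrite IH addnA. Qed.

(** Balance allows edges of positive flow to be followed forever, so a vertex repeats. The closed
    walk is shortened to a simple cycle, which uses each edge at most once and hence stays below
    [f]. *)
Lemma balanced_cycle (f : X -> X -> nat) : balanced f -> (0 < \sum_a \sum_b f a b)%N ->
  exists x z, [/\ (0 < size z)%N, last x z = x & forall a b, (ecnt x z a b <= f a b)%N].
Proof.
move=> bal; rewrite lt0n sum_nat_eq0 negb_forall => /existsP[a0 /=]; rewrite -lt0n => Ha0.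
pose out a := (0 < \sum_b f a b)%N.
pose nxt a := odflt a [pick b | (0 < f a b)%N].
have nxtP a : out a -> (0 < f a (nxt a))%N.
  rewrite /out lt0n sum_nat_eq0 negb_forall => /existsP[b /=]; rewrite -lt0n => Hb.
  by rewrite /nxt; case: pickP => [//|/(_ b)]; rewrite Hb.
have outN a : out a -> out (nxt a).
  move=> Ha; rewrite /out bal; apply: leq_trans (nxtP _ Ha) _.
  by rewrite (bigD1 a) //= leq_addr.
have outI k : out (iter k nxt a0) by elim: k => //= k; exact: outN.
pose F a b := (0 < f a b)%N.
have [i [j [ij Eij]]] : exists i j, (i < j)%N /\ iter i nxt a0 = iter j nxt a0.
  apply: contrapT => Hno.
  have inj : injective (fun k : 'I_(#|X|.+1) => iter k nxt a0).
    move=> k k' Ek; apply/val_inj; case: (ltngtP k k') => // H.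
      by case: Hno; exists k, k'.
    by case: Hno; exists k', k.
  by have := leq_card _ inj; rewrite card_ord ltnn.
pose rho k := iter k nxt a0.
have rstep k : F (rho k) (rho k.+1) by rewrite /F; exact: nxtP (outI k).
have Hp := nseg_path i (j - i) rstep; have Hl := nseg_last rho i (j - i).
rewrite subnKC ?(ltnW ij) // in Hl.
move: Hp Hl; rewrite -(ltn_predK (m := 0) (n := j - i)) ?subn_gt0 // nsegS /= => /andP[F1 Hp] Hl.
case/shortenP: Hp Hl => q Hq Uq _ Hl.
set x := rho i; set y := rho i.+1 in Hq Uq Hl F1.
have lx : last x (y :: q) = x by rewrite /= Hl /x /rho Eij.
exists x, (y :: q); split=> // a b.
have pF : path F x (y :: q) by rewrite /= Hq andbT.
case: (posnP (ecnt x (y :: q) a b)) => [->//|pos].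
apply: (@leq_trans 1); last by have := ecnt_gt0 pF pos.
apply: (@leq_trans (\sum_b ecnt x (y :: q) a b)%N); first by rewrite (bigD1 b) //= leq_addr.
rewrite ecnt_balanced // ecnt_in count_uniq_mem //; by case: (_ \in _).
Qed.

(* A circulation inside the strongly connected component of [x] is realised, up to a fixed
   error [d'], by closed walks at [x] repeating each of its cycles [N] times. *)
Lemma circulation_walks (E : rel X) (f : X -> X -> nat) x d :
  balanced f -> (forall a b, (0 < f a b)%N -> [/\ E a b, connect E x a & connect E b x]) ->
  path E x d -> last x d = x ->
  exists d', last x d' = x /\ forall N, exists p, [/\ path E x (d ++ p), last x (d ++ p) = x &
    forall w, wsum w x (d ++ p) = N%:R * (\sum_a \sum_b (f a b)%:R * w a b) + wsum w x d'].
Proof.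
move En: (\sum_a \sum_b f a b)%N => n; elim/ltn_ind: n f En => n IH f En bal Hf dp dl.
case: (posnP n) => n0.
  exists d; split=> // N; exists [::]; rewrite cats0; split=> // w.
  rewrite big1 ?mulr0 ?add0r // => a _; rewrite big1 // => b _.
  by move: En; rewrite n0 => /eqP; rewrite sum_nat_eq0 => /forallP/(_ a)/=; rewrite sum_nat_eq0 => /forallP/(_ b)/= /eqP->; rewrite mul0r.
have [|y [z [z0 zl zf]]] := balanced_cycle bal; first by rewrite En.
pose f' a b := (f a b - ecnt y z a b)%N.
have fE a b : f a b = (f' a b + ecnt y z a b)%N by rewrite /f' subnK.
have bal' : balanced f'.
  move=> a; have := bal a; have := ecnt_balanced zl a.
  have E1 : (\sum_b f a b = \sum_b f' a b + \sum_b ecnt y z a b)%N by rewrite -big_split; apply: eq_bigr.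
  have E2 : (\sum_b f b a = \sum_b f' b a + \sum_b ecnt y z b a)%N by rewrite -big_split; apply: eq_bigr.
  by rewrite E1 E2; lia.
have [|a b Hab|d' [ld' Hd']] := IH (\sum_a \sum_b f' a b)%N _ f' erefl bal' _ dp dl.
- rewrite -En; under [X in (_ < X)%N]eq_bigr do under eq_bigr do rewrite fE.
  under [X in (_ < X)%N]eq_bigr do rewrite big_split /=.
  by rewrite big_split /= ecnt_size -[X in (X < _)%N]addn0 ltn_add2l.
- by apply: Hf; rewrite fE addn_gt0 Hab.
have pz : path (fun a b => (0 < f a b)%N) y z.
  have gen u q : (forall a b, (ecnt u q a b <= f a b)%N) -> path (fun a b => (0 < f a b)%N) u q.
    elim: q u => [|v q IHq] u //= H; rewrite IHq ?andbT.
      by have := H u v; rewrite !eqxx; case: (f u v).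
    by move=> a b; apply: leq_trans (H a b); rewrite leq_addl.
  exact: gen.
have pzE : path E y z by apply: sub_path pz => a b /Hf[].
have [Cxy Cyx] : connect E x y /\ connect E y x.
  case: z z0 zl zf pz pzE {f' fE bal' ld' Hd'} => // v z _ zl zf /= /andP[/Hf[Eyv H1 H2] _] _.
  by split=> //; apply: connect_trans H2; exact: connect1.
have /connectP[u pu lu] := Cxy; have /connectP[v pv lv] := Cyx.
(* The connecting paths [u] and [v] are walked once, whatever [N] is, and so belong to the fixed
   error. *)
exists (d' ++ u ++ v); split; first by rewrite !last_cat ld' -lu.
move=> N; have [p [p1 p2 p3]] := Hd' N.
exists (p ++ u ++ rep N z ++ v).
have rp : path E y (rep N z) /\ last y (rep N z) = y.
  by elim: (N) => [|m [h1 h2]] //=; rewrite cat_path last_cat pzE zl h1 h2.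
have [r1 r2] := rp.
have rw w : wsum w y (rep N z) = N%:R * wsum w y z.
  elim: (N) => [|m IHm] /=; first by rewrite mul0r.
  by rewrite wsum_cat zl -/(rep _ _) IHm -natr1; ring.
rewrite !(catA d); move: (d ++ p) p1 p2 p3 => dq p1 p2 p3.
split.
- by rewrite !cat_path p1 p2 pu -lu r1 r2.
- by rewrite !last_cat p2 -lu r2.
move=> w; rewrite !wsum_cat p2 -lu r2 rw (p3 w) ld' -lu [wsum w y z]ecnt_wsum.
have -> : \sum_a \sum_b (f a b)%:R * w a b =
   \sum_a \sum_b (f' a b)%:R * w a b + \sum_a \sum_b (ecnt y z a b)%:R * w a b.
  rewrite -big_split; apply: eq_bigr => a _; rewrite -big_split; apply: eq_bigr => b _.
  by rewrite fE natrD mulrDl.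
ring.
Qed.

Lemma short_closed_walk (E : rel X) w x p : path E x p -> last x p = x -> (0 < size p)%N ->
  wsum w x p <= 0 -> exists y q, [/\ path E y q, last y q = y, (0 < size q <= #|X|)%N,
    wsum w y q <= 0 & forall a b, (0 < ecnt y q a b)%N -> (0 < ecnt x p a b)%N].
Proof.
move En: (size p) => n; elim/ltn_ind: n x p En => n IH x p En pp pl p0 pw.
case: (boolP (uniq p)) => Up.
  exists x, p; split=> //; rewrite En p0 /= -En.
  by rewrite -(card_uniqP Up) max_card.
have [y [p1 [p2 [p3 Ep]]]] : exists y p1 p2 p3, p = p1 ++ y :: p2 ++ y :: p3.
  elim: p Up {IH En pp pl p0 pw} => // y p IHp /=; rewrite negb_and negbK => /orP[yp|/IHp[z [p1 [p2 [p3 ->]]]]].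
    by have [p2 p3] := splitPr yp; exists y, [::], p2, p3.
  by exists z, (y :: p1), p2, p3.
pose pin := rcons p2 y; pose pout := p1 ++ y :: p3.
have E1 : p = p1 ++ y :: pin ++ p3 by rewrite Ep /pin cat_rcons.
have [pin1 pout1 pinl poutl] : [/\ path E y pin, path E x pout, last y pin = y & last x pout = x].
  move: pp pl; rewrite E1 /pout cat_path last_cat /= cat_path last_cat /pin last_rcons.
  by move=> /and3P[h1 h2 /andP[h3 h4]] hl; split=> //; rewrite ?cat_path ?last_cat ?h1 /= ?h2 ?h4.
have wE : wsum w x p = wsum w y pin + wsum w x pout.
  rewrite E1 /pout !wsum_cat /= wsum_cat /pin last_rcons; ring.
have eE a b : ecnt x p a b = (ecnt y pin a b + ecnt x pout a b)%N.
  rewrite E1 /pout !ecnt_cat /= ecnt_cat /pin last_rcons; lia.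
have sE : n = (size pin + size pout)%N.
  rewrite -En E1 /pout !size_cat /= size_cat; lia.
have s1 : (0 < size pin)%N by rewrite size_rcons.
have s2 : (0 < size pout)%N by rewrite size_cat /= addnS.
case: (lerP (wsum w y pin) 0) => Hw.
  have [|z [q [h1 h2 h3 h4 h5]]] := IH (size pin) _ y pin erefl pin1 pinl s1 Hw; first by lia.
  by exists z, q; split=> // a b /h5; rewrite eE; lia.
have Hw2 : wsum w x pout <= 0 by move: pw; rewrite wE; lra.
have [|z [q [h1 h2 h3 h4 h5]]] := IH (size pout) _ x pout erefl pout1 poutl s2 Hw2; first by lia.
by exists z, q; split=> // a b /h5; rewrite eE; lia.
Qed.

(** * Closed segments that approximate averages *)

Definition avg_low w (rho : nat -> X) (l : R) :=
  forall d, 0 < d -> exists N, forall n, (N <= n)%N -> (l - d) * n%:R <= psum w rho n.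
Definition avg_inf_le w (rho : nat -> X) (l : R) :=
  forall d N, 0 < d -> exists2 n, (N <= n)%N & psum w rho n <= (l + d) * n%:R.

(** The prefixes with a good average end in finitely many vertices, so one vertex ends arbitrarily
    late and arbitrarily good ones. *)
Lemma recurrent_average w0 (a : R) rho : avg_inf_le w0 rho a ->
  exists x, forall d N, 0 < d -> exists n, [/\ (N <= n)%N, rho n = x & psum w0 rho n <= (a + d) * n%:R].
Proof.
move=> H; apply: contrapT => Hno.
have Hx x : exists dN : R * nat, 0 < dN.1 /\
    forall n, (dN.2 <= n)%N -> rho n = x -> ~ (psum w0 rho n <= (a + dN.1) * n%:R).
  apply: contrapT => Hx; apply: Hno; exists x => d N d0; apply: contrapT => Hn; apply: Hx.
  by exists (d, N); split=> // n Nn En Hp; apply: Hn; exists n.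
pose dN x := projT1 (cid (Hx x)).
have dN0 x : 0 < (dN x).1 by rewrite /dN; case: cid => ? [].
have dNP x n : ((dN x).2 <= n)%N -> rho n = x -> ~ (psum w0 rho n <= (a + (dN x).1) * n%:R).
  by rewrite /dN; case: cid => ? [? HH] /=; exact: HH.
have [d [d0 Hd]] : exists d : R, 0 < d /\ forall x, d <= (dN x).1.
  suff [d [d0 Hd]] : exists d : R, 0 < d /\ forall x, x \in enum X -> d <= (dN x).1.
    by exists d; split=> // x; apply: Hd; rewrite mem_enum.
  elim: (enum X) => [|c s [e [e0 IH]]]; first by exists 1.
  exists (Num.min e (dN c).1); split; first by rewrite lt_min e0 dN0.
  move=> c'; rewrite inE => /orP[/eqP->|/IH H']; first by rewrite ge_min lexx orbT.
  by rewrite ge_min H'.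
have [n Hn Hp] := H d (\sum_x (dN x).2)%N d0.
apply: (dNP (rho n) n) => //; first by apply: leq_trans Hn; rewrite (bigD1 (rho n)) //= leq_addr.
by apply: le_trans Hp _; rewrite ler_wpM2r // lerD2l.
Qed.

(** The segment between a fixed visit of [x] and a sufficiently late good one inherits the averages,
    because the prefix before [s] contributes only a bounded amount. *)
Lemma extract_segment (J : finType) (w : J -> X -> X -> R) (l : J -> R) w0 (a : R) rho x :
  (forall d N, 0 < d -> exists n, [/\ (N <= n)%N, rho n = x & psum w0 rho n <= (a + d) * n%:R]) ->
  (forall j, avg_low (w j) rho (l j)) ->
  forall d N, 0 < d -> exists s, [/\ (N <= s)%N, rho s = x & forall M, exists e,
    [/\ (M <= e)%N, (0 < e)%N, rho (s + e)%N = x,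
      psum w0 rho (s + e) - psum w0 rho s <= (a + d) * e%:R &
      forall j, (l j - d) * e%:R <= psum (w j) rho (s + e) - psum (w j) rho s]].
Proof.
move=> Hx Hl d N d0; have d2 : 0 < d / 2 by rewrite divr_gt0.
have [s [Ns Es _]] := Hx d N d0; exists s; split=> // M.
have HN j : exists N, forall n, (N <= n)%N -> (l j - d / 2) * n%:R <= psum (w j) rho n by exact: Hl.
pose NN j := projT1 (cid (HN j)).
have NNP j n : (NN j <= n)%N -> (l j - d / 2) * n%:R <= psum (w j) rho n.
  by rewrite /NN; case: cid => ? HH /=; exact: HH.
(* Bounds all that the first [s] steps contribute to the estimates; beyond length [2 * B / d] this
   is at most half the tolerance. *)
pose B : R := `|psum w0 rho s| + \sum_j `|psum (w j) rho s| + (`|a| + \sum_j `|l j|) * s%:R + d * s%:R.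
have B0 : 0 <= B.
  by rewrite /B !addr_ge0 ?mulr_ge0 ?addr_ge0 ?sumr_ge0 // ltW.
pose K := (Num.truncn (2 * B / d)).+1.
have KB : 2 * B / d < K%:R by rewrite /K; have := truncnS_gt (2 * B / d).
have [n [Nn En Hn]] := Hx (d / 2) (s + M + K + 1 + \sum_j NN j)%N d2.
exists (n - s)%N; rewrite subnKC; last by lia.
split=> //; try by lia.
  rewrite natrB; last by lia.
  have Kn : K%:R <= n%:R :> R by rewrite ler_nat; lia.
  rewrite ltr_pdivrMr // in KB.
  have H1 : B <= d / 2 * n%:R by nra.
  have H2 : - psum w0 rho s <= `|psum w0 rho s| by rewrite -normrN ler_norm.
  have H3 : a * s%:R <= `|a| * s%:R by rewrite ler_wpM2r // ler_norm.
  have H4 : 0 <= \sum_j `|psum (w j) rho s| by rewrite sumr_ge0.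
  have H5 : 0 <= (\sum_j `|l j|) * s%:R by rewrite mulr_ge0 // sumr_ge0.
  rewrite /B mulrDl in H1; lra.
move=> j; rewrite natrB; last by lia.
have Kn : K%:R <= n%:R :> R by rewrite ler_nat; lia.
rewrite ltr_pdivrMr // in KB.
have H1 : B <= d / 2 * n%:R by nra.
have Hj : (NN j <= n)%N.
  have : (NN j <= \sum_j NN j)%N by rewrite (bigD1 j) //= leq_addr.
  lia.
have H0 := NNP j n Hj.
have H2 : psum (w j) rho s <= \sum_j `|psum (w j) rho s|.
  by rewrite (bigD1 j) //= (le_trans (ler_norm _)) // lerDl sumr_ge0.
have H3 : - l j * s%:R <= (\sum_j `|l j|) * s%:R.
  rewrite ler_wpM2r // (bigD1 j) //= -normrN (le_trans (ler_norm _)) // lerDl sumr_ge0 //.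
have H4 : 0 <= `|a| * s%:R by rewrite mulr_ge0.
have H5 : 0 <= `|psum w0 rho s| by [].
rewrite /B mulrDl in H1; lra.
Qed.

End Walks.

(** * Mean payoffs and strategies *)

Notation RR := Rdefinitions.R (only parsing).

(** [lowC u l] and [infle u l] say that the limit inferior of [u n / n] is at least, respectively at
    most, [l]. In [lowC] an additive constant replaces the usual threshold on [n], because constants
    add up when plays are interleaved. *)
Definition lowC (u : nat -> RR) (l : RR) :=
  forall d : RR, (0 < d)%R -> exists C : RR, forall n, ((l - d) * n%:R - C <= u n)%R.
Definition infle (u : nat -> RR) (l : RR) :=
  forall d N, (0 < d)%R -> exists2 n, N <= n & (u n <= (l + d) * n%:R)%R.

Section Averages.
Local Open Scope ring_scope.
Implicit Types (u v : nat -> RR) (l : RR).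

Lemma archi_nat (x : RR) : exists n : nat, x < n%:R.
Proof. by exists (Num.truncn x).+1; rewrite truncnS_gt. Qed.

Lemma lowC_ev u l : lowC u l <->
  (forall d, 0 < d -> exists N, forall n, (N <= n)%N -> (l - d) * n%:R <= u n).
Proof.
split=> H d d0.
  have d2 : 0 < d / 2 by rewrite divr_gt0.
  have [C HC] := H _ d2; have [N HN] := archi_nat (2 * C / d).
  exists N => n Nn; apply: le_trans (HC n).
  have Hn : N%:R <= n%:R :> RR by rewrite ler_nat.
  rewrite ltr_pdivrMr // in HN; nra.
have [N HN] := H _ d0.
exists (\sum_(k < N) `|(l - d) * k%:R - u k|) => n.
rewrite lerBlDr; case: (leqP N n) => Nn.
  by apply: le_trans (HN n Nn) _; rewrite lerDl sumr_ge0.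
rewrite -lerBlDl (bigD1 (Ordinal Nn)) //=; apply: le_trans (ler_norm _) _.
by rewrite lerDl sumr_ge0.
Qed.

Lemma lowC_shift u v l a b c (M : RR) : (forall n, u (n + a)%N + c = v (n + b)%N) ->
  (forall n, `|v n| <= M * n%:R) -> lowC u l -> lowC v l.
Proof.
move=> E HM H d d0; have [C HC] := H d d0.
exists (`|C| + `|c| + `|l - d| * (a%:R + b%:R) + M * b%:R) => n.
have M0 : 0 <= M * b%:R by apply: le_trans (HM b).
have ab0 : 0 <= `|l - d| * (a%:R + b%:R) by rewrite mulr_ge0 // addr_ge0.
case: (leqP b n) => bn.
  have := E (n - b)%N; rewrite subnK // => <-.
  have := HC (n - b + a)%N; rewrite natrD natrB // => H1.
  have H2 : - c <= `|c| by rewrite -normrN ler_norm.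
  have H3 : C <= `|C| by exact: ler_norm.
  have H4 : (l - d) * (b%:R - a%:R) <= `|l - d| * (a%:R + b%:R).
    apply: le_trans (ler_norm _) _; rewrite normrM ler_wpM2l //.
    by apply: le_trans (ler_normB _ _) _; rewrite !normr_nat addrC.
  nra.
have Hv : - (M * n%:R) <= v n by have := HM n; rewrite ler_norml => /andP[].
have nb : n%:R <= b%:R :> RR by rewrite ler_nat ltnW.
have b0 : 0 <= b%:R :> RR by [].
have n0 : 0 <= n%:R :> RR by [].
have H1 : (l - d) * n%:R <= `|l - d| * (a%:R + b%:R).
  apply: le_trans (ler_norm _) _; rewrite normrM ler_wpM2l // normr_nat.
  by apply: le_trans nb _; rewrite lerDr.
have H2 : M * n%:R <= M * b%:R.
  have M1 : 0 <= M by apply: contrapT => /negP; rewrite -ltNge => M1; have := HM 1%N; have := normr_ge0 (v 1%N); lra.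
  by rewrite ler_wpM2l.
have H3 : 0 <= `|C| by []. have H4 : 0 <= `|c| by [].
lra.
Qed.

Lemma infle_shift u v l a b c : (forall n, u (n + a)%N + c = v (n + b)%N) ->
  infle u l -> infle v l.
Proof.
move=> E H d N d0; have d2 : 0 < d / 2 by rewrite divr_gt0.
pose B := `|c| + `|l + d| * (a%:R + b%:R).
have [K HK] := archi_nat (2 * B / d).
have [n Hn Hu] := H _ (N + K + a)%N d2.
exists (n - a + b)%N; first by lia.
have := E (n - a)%N; rewrite subnK; last by lia.
move=> <-; rewrite natrD natrB; last by lia.
have nK : K%:R <= n%:R :> RR by rewrite ler_nat; lia.
rewrite ltr_pdivrMr // in HK.
have H1 : c <= `|c| by exact: ler_norm.
have H2 : (l + d) * (a%:R - b%:R) <= `|l + d| * (a%:R + b%:R).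
  apply: le_trans (ler_norm _) _; rewrite normrM ler_wpM2l //.
  by apply: le_trans (ler_normB _ _) _; rewrite !normr_nat.
rewrite /B in HK; nra.
Qed.

End Averages.

(** * Mean payoffs as bounds on partial sums *)

Section MeanPayoff.
Variable G : game.
Local Notation V := 'I_(nv G).
Local Notation P := 'I_(np G).
Local Open Scope ring_scope.

Definition rw (j : P) (u v : V) : RR := ratr (rew G j u v).
Definition pay (j : P) (rho : nat -> V) (n : nat) : RR := psum (rw j) rho n.

Lemma pay_bound j : exists2 M : RR, 0 <= M & forall rho n, `|pay j rho n| <= M * n%:R.
Proof.
have [C C0 HC] := weight_bound (rw j); exists C; first exact: ltW.
move=> rho n; apply: le_trans (ler_norm_sum _ _ _) _.
apply: (@le_trans _ _ (\sum_(k < n) C)); first by apply: ler_sum.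
by rewrite sumr_const card_ord -[leLHS]mulr_natr.
Qed.

Definition mavg (j : P) (rho : nat -> V) n : RR := (\sum_(k < n) ratr (rew G j (rho k) (rho k.+1))) / n%:R.

Lemma mp_sup (j : P) (rho : nat -> V) : mean_payoff j rho =
  ereal_sup (range (einfs (fun n => (mavg j rho n)%:E))).
Proof. by rewrite /mean_payoff limn_einf_lim; apply/cvg_lim => //; exact: cvg_einfs_sup. Qed.

Lemma mavgE j rho n : (0 < n)%N -> mavg j rho n * n%:R = pay j rho n.
Proof. by move=> n0; rewrite /mavg divfK // pnatr_eq0 -lt0n. Qed.

Lemma mp_ge j rho (l : RR) : (l%:E <= mean_payoff j rho)%E <-> lowC (pay j rho) l.
Proof.
rewrite lowC_ev mp_sup; split=> [H d d0|H].
  have : ((l - d)%:E < ereal_sup (range (einfs (fun n => (mavg j rho n)%:E))))%E.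
    by apply: lt_le_trans H; rewrite lte_fin ltrBlDr ltrDl.
  move=> /ereal_sup_gt[_ [N _ <-]] HN; exists N.+1 => n Nn.
  rewrite -mavgE ?(leq_ltn_trans _ Nn) // ler_wpM2r // -lee_fin.
  apply: ltW; apply: lt_le_trans HN _; apply: ereal_inf_lbound.
  by exists n => //=; exact: ltnW.
apply/lee_addgt0Pr => d d0; have [N HN] := H d d0.
have : ((l - d)%:E <= einfs (fun n => (mavg j rho n)%:E) N.+1)%E.
  apply: le_ereal_inf_tmp => _ [n /= Nn <-]; rewrite lee_fin.
  have n0 : 0 < n%:R :> RR by rewrite ltr0n; lia.
  rewrite -(ler_pM2r n0) mavgE; last by lia.
  by apply: HN; lia.
move=> H1; have H2 : (einfs (fun n => (mavg j rho n)%:E) N.+1 <=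
    ereal_sup (range (einfs (fun n => (mavg j rho n)%:E))))%E.
  by apply: ereal_sup_ubound; exists N.+1.
have := le_trans H1 H2; rewrite EFinB leeBlDr //.
Qed.

Lemma mp_le j rho (l : RR) : (mean_payoff j rho <= l%:E)%E <-> infle (pay j rho) l.
Proof.
rewrite mp_sup; split=> [H d N d0|H].
  have H1 : (einfs (fun n => (mavg j rho n)%:E) N.+1 < (l + d)%:E)%E.
    apply: (@le_lt_trans _ _ l%:E); last by rewrite lte_fin ltrDl.
    by apply: le_trans H; apply: ereal_sup_ubound; exists N.+1.
  have [_ [n /= Nn <-]] := ereal_inf_lt H1; rewrite lte_fin => H2.
  exists n; first by lia.
  by rewrite -mavgE ?ler_wpM2r // ?(ltW H2) //; lia.
apply: ge_ereal_sup => _ [N _ <-]; apply/lee_addgt0Pr => d d0.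
have [n Nn Hn] := H d N.+1 d0; apply: (@le_trans _ _ (mavg j rho n)%:E).
  by apply: ereal_inf_lbound; exists n => //=; exact: ltnW.
have n0 : 0 < n%:R :> RR by rewrite ltr0n; lia.
by rewrite -EFinD lee_fin -(ler_pM2r n0) mavgE //; lia.
Qed.

Lemma mp_fin (j : P) (rho : nat -> V) : exists m : RR, mean_payoff j rho = m%:E.
Proof.
have [M M0 HM] := pay_bound j.
have H1 : ((- M)%:E <= mean_payoff j rho)%E.
  apply/mp_ge => d d0; exists 0 => n; have := HM rho n; rewrite ler_norml => /andP[H _].
  have n0 : 0 <= n%:R :> RR by []. nra.
have H2 : (mean_payoff j rho <= M%:E)%E.
  apply/mp_le => d N d0; exists N => //; have := HM rho N; rewrite ler_norml => /andP[_ H].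
  have n0 : 0 <= N%:R :> RR by []. nra.
by move: H1 H2; case: (mean_payoff j rho) => [m| |] //; exists m.
Qed.

Definition mp (j : P) (rho : nat -> V) : RR := projT1 (cid (mp_fin j rho)).
Lemma mpE j rho : mean_payoff j rho = (mp j rho)%:E.
Proof. by rewrite /mp; case: cid. Qed.

Lemma mp_lowC j rho l : l <= mp j rho <-> lowC (pay j rho) l.
Proof. by rewrite -mp_ge mpE lee_fin. Qed.
Lemma mp_infle j rho l : mp j rho <= l <-> infle (pay j rho) l.
Proof. by rewrite -mp_le mpE lee_fin. Qed.

Lemma pay_shift j rho a n : pay j (fun k => rho (k + a)%N) n + pay j rho a = pay j rho (n + a).
Proof.
elim: n => [|n IH]; first by rewrite /pay /psum big_ord0 add0r add0n.
by move: IH; rewrite /pay /psum addSn !big_ord_recr /= => <-; ring.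
Qed.

Lemma mp_shift j rho rho' a b : (forall k, rho (k + a)%N = rho' (k + b)%N) -> mp j rho = mp j rho'.
Proof.
suff H r r' c d : (forall k, r (k + c)%N = r' (k + d)%N) -> mp j r <= mp j r'.
  by move=> E; apply/eqP; rewrite eq_le (H _ _ a b) //=; apply: (H _ _ b a).
move=> E; apply/mp_lowC; have [M _ HM] := pay_bound j.
apply: (@lowC_shift (pay j r) _ _ c d (pay j r' d - pay j r c) M) => //; last exact/mp_lowC.
move=> n; rewrite -!pay_shift.
have -> : (fun k => r' (k + d)%N) = (fun k => r (k + c)%N) by apply/funext.
ring.
Qed.

End MeanPayoff.

Lemma iota0S k : iota 0 k.+1 = rcons (iota 0 k) k.
Proof. by rewrite -[k.+1]addn1 iotaD cats1. Qed.

Lemma iota1S k : iota 1 k.+1 = rcons (iota 1 k) k.+1.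
Proof. by rewrite -[k.+1]addn1 iotaD add1n cats1 addn1. Qed.

(** * Histories, profiles and deviating plays *)

Section Strategies.
Variable G : game.
Local Notation V := 'I_(nv G).
Local Notation P := 'I_(np G).
Variable v0 : V.

(** A profile is merged into one map [s] on full histories, as the owner of the last vertex
    determines whose strategy is consulted. *)
Definition hext (s : seq V -> V) (h : seq V) k := iter k (fun h => rcons h (s h)) h.
Definition hout s h k := last v0 (hext s h k).
Definition hplay (h : seq V) (rho : nat -> V) k := h ++ [seq rho i.+1 | i <- iota 0 k].

(** The plays that player [i] can bring about from [h] while the others follow [s]. Deviations are
    treated as such plays rather than as strategies. *)
Definition compat (i : P) (s : seq V -> V) h (rho : nat -> V) := rho 0 = last v0 h /\
  forall k, edge G (rho k) (rho k.+1) /\ (own G (rho k) <> i -> rho k.+1 = s (hplay h rho k)).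

Lemma hplayS h rho k : hplay h rho k.+1 = rcons (hplay h rho k) (rho k.+1).
Proof. by rewrite /hplay iota0S map_rcons rcons_cat. Qed.

Lemma hext_play s h k : hext s h k = hplay h (hout s h) k.
Proof.
elim: k => [|k IH]; first by rewrite /hplay cats0.
rewrite hplayS -IH /hout /hext /= last_rcons //.
Qed.

Definition valid_s s := forall h, is_hist v0 h -> edge G (last v0 h) (s h).

Lemma hist_rcons h w : is_hist v0 h -> edge G (last v0 h) w -> is_hist v0 (rcons h w).
Proof. by case: h => [|u t] //= /andP[-> Ht] E; rewrite rcons_path Ht. Qed.

Lemma hist_ext s h k : valid_s s -> is_hist v0 h -> is_hist v0 (hext s h k).
Proof. by move=> Hs Hh; elim: k => //= k IH; apply: hist_rcons => //; exact: Hs. Qed.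

Lemma hist_play h rho k : is_hist v0 h -> rho 0 = last v0 h ->
  (forall k, edge G (rho k) (rho k.+1)) -> is_hist v0 (hplay h rho k) /\ last v0 (hplay h rho k) = rho k.
Proof.
move=> Hh E0 HE; elim: k => [|k [IH1 IH2]]; first by rewrite /hplay cats0.
by rewrite hplayS last_rcons; split=> //; apply: hist_rcons; rewrite ?IH2.
Qed.

Lemma hist_split h : is_hist v0 h -> h = rcons (hist_prefix h) (last v0 h).
Proof. by case: h => [|u t] //= _; rewrite -lastI. Qed.

Lemma sub_prefix (sg : profile G) hv k : is_hist v0 hv ->
  hist_prefix hv ++ out_prefix (subprofile sg hv) (last v0 hv) k =
  hext (fun h => sg (own G (last v0 h)) h) hv k.
Proof.
move=> Hh; elim: k => [|k IH]; first by rewrite cats1 -hist_split.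
rewrite /= -rcons_cat IH; congr rcons.
set h' := hext _ hv k in IH *; rewrite /subprofile IH.
have -> : last (last v0 hv) (out_prefix (subprofile sg hv) (last v0 hv) k) = last v0 h'; last by [].
rewrite -IH; have : 0 < size (out_prefix (subprofile sg hv) (last v0 hv) k).
  by case: (k) => //= m; rewrite size_rcons.
by rewrite last_cat; case: out_prefix.
Qed.

Lemma sub_outcome (sg : profile G) hv : is_hist v0 hv ->
  outcome (subprofile sg hv) (last v0 hv) = hout (fun h => sg (own G (last v0 h)) h) hv.
Proof.
move=> Hh; apply/funext => k; rewrite /outcome /hout -sub_prefix // last_cat.
have : 0 < size (out_prefix (subprofile sg hv) (last v0 hv) k).
  by case: (k) => //= m; rewrite size_rcons.
by case: out_prefix.
Qed.

Lemma dev_outcome (sg : profile G) hv i tau : is_hist v0 hv ->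
  let rho := outcome (deviate (subprofile sg hv) i tau) (last v0 hv) in
  forall k, out_prefix (deviate (subprofile sg hv) i tau) (last v0 hv) k =
     [seq rho i | i <- iota 0 k.+1] /\
   rho k.+1 = (if own G (rho k) == i then tau [seq rho i | i <- iota 0 k.+1]
     else sg (own G (rho k)) (hplay hv rho k)).
Proof.
move=> Hh rho k.
have E : forall k, out_prefix (deviate (subprofile sg hv) i tau) (last v0 hv) k = [seq rho i | i <- iota 0 k.+1].
  elim=> [|m IH] //; rewrite iota0S map_rcons -IH /=; congr rcons.
  by rewrite /rho /outcome /= last_rcons.
split=> //; rewrite {1}/rho /outcome /= last_rcons /deviate /subprofile.
have -> : last (last v0 hv) (out_prefix (deviate (subprofile sg hv) i tau) (last v0 hv) k) = rho k by [].
case: eqP => _; rewrite -/(deviate _ _ _) E //; congr (sg _ _).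
rewrite /hplay /= -cat_rcons -(hist_split Hh); congr (_ ++ _).
by rewrite (iotaDl 1 0 k) -map_comp.
Qed.

Lemma spe_sound eps s : valid_s s ->
  (forall h, is_hist v0 h -> forall i rho, compat i s h rho -> (mp i rho <= mp i (hout s h) + ratr eps)%R) ->
  eps_SPE eps v0 (fun=> s).
Proof.
move=> Hs HD; split; first by move=> i h Hh _; exact: Hs.
move=> hv Hh i tau Htau; rewrite sub_outcome // !mpE -EFinD lee_fin; apply: HD => //.
set rho := outcome _ _; have HE := dev_outcome (fun=> s) i tau Hh; cbv zeta in HE; rewrite -/rho in HE.
split=> // k; suff H : edge G (rho k) (rho k.+1).
  by split=> // /eqP/negbTE ne; have [_ ->] := HE k; rewrite ne.
(* [tau] and [s] are known to be legal only on histories, so legality of a step needs legality of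
   all earlier ones. *)
elim/ltn_ind: k => k IH.
have path0 m : m <= k -> path (edge G) (rho 0) [seq rho i | i <- iota 1 m].
  elim: m => [|m IHm] // mk; rewrite iota1S map_rcons rcons_path IHm ?(ltnW mk) //=.
  have -> : last (rho 0) [seq rho i | i <- iota 1 m] = rho m; last exact: IH.
  by case: (m) => // m'; rewrite iota1S map_rcons last_rcons.
have lastE m : last (rho 0) [seq rho i | i <- iota 0 m.+1] = rho m.
  by rewrite iota0S map_rcons last_rcons.
have [_ ->] := HE k; case: eqP => Eo.
  have := Htau [seq rho i | i <- iota 0 k.+1]; rewrite (lastE k); apply=> //.
  by rewrite /= eqxx path0.
have [H1 H2] : is_hist v0 (hplay hv rho k) /\ last v0 (hplay hv rho k) = rho k.
  have : forall m, m <= k -> is_hist v0 (hplay hv rho m) /\ last v0 (hplay hv rho m) = rho m.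
    elim=> [|m IHm] mk; first by rewrite /hplay cats0.
    have [h1 h2] := IHm (ltnW mk); rewrite hplayS last_rcons; split=> //.
    by apply: hist_rcons => //; rewrite h2; exact: IH.
  exact.
by rewrite -{1}H2; exact: Hs.
Qed.

Lemma spe_complete eps sg : no_deadlock G -> eps_SPE eps v0 sg ->
  let s := fun h => sg (own G (last v0 h)) h in
  valid_s s /\ forall h, is_hist v0 h -> forall i rho, compat i s h rho ->
     (mp i rho <= mp i (hout s h) + ratr eps)%R.
Proof.
move=> nd [Hp HD] s; split; first by move=> h Hh; exact: Hp.
move=> h Hh i rho [E0 Hc].
pose sc v := projT1 (cid (nd v)).
have scP v : edge G v (sc v) by rewrite /sc; case: cid.
(* Replays [rho] while the history agrees with it and takes an arbitrary successor elsewhere, so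
   that it is legal on every history. *)
pose tau h' := if h' == [seq rho i | i <- iota 0 (size h')] then rho (size h') else sc (last (last v0 h) h').
have Htau : strategy_from i (last v0 h) tau.
  move=> h' Hh' _; rewrite /tau; case: eqP => [Eh|_]; last exact: scP.
  case: h' Hh' Eh => // u t Hu Eh; have -> : last (last v0 h) (u :: t) = rho (size t); last first.
    by have [] := Hc (size t).
  by rewrite Eh [size (_ :: _)]/= iota0S map_rcons last_rcons.
have := HD h Hh i tau Htau; rewrite sub_outcome // -/s !mpE -EFinD lee_fin.
suff -> : outcome (deviate (subprofile sg h) i tau) (last v0 h) = rho by [].
have HE := dev_outcome sg i tau Hh; cbv zeta in HE; set r := outcome _ _ in HE *.
have H : forall k m, m <= k -> r m = rho m.
  elim=> [|k IH] m; first by rewrite leqn0 => /eqP->; rewrite E0.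
  rewrite leq_eqVlt => /orP[/eqP->|]; last exact: IH.
  have Em : [seq r i | i <- iota 0 k.+1] = [seq rho i | i <- iota 0 k.+1].
    by apply/eq_in_map => j; rewrite mem_iota => /andP[_ Hj]; exact: IH.
  have [_ ->] := HE k; rewrite IH //; case: eqP => Eo.
    by rewrite Em /tau size_map size_iota eqxx.
  have [_ /(_ Eo) ->] := Hc k; rewrite /s.
  have [_ ->] := @hist_play h rho k Hh E0 (fun k => (Hc k).1).
  congr (sg _ _); rewrite /hplay; congr (_ ++ _); apply/eq_in_map => j; rewrite mem_iota => /andP[_ Hj].
  exact: IH.
by apply/funext => k; exact: (H k).
Qed.

End Strategies.

(** * Lower averages under tails and interleaving *)

Section Osum.
Local Open Scope ring_scope.
Implicit Types (c : nat -> RR) (l M : RR).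

Definition osum c n : RR := \sum_(k < n) c k.

Lemma osum_shift c a n : osum (fun k => c (k + a)%N) n + osum c a = osum c (n + a)%N.
Proof.
elim: n => [|n IH]; first by rewrite /osum big_ord0 add0r add0n.
by move: IH; rewrite /osum addSn !big_ord_recr /= => <-; ring.
Qed.

Lemma osum_bound c M n : (forall k, `|c k| <= M) -> `|osum c n| <= M * n%:R.
Proof.
move=> H; apply: le_trans (ler_norm_sum _ _ _) _.
apply: (@le_trans _ _ (\sum_(k < n) M)); first by apply: ler_sum.
by rewrite sumr_const card_ord -[leLHS]mulr_natr.
Qed.

Lemma lowC_tail c c' a b l M : (forall k, c (k + a)%N = c' (k + b)%N) -> (forall k, `|c' k| <= M) ->
  lowC (osum c) l -> lowC (osum c') l.
Proof.
move=> E HM; apply: (@lowC_shift _ _ _ a b (osum c' b - osum c a) M); last by move=> n; exact: osum_bound.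
move=> n; rewrite -!osum_shift.
have -> : (fun k => c' (k + b)%N) = (fun k => c (k + a)%N) by apply/funext => k; rewrite E.
ring.
Qed.

Lemma lowC_infle c l : lowC (osum (fun k => - c k)) (- l) -> infle (osum c) l.
Proof.
move=> /lowC_ev H d N d0; have [N' HN] := H d d0.
exists (maxn N N'); first exact: leq_maxl.
have := HN _ (leq_maxr N N'); rewrite /osum sumrN; lra.
Qed.

(** The numbers of terms taken from the two sequences add up to [n] up to a constant, so the two
    linear lower bounds add up as well. No such rule holds for [infle]. *)
Lemma lowC_mix c1 c2 c l (g : nat -> bool) (p1 p2 : nat -> nat) :
  lowC (osum c1) l -> lowC (osum c2) l ->
  (forall k, p1 k.+1 = p1 k + g k)%N -> (forall k, p2 k.+1 = p2 k + ~~ g k)%N ->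
  (forall k, c k = if g k then c1 (p1 k) else c2 (p2 k)) -> lowC (osum c) l.
Proof.
move=> H1 H2 P1 P2 Hc d d0; have [C1 HC1] := H1 d d0; have [C2 HC2] := H2 d d0.
have E n : osum c n = osum c1 (p1 n) - osum c1 (p1 0%N) + (osum c2 (p2 n) - osum c2 (p2 0%N)).
  elim: n => [|n IH]; first by rewrite /osum big_ord0; ring.
  rewrite {1}/osum big_ord_recr /= -/(osum c n) IH Hc P1 P2; case: (g n).
    by rewrite addn0 addn1 {5}/osum big_ord_recr /= -/(osum c1 (p1 n)); ring.
  by rewrite addn0 addn1 {7}/osum big_ord_recr /= -/(osum c2 (p2 n)); ring.
have Ep n : (p1 n + p2 n = n + (p1 0 + p2 0))%N.
  by elim: n => [|n IH] //; rewrite P1 P2; case: (g n) => /=; lia.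
exists (C1 + C2 + osum c1 (p1 0%N) + osum c2 (p2 0%N) - (l - d) * (p1 0%N + p2 0%N)%:R) => n.
have := HC1 (p1 n); have := HC2 (p2 n); rewrite E.
have : (p1 n)%:R + (p2 n)%:R = n%:R + (p1 0 + p2 0)%N%:R :> RR by rewrite -!natrD Ep.
move: (p1 n)%:R (p2 n)%:R n%:R (p1 0 + p2 0)%N%:R => a b m k Eab h2 h1.
have -> : m = a + b - k by lra.
nra.
Qed.

End Osum.

(** * Digits *)

Lemma dig_small b c i : c < b ^ i -> dig b c i = 0.
Proof. by move=> H; rewrite /dig divn_small // mod0n. Qed.

Lemma dig_exists b m (g : nat -> nat) : 0 < b -> (forall i, i < m -> g i < b) ->
  exists2 c, c < b ^ m & forall i, dig b c i = if i < m then g i else 0.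
Proof.
move=> b0; elim: m => [|m IH] Hg.
  by exists 0 => // i; rewrite /dig div0n mod0n.
have [|c Hc Hd] := IH; first by move=> i Hi; apply: Hg; exact: ltnW.
have gm := Hg m (ltnSn m).
have Hc' : c + g m * b ^ m < b ^ m.+1.
  by rewrite expnS; move: (b ^ m) Hc gm => z; nia.
exists (c + g m * b ^ m) => // i; rewrite ltnS; case: (ltngtP i m) => Hi.
- have := Hd i; rewrite Hi => <-; rewrite /dig.
  have -> : b ^ m = b ^ (m - i).-1 * b * b ^ i.
    by rewrite -expnSr prednK ?subn_gt0 // -expnD subnK // ltnW.
  rewrite mulnA divnDMl ?expn_gt0 ?b0 // mulnA -modnDmr modnMl addn0 //.
- apply: dig_small; apply: leq_trans Hc' _; rewrite leq_pexp2l //.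
- by rewrite Hi /dig divnDMl ?expn_gt0 ?b0 // divn_small // add0n modn_small.
Qed.

Lemma dig_lt b c i : 0 < b -> dig b c i < b.
Proof. by move=> b0; rewrite /dig ltn_mod. Qed.

Definition inS (S u : nat) : bool := dig 2 S u == 1.

Lemma inS0 u : inS 0 u = false.
Proof. by rewrite /inS /dig div0n mod0n. Qed.

Lemma mask_exists n (a : pred 'I_n) : exists S : 'I_(2 ^ n), forall u : 'I_n, inS S u = a u.
Proof.
have [|c Hc Hd] := @dig_exists 2 n (fun i => if insub i is Some u then a u else false) isT.
  by move=> i _; case: insubP => // u _ _; case: (a u).
exists (Ordinal Hc) => u; rewrite /inS /= Hd ltn_ord insubT //= => H.
by rewrite (_ : Sub _ _ = u) ?eqb1 //; apply/val_inj.
Qed.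

(** * The negotiation arena *)

(* A position [(u, S)] consists of the current vertex and the set [S] (a bit mask) inside which
   the protagonist has promised to stay; [S = 0] right after a deviation, when a new promise
   is made.  A move [((u, S), u')] proposes the edge from [u] to [u'] under the promise [S]; at a
   vertex of player [i] the opponent may answer [Some w] and go to [w] instead. *)
Section Arena.
Variable G : game.
Local Notation n := (nv G).
Local Notation V := 'I_(nv G).
Local Notation P := 'I_(np G).
Local Notation MS := 'I_(2 ^ nv G).
Local Notation X := (V * MS)%type.
Local Notation Y := (V * MS * V)%type.
Local Notation T := (option V).

Lemma exp2_gt0 m : 0 < 2 ^ m. Proof. by rewrite expn_gt0. Qed.
Definition zM : MS := Ordinal (exp2_gt0 n).

(** The deviator is given as a number so that [np G] can stand for nobody, in which case every
    answer is ignored. An effective deviation clears the promise. *)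
Definition nx (i : nat) (y : Y) (t : T) : X :=
  if t is Some w then
    if (own G y.1.1 == i :> nat) && edge G y.1.1 w then (w, zM) else (y.2, y.1.2)
  else (y.2, y.1.2).

(** The promise of a move contains both ends of the proposed edge, so it is never empty; mask 0
    therefore marks a deviation. *)
Definition Amv (x : X) (y : Y) : bool :=
  [&& y.1.1 == x.1, (x.2 == 0 :> nat) || (y.1.2 == x.2), inS y.1.2 x.1, inS y.1.2 y.2 & edge G x.1 y.2].

Definition stp i (tau : Y -> T) : rel X := fun x x' => [exists y, Amv x y && (x' == nx i y (tau y))].

Definition wX (j : P) (x x' : X) : RR := rw j x.1 x'.1.

Definition zw (i : nat) (j : P) (z : Y * T) : RR := rw j z.1.1.1 (nx i z.1 z.2).1.
Definition zdev (i : nat) (z : Y * T) : bool := (nx i z.1 z.2).2 == 0 :> nat.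

(** The first condition bounds the limit superior of the deviator's payoff: this is more than a
    bound on his mean payoff but, unlike it, stable under mixing. *)
Definition Win (lam : V -> RR) (eps : RR) (i : P) (alpha : RR) (rho : nat -> Y * T) : Prop :=
  lowC (osum (fun k => - zw i i (rho k))%R) (- alpha)%R /\
  (infoft (fun k => zdev i (rho k)) \/ exists S : MS,
    (exists N, forall k, N <= k -> (rho k).1.1.2 = S) /\
    forall u : V, inS S u -> lowC (osum (fun k => zw i (own G u) (rho k))) (lam u - eps)%R).

Lemma rw_bound : exists2 M : RR, (0 <= M)%R & forall (j : P) u v, (`|rw j u v| <= M)%R.
Proof.
have H j : exists C : RR, (0 <= C)%R /\ forall u v : V, (`|rw j u v| <= C)%R.
  by have [C C0 HC] := weight_bound (rw j); exists C; split=> //; exact: ltW.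
pose C j := projT1 (cid (H j)).
have C0 j : (0 <= C j)%R by rewrite /C; case: cid => ? [].
have HC j u v : (`|rw j u v| <= C j)%R by rewrite /C; case: cid => ? [? HH] /=; exact: HH.
exists (\sum_j C j)%R; first by rewrite sumr_ge0.
by move=> j u v; apply: le_trans (HC j u v) _; rewrite (bigD1 j) //= lerDl sumr_ge0.
Qed.

Lemma win_shiftG lam eps i alpha rho rho' a b :
  (forall k, rho (k + a) = rho' (k + b)) -> Win lam eps i alpha rho -> Win lam eps i alpha rho'.
Proof.
move=> E [H1 H2]; have [M M0 HM] := rw_bound; split.
  apply: (lowC_tail (a := a) (b := b) (M := M)) H1; first by move=> k; rewrite E.
  by move=> k; rewrite normrN; exact: HM.
case: H2 => [Hd|[S [[N HN] HS]]]; [left | right].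
  move=> N; have [k Hk Dk] := Hd (N + a); exists (k - a + b); first by lia.
  by rewrite -E subnK //; lia.
exists S; split.
  by exists (N + b) => k Hk; rewrite -(subnK (m := b) (n := k)) -?E ?HN //; lia.
move=> u Hu; apply: (lowC_tail (a := a) (b := b) (M := M)) (HS u Hu); first by move=> k; rewrite E.
by move=> k; exact: HM.
Qed.

(** Infinitely many deviations in one part give infinitely many in the mix. Otherwise both promises
    are finally constant, and the recurrence of the common move [y] shows that they are equal. *)
Lemma win_mixG lam eps i alpha y rho1 rho2 rho (g : nat -> bool) c1 c2 :
  Win lam eps i alpha rho1 -> Win lam eps i alpha rho2 ->
  (forall k, c1 k.+1 = c1 k + g k) -> (forall k, c2 k.+1 = c2 k + ~~ g k) ->
  (forall k, rho k = if g k then rho1 (c1 k) else rho2 (c2 k)) ->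
  infoft (fun k => g k) -> infoft (fun k => ~~ g k) ->
  infoft (fun k => (rho1 k).1 = y) -> infoft (fun k => (rho2 k).1 = y) -> Win lam eps i alpha rho.
Proof.
move=> [A1 B1] [A2 B2] C1 C2 Hr gi ngi y1 y2.
have mono (f : nat -> nat) (h : nat -> bool) : (forall k, f k.+1 = f k + h k) ->
    infoft (fun k => h k) -> forall m N, f 0 <= m -> N <= m -> exists2 k, f k = m & h k.
  move=> fS hi m N f0 _.
  have ex : exists k, m < f k.
    have : forall m, exists k, m <= f k.
      elim=> [|m' [k Hk]]; first by exists 0.
      have [k' kk hk] := hi k; exists k'.+1; rewrite fS hk addn1 ltnS; apply: leq_trans Hk _.
      by rewrite -(subnKC kk); elim: (k' - k) => [|d IH]; rewrite ?addn0 // addnS fS (leq_trans IH) // leq_addr.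
    by move=> /(_ m.+1).
  case: (ex_minnP ex) => -[|k] Hk Hmin; first by move: (leq_trans Hk f0); rewrite ltnn.
  have : f k <= m by rewrite leqNgt; apply/negP => /Hmin; rewrite ltnn.
  by move: Hk; rewrite fS => h1 h2; exists k; move: h1 h2; case: (h k); lia.
have cmono (f : nat -> nat) (h : nat -> bool) k k' : (forall k, f k.+1 = f k + h k) -> k <= k' -> f k <= f k'.
  by move=> fS kk; rewrite -(subnKC kk); elim: (k' - k) => [|d IH]; rewrite ?addn0 // addnS fS (leq_trans IH) // leq_addr.
have W1 : lowC (osum (fun k => - zw i i (rho k))%R) (- alpha)%R.
  by apply: (lowC_mix A1 A2 C1 C2) => k; rewrite Hr; case: (g k).
split=> //.
have dev1 : infoft (fun k => zdev i (rho1 k)) -> infoft (fun k => zdev i (rho k)).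
  move=> H N; have [m Hm Dm] := H (c1 0 + c1 N).
  have [|k Ek gk] := mono c1 g C1 gi m 0 _ isT; first by lia.
  exists k; last by rewrite Hr gk Ek.
  rewrite leqNgt; apply/negP => kN; have := cmono c1 g _ _ C1 kN; rewrite C1 gk Ek; lia.
have dev2 : infoft (fun k => zdev i (rho2 k)) -> infoft (fun k => zdev i (rho k)).
  move=> H N; have [m Hm Dm] := H (c2 0 + c2 N).
  have [|k Ek gk] := mono c2 (fun k => ~~ g k) C2 ngi m 0 _ isT; first by lia.
  exists k; last by rewrite Hr (negbTE gk) Ek.
  rewrite leqNgt; apply/negP => kN; have := cmono c2 (fun k => ~~ g k) _ _ C2 kN; rewrite C2 gk Ek; lia.
case: B1 => [/dev1|[S1 [[N1 HN1] HS1]]]; first by left.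
case: B2 => [/dev2|[S2 [[N2 HN2] HS2]]]; first by left.
right; exists y.1.2.
have E1 : S1 = y.1.2 by have [k Hk <-] := y1 N1; rewrite HN1.
have E2 : S2 = y.1.2 by have [k Hk <-] := y2 N2; rewrite HN2.
split; last first.
  by move=> u Hu; apply: (lowC_mix (HS1 u _) (HS2 u _) C1 C2); rewrite ?E1 ?E2 // => k; rewrite Hr; case: (g k).
have [k1 Hk1] : exists k, N1 <= c1 k.
  by have [|k Ek _] := mono c1 g C1 gi (c1 0 + N1) 0 _ isT; [lia | exists k; lia].
have [k2 Hk2] : exists k, N2 <= c2 k.
  by have [|k Ek _] := mono c2 (fun k => ~~ g k) C2 ngi (c2 0 + N2) 0 _ isT; [lia | exists k; lia].
exists (k1 + k2) => k Hk; rewrite Hr; case: (g k).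
  by rewrite HN1 ?E1 //; apply: leq_trans Hk1 _; apply: (cmono c1 g) => //; lia.
by rewrite HN2 ?E2 //; apply: leq_trans Hk2 _; apply: (cmono c2 (fun k => ~~ g k)) => //; lia.
Qed.

Definition Pwin lam eps (i : P) alpha (x0 : X) (s : seq T -> Y) :=
  @swin X Y T Amv (nx i) x0 (Win lam eps i alpha) (fun _ _ => true) s.

Lemma winplay lam eps (i : P) alpha (tau : Y -> T) (x0 : X) (xs : nat -> X) : xs 0 = x0 ->
  (forall k, stp i tau (xs k) (xs k.+1)) ->
  lowC (osum (fun k => - wX i (xs k) (xs k.+1))%R) (- alpha)%R ->
  (infoft (fun k => (xs k).2 == 0 :> nat) \/ exists S : MS, [/\ S != 0 :> nat,
    exists N, forall k, N <= k -> (xs k).2 = S &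
    forall u : V, inS S u -> lowC (osum (fun k => wX (own G u) (xs k) (xs k.+1))) (lam u - eps)%R]) ->
  exists ys : nat -> Y, [/\ Amv x0 (ys 0), forall k, Amv (nx i (ys k) (tau (ys k))) (ys k.+1) &
     Win lam eps i alpha (fun k => (ys k, tau (ys k)))].
Proof.
move=> E0 Hs Ha Hd.
have Hy k : exists y, Amv (xs k) y /\ xs k.+1 = nx i y (tau y).
  by have /existsP[y /andP[H1 /eqP H2]] := Hs k; exists y.
pose ys k := projT1 (cid (Hy k)).
have ysA k : Amv (xs k) (ys k) by rewrite /ys; case: cid => ? [].
have ysN k : xs k.+1 = nx i (ys k) (tau (ys k)) by rewrite /ys; case: cid => ? [].
have ysu k : (ys k).1.1 = (xs k).1 by have /and5P[/eqP] := ysA k.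
have zwE j k : zw i j (ys k, tau (ys k)) = wX j (xs k) (xs k.+1) by rewrite /zw /= -ysN ysu.
exists ys; split; [by rewrite -E0 | by move=> k; rewrite -ysN | split].
  by have -> : (fun k => - zw i i (ys k, tau (ys k)))%R = (fun k => - wX i (xs k) (xs k.+1))%R
    by apply/funext => k; rewrite zwE.
case: Hd => [Hd|[S [S0 [N HN] HS]]]; [left | right].
  move=> N; have [[|k] Hk Dk] := Hd N.+1 => //; exists k => //.
  by rewrite /zdev /= -ysN.
exists S; split.
  exists N => k Hk; have := HN k.+1 (leqW Hk); rewrite ysN /nx.
  case: (tau _) => [w|] //=; case: ifP => //= _ E; by move: S0; rewrite -E.
move=> u Hu; have := HS u Hu.
by have -> : (fun k => zw i (own G u) (ys k, tau (ys k))) = (fun k => wX (own G u) (xs k) (xs k.+1))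
  by apply/funext => k; rewrite zwE.
Qed.

Lemma Pwin_exists lam eps (i : P) alpha (x0 : X) :
  (forall tau : Y -> T, exists ys : nat -> Y, [/\ Amv x0 (ys 0),
     forall k, Amv (nx i (ys k) (tau (ys k))) (ys k.+1) &
     Win lam eps i alpha (fun k => (ys k, tau (ys k)))]) ->
  exists s, Pwin lam eps i alpha x0 s.
Proof.
move=> H; apply: (@shuffle_win _ _ _ Amv (nx i) x0 (Win lam eps i alpha) _ _
  (\sum_(y : Y) #|(fun=> true) : pred T|)) => //.
- by move=> rho rho' a b; exact: win_shiftG.
- by move=> y rho1 rho2 rho g c1 c2; exact: win_mixG.
- by move=> y; exists None.
Qed.

End Arena.

(** * From winning negotiation strategies to an equilibrium *)

Section Soundness.
Variable G : game.
Local Notation V := 'I_(nv G).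
Local Notation P := 'I_(np G).
Local Notation X := (V * 'I_(2 ^ nv G))%type.
Local Notation Y := (V * 'I_(2 ^ nv G) * V)%type.
Local Notation T := (option V).
Variables (v0 : V) (lam : V -> RR) (eps : RR) (D : pred V) (sA : V -> seq T -> Y) (rho0 : nat -> V).
Hypothesis D0 : D v0.
Hypothesis Dclosed : forall u w, D u -> edge G u w -> D w.
Hypothesis sAP : forall v, D v -> Pwin lam eps (own G v) (lam v) (v, zM G) (sA v).
Hypothesis rho00 : rho0 0 = v0.
Hypothesis rho0E : forall k, edge G (rho0 k) (rho0 k.+1).
Hypothesis rho0C : forall k, (lam (rho0 k) - eps <= mp (own G (rho0 k)) rho0)%R.
Hypothesis eps0 : (0 <= eps)%R.

(* [None]: the initial play [rho0] is being followed.  [Some (v, H)]: a deviation of the owner of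
   [v] is being answered by [sA v], after the responses [H]. *)
Local Notation rst := (option (V * seq T)).

Definition prop (st : rst) k : V := if st is Some vH then (sA vH.1 vH.2).2 else rho0 k.

(* When a player deviates at [u] while the regime of one of his vertices [v] is on, the
   regime is kept only if [lam v <= lam u]; hence [lam] decreases along his deviations. *)
Definition updS (st : rst) (u : V) k (w : V) : rst :=
  if w == prop st k then (if st is Some vH then Some (vH.1, None :: vH.2) else None)
  else let fresh := Some (u, [:: if w == (sA u [::]).2 then None else Some w]) in
    if st is Some vH then
      if (own G vH.1 == own G u) && (lam vH.1 <= lam u)%R then Some (vH.1, Some w :: vH.2) else fresh
    else fresh.

Fixpoint sr (r : seq V) : rst :=
  if r is w :: r1 then (if r1 is u :: _ then updS (sr r1) u (size r1) w else None) else None.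

Definition sst h := sr (rev h).
Definition ss h := prop (sst h) (size h).

Definition vpos v H : X := @hpos X Y T (nx (own G v)) (v, zM G) (sA v) H.

Lemma sst_rcons h w : is_hist v0 h -> sst (rcons h w) = updS (sst h) (last v0 h) (size h) w.
Proof.
case/lastP: h => [|h u] // _; rewrite /sst !rev_rcons last_rcons.
by rewrite /= size_rcons size_rev.
Qed.

Lemma hist_rconsE h w : is_hist v0 (rcons h w) ->
  (h = [::] /\ w = v0) \/ (is_hist v0 h /\ edge G (last v0 h) w).
Proof.
case: h => [|u t] /=; first by rewrite andbT => /eqP->; left.
by rewrite rcons_path => /and3P[-> -> E]; right.
Qed.

Lemma Amv_ok v H : D v -> Amv (vpos v H) (sA v H).
Proof.
move=> Dv; have [HA _] := sAP Dv; apply: HA.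
by elim: H => //= t H ->.
Qed.

Lemma inv h : is_hist v0 h -> D (last v0 h) /\ (if sst h is Some vH then
  D vH.1 /\ (vpos vH.1 vH.2).1 = last v0 h else last v0 h = rho0 (size h).-1).
Proof.
elim/last_ind: h => // h w IH Hh; rewrite last_rcons.
case: (hist_rconsE Hh) => [[-> ->]|[Hh' E]]; first by rewrite /= rho00.
have [Du Hst] := IH Hh'; split; first exact: Dclosed E.
have Dw := Dclosed Du E; rewrite sst_rcons //.
have fresh : D (last v0 h) /\ (vpos (last v0 h) [:: if w == (sA (last v0 h) [::]).2 then None else Some w]).1 = w.
  split=> //; rewrite /vpos /= /nx.
  have /and5P[/eqP Ey _ _ _ _] := Amv_ok [::] Du; rewrite /vpos /= in Ey.
  by case: eqP => [->|_] //; rewrite Ey eqxx E.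
rewrite /updS; case: eqP => Ew.
  case: (sst h) Hst Ew => [[v H] [/= Dv Ep]|E0] Ew /=.
    by split=> //; rewrite /vpos /= -Ew.
  by rewrite Ew /= size_rcons.
case: (sst h) Hst Ew => [[v H] [/= Dv Ep]|E0] Ew //=.
case: ifP => //= /andP[/eqP Eo _]; split=> //; rewrite /vpos /= /nx.
have /and5P[/eqP Ey _ _ _ _] := Amv_ok H Dv; rewrite Ey Ep.
by rewrite Eo eqxx E.
Qed.

Lemma ss_valid : valid_s v0 ss.
Proof.
move=> h Hh; have [_] := inv Hh; rewrite /ss /prop; case: (sst h) => [[v H] /= [Dv Ep]|E].
  by have /and5P[_ _ _ _] := Amv_ok H Dv; rewrite Ep.
rewrite E; case: h Hh E => // u t _ _ /=; exact: rho0E.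
Qed.

Lemma hs_glue (H : seq T) (t' : nat -> T) (Hk : nat -> seq T) : Hk 0 = H ->
  (forall k, Hk k.+1 = t' k :: Hk k) ->
  exists t, (forall k, hs t (size H + k) = Hk k) /\ forall k, t (size H + k) = t' k.
Proof.
move=> E0 ES; pose t m := if m < size H then nth None (rev H) m else t' (m - size H).
have t2 k : t (size H + k) = t' k by rewrite /t ltnNge leq_addr /= addKn.
exists t; split=> //; elim=> [|k IH]; last by rewrite addnS /= IH t2 ES.
rewrite addn0 E0.
have gen h : (forall m, m < size h -> t m = nth None (rev h) m) -> hs t (size h) = h.
  elim: h => [|x h IH] //= Hx; rewrite Hx ?ltnS // rev_cons nth_rcons size_rev ltnn eqxx IH //.
  by move=> m Hm; rewrite Hx ?rev_cons ?nth_rcons ?size_rev ?Hm // ltnW.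
by apply: gen => m Hm; rewrite /t Hm.
Qed.

(** While one regime lasts, the play is a run of [sA v] in the arena entered midway, and shift
    invariance passes the winning condition on to it. *)
Lemma regime_play h (rho : nat -> V) v (Hk : nat -> seq T) (t' : nat -> T) : is_hist v0 h -> rho 0 = last v0 h ->
  (forall k, edge G (rho k) (rho k.+1)) ->
  (forall k, sst (hplay h rho k) = Some (v, Hk k)) -> (forall k, Hk k.+1 = t' k :: Hk k) ->
  [/\ D v, Win lam eps (own G v) (lam v) (fun k => (sA v (Hk k), t' k)),
   forall k, vpos v (Hk k.+1) = nx (own G v) (sA v (Hk k)) (t' k),
   forall k, (vpos v (Hk k)).1 = rho k &
   forall j k, zw (own G v) j (sA v (Hk k), t' k) = rw j (rho k) (rho k.+1)].
Proof.
move=> Hh E0 HE Hst HS.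
have Hp k : is_hist v0 (hplay h rho k) /\ last v0 (hplay h rho k) = rho k by exact: hist_play.
have I k : D v /\ (vpos v (Hk k)).1 = rho k.
  by have [H1 H2] := Hp k; have [_] := inv H1; rewrite Hst H2.
have Dv : D v by have [] := I 0.
have posS k : vpos v (Hk k.+1) = nx (own G v) (sA v (Hk k)) (t' k) by rewrite HS.
split=> //.
- have [t [Ht1 Ht2]] := @hs_glue (Hk 0) t' Hk erefl HS.
  have [_ HW] := sAP Dv.
  apply: (@win_shiftG G lam eps (own G v) (lam v) (fun k => (sA v (hs t k), t k)) _ (size (Hk 0)) 0).
    by move=> k; rewrite addn0 addnC Ht1 Ht2.
  by apply: HW => k; elim: (hs t k) => //= ? ? ->.
- by move=> k; have [] := I k.
move=> j k; rewrite /zw /=.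
have /and5P[/eqP-> _ _ _ _] := Amv_ok (Hk k) Dv.
by rewrite -posS; have [_ ->] := I k; have [_ ->] := I k.+1.
Qed.

Lemma hout_edge h : is_hist v0 h -> forall k, edge G (hout v0 ss h k) (hout v0 ss h k.+1).
Proof.
move=> Hh k; rewrite /hout /= last_rcons; apply: ss_valid; exact: hist_ext ss_valid Hh.
Qed.

Lemma hext_size s (h : seq V) k : size (hext s h k) = size h + k.
Proof. by elim: k => [|k IH]; rewrite ?addn0 //= size_rcons IH addnS. Qed.

(** If nobody deviates any more, a running regime receives only the answer [None]. Its promise is
    then constant and contains every visited vertex, so the winning condition meets all their
    requirements up to [eps]. *)
Lemma consistent h : is_hist v0 h ->
  forall k, (lam (hout v0 ss h k) - eps <= mp (own G (hout v0 ss h k)) (hout v0 ss h))%R.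
Proof.
move=> Hh k; set rho := hout v0 ss h.
have Hx m : is_hist v0 (hext ss h m) by exact: hist_ext ss_valid Hh.
case Est: (sst h) => [[v H]|]; last first.
  have Hst m : sst (hext ss h m) = None.
    elim: m => [|m IH] //; rewrite /hext /= -/(hext ss h m) sst_rcons // /updS.
    by rewrite /ss IH /= eqxx.
  have E m : rho m = rho0 (m + (size h).-1).
    have [_] := inv (Hx m); rewrite Hst hext_size -/(hout v0 ss h m) -/rho => ->.
    by case: (h) Hh => //= u t _; rewrite addnC.
  rewrite E; apply: le_trans (rho0C _) _.
  by rewrite (@mp_shift _ _ rho0 rho (size h).-1 0) // => m; rewrite addn0 E.
pose Hk m := nseq m (None : T) ++ H.
have Hst m : sst (hext ss h m) = Some (v, Hk m).
  elim: m => [|m IH] //; rewrite /hext /= -/(hext ss h m) sst_rcons // /updS.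
  by rewrite /ss IH /= eqxx.
have [||Dv [_ HW] posS pos1 zwE] := @regime_play h rho v Hk (fun=> None) Hh erefl (hout_edge Hh) => //.
  by move=> m; rewrite /rho -hext_play Hst.
pose S m := (sA v (Hk m)).1.2.
have HA m : Amv (vpos v (Hk m)) (sA v (Hk m)) by exact: Amv_ok.
have Su m : inS (S m) (rho m) by have /and5P[_ _ + _ _] := HA m; rewrite pos1.
have Sn0 m : S m != 0 :> nat by apply/eqP => S0; have := Su m; rewrite S0 inS0.
have SS m : S m.+1 = S m.
  by have /and5P[_ + _ _ _] := HA m.+1; rewrite posS /= (negbTE (Sn0 m)) /= => /eqP.
case: HW => [Hd|[S1 [[N HN] HS]]].
  by have [m _] := Hd 0; rewrite /zdev /= (negbTE (Sn0 m)).
have SE m : S m = S1.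
  have S00 q : S q = S 0 by elim: q => // q; rewrite SS.
  by rewrite S00 -(S00 N); exact: HN.
have Hu : inS S1 (rho k) by rewrite -(SE k); exact: Su.
apply/mp_lowC; have := HS _ Hu.
suff -> : osum (fun m => zw (own G v) (own G (rho k)) (sA v (Hk m), None)) = pay (own G (rho k)) rho by [].
by apply/funext => m; apply: eq_bigr => q _; rewrite zwE.
Qed.

(** At his first deviation, at [u], player [i] gives up a payoff of at least [lam u - eps]. From
    then on he faces regimes of his own vertices with requirements at most [lam u]; they change
    finitely often, and the last one holds his payoff to its requirement. *)
Lemma no_profit h : is_hist v0 h -> forall i rho, compat v0 i ss h rho ->
  (mp i rho <= mp i (hout v0 ss h) + eps)%R.
Proof.
move=> Hh i rho [E0 Hc].
have HE k : edge G (rho k) (rho k.+1) by have [] := Hc k.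
have Hp k : is_hist v0 (hplay h rho k) /\ last v0 (hplay h rho k) = rho k by exact: hist_play.
case: (pselect (forall k, rho k.+1 = ss (hplay h rho k))) => [Hall|/existsNP[k1 Hk1]].
  suff -> : rho = hout v0 ss h by rewrite lerDl.
  have H k : hplay h rho k = hext ss h k.
    by elim: k => [|k IH]; rewrite ?hplayS ?Hall /hext /= -?/(hext ss h k) ?IH // /hplay cats0.
  by apply/funext => k; have [_ <-] := Hp k; rewrite H.
have ex : exists k, rho k.+1 != ss (hplay h rho k) by exists k1; apply/eqP.
case: (ex_minnP ex) => k0 /eqP dev0 Hmin.
have agree m : m <= k0 -> hplay h rho m = hext ss h m.
  elim: m => [|m IH] mk; first by rewrite /hplay cats0.
  rewrite hplayS /hext /= -/(hext ss h m) -IH ?(ltnW mk) //; congr rcons.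
  by apply/eqP; apply: contraTT mk => /Hmin; rewrite -leqNgt.
pose u := rho k0.
have uE : u = hout v0 ss h k0 by rewrite /hout -agree //; have [_ ->] := Hp k0.
have ownu k : rho k.+1 != ss (hplay h rho k) -> own G (rho k) = i.
  by move=> /eqP ne; apply: contrapT => Eo; apply: ne; have [_] := Hc k; apply.
have ou : own G u = i by apply: ownu; exact/eqP.
have Hu : (lam u - eps <= mp i (hout v0 ss h))%R by rewrite -ou uE; exact: consistent.
pose st k := sst (hplay h rho k).
have stS k : st k.+1 = updS (st k) (rho k) (size (hplay h rho k)) (rho k.+1).
  by have [H1 H2] := Hp k; rewrite /st hplayS sst_rcons // H2.
pose good (s : rst) := exists v H, [/\ s = Some (v, H), own G v = i & (lam v <= lam u)%R].
have g0 : good (st k0.+1).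
  rewrite stS /updS; move/eqP/negbTE: (dev0); rewrite /ss -/(st k0) => ->.
  case: (st k0) => [[v H]|] /=; last by exists u; eexists; split.
  by case: ifP => [/andP[/eqP Eo Hl]|_]; [exists v; eexists; split=> //; rewrite Eo | exists u; eexists; split].
have gS k v H : st k = Some (v, H) -> own G v = i ->
    exists v' H', [/\ st k.+1 = Some (v', H'), own G v' = i &
      ((lam v' < lam v)%R \/ (v' = v /\ exists t, H' = t :: H))].
  move=> Es Eo; rewrite stS Es /updS /=; case: eqP => Ew.
    by exists v; eexists; split=> //; right; split=> //; eexists.
  have Eu : own G (rho k) = i by apply: ownu; apply/eqP; rewrite /ss -/(st k) Es.
  rewrite Eo Eu eqxx /=; case: ifP => Hl.
    by exists v; eexists; split=> //; right; split=> //; eexists.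
  by exists (rho k); eexists; split=> //; left; rewrite ltNge Hl.
have gall k : good (st (k0.+1 + k)).
  elim: k => [|k [v [H [Es Eo Hl]]]]; first by rewrite addn0.
  rewrite addnS; have [v' [H' [Es' Eo' Hc']]] := gS _ _ _ Es Eo.
  exists v', H'; split=> //; case: Hc' => [lt|[-> _]] //.
  by apply: le_trans (ltW lt) Hl.
(* A change of regime strictly lowers [lam], hence the number of vertices below it; where this
   number is least the regime is final. *)
pose pot (s : rst) := if s is Some vH then #|[pred w | (lam w < lam vH.1)%R]| else 0.
have exm : exists m, exists k, pot (st (k0.+1 + k)) == m by exists (pot (st (k0.+1 + 0))), 0.
have [m [[k2 /eqP Ek2] Hm]] : exists m, (exists k, pot (st (k0.+1 + k)) == m) /\
    forall k, m <= pot (st (k0.+1 + k)).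
  have [m /asboolP Hm1 Hm2] := @ex_minnP (fun m => `[< exists k, pot (st (k0.+1 + k)) == m >])
    (let: ex_intro m Hm := exm in ex_intro _ m (introT (asboolP _) Hm)).
  by exists m; split=> // k; apply: Hm2; apply/asboolP; exists k.
have [v [H0 [Es0 Eo Hl]]] := gall k2.
have stab k : exists H, st (k0.+1 + (k2 + k)) = Some (v, H) /\
    exists t, st (k0.+1 + (k2 + k)).+1 = Some (v, t :: H).
  elim: k => [|k [H [Es [t Et]]]].
    rewrite addn0; exists H0; split=> //.
    have [v' [H' [Es' Eo' [lt|[Ev [t Et]]]]]] := gS _ _ _ Es0 Eo; last by exists t; rewrite Es' Ev Et.
    have := Hm k2.+1; rewrite addnS Es' -Ek2 Es0 /= leqNgt => /negP[].
    apply: proper_card; apply/fintype.properP; split.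
      by apply/fintype.subsetP => w; rewrite !inE => /lt_trans; apply.
    by exists v'; rewrite !inE // ltxx.
  rewrite !addnS; exists (t :: H); split=> //.
  have Ek : pot (st (k0.+1 + (k2 + k)).+1) = m by rewrite -Ek2 Et Es0.
  have [v' [H' [Es' Eo' [lt|[Ev [t' Et']]]]]] := gS _ _ _ Et Eo; last by exists t'; rewrite Es' Ev Et'.
  have := Hm (k2 + k).+2; rewrite !addnS Es' -Ek Et /= leqNgt => /negP[].
  apply: proper_card; apply/fintype.properP; split.
    by apply/fintype.subsetP => w; rewrite !inE => /lt_trans; apply.
  by exists v'; rewrite !inE // ltxx.
pose K := k0.+1 + k2.
pose Hk k := if st (K + k) is Some vH then vH.2 else [::].
have stE k : st (K + k) = Some (v, Hk k).
  by have [H [Es _]] := stab k; rewrite /Hk -addnA Es.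
pose t' k := head None (Hk k.+1).
have HkS k : Hk k.+1 = t' k :: Hk k.
  rewrite /t'; have [H [Es [t Et]]] := stab k.
  have -> : Hk k.+1 = t :: H by rewrite /Hk addnS -addnA Et.
  by have -> : Hk k = H by rewrite /Hk -addnA Es.
have [hK lK] := Hp K.
pose rhoK k := rho (k + K).
have hpK k : hplay (hplay h rho K) rhoK k = hplay h rho (K + k).
  elim: k => [|k IH]; first by rewrite addn0 {1}/hplay cats0.
  by rewrite hplayS IH addnS hplayS /rhoK addSn addnC.
have [||||Dv [HW _] _ _ zwE] := @regime_play (hplay h rho K) rhoK v Hk t' hK => //.
- by move=> k; exact: HE.
- by move=> k; rewrite hpK; exact: stE.
have Hi : (mp i rhoK <= lam v)%R.
  apply/mp_infle; rewrite -Eo.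
  have -> : pay (own G v) rhoK = osum (fun k => zw (own G v) (own G v) (sA v (Hk k), t' k)).
    by apply/funext => m1; apply: eq_bigr => q _; rewrite zwE.
  exact: lowC_infle.
rewrite -(@mp_shift _ i rhoK rho 0 K); last by move=> k; rewrite addn0.
lra.
Qed.

Lemma hout_init k : hout v0 ss [:: v0] k = rho0 k.
Proof.
have Hh : is_hist v0 [:: v0] by rewrite /= eqxx.
have Hst m : sst (hext ss [:: v0] m) = None.
  elim: m => [|m IH] //; rewrite /hext /= -/(hext ss [:: v0] m) sst_rcons ?hist_ext //; last exact: ss_valid.
  by rewrite /updS /ss IH /= eqxx.
have [_] := inv (hist_ext k ss_valid Hh); rewrite Hst hext_size add1n /= => <-.
by [].
Qed.

End Soundness.

(** * From an equilibrium to plays in the arena *)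

Section Completeness.
Variable G : game.
Local Notation V := 'I_(nv G).
Local Notation P := 'I_(np G).
Local Notation MS := 'I_(2 ^ nv G).
Local Notation X := (V * MS)%type.
Local Notation Y := (V * MS * V)%type.
Local Notation T := (option V).
Variables (v0 : V) (eps : RR) (s : seq V -> V).
Hypothesis sV : valid_s v0 s.

(** The promise made after [h]: the vertices that the equilibrium is going to visit if nobody
    deviates. *)
Definition vis (h : seq V) : MS := projT1 (cid (mask_exists (fun u => `[< exists k, hout v0 s h k = u >]))).

Lemma visP h (u : V) : inS (vis h) u <-> exists k, hout v0 s h k = u.
Proof. by rewrite /vis; case: cid => S HS /=; rewrite HS; split=> /asboolP. Qed.

Lemma hout_rcons h k : hout v0 s (rcons h (s h)) k = hout v0 s h k.+1.
Proof. by rewrite /hout /hext iterSr. Qed.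

Section Play.
Variables (i : nat) (tau : Y -> T) (h0 : seq V).
Hypothesis Hh0 : is_hist v0 h0.

(** The equilibrium is consulted on the actual history, which is carried along with the mask; a
    cleared mask is replaced by a fresh promise. *)
Definition pS (hS : seq V * MS) : MS := if hS.2 == 0 :> nat then vis hS.1 else hS.2.
Definition py (hS : seq V * MS) : Y := (last v0 hS.1, pS hS, s hS.1).
Definition pstep (hS : seq V * MS) : seq V * MS :=
  let x := nx i (py hS) (tau (py hS)) in (rcons hS.1 x.1, x.2).
Definition pst k := iter k pstep (h0, zM G).
Definition pxs k : X := (last v0 (pst k).1, (pst k).2).
Definition prho k : V := (pxs k).1.

Lemma nx_cases y t : (nx i y t = (y.2, y.1.2)) \/
  (exists w, [/\ nx i y t = (w, zM G), own G y.1.1 = i :> nat & edge G y.1.1 w]).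
Proof.
rewrite /nx; case: t => [w|]; last by left.
by case: ifP => [/andP[/eqP E1 E2]|_]; [right; exists w | left].
Qed.

Lemma pst_inv k : is_hist v0 (pst k).1 /\
  (forall m, inS (pS (pst k)) (hout v0 s (pst k).1 m)).
Proof.
elim: k => [|k [IH1 IH2]].
  split=> // m; rewrite /pS /=; apply/visP; by exists m.
have Ek : pst k.+1 = pstep (pst k) by [].
rewrite Ek /pstep; case: (nx_cases (py (pst k)) (tau (py (pst k)))) => [->|[w [-> Eo Ee]]] /=.
  split; first by apply: hist_rcons => //; exact: sV.
  move=> m; rewrite {1}/pS /=; case: ifP => S0; first by apply/visP; exists m.
  by rewrite hout_rcons; exact: IH2.
split; first by apply: hist_rcons.
by move=> m; rewrite {1}/pS /=; apply/visP; exists m.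
Qed.

Lemma pxs_Amv k : Amv (pxs k) (py (pst k)).
Proof.
have [H1 H2] := pst_inv k; apply/and5P; split=> //=.
- by rewrite /pS; case: ifP => //= _; rewrite eqxx.
- exact: (H2 0).
- by have := H2 1; rewrite {1}/hout /= last_rcons.
- exact: sV.
Qed.

Lemma pxs_next k : pxs k.+1 = nx i (py (pst k)) (tau (py (pst k))).
Proof. by rewrite /pxs /= last_rcons; case: nx. Qed.

Lemma pxs_step k : stp i tau (pxs k) (pxs k.+1).
Proof. by apply/existsP; exists (py (pst k)); rewrite pxs_Amv pxs_next eqxx. Qed.

Lemma prho_edge k : edge G (prho k) (prho k.+1).
Proof.
rewrite /prho pxs_next; have [H1 _] := pst_inv k.
case: (nx_cases (py (pst k)) (tau (py (pst k)))) => [->|[w [-> _ Ee]]] //=.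
exact: sV.
Qed.

Lemma prho_hist k : hplay h0 prho k = (pst k).1.
Proof.
elim: k => [|k IH]; first by rewrite /hplay cats0.
by rewrite hplayS IH /prho /pxs /= last_rcons.
Qed.

Lemma prho_compat k : own G (prho k) <> i :> nat -> prho k.+1 = s (hplay h0 prho k).
Proof.
move=> Eo; rewrite prho_hist /prho pxs_next.
case: (nx_cases (py (pst k)) (tau (py (pst k)))) => [->|[w [_ E _]]] //=.
Qed.

(** After the last position with a cleared mask the play is the outcome of [s] and keeps the promise
    made there. *)
Lemma prho_tail : infoft (fun k => (pxs k).2 == 0 :> nat) \/ exists m, [/\ is_hist v0 (pst m).1,
    forall k, m < k -> (pxs k).2 = vis (pst m).1,
    forall k, prho (m + k) = hout v0 s (pst m).1 k & vis (pst m).1 != 0 :> nat].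
Proof.
case: (pselect (infoft (fun k => (pxs k).2 == 0 :> nat))) => [|/infoftN[N HN]]; [by left | right].
have [m [m0 Hm]] : exists m, (pxs m).2 == 0 :> nat /\ forall k, m < k -> (pxs k).2 != 0 :> nat.
  have exm : exists m, ((pxs m).2 == 0 :> nat) && (m <= N) by exists 0.
  have ub m : ((pxs m).2 == 0 :> nat) && (m <= N) -> m <= N by case/andP.
  case: (ex_maxnP exm ub) => m /andP[m0 mN] Hmax; exists m; split=> // k mk.
  case: (leqP N k) => Nk; first exact: HN.
  by apply/negP => k0; have := Hmax k; rewrite k0 ltnW // => /(_ isT); rewrite leqNgt mk.
have [Hh _] := pst_inv m.
have Hv : vis (pst m).1 != 0 :> nat.
  apply/eqP => E; have : inS (vis (pst m).1) (hout v0 s (pst m).1 0) by apply/visP; exists 0.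
  by rewrite E inS0.
have key k : (pst (m + k)).1 = hext s (pst m).1 k /\ pS (pst (m + k)) = vis (pst m).1.
  elim: k => [|k [IH1 IH2]]; first by rewrite addn0 /pS m0.
  have := Hm (m + k).+1; rewrite ltnS leq_addr => /(_ isT); rewrite addnS.
  rewrite pxs_next; have Ek : pst (m + k).+1 = pstep (pst (m + k)) by [].
  rewrite Ek /pstep; case: (nx_cases (py (pst (m + k))) (tau (py (pst (m + k))))) => [->|[w [-> _ _]]] //= Hn0.
  by rewrite IH1 /hext /=; split=> //; rewrite {1}/pS /= (negbTE Hn0).
exists m; split=> //.
  move=> k mk; have Ek : m + (k - m.+1).+1 = k by lia.
  have [_] := key (k - m.+1).+1; rewrite Ek /pS /pxs /=; case: ifP => // k0 _.
  by have := Hm k mk; rewrite /pxs /= k0.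
by move=> k; rewrite /prho /pxs /=; have [-> _] := key k.
Qed.

End Play.

(** The arena forgets histories, so the protagonist may pretend any history that ends in [v]; one
    with a small payoff binds the owner of [v] most. The infimum need not be attained, which is the
    source of the tolerance [d] below. *)
Definition lamset (v : V) : set RR :=
  [set x | exists2 h, is_hist v0 h & last v0 h = v /\ x = (mp (own G v) (hout v0 s h) + eps)%R].
Definition lamv v : RR := inf (lamset v).

Lemma lamset_lb v : has_lbound (lamset v).
Proof.
have [M M0 HM] := pay_bound (own G v); exists (- M + eps)%R => _ [h _ [_ ->]].
rewrite lerD2r; apply/mp_lowC => d d0; exists 0%R => k.
have := HM (hout v0 s h) k; rewrite ler_norml => /andP[H _].
have n0 : (0 <= k%:R :> RR)%R by []. nra.
Qed.

Lemma lamv_le h : is_hist v0 h -> (lamv (last v0 h) <= mp (own G (last v0 h)) (hout v0 s h) + eps)%R.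
Proof. by move=> Hh; apply: ge_inf; [exact: lamset_lb | exists h]. Qed.

Lemma hist_reach v : connect (edge G) v0 v -> exists2 h, is_hist v0 h & last v0 h = v.
Proof. by move=> /connectP[p Hp ->]; exists (v0 :: p); rewrite //= eqxx. Qed.

Lemma lamv_inf v d : connect (edge G) v0 v -> (0 < d)%R -> exists h, [/\ is_hist v0 h, last v0 h = v &
  (mp (own G v) (hout v0 s h) + eps <= lamv v + d)%R].
Proof.
move=> Hv d0; have [h Hh Eh] := hist_reach Hv.
have hi : has_inf (lamset v) by split; [exists (mp (own G v) (hout v0 s h) + eps)%R, h | exact: lamset_lb].
have [x [h' Hh' [El ->]] Hx] := inf_adherent d0 hi.
by exists h'; split=> //; exact: ltW.
Qed.

Hypothesis sD : forall h, is_hist v0 h -> forall i rho, compat v0 i s h rho ->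
  (mp i rho <= mp i (hout v0 s h) + eps)%R.

Lemma hout_hext h m k : hout v0 s (hext s h m) k = hout v0 s h (k + m).
Proof. by rewrite /hout /hext iterD. Qed.

Lemma pay_xs (j : P) (xs : nat -> X) : psum (wX j) xs = pay j (fun k => (xs k).1).
Proof. by []. Qed.

Lemma arena_tail i tau h : is_hist v0 h -> let xs := pxs i tau h in
  [/\ xs 0 = (last v0 h, zM G), forall k, stp i tau (xs k) (xs k.+1) &
   infoft (fun k => (xs k).2 == 0 :> nat) \/ exists S : MS, [/\ S != 0 :> nat,
     exists N, forall k, N <= k -> (xs k).2 = S &
     forall u : V, inS S u -> lowC (psum (wX (own G u)) xs) (lamv u - eps)%R]].
Proof.
move=> Hh xs; split=> //; first by move=> k; exact: pxs_step.
case: (prho_tail i tau Hh) => [|[m [Hm HS Hr S0]]]; [by left | right].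
exists (vis (pst i tau h m).1); split=> //; first by exists m.+1 => k; exact: HS.
move=> u /visP[k Ek]; rewrite pay_xs; apply/mp_lowC; rewrite lerBlDr.
have Hk : is_hist v0 (hext s (pst i tau h m).1 k) by exact: hist_ext.
have := lamv_le Hk; rewrite -/(hout v0 s (pst i tau h m).1 k) Ek => H; apply: le_trans H _.
rewrite lerD2r le_eqVlt; apply/orP; left; apply/eqP.
apply: (@mp_shift _ _ _ _ 0 (m + k)) => q; rewrite addn0 hout_hext addnCA -/(prho i tau h _).
by rewrite Hr.
Qed.

(** The pretended history nearly attains the infimum, and the equilibrium condition at that history
    bounds the payoff of every deviating play. *)
Lemma arena_dev v tau d : connect (edge G) v0 v -> (0 < d)%R -> exists xs : nat -> X,
  [/\ xs 0 = (v, zM G), forall k, stp (own G v) tau (xs k) (xs k.+1),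
   infle (psum (wX (own G v)) xs) (lamv v + d)%R &
   infoft (fun k => (xs k).2 == 0 :> nat) \/ exists S : MS, [/\ S != 0 :> nat,
     exists N, forall k, N <= k -> (xs k).2 = S &
     forall u : V, inS S u -> lowC (psum (wX (own G u)) xs) (lamv u - eps)%R]].
Proof.
move=> Hv d0; have [h [Hh Eh Hl]] := lamv_inf Hv d0.
have [X0 XS XT] := arena_tail (own G v) tau Hh.
exists (pxs (own G v) tau h); split=> //; first by rewrite X0 Eh.
rewrite pay_xs; apply/mp_infle; apply: le_trans Hl; apply: sD => //; split=> // k; split; first exact: prho_edge.
by move=> ne; apply: prho_compat => // E; apply: ne; apply/val_inj.
Qed.

Lemma arena_box tau : exists xs : nat -> X,
  [/\ xs 0 = (v0, zM G), forall k, stp (np G) tau (xs k) (xs k.+1),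
   forall k, (xs k).1 = hout v0 s [:: v0] k &
   exists S : MS, [/\ S != 0 :> nat,
     exists N, forall k, N <= k -> (xs k).2 = S &
     forall u : V, inS S u -> lowC (psum (wX (own G u)) xs) (lamv u - eps)%R]].
Proof.
have Hh : is_hist v0 [:: v0] by rewrite /= eqxx.
have [X0 XS XT] := arena_tail (np G) tau Hh.
have ne (u : V) : own G u <> np G :> nat by move=> E; have := ltn_ord (own G u); rewrite E ltnn.
exists (pxs (np G) tau [:: v0]); split=> //.
  have H k : (pst (np G) tau [:: v0] k).1 = hext s [:: v0] k.
    elim: k => [|k IH] //; rewrite -prho_hist // hplayS prho_hist // IH; congr rcons.
    by rewrite prho_compat ?prho_hist ?IH //; exact: ne.
  by move=> k; rewrite /pxs /= H.
case: XT => // Hd; exfalso.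
have [[|k] Hk D] := Hd 1 => //; move: D; rewrite pxs_next.
case: (nx_cases (np G) (py (pst (np G) tau [:: v0] k)) (tau (py (pst (np G) tau [:: v0] k)))) => [->|[w [_ E _]]]; last by case: (ne _ E).
have /and5P[_ _ Hi _ _] := pxs_Amv (np G) tau Hh k.
by move=> /= /eqP E; move: Hi; rewrite /= E inS0.
Qed.

End Completeness.

(** * Certificates *)

Section Certificates.
Variable G : game.
Local Notation V := 'I_(nv G).
Local Notation P := 'I_(np G).
Local Notation MS := 'I_(2 ^ nv G).
Local Notation X := (V * MS)%type.
Local Notation Y := (V * MS * V)%type.
Local Notation T := (option V).
Variables (v0 : V) (Rn : P -> V -> V -> nat) (E : nat) (Xb Yb : P -> nat).

(* Rewards are scaled to naturals, [rw = Rn / Dl - K], and the requirement of the vertex [v] is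
   [L v / (q * Dl) - K]; a circulation [f] stands for a play with these average payoffs. *)
Definition fsum (f : X -> X -> nat) := \sum_a \sum_b f a b.
Definition fR j (f : X -> X -> nat) := \sum_a \sum_b f a b * Rn j a.1 b.1.

(** The support lies in the strongly connected component of [x]; a disconnected circulation can thus
    still be walked from [x], through connecting paths. *)
Definition circ i tau x (f : X -> X -> nat) := [/\ balanced f, 0 < fsum f &
  forall a b, 0 < f a b ->
    [/\ @stp G i tau a b, connect (@stp G i tau) x a & connect (@stp G i tau) b x]].

Definition lowq q (L : V -> nat) (S : nat) f := forall u : V, inS S u ->
  L u * fsum f <= q * fR (own G u) f + q * E * fsum f.

(** A deviation step inside the component can be visited infinitely often at vanishing cost to the
    averages. *)
Definition devscc i tau x := exists a b, [/\ @stp G i tau a b, connect (@stp G i tau) x a,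
  connect (@stp G i tau) b x & b.2 == 0 :> nat].

Definition cert_dev F q L v (tau : Y -> T) := exists x f,
  [/\ connect (@stp G (own G v) tau) (v, zM G) x, circ (own G v) tau x f, forall a b, f a b <= F,
      q * fR (own G v) f <= L v * fsum f & devscc (own G v) tau x \/ lowq q L x.2 f].

Definition tau0 : Y -> T := fun=> None.

(** There is one circulation per player [j], since the limit inferiors of different players may be
    approached at different times; the lower bounds must hold in all of these circulations. *)
Definition cert_box F q L := exists x, connect (@stp G (np G) tau0) (v0, zM G) x /\
  forall j, exists f, [/\ circ (np G) tau0 x f, forall a b, f a b <= F, fR j f <= Yb j * fsum f,
    forall j', Xb j' * fsum f <= fR j' f & lowq q L x.2 f].

(** [D] may be any set containing [v0] and closed under edges; all reachable vertices belong to
    it. *)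
Definition cert F := exists q L (D : pred V), [/\ 0 < q <= F, forall v, L v <= F,
  D v0 /\ (forall u w, D u -> edge G u w -> D w), forall v, D v -> forall tau, cert_dev F q L v tau &
  cert_box F q L].

(** * From circulations to plays *)

Section FromWalks.
Local Open Scope ring_scope.

Definition rsum (f : X -> X -> nat) (w : X -> X -> RR) : RR := \sum_a \sum_b (f a b)%:R * w a b.

(** Every walk begins with the detour [d] and runs through the circulation [k.+1] times, so that the
    detour fades from the averages without disappearing from the play. *)
Lemma circ_walks i tau x f d : circ i tau x f -> path (@stp G i tau) x d -> last x d = x ->
  exists Pk : nat -> seq X, [/\ forall k, path (@stp G i tau) x (Pk k) /\ last x (Pk k) = x,
    forall k, (0 < size (Pk k))%N, forall k, exists p, Pk k = d ++ p &
    forall w l, l * (fsum f)%:R <= rsum f w -> forall e, 0 < e -> exists K, forall k, (K <= k)%N ->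
      (l - e) * (size (Pk k))%:R <= wsum w x (Pk k)].
Proof.
move=> [bal f0 Hf] dp dl.
have [d' [ld' Hd']] := @circulation_walks RR X (@stp G i tau) f x d bal Hf dp dl.
pose pk k := projT1 (cid (Hd' k.+1)).
have pkP k : [/\ path (@stp G i tau) x (d ++ pk k), last x (d ++ pk k) = x &
    forall w, wsum w x (d ++ pk k) = k.+1%:R * rsum f w + wsum w x d'].
  by rewrite /pk; case: cid.
have szE k : (size (d ++ pk k))%:R = k.+1%:R * (fsum f)%:R + (size d')%:R :> RR.
  have [_ _ /(_ (fun _ _ => 1))] := pkP k; rewrite !wsum_const !mul1r => ->.
  congr (_ * _ + _); rewrite /rsum /fsum natr_sum; apply: eq_bigr => a _.
  by rewrite natr_sum; apply: eq_bigr => b _; rewrite mulr1.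
have f1 : 1 <= (fsum f)%:R :> RR by rewrite ler1n.
exists (fun k => d ++ pk k); split.
- by move=> k; have [] := pkP k.
- move=> k; rewrite -(ltr_nat RR) szE; apply: ltr_pwDl => //.
  by rewrite mulr_gt0 // ltr0n.
- by move=> k; exists (pk k).
move=> w l Hl e e0.
pose C := wsum (fun a b => w a b - l) x d'.
have [K HK] := archi_nat (- C / e).
exists K => k Kk; have [_ _ Hw] := pkP k.
rewrite Hw szE; rewrite ltr_pdivrMr // in HK.
have Kk' : K%:R <= k.+1%:R :> RR by rewrite ler_nat leqW.
have Cs : wsum w x d' = C + l * (size d')%:R by rewrite /C wsum_shift subrK.
rewrite Cs; have H1 : - C <= k.+1%:R * e by nra.
have H2 : k.+1%:R * (l * (fsum f)%:R) <= k.+1%:R * rsum f w by rewrite ler_wpM2l.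
have H3 : k.+1%:R * e <= k.+1%:R * (fsum f)%:R * e by rewrite ler_wpM2r ?(ltW e0) // ler_peMr.
have H4 : 0 <= e * (size d')%:R by rewrite mulr_ge0 // ltW.
nra.
Qed.

End FromWalks.

Definition glue (x0 : X) (p : seq X) (r : nat -> X) k : X :=
  if k < size p then nth x0 (x0 :: p) k else r (k - size p).

Lemma glue_step (e : rel X) x0 p r : path e x0 p -> last x0 p = r 0 -> (forall k, e (r k) (r k.+1)) ->
  forall k, e (glue x0 p r k) (glue x0 p r k.+1).
Proof.
move=> pp pl Hr k; rewrite /glue; case: (ltnP k (size p)) => Hk.
  have Hs : e (nth x0 (x0 :: p) k) (nth x0 p k) by have /(pathP x0) /(_ k Hk) := pp.
  case: ltnP => Hk1 //=.
  have Ek : k = (size p).-1 by lia.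
  have -> : k.+1 - size p = 0 by lia.
  by rewrite -pl -(nth_last x0) -Ek; case: (p) Hk Hs.
by rewrite ltnNge (leqW Hk) /= subSn.
Qed.

Lemma glue0 x0 p r : last x0 p = r 0 -> glue x0 p r 0 = x0.
Proof. by rewrite /glue; case: p. Qed.

Lemma glue_tail x0 p r k : glue x0 p r (k + size p) = r k.
Proof. by rewrite /glue ltnNge leq_addl /= addnK. Qed.

Lemma stp_mask i tau (a b : X) : @stp G i tau a b -> b.2 != 0 :> nat ->
  [/\ inS b.2 b.1, inS b.2 a.1 & a.2 != 0 :> nat -> b.2 = a.2].
Proof.
move=> /existsP[y /andP[/and5P[/eqP E1 E2 E3 E4 E5] /eqP ->]].
case: (nx_cases i y (tau y)) => [->|[w [-> _ _]]] //= _.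
by split=> // a0; move: E2; rewrite (negbTE a0) /= => /eqP.
Qed.

Section Scaled.
Local Open Scope ring_scope.
Variables (Dl K : nat).
Hypothesis Dl0 : (0 < Dl)%N.
Hypothesis scaleR : forall j u v, edge G u v -> rw j u v = (Rn j u v)%:R / Dl%:R - K%:R.

Lemma stp_edge i tau (a b : X) : @stp G i tau a b -> edge G a.1 b.1.
Proof.
move=> /existsP[y /andP[/and5P[/eqP E1 _ _ _ E5] /eqP ->]].
by case: (nx_cases i y (tau y)) => [->|[w [-> _ Ee]]] //=; rewrite -E1.
Qed.

Lemma rsum_scale i tau x f j : circ i tau x f ->
  rsum f (wX j) = (fR j f)%:R / Dl%:R - K%:R * (fsum f)%:R.
Proof.
move=> [_ _ Hf]; rewrite /rsum /fR /fsum !natr_sum mulr_suml mulr_sumr -sumrB; apply: eq_bigr => a _.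
rewrite !natr_sum mulr_suml mulr_sumr -sumrB; apply: eq_bigr => b _.
case: (posnP (f a b)) => [->|pos]; first by rewrite !mul0r mulr0 subr0.
have [Hs _ _] := Hf a b pos.
by rewrite /wX scaleR ?natrM; [ring | exact: stp_edge Hs].
Qed.

Variables (q : nat) (L : V -> nat).
Hypothesis q0 : (0 < q)%N.
Definition lamq (v : V) : RR := (L v)%:R / (q%:R * Dl%:R) - K%:R.
Definition epsq : RR := E%:R / Dl%:R.

Let DlR : 0 < Dl%:R :> RR. Proof. by rewrite ltr0n. Qed.
Let qR : 0 < q%:R :> RR. Proof. by rewrite ltr0n. Qed.

Lemma up_scale i tau x f j (v : V) : circ i tau x f -> (q * fR j f <= L v * fsum f)%N ->
  - lamq v * (fsum f)%:R <= rsum f (fun a b => - wX j a b).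
Proof.
move=> Hc H; have -> : rsum f (fun a b => - wX j a b) = - rsum f (wX j).
  by rewrite /rsum -sumrN; apply: eq_bigr => a _; rewrite -sumrN; apply: eq_bigr => b _; rewrite mulrN.
rewrite (rsum_scale _ Hc) mulNr lerN2 /lamq mulrBl lerD2r.
move: H; rewrite -(ler_nat RR) !natrM => H.
rewrite -(ler_pM2l (mulr_gt0 qR DlR)).
have -> : q%:R * Dl%:R * ((fR j f)%:R / Dl%:R) = q%:R * (fR j f)%:R :> RR by field; rewrite gt_eqF.
have -> : q%:R * Dl%:R * ((L v)%:R / (q%:R * Dl%:R) * (fsum f)%:R) = (L v)%:R * (fsum f)%:R :> RR.
  by field; rewrite !gt_eqF.
by [].
Qed.

Lemma low_scale i tau x f j (u : V) : circ i tau x f ->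
  (L u * fsum f <= q * fR j f + q * E * fsum f)%N ->
  (lamq u - epsq) * (fsum f)%:R <= rsum f (wX j).
Proof.
move=> Hc H; rewrite (rsum_scale _ Hc) /lamq /epsq.
move: H; rewrite -(ler_nat RR) natrD !natrM => H.
have Hq : q%:R * Dl%:R * (fsum f)%:R * 1 = q%:R * Dl%:R * (fsum f)%:R :> RR by rewrite mulr1.
rewrite -(ler_pM2l (mulr_gt0 qR DlR)).
have -> : q%:R * Dl%:R * (((L u)%:R / (q%:R * Dl%:R) - K%:R - E%:R / Dl%:R) * (fsum f)%:R) =
    (L u)%:R * (fsum f)%:R - q%:R * Dl%:R * K%:R * (fsum f)%:R - q%:R * E%:R * (fsum f)%:R :> RR.
  by field; rewrite !gt_eqF.
have -> : q%:R * Dl%:R * ((fR j f)%:R / Dl%:R - K%:R * (fsum f)%:R) =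
    q%:R * (fR j f)%:R - q%:R * Dl%:R * K%:R * (fsum f)%:R :> RR.
  by field; rewrite gt_eqF.
lra.
Qed.

Lemma box_low i tau x f j (b : nat) : circ i tau x f -> (b * fsum f <= fR j f)%N ->
  (b%:R / Dl%:R - K%:R) * (fsum f)%:R <= rsum f (wX j).
Proof.
move=> Hc H; rewrite (rsum_scale _ Hc) mulrBl lerD2r -mulrA (mulrC (Dl%:R^-1)) mulrA.
by rewrite ler_pM2r ?invr_gt0 // -natrM ler_nat.
Qed.

Lemma box_up i tau x f j (b : nat) : circ i tau x f -> (fR j f <= b * fsum f)%N ->
  rsum f (wX j) <= (b%:R / Dl%:R - K%:R) * (fsum f)%:R.
Proof.
move=> Hc H; rewrite (rsum_scale _ Hc) mulrBl lerD2r -[leRHS]mulrA (mulrC (Dl%:R^-1) (fsum f)%:R) mulrA.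
by rewrite ler_pM2r ?invr_gt0 // -natrM ler_nat.
Qed.

(** A nonempty promise changes only by being cleared, that is by a deviation; a component without
    deviations has a constant mask. *)
Lemma closed_mask i tau x p : path (@stp G i tau) x p -> last x p = x -> (0 < size p)%N ->
  ~ devscc i tau x -> x.2 != 0%N :> nat /\ all (fun b : X => b.2 == x.2) p.
Proof.
move=> pp pl p0 nd.
have nz y r : path (@stp G i tau) y r -> connect (@stp G i tau) x y ->
    last y r = x -> all (fun b : X => b.2 != 0%N :> nat) r.
  elim: r y => [|z r IH] y //= /andP[s1 s2] Hxy Hl.
  have Hz : connect (@stp G i tau) x z by apply: connect_trans Hxy (connect1 s1).
  rewrite (IH z) // andbT; apply/negP => z0; apply: nd; exists y, z; split=> //.
  by apply/connectP; exists r.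
have Hnz := nz x p pp (connect0 _ _) pl.
have x0 : x.2 != 0%N :> nat.
  by move/allP: Hnz => /(_ x); apply; rewrite -{1}pl; case: (p) p0 => //= y r _; exact: mem_last.
split=> //.
have gen y r : path (@stp G i tau) y r -> y.2 = x.2 -> all (fun b : X => b.2 != 0%N :> nat) r ->
    all (fun b : X => b.2 == x.2) r.
  elim: r y => [|z r IH] y //= /andP[s1 s2] Ey /andP[z0 Hr].
  have [_ _ Ez] := stp_mask s1 z0; have {}Ez : z.2 = x.2 by rewrite Ez Ey.
  by rewrite Ez eqxx (IH z).
exact: gen pp erefl Hnz.
Qed.

Lemma osum_glue (w : X -> X -> RR) x0 p r l : last x0 p = r 0%N ->
  lowC (osum (fun k => w (r k) (r k.+1))) l ->
  lowC (osum (fun k => w (glue x0 p r k) (glue x0 p r k.+1))) l.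
Proof.
move=> pl H; have [M M0 HM] := weight_bound w.
apply: (lowC_tail (a := 0) (b := size p) (M := M)) H => [k|k] //.
by rewrite addn0 -addSn !glue_tail.
Qed.

Lemma cert_dev_win F v tau : cert_dev F q L v tau -> exists ys : nat -> Y,
  [/\ Amv (v, zM G) (ys 0%N), forall k, Amv (nx (own G v) (ys k) (tau (ys k))) (ys k.+1) &
     Win lamq epsq (own G v) (lamq v) (fun k => (ys k, tau (ys k)))].
Proof.
move=> [x [f [/connectP[p0 pp0 px] Hc _ Hup Hdl]]].
set i := own G v in pp0 Hc Hup Hdl *.
(* If the component contains a deviation, [d] is a closed detour through it, taken once in every
   walk; otherwise the empty detour will do. *)
have [d [dp [dl Hd]]] : exists d, path (@stp G i tau) x d /\ (last x d = x /\
    (has (fun b : X => b.2 == 0%N :> nat) d \/ (~ devscc i tau x /\ lowq q L x.2 f))).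
  case: (pselect (devscc i tau x)) => [|nd].
    move=> [a [b [s1 /connectP[pa ppa la] /connectP[pb ppb lb] b0]]].
    exists (pa ++ b :: pb); rewrite cat_path last_cat /= ppa -la s1 ppb -lb; split=> //; split=> //.
    by left; rewrite has_cat /= b0 orbT.
  by case: Hdl => // Hlo; exists [::]; split=> //; split=> //; right.
have [Pk [HP1 HP2 HP3 HP4]] := circ_walks Hc dp dl.
have Pp k : path (@stp G i tau) x (Pk k) by have [] := HP1 k.
have Pl k : last x (Pk k) = x by have [] := HP1 k.
pose r := brho x Pk.
have r0 : last (v, zM G) p0 = r 0%N by rewrite -px.
have rs k : @stp G i tau (r k) (r k.+1) by exact: brho_step.
have low w l : l * (fsum f)%:R <= rsum f w -> lowC (osum (fun k => w (r k) (r k.+1))) l.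
  move=> Hl; apply/lowC_ev.
  by move=> e e0; exact: (blocks_low Pp Pl HP2 (HP4 w l Hl) e0).
apply: (@winplay G lamq epsq i (lamq v) tau (v, zM G) (glue (v, zM G) p0 r)).
- exact: glue0.
- exact: glue_step.
- apply: (osum_glue (w := fun a b => - wX i a b)) => //.
  exact: (low (fun a b => - wX i a b) _ (up_scale Hc Hup)).
case: Hd => [Hd|[nd Hlo]]; [left | right].
  have Hh : infoft (fun k => (r k).2 == 0%N :> nat).
    apply: (@brho_has X x Pk HP2 (fun b : X => b.2 == 0%N :> nat)) => k.
    by have [p ->] := HP3 k; rewrite has_cat Hd.
  move=> N; have [k Hk Dk] := Hh N; exists (k + size p0)%N; first by lia.
  by rewrite glue_tail.
have [x0 _] := closed_mask (Pp 0%N) (Pl 0%N) (HP2 0%N) nd.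
have rm k : (r k).2 = x.2.
  apply/eqP; apply: (@brho_all X x Pk HP2 (fun b : X => b.2 == x.2)) => // m.
  by have [] := closed_mask (Pp m) (Pl m) (HP2 m) nd.
exists x.2; split=> //.
  by exists (size p0) => k Hk; rewrite -(subnK Hk) glue_tail.
move=> u Hu; apply: (osum_glue (w := wX (own G u))) => //.
exact: (low _ _ (low_scale Hc (Hlo u Hu))).
Qed.

Lemma nodev_np tau x : ~ devscc (np G) tau x.
Proof.
move=> [a [b [/existsP[y /andP[/and5P[_ _ H3 _ _] /eqP ->]] _ _ b0]]].
case: (nx_cases (np G) y (tau y)) b0 => [->|[w [_ Eo _]]] /=.
  by move=> /eqP E0; rewrite E0 inS0 in H3.
by have := ltn_ord (own G y.1.1); rewrite Eo ltnn.
Qed.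

Lemma cert_box_play F : (0 < np G)%N -> cert_box F q L -> exists rho : nat -> V,
  [/\ rho 0%N = v0, forall k, edge G (rho k) (rho k.+1),
    forall k, lamq (rho k) - epsq <= mp (own G (rho k)) rho,
    forall j, (Xb j)%:R / Dl%:R - K%:R <= mp j rho &
    forall j, mp j rho <= (Yb j)%:R / Dl%:R - K%:R].
Proof.
move=> np0 [x [/connectP[p0 pp0 px] Hf]].
pose i := np G; pose st := @stp G i tau0.
have [ff ffP] : exists ff : P -> X -> X -> nat, forall j, [/\ circ i tau0 x (ff j),
    (fR j (ff j) <= Yb j * fsum (ff j))%N, forall j', (Xb j' * fsum (ff j) <= fR j' (ff j))%N &
    lowq q L x.2 (ff j)].
  exists (fun j => projT1 (cid (Hf j))) => j; case: cid => f [h1 _ h3 h4 h5] /=.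
  by split.
have HPk j : exists Pk : nat -> seq X, [/\ forall k, path st x (Pk k) /\ last x (Pk k) = x,
    forall k, (0 < size (Pk k))%N &
    forall w l, l * (fsum (ff j))%:R <= rsum (ff j) w -> forall e, 0 < e -> exists K, forall k, (K <= k)%N ->
      (l - e) * (size (Pk k))%:R <= wsum w x (Pk k)].
  have [h1 _ _ _] := ffP j; have [Pk [a1 a2 _ a4]] := circ_walks (d := [::]) h1 isT erefl.
  by exists Pk.
pose PP j := projT1 (cid (HPk j)).
have PPp j k : path st x (PP j k) by rewrite /PP; case: cid => ? [H _ _] /=; have [] := H k.
have PPl j k : last x (PP j k) = x by rewrite /PP; case: cid => ? [H _ _] /=; have [] := H k.
have PPn j k : (0 < size (PP j k))%N by rewrite /PP; case: cid => ? [_ H _] /=.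
have PPa j w l : l * (fsum (ff j))%:R <= rsum (ff j) w -> forall e, 0 < e -> exists K, forall k, (K <= k)%N ->
      (l - e) * (size (PP j k))%:R <= wsum w x (PP j k).
  by rewrite /PP; case: cid => ? [_ _ H] /=; exact: H.
(* The blocks serve the players cyclically. Lower bounds hold in every block, the upper bound of [j]
   in the blocks of [j], which are infinitely many. *)
pose jk k : P := Ordinal (ltn_pmod k np0).
pose Pk k := PP (jk k) k.
have Pp k : path st x (Pk k) by exact: PPp.
have Pl k : last x (Pk k) = x by exact: PPl.
have Pn k : (0 < size (Pk k))%N by exact: PPn.
pose r := brho x Pk.
have rs k : st (r k) (r k.+1) by exact: brho_step.
have low w l : (forall j, l * (fsum (ff j))%:R <= rsum (ff j) w) -> lowC (osum (fun k => w (r k) (r k.+1))) l.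
  move=> Hl; apply/lowC_ev.
  move=> e0 e00; apply: (blocks_low Pp Pl Pn _ e00) => {e0 e00} e e0.
  pose KK j := projT1 (cid (PPa j w l (Hl j) e e0)).
  have KKP j k : (KK j <= k)%N -> (l - e) * (size (PP j k))%:R <= wsum w x (PP j k).
    by rewrite /KK; case: cid => ? H /=; exact: H.
  exists (\sum_j KK j)%N => k Hk; apply: KKP; apply: leq_trans Hk.
  by rewrite (bigD1 (jk k)) //= leq_addr.
have r0 : last (v0, zM G) p0 = r 0%N by rewrite -px.
have high (j : P) l : rsum (ff j) (wX j) <= l * (fsum (ff j))%:R -> infle (osum (fun k => wX j (r k) (r k.+1))) l.
  move=> Hl e N e0; apply: (blocks_high Pp Pl Pn _ N e0) => {N e0} e' N' e'0.
  have [|K1 HK1] := PPa j (fun a b => - wX j a b) (- l) _ e' e'0.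
    have -> : rsum (ff j) (fun a b => - wX j a b) = - rsum (ff j) (wX j).
      by rewrite /rsum -sumrN; apply: eq_bigr => a _; rewrite -sumrN; apply: eq_bigr => b _; rewrite mulrN.
    by rewrite mulNr lerN2.
  (* A sufficiently late block that belongs to player [j]. *)
  exists ((N' + K1) * np G + j)%N; first by nia.
  have Ej : jk ((N' + K1) * np G + j)%N = j by apply/val_inj; rewrite /= modnMDl modn_small.
  rewrite /Pk Ej; have := HK1 ((N' + K1) * np G + j)%N; set p := PP _ _.
  have wN y s : wsum (fun a b => - wX j a b) y s = - wsum (wX j) y s.
    by elim: s y => [|z s IH] y /=; rewrite ?oppr0 // IH opprD.
  have Hle : (K1 <= (N' + K1) * np G + j)%N by nia.
  move=> /(_ Hle); rewrite wN; lra.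
have [x0 _] := closed_mask (Pp 0%N) (Pl 0%N) (Pn 0%N) (@nodev_np tau0 x).
have rm k : (r k).2 = x.2.
  apply/eqP; apply: (@brho_all X x Pk Pn (fun b : X => b.2 == x.2)) => // m.
  by have [] := closed_mask (Pp m) (Pl m) (Pn m) (@nodev_np tau0 x).
pose xs := glue (v0, zM G) p0 r.
have xs0 : xs 0%N = (v0, zM G) by exact: glue0.
have xss k : st (xs k) (xs k.+1) by exact: glue_step.
have xnz k : (xs k.+1).2 != 0%N :> nat.
  have /existsP[y /andP[/and5P[_ _ H3 _ _] /eqP ->]] := xss k.
  case: (nx_cases (np G) y (tau0 y)) => [->|[w [_ Eo _]]] /=.
    by apply/eqP => E0; rewrite E0 inS0 in H3.
  by have := ltn_ord (own G y.1.1); rewrite Eo ltnn.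
have xm k : (xs k.+1).2 = x.2.
  have step1 m : (xs m.+2).2 = (xs m.+1).2 by have [_ _] := stp_mask (xss m.+1) (xnz m.+1); apply.
  have cst m : (xs (k + m).+1).2 = (xs k.+1).2.
    by elim: m => [|m IH]; rewrite ?addn0 // addnS step1.
  by rewrite -(cst (size p0)) -addSn /xs glue_tail rm.
have inx k : inS x.2 (xs k).1.
  case: k => [|k]; last by have [+ _ _] := stp_mask (xss k) (xnz k); rewrite xm.
  by have [_ + _] := stp_mask (xss 0%N) (xnz 0%N); rewrite xm.
pose rho k := (xs k).1.
have payE j : pay j rho = osum (fun k => wX j (xs k) (xs k.+1)) by [].
exists rho; split.
- by rewrite /rho xs0.
- by move=> k; exact: stp_edge (xss k).
- move=> k; apply/mp_lowC; rewrite payE; apply: osum_glue => //; apply: low => j.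
  by have [h1 _ _ h4] := ffP j; apply: (low_scale h1); apply: h4; exact: inx.
- move=> j; apply/mp_lowC; rewrite payE; apply: osum_glue => //; apply: low => j'.
  by have [h1 _ h3 _] := ffP j'; apply: (box_low h1).
move=> j; apply/mp_infle; rewrite payE.
apply: (infle_shift (u := osum (fun k => wX j (r k) (r k.+1))) (a := 0) (b := size p0)
  (c := osum (fun k => wX j (xs k) (xs k.+1)) (size p0))).
  move=> k; rewrite addn0 -osum_shift; congr (_ + _); apply: eq_bigr => m _.
  by rewrite /xs -addSn !glue_tail.
by apply: high; have [h1 h2 _ _] := ffP j; exact: box_up h1 h2.
Qed.

End Scaled.

End Certificates.

(** * Joint rational solutions of the circulation constraints *)

Section JointSolution.
Variables (V P KT : finType) (ow : V -> P) (Rn : P -> V * V -> nat) (E : nat) (Xb Yb : P -> nat).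
Variables (len wt : V -> nat) (act : pred KT) (pl : KT -> P) (ub : KT -> option V)
  (low : KT -> pred V) (U : KT -> {set V * V}).
Local Open Scope ring_scope.

(* Row kinds of a circulation: total at most one, total at least one, support, upper bound;
   balance at a vertex in both directions; lower bound at a vertex; lower bound of the box. *)
Local Notation RK := (((bool * bool) + (bool * V)) + V + P)%type.
Local Notation RT := (V + KT * RK)%type.
Local Notation JT := (V + KT * (V * V))%type.

Definition rL k (r : RK) v : int := match r with
  | inl (inl (inl (true, true))) => if ub k is Some v' then - (v == v')%:R else 0
  | inl (inr u) => (low k u && (v == u))%:R
  | _ => 0
  end.

Definition rG k (r : RK) (p : V * V) : int := match r with
  | inl (inl (inl (false, false))) => 1
  | inl (inl (inl (false, true))) => -1
  | inl (inl (inl (true, false))) => (p \notin U k)%:R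
  | inl (inl (inl (true, true))) => (Rn (pl k) p)%:R
  | inl (inl (inr (s, u))) => (-1) ^+ s * ((p.1 == u)%:R - (p.2 == u)%:R)
  | inl (inr u) => if low k u then - (Rn (ow u) p)%:R else 0
  | inr j => if ub k is None then - (Rn j p)%:R else 0
  end.

Definition rB k (r : RK) : int := match r with
  | inl (inl (inl (false, false))) => 1
  | inl (inl (inl (false, true))) => -1
  | inl (inl (inl (true, true))) => if ub k is None then (Yb (pl k))%:R else 0
  | inl (inr u) => if low k u then E%:R else 0
  | inr j => if ub k is None then - (Xb j)%:R else 0
  | _ => 0
  end.

(** Inactive indices produce zero rows and columns, so that the index types need not depend on
    [act]. *)
Definition Amat (r : RT) (j : JT) : int := match r, j with
  | inl u, inl v => - ((len u)%:R * (v == u)%:R)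
  | inr kr, inl v => if act kr.1 then rL kr.1 kr.2 v else 0
  | inr kr, inr kp => if act kr.1 && (kp.1 == kr.1) then rG kr.1 kr.2 kp.2 else 0
  | _, _ => 0
  end.

Definition bvec (r : RT) : int := match r with
  | inl u => - (wt u)%:R
  | inr kr => if act kr.1 then rB kr.1 kr.2 else 0
  end.

Lemma sum_delta (R : pzRingType) (I : finType) (u : I) (F : I -> R) :
  \sum_v (v == u)%:R * F v = F u.
Proof.
by rewrite (bigD1 u) //= eqxx mul1r big1 ?addr0 // => v /negbTE ->; rewrite mul0r.
Qed.

Lemma sum_ind (R : pzRingType) (I : finType) (a : pred I) (F : I -> R) :
  \sum_v (a v)%:R * F v = \sum_(v | a v) F v.
Proof. by rewrite [RHS]big_mkcond; apply: eq_bigr => v _; case: (a v); rewrite ?mul1r ?mul0r. Qed.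

Lemma AmatL (R : comPzRingType) u (x : JT -> R) :
  \sum_j (Amat (inl u) j)%:~R * x j = - ((len u)%:R * x (inl u)).
Proof.
rewrite big_sumType /= [X in _ + X]big1 ?addr0 => [|p _]; last by rewrite mul0r.
rewrite -(sum_delta u (fun v => - ((len u)%:R * x (inl v)))); apply: eq_bigr => v _.
by rewrite rmorphN rmorphM /= !rmorph_nat mulNr mulrN -!mulrA mulrCA.
Qed.

Lemma AmatR (R : comPzRingType) k r (x : JT -> R) : act k ->
  \sum_j (Amat (inr (k, r)) j)%:~R * x j =
  \sum_v (rL k r v)%:~R * x (inl v) + \sum_p (rG k r p)%:~R * x (inr (k, p)).
Proof.
move=> ak; rewrite big_sumType /= ak /=; congr (_ + _).
transitivity (\sum_k' \sum_p (if k' == k then rG k r p else 0)%:~R * x (inr (k', p))).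
  by rewrite pair_bigA; apply: eq_bigr => -[k' p] _.
rewrite (bigD1 k) //= eqxx [X in _ + X]big1 ?addr0 // => k' /negbTE ->.
by rewrite big1 // => p _; rewrite mul0r.
Qed.

Lemma rowE (R : comPzRingType) k r (La : V -> R) (g : V * V -> R) :
  \sum_v (rL k r v)%:~R * La v + \sum_p (rG k r p)%:~R * g p = match r with
  | inl (inl (inl (false, false))) => \sum_p g p
  | inl (inl (inl (false, true))) => - \sum_p g p
  | inl (inl (inl (true, false))) => \sum_(p | p \notin U k) g p
  | inl (inl (inl (true, true))) =>
      \sum_p (Rn (pl k) p)%:R * g p - (if ub k is Some v then La v else 0)
  | inl (inl (inr (s, u))) => (-1) ^+ s * (\sum_(p | p.1 == u) g p - \sum_(p | p.2 == u) g p)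
  | inl (inr u) => if low k u then La u - \sum_p (Rn (ow u) p)%:R * g p else 0
  | inr j => if ub k is None then - \sum_p (Rn j p)%:R * g p else 0
  end.
Proof.
have Z (F : V -> R) : \sum_v 0%:~R * F v = 0 by rewrite big1 // => v _; rewrite mul0r.
have Z' (F : V * V -> R) : \sum_v 0%:~R * F v = 0 by rewrite big1 // => v _; rewrite mul0r.
case: r => [[[[[] []]|[s u]]|u]|j] /=.
- rewrite addrC; congr (_ + _); first by apply: eq_bigr => p _; rewrite rmorph_nat.
  case: (ub k) => [v'|]; last by rewrite Z oppr0.
  by rewrite -(sum_delta v' La) -sumrN; apply: eq_bigr => v _; rewrite rmorphN rmorph_nat mulNr.
- by rewrite Z add0r -(sum_ind (fun p => p \notin U k)); apply: eq_bigr => p _; rewrite rmorph_nat.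
- by rewrite Z add0r -sumrN; apply: eq_bigr => p _; rewrite mulN1r.
- by rewrite Z add0r; apply: eq_bigr => p _; rewrite mul1r.
- rewrite Z add0r -(sum_ind (fun p => p.1 == u)) -(sum_ind (fun p => p.2 == u)) -sumrB mulr_sumr; apply: eq_bigr => p _.
  by rewrite rmorphM rmorph_sign rmorphB !rmorph_nat -mulrBl mulrA.
- case: (low k u) => /=; last by rewrite Z Z' addr0.
  rewrite -(sum_delta u La); congr (_ + _); first by apply: eq_bigr => p _; rewrite rmorph_nat.
  rewrite -sumrN.
  by apply: eq_bigr => p _; rewrite rmorphN rmorph_nat mulNr.
- rewrite Z add0r; case: (ub k) => [v'|]; first by rewrite Z'.
  by rewrite -sumrN; apply: eq_bigr => p _; rewrite rmorphN rmorph_nat mulNr.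
Qed.

(** The unknowns are the requirements and one circulation per active index, normalised to total 1.
    Solving for all of them at once yields a common denominator [q], so that requirements and
    averages remain comparable. [wt v] over [len v] is a lower bound on the requirement of [v]. *)
Lemma joint_solution (R : realFieldType) (M : nat) (La : V -> R) :
  (0 < M)%N -> (forall j p, (Rn j p <= M)%N) -> (E <= M)%N -> (forall j, (Xb j <= M)%N) ->
  (forall j, (Yb j <= M)%N) -> (forall v, (len v <= M)%N) -> (forall v, (wt v <= M)%N) ->
  (forall v, 0 <= La v) -> (forall v, (wt v)%:R <= La v * (len v)%:R) ->
  (forall k, act k -> forall e, 0 < e -> exists g : V * V -> R, [/\ forall p, 0 <= g p,
     forall p, p \notin U k -> g p = 0,
     (forall u, \sum_(p | p.1 == u) g p = \sum_(p | p.2 == u) g p) /\ \sum_p g p = 1,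
     \sum_p (Rn (pl k) p)%:R * g p <= (if ub k is Some v then La v else (Yb (pl k))%:R) + e &
     (forall u, low k u -> La u - E%:R - e <= \sum_p (Rn (ow u) p)%:R * g p) /\
     (ub k = None -> forall j, (Xb j)%:R - e <= \sum_p (Rn j p)%:R * g p)]) ->
  let F := (((#|{: RT}|)`!) * M ^ #|{: RT}|)%N in
  exists (q : nat) (L : V -> nat) (z : KT -> V * V -> nat),
    [/\ (0 < q <= F)%N, forall v, (L v <= F)%N, forall k p, (z k p <= F)%N,
     forall v, (q * wt v <= L v * len v)%N &
     forall k, act k -> [/\ forall p, (0 < z k p)%N -> p \in U k,
     forall u, (\sum_(p | p.1 == u) z k p = \sum_(p | p.2 == u) z k p)%N,
     (\sum_p z k p = q)%N,
     (\sum_p Rn (pl k) p * z k p <= (if ub k is Some v then L v else q * Yb (pl k)))%N &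
     (forall u, low k u -> (L u <= \sum_p Rn (ow u) p * z k p + q * E)%N) /\
     (ub k = None -> forall j, (q * Xb j <= \sum_p Rn j p * z k p)%N)]].
Proof.
move=> M0 HR HE HX HY Hlen Hwt La0 HA HK F.
have absn n : `|n%:R| = n%:R :> int by rewrite ger0_norm // ler0n.
have b01 (b : bool) : (b%:R : int) <= M%:R by rewrite ler_nat; apply: leq_trans M0; case: b.
have AM r j : `|Amat r j| <= M%:R.
  case: r j => [u|[k r]] [v|[k' p]] //=.
  - by rewrite normrN normrM !absn -natrM ler_nat; case: eqP => _; rewrite ?muln1 ?muln0.
  - case: (act k) => //; case: r => [[[[[] []]|[s u]]|u]|j] //=.
      by case: (ub k) => [v'|] //; rewrite normrN absn.
    by rewrite absn.
  - case: (act k && _) => //; case: r => [[[[[] []]|[s u]]|u]|j] //=.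
    + by rewrite absn ler_nat.
    + by rewrite absn.
    + by rewrite normrN1 ler1n.
    + by rewrite normr1 ler1n.
    + rewrite normrMsign; case: (p.1 == u); case: (p.2 == u); rewrite ?subrr ?subr0 ?sub0r ?normrN ?normr1 ?normr0 //;
      by rewrite ler1n.
    + by case: (low k u) => //; rewrite normrN absn ler_nat.
    + by case: (ub k) => // ; rewrite normrN absn ler_nat.
have bM r : `|bvec r| <= M%:R.
  case: r => [u|[k r]] /=; first by rewrite normrN absn ler_nat.
  case: (act k) => //; case: r => [[[[[] []]|[s u]]|u]|j] //=.
  - by case: (ub k) => // ; rewrite absn ler_nat.
  - by rewrite normrN1 ler1n.
  - by rewrite normr1 ler1n.
  - by case: (low k u) => //; rewrite absn ler_nat.
  - by case: (ub k) => // ; rewrite normrN absn ler_nat.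
have AM' r j : `|Amat r j| <= M%:Z by rewrite -natz.
have bM' r : `|bvec r| <= M%:Z by rewrite -natz.
have [|q [z [q0 qF zF Hz]]] := @bounded_solution R _ _ Amat bvec (fun=> 1) M M0 AM' bM'.
  move=> e e0.
  have Hg k : exists g : V * V -> R, (forall p, 0 <= g p) /\ (act k -> [/\
     forall p, p \notin U k -> g p = 0,
     (forall u, \sum_(p | p.1 == u) g p = \sum_(p | p.2 == u) g p) /\ \sum_p g p = 1,
     \sum_p (Rn (pl k) p)%:R * g p <= (if ub k is Some v then La v else (Yb (pl k))%:R) + e &
     (forall u, low k u -> La u - E%:R - e <= \sum_p (Rn (ow u) p)%:R * g p) /\
     (ub k = None -> forall j, (Xb j)%:R - e <= \sum_p (Rn j p)%:R * g p)]).
    case Ak: (act k); last by exists (fun=> 0).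
    by have [g [g1 g2 g3 g4 g5]] := HK k Ak e e0; exists g.
  pose g k := projT1 (cid (Hg k)).
  have gP k : (forall p, 0 <= g k p) /\ (act k -> [/\
     forall p, p \notin U k -> g k p = 0,
     (forall u, \sum_(p | p.1 == u) g k p = \sum_(p | p.2 == u) g k p) /\ \sum_p g k p = 1,
     \sum_p (Rn (pl k) p)%:R * g k p <= (if ub k is Some v then La v else (Yb (pl k))%:R) + e &
     (forall u, low k u -> La u - E%:R - e <= \sum_p (Rn (ow u) p)%:R * g k p) /\
     (ub k = None -> forall j, (Xb j)%:R - e <= \sum_p (Rn j p)%:R * g k p)]).
    by rewrite /g; case: cid.
  exists (fun j => match j with inl v => La v | inr kp => g kp.1 kp.2 end); split.
    by case=> [v|[k p]] //=; have [] := gP k.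
  rewrite mulr1; case=> [u|[k r]].
    rewrite AmatL /= rmorphN rmorph_nat; have := HA u; rewrite mulrC; lra.
  case Ak: (act k); last first.
    rewrite big1 => [|j _]; first by rewrite /= Ak add0r ltW.
    by case: j => [v|kp] /=; rewrite Ak mul0r.
  have [_ /(_ Ak) [g2 [g3 g4] g5 [g6 g7]]] := gP k.
  rewrite AmatR // rowE /= Ak; case: r => [[[[[] []]|[s u]]|u]|j] /=.
  - by move: g5; case: (ub k) => [v|]; rewrite ?rmorph_nat /=; lra.
  - by rewrite big1 // add0r ltW.
  - by rewrite g4 rmorphN1; lra.
  - by rewrite g4 rmorph1; lra.
  - by rewrite g3 subrr mulr0 add0r ltW.
  - case Lu: (low k u); last by rewrite add0r ltW.
    by have := g6 u Lu; rewrite rmorph_nat; lra.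
  - case Uk: (ub k) => [v|]; first by rewrite add0r ltW.
    by have := g7 Uk j; rewrite rmorphN rmorph_nat; lra.
have {}Hz i : \sum_j (Amat i j)%:~R * (z j)%:R <= q%:R * bvec i.
  by rewrite natz; under eq_bigr => j _ do rewrite intz natz; exact: Hz.
exists q, (fun v => z (inl v)), (fun k p => z (inr (k, p))); split=> //.
- by rewrite q0.
- by move=> v; have := Hz (inl v); rewrite AmatL /= mulrN lerN2 -!natrM ler_nat [(z _ * _)%N]mulnC.
move=> k Ak.
have rowH (r : RK) : match r with
  | inl (inl (inl (false, false))) => \sum_p (z (inr (k, p)))%:R <= q%:R :> int
  | inl (inl (inl (false, true))) => q%:R <= \sum_p (z (inr (k, p)))%:R :> int
  | inl (inl (inl (true, false))) => \sum_(p | p \notin U k) (z (inr (k, p)))%:R <= 0 :> int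
  | inl (inl (inl (true, true))) =>
      \sum_p (Rn (pl k) p)%:R * (z (inr (k, p)))%:R <= (if ub k is Some v then (z (inl v))%:R else q%:R * (Yb (pl k))%:R) :> int
  | inl (inl (inr (s, u))) => (-1) ^+ s * (\sum_(p | p.1 == u) (z (inr (k, p)))%:R - \sum_(p | p.2 == u) (z (inr (k, p)))%:R) <= 0 :> int
  | inl (inr u) => low k u -> (z (inl u))%:R <= \sum_p (Rn (ow u) p)%:R * (z (inr (k, p)))%:R + q%:R * E%:R :> int
  | inr j => ub k = None -> q%:R * (Xb j)%:R <= \sum_p (Rn j p)%:R * (z (inr (k, p)))%:R :> int
  end.
  have := Hz (inr (k, r)); rewrite AmatR // (rowE k r (fun v => (z (inl v))%:R) (fun p => (z (inr (k, p)))%:R)) /= Ak.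
  case: r => [[[[[] []]|[s u]]|u]|j] /=.
  - by case: (ub k) => [v|]; rewrite ?mulr0 ?subr0 // subr_le0.
  - by rewrite mulr0.
  - by rewrite mulrN1 lerN2.
  - by rewrite mulr1.
  - by rewrite mulr0.
  - by case: (low k u) => // + _; rewrite lerBlDl.
  - by case: (ub k) => // + _; rewrite mulrN lerN2.
have sumN (Q : pred (V * V)) (h : V * V -> nat) : (\sum_(p | Q p) (h p)%:R = (\sum_(p | Q p) h p)%N%:R :> int).
  by rewrite natr_sum.
have sumM (h h' : V * V -> nat) : (\sum_p (h p)%:R * (h' p)%:R = (\sum_p h p * h' p)%N%:R :> int).
  by rewrite natr_sum; apply: eq_bigr => p _; rewrite natrM.
split.
- move=> p zp; apply/negPn/negP => pU; have := rowH (inl (inl (inl (true, false)))).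
  rewrite sumN (ler_nat _ _ 0) leqn0 (bigD1 p) //= addn_eq0 => /andP[/eqP E0 _].
  by rewrite E0 in zp.
- move=> u; have := rowH (inl (inl (inr (false, u)))); have := rowH (inl (inl (inr (true, u)))).
  rewrite expr0 expr1 mulN1r mul1r opprB !subr_le0 !sumN !ler_nat => h1 h2.
  by apply/eqP; rewrite eqn_leq h1 h2.
- have := rowH (inl (inl (inl (false, false)))); have := rowH (inl (inl (inl (false, true)))).
  by rewrite !sumN !ler_nat => h1 h2; apply/eqP; rewrite eqn_leq h1 h2.
- have := rowH (inl (inl (inl (true, true)))); rewrite sumM.
  by case: (ub k) => [v|]; rewrite -?natrM ler_nat.
split=> [u Lu|Uk j].
  by have := rowH (inl (inr u)) Lu; rewrite sumM -natrM -natrD ler_nat.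
by have := rowH (inr j) Uk; rewrite sumM -natrM ler_nat.
Qed.

End JointSolution.

(** * Circulations extracted from plays *)

Lemma big_level (T : Type) (idx : T) (op : Monoid.com_law idx) (V M : finType) (S : M) (F : V -> V -> T) :
  \big[op/idx]_(a : V * M) \big[op/idx]_(b : V * M) (if (a.2 == S) && (b.2 == S) then F a.1 b.1 else idx) =
  \big[op/idx]_u \big[op/idx]_u' F u u'.
Proof.
transitivity (\big[op/idx]_u \big[op/idx]_m \big[op/idx]_(b : V * M)
    (if (m == S) && (b.2 == S) then F u b.1 else idx)).
  by rewrite pair_bigA; apply: eq_bigr => -[].
apply: eq_bigr => u _; rewrite (bigD1 S) //= [X in op _ X]big1 ?Monoid.mulm1; last first.
  by move=> m /negbTE ->; rewrite big1.
transitivity (\big[op/idx]_u' \big[op/idx]_m (if (S == S) && (m == S) then F u u' else idx)).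
  by rewrite pair_bigA; apply: eq_bigr => -[].
by apply: eq_bigr => u' _; rewrite (bigD1 S) //= eqxx big1 ?Monoid.mulm1 // => m /negbTE ->.
Qed.

Section PlayCirculations.
Variable G : game.
Local Notation V := 'I_(nv G).
Local Notation P := 'I_(np G).
Local Notation MS := 'I_(2 ^ nv G).
Local Notation X := (V * MS)%type.
Local Notation Y := (V * MS * V)%type.
Local Notation T := (option V).

(** All that matters about an opponent once the promise is final: the edges usable at that level
    inside the component of [x]. Such sets are only exponentially many. *)
Definition Ustp i (tau : Y -> T) (x : X) : {set V * V} :=
  [set p | [&& @stp G i tau (p.1, x.2) (p.2, x.2), connect (@stp G i tau) x (p.1, x.2) &
    connect (@stp G i tau) (p.2, x.2) x]].

Local Open Scope ring_scope.

Definition rcirc (U : {set V * V}) (g : V -> V -> RR) := [/\ forall u u', 0 <= g u u',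
  forall u u', (u, u') \notin U -> g u u' = 0, forall u, \sum_u' g u u' = \sum_u' g u' u &
  \sum_u \sum_u' g u u' = 1].

Definition ravg (g : V -> V -> RR) (j : P) := \sum_u \sum_u' g u u' * rw j u u'.

Lemma infoft_connect i tau (xs : nat -> X) k m : (forall k, @stp G i tau (xs k) (xs k.+1)) ->
  (k <= m)%N -> connect (@stp G i tau) (xs k) (xs m).
Proof.
move=> st km; rewrite -(subnKC km); elim: (m - k)%N => [|d IH]; first by rewrite addn0.
by rewrite addnS; apply: connect_trans IH (connect1 _).
Qed.

(** The circulation consists of the edge frequencies on a closed segment with nearly optimal
    averages. The segment stays at the level [S0], so frequencies of pairs of vertices suffice; [x]
    does not depend on the tolerance. *)
Lemma play_circ i tau (xs : nat -> X) (S0 : MS) N (j : P) (a : RR) (J : finType) (jj : J -> P) (l : J -> RR) :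
  (forall k, @stp G i tau (xs k) (xs k.+1)) -> (forall k, (N <= k)%N -> (xs k).2 = S0) ->
  infle (psum (wX j) xs) a -> (forall t, lowC (psum (wX (jj t)) xs) (l t)) ->
  exists x, [/\ x.2 = S0, infoft (fun k => xs k == x) & forall e, 0 < e -> exists g,
    [/\ rcirc (Ustp i tau x) g, ravg g j <= a + e & forall t, l t - e <= ravg g (jj t)]].
Proof.
move=> st stab Hup Hlow.
have [x Hx] := recurrent_average Hup.
have xi : infoft (fun k => xs k == x).
  by move=> m; have [n [nm En _]] := Hx 1 m ltr01; exists n => //; apply/eqP.
have xS : x.2 = S0 by have [n Nn /eqP En] := xi N; rewrite -En stab.
have Hlow' t : avg_low (wX (jj t)) xs (l t) by apply/lowC_ev.
exists x; split=> // e e0.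
have [s [Ns Es]] := extract_segment Hx Hlow' N e0.
move=> /(_ 0%N) [d [_ d0 Ed Hd1 Hd2]].
pose p := nseg xs s d.
have pp : path (@stp G i tau) x p by rewrite /p -Es; exact: nseg_path.
have pl : last x p = x by rewrite /p -{1}Es nseg_last.
have psz : size p = d by rewrite /p nseg_size.
have lev b : b \in x :: p -> b.2 = S0.
  rewrite in_cons => /orP[/eqP -> //|/mapP[m _ ->]]; apply: stab; lia.
have pS : path (fun a b : X => (a.2 == S0) && (b.2 == S0)) x p.
  have gen r y : (forall b, b \in y :: r -> b.2 = S0) ->
      path (fun a b : X => (a.2 == S0) && (b.2 == S0)) y r.
    elim: r y => [|z r IH] y lv //=.
    rewrite (lv y) ?mem_head // (lv z) ?in_cons ?eqxx ?orbT //= IH // => b Hb.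
    by apply: lv; rewrite in_cons Hb orbT.
  exact: gen.
have EcS c b : ecnt x p c b = (if (c.2 == S0) && (b.2 == S0) then ecnt x p (c.1, S0) (b.1, S0) else 0)%N.
  case: c b => [c m] [b m'] /=; case: (posnP (ecnt x p (c, m) (b, m'))) => [E0|].
    by rewrite E0; case: ifP => // /andP[/eqP E1 /eqP E2]; rewrite E1 E2 in E0.
  by move/(ecnt_gt0 pS) => /= /andP[/eqP -> /eqP ->]; rewrite eqxx.
have dR : 0 < d%:R :> RR by rewrite ltr0n.
pose g u u' : RR := (ecnt x p (u, S0) (u', S0))%:R / d%:R.
have wS (w : X -> X -> RR) : wsum w x p = d%:R * \sum_u \sum_u' g u u' * w (u, S0) (u', S0).
  transitivity (\sum_u \sum_u' (ecnt x p (u, S0) (u', S0))%:R * w (u, S0) (u', S0)).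
    rewrite ecnt_wsum -[RHS](big_level _ S0); apply: eq_bigr => -[c m] _; apply: eq_bigr => -[b m'] _.
    by rewrite EcS /=; case: ifP => [/andP[/eqP -> /eqP ->]|_] //; rewrite mul0r.
  rewrite mulr_sumr; apply: eq_bigr => u _; rewrite mulr_sumr; apply: eq_bigr => u' _.
  by rewrite /g mulrA mulrCA divff ?mulr1 // gt_eqF.
have bal : balanced (ecnt x p) by exact: ecnt_balanced.
exists g; split.
- split.
  + by move=> u u'; rewrite divr_ge0.
  + move=> u u'; rewrite inE xS /= => Hn; rewrite /g.
    case: (posnP (ecnt x p (u, S0) (u', S0))) => [->|pos]; first by rewrite mul0r.
    have [c1 c2] := ecnt_conn pp pos; have s1 := ecnt_gt0 pp pos.
    by move: Hn; rewrite s1 c1; rewrite pl in c2; rewrite c2.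
  + move=> u; rewrite -!mulr_suml -!natr_sum; congr (_%:R / _).
    have := bal (u, S0).
    have H1 (F : X -> nat) : (forall b, b.2 != S0 -> F b = 0)%N -> (\sum_b F b = \sum_u' F (u', S0))%N.
      move=> HF; transitivity (\sum_u' \sum_m F (u', m))%N.
        by rewrite pair_bigA; apply: eq_bigr => -[].
      by apply: eq_bigr => u' _; rewrite (bigD1 S0) //= big1 ?addn0 // => m mS; exact: HF.
    by rewrite !H1 // => b bS; rewrite EcS /= (negbTE bS) ?andbF.
  + have := wS (fun _ _ => 1); rewrite wsum_const mul1r psz => H.
    have {H} : d%:R * 1 = d%:R * \sum_u \sum_u' g u u' :> RR.
      by rewrite mulr1 {1}H; congr (_ * _); apply: eq_bigr => u _; apply: eq_bigr => u' _; rewrite mulr1.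
    by move/(mulfI (lt0r_neq0 dR)).
- have := wS (wX j); rewrite /p -{1}Es nseg_wsum => H; move: Hd1; rewrite H mulrC.
  by rewrite ler_pM2r.
move=> t; have := wS (wX (jj t)); rewrite /p -{1}Es nseg_wsum => H; have := Hd2 t; rewrite H.
by rewrite [d%:R * _]mulrC ler_pM2r.
Qed.

(** With infinitely many deviations only the upper bound on the deviator matters, so a short closed
    walk of small average suffices; its length also bounds the numbers involved. *)
Lemma play_dev i tau (xs : nat -> X) (j : P) (a : RR) :
  (forall k, @stp G i tau (xs k) (xs k.+1)) ->
  infle (psum (wX j) xs) a -> infoft (fun k => (xs k).2 == 0 :> nat)%N ->
  forall e, 0 < e -> exists y f, [/\ connect (@stp G i tau) (xs 0%N) y, circ i tau y f,
    (fsum f <= #|{: X}|)%N, devscc i tau y & rsum f (wX j) <= (a + e) * (fsum f)%:R].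
Proof.
move=> st Hup Hdev e e0.
have [x Hx] := recurrent_average Hup.
have xi : infoft (fun k => xs k == x).
  by move=> m; have [n [nm En _]] := Hx 1 m ltr01; exists n => //; apply/eqP.
have Hlow (t : void) : avg_low (wX j) xs ((fun=> 0) t) by case: t.
have [s [_ Es]] := extract_segment Hx Hlow 0%N e0.
move=> /(_ 0%N) [d [_ d0 Ed Hd1 _]].
pose p := nseg xs s d.
have pp : path (@stp G i tau) x p by rewrite /p -Es; exact: nseg_path.
have pl : last x p = x by rewrite /p -{1}Es nseg_last.
have psz : size p = d by rewrite /p nseg_size.
have [||y [q [qp ql /andP[q0 qX] qw qe]]] := short_closed_walk (w := fun c b => wX j c b - (a + e)) pp pl.
- by rewrite psz.
- by rewrite wsum_shift psz subr_le0 /p -{1}Es nseg_wsum.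
have [c1 c2] : connect (@stp G i tau) x y /\ connect (@stp G i tau) y x.
  case: q q0 qp {ql qw qX} qe => // b r _ /= /andP[s1 _] /(_ y b); rewrite !eqxx => /(_ isT) pos.
  have [h1 h2] := ecnt_conn pp pos; split=> //.
  by apply: connect_trans (connect1 s1) _; rewrite pl in h2.
have fs : fsum (ecnt y q) = size q by exact: ecnt_size.
exists y, (ecnt y q); split.
- apply: connect_trans c1; have [n _ /eqP <-] := xi 0%N; exact: infoft_connect.
- split; [exact: ecnt_balanced | by rewrite fs |].
  move=> b c pos; have [h1 h2] := ecnt_conn qp pos; split=> //; first exact: ecnt_gt0 pos.
  by rewrite ql in h2.
- by rewrite fs.
- have [n1 _ /eqP E1] := xi 0%N; have [[|n2] H2 D2] := Hdev n1.+1 => //; have [n3 H3 /eqP E3] := xi n2.+1.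
  exists (xs n2), (xs n2.+1); split=> //.
    by apply: connect_trans c2 _; rewrite -E1; exact: infoft_connect.
  by apply: connect_trans c1; rewrite -E3; exact: infoft_connect.
by move: qw; rewrite wsum_shift subr_le0 fs ecnt_wsum.
Qed.

(** Each tolerance leads to one of finitely many outcomes, a bounded circulation or a position. One
    of them recurs as the tolerance vanishes; for a fixed circulation the tolerance can then be
    dropped altogether. *)
Lemma dev_choice v tau (lam : V -> RR) (eps : RR) :
  (forall d, 0 < d -> exists xs : nat -> X,
  [/\ xs 0%N = (v, zM G), forall k, @stp G (own G v) tau (xs k) (xs k.+1),
   infle (psum (wX (own G v)) xs) (lam v + d)%R &
   infoft (fun k => (xs k).2 == 0%N :> nat) \/ exists S : MS, [/\ S != 0%N :> nat,
     exists N, forall k, (N <= k)%N -> (xs k).2 = S &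
     forall u : V, inS S u -> lowC (psum (wX (own G u)) xs) (lam u - eps)%R]]) ->
  (exists y f, [/\ connect (@stp G (own G v) tau) (v, zM G) y, circ (own G v) tau y f,
    (fsum f <= #|{: X}|)%N, devscc (own G v) tau y & rsum f (wX (own G v)) <= lam v * (fsum f)%:R]) \/
  (exists x, connect (@stp G (own G v) tau) (v, zM G) x /\ forall e, 0 < e -> exists g,
    [/\ rcirc (Ustp (own G v) tau x) g, ravg g (own G v) <= lam v + e &
     forall u : V, inS x.2 u -> lam u - eps - e <= ravg g (own G u)]).
Proof.
move=> H; set i := own G v in H *.
pose B := #|{: X}|.+1.
pose fF (f : {ffun X * X -> 'I_B}) a b : nat := f (a, b).
pose PA (y : X) (f : {ffun X * X -> 'I_B}) (d : RR) := [/\ connect (@stp G i tau) (v, zM G) y,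
  circ i tau y (fF f), (fsum (fF f) <= #|{: X}|)%N, devscc i tau y &
  rsum (fF f) (wX i) <= (lam v + d + d) * (fsum (fF f))%:R].
pose PB (x : X) (d : RR) := connect (@stp G i tau) (v, zM G) x /\ exists g,
  [/\ rcirc (Ustp i tau x) g, ravg g i <= lam v + d + d &
     forall u : V, inS x.2 u -> lam u - eps - d <= ravg g (own G u)].
have [|c Hc] := @fin_small RR (X * {ffun X * X -> 'I_B} + X)%type
  (fun c d => match c with inl yf => PA yf.1 yf.2 d | inr x => PB x d end).
  move=> e e0; have d0 : 0 < e / 2 by rewrite divr_gt0.
  have de : e / 2 < e by lra.
  have [xs [xs0 xss xu [Hdev|[S [S0 [N HN] Hlow]]]]] := H _ d0.
    have [y [f [f1 f2 f3 f4 f5]]] := play_dev xss xu Hdev d0.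
    have fB a b : (f a b < B)%N.
      rewrite ltnS; apply: leq_trans f3; rewrite /fsum (bigD1 a) //= (bigD1 b) //=.
      by rewrite -addnA leq_addr.
    have fE : fF [ffun ab : X * X => Ordinal (fB ab.1 ab.2)] = f.
      by apply/funext => a; apply/funext => b; rewrite /fF ffunE.
    exists (inl (y, [ffun ab : X * X => Ordinal (fB ab.1 ab.2)])), (e / 2); split=> //=.
    by rewrite /PA fE; split=> //; rewrite -xs0.
  have [|x [xS xi Hx]] := @play_circ i tau xs S N i _ {u : V | inS S u} (fun t => own G (val t))
    (fun t => lam (val t) - eps) xss HN xu.
    by move=> t; apply: Hlow; exact: valP t.
  exists (inr x), (e / 2); split=> //=; split.
    by rewrite -xs0; have [n _ /eqP <-] := xi 0%N; exact: infoft_connect.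
  have [g [g1 g2 g3]] := Hx _ d0; exists g; split=> // u; rewrite xS => Hu.
  exact: (g3 (Sub u Hu)).
case: c Hc => [[y f]|x] /= Hc; [left | right].
  have [_ [_ _ [h1 h2 h3 h4 _]]] := Hc 1 ltr01.
  exists y, (fF f); split=> //.
  rewrite -subr_ge0; apply: (@small_ge0 RR _ (2 * (fsum (fF f))%:R)) => e e0.
  have [d [d0 de [_ _ _ _ h5]]] := Hc e e0; exists d; split=> //; lra.
exists x; have [_ [_ _ [h1 _]]] := Hc 1 ltr01; split=> // e e0.
have e2 : 0 < e / 2 by rewrite divr_gt0.
have [d [d0 de [_ [g [g1 g2 g3]]]]] := Hc _ e2; exists g; split=> //; first by lra.
by move=> u Hu; have := g3 u Hu; lra.
Qed.

End PlayCirculations.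

(** * Equilibria and certificates *)

Lemma big_fst (T : Type) (idx : T) (op : Monoid.com_law idx) (V : finType) (u : V) (F : V -> V -> T) :
  \big[op/idx]_(p : V * V | p.1 == u) F p.1 p.2 = \big[op/idx]_u' F u u'.
Proof.
rewrite big_mkcond; transitivity (\big[op/idx]_a \big[op/idx]_b (if a == u then F a b else idx)).
  by rewrite pair_bigA; apply: eq_bigr => -[].
by rewrite (bigD1 u) //= eqxx [X in op _ X]big1 ?Monoid.mulm1 // => a /negbTE ->; rewrite big1.
Qed.

Lemma big_snd (T : Type) (idx : T) (op : Monoid.com_law idx) (V : finType) (u : V) (F : V -> V -> T) :
  \big[op/idx]_(p : V * V | p.2 == u) F p.1 p.2 = \big[op/idx]_u' F u' u.
Proof.
rewrite big_mkcond; transitivity (\big[op/idx]_a \big[op/idx]_b (if b == u then F a b else idx)).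
  by rewrite pair_bigA; apply: eq_bigr => -[].
by apply: eq_bigr => a _; rewrite (bigD1 u) //= eqxx big1 ?Monoid.mulm1 // => b /negbTE ->.
Qed.

(** Among finitely many lower bounds [a t / b t] on [L / q] the largest implies the others. This
    replaces one row per opponent by one row per vertex. *)
Lemma max_ratio (T : finType) (Q : pred T) (a b : T -> nat) : (forall t, Q t -> 0 < b t) ->
  exists a0 b0, ((a0 = 0 /\ b0 = 0 \/ exists2 t, Q t & a0 = a t /\ b0 = b t)) /\
    forall q L, q * a0 <= L * b0 -> forall t, Q t -> q * a t <= L * b t.
Proof.
move=> Hb; case: (pickP Q) => [t0 Qt0|none]; last first.
  by exists 0, 0; split; [left | move=> q L _ t; rewrite none].
pose r t : rat := ((a t)%:R / (b t)%:R)%R.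
case: (@Order.TotalTheory.arg_maxP _ _ _ t0 Q r Qt0) => t Qt Ht.
exists (a t), (b t); split; first by right; exists t.
move=> q L HqL t' Qt'; have := Ht _ Qt'; rewrite /Order.ge /= /r.
rewrite ler_pdivlMr ?ltr0n ?Hb // mulrAC ler_pdivrMr ?ltr0n ?Hb // -!natrM ler_nat => Hr.
rewrite -(leq_pmul2r (Hb _ Qt)); apply: leq_trans (_ : q * a t * b t' <= _); first by nia.
by rewrite [leqRHS]mulnAC leq_mul2r HqL orbT.
Qed.

Section CertComplete.
Variable G : game.
Local Notation V := 'I_(nv G).
Local Notation P := 'I_(np G).
Local Notation MS := 'I_(2 ^ nv G).
Local Notation X := (V * MS)%type.
Local Notation Y := (V * MS * V)%type.
Local Notation T := (option V).
Variables (v0 : V) (Rn : P -> V -> V -> nat) (E : nat) (Xb Yb : P -> nat) (Dl K M0 : nat).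
Hypothesis Dl0 : 0 < Dl.
Hypothesis scaleR : forall j u v, edge G u v -> rw j u v = ((Rn j u v)%:R / Dl%:R - K%:R)%R.
Hypothesis M00 : 0 < M0.
Hypothesis RnM : forall j u v, Rn j u v <= M0.
Hypothesis EM : E <= M0.
Hypothesis XM : forall j, Xb j <= M0.
Hypothesis YM : forall j, Yb j <= M0.

Local Notation KT := ((V * MS * {set V * V}) + P)%type.
Local Notation RT := (V + KT * (((bool * bool) + (bool * V)) + V + P))%type.
(** Cramer's bound for as many rows as [RT] has elements. The factor [#|{: X}|] in the size of the
    entries comes from the short closed walks, whose lengths and total rewards are coefficients. *)
Definition cbound := ((#|{: RT}|)`!) * (#|{: X}| * M0) ^ #|{: RT}|.

Definition lift_level (S : MS) (z : V * V -> nat) (a b : X) : nat :=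
  if (a.2 == S) && (b.2 == S) then z (a.1, b.1) else 0.

Lemma lift_fsum S z : fsum (lift_level S z) = \sum_p z p.
Proof.
rewrite /fsum (big_level _ S (fun u u' => z (u, u'))) pair_bigA.
by apply: eq_bigr => -[].
Qed.

Lemma lift_fR S z j : fR Rn j (lift_level S z) = \sum_p Rn j p.1 p.2 * z p.
Proof.
transitivity (\sum_u \sum_u' z (u, u') * Rn j u u').
  rewrite /fR -[RHS](big_level _ S); apply: eq_bigr => a _; apply: eq_bigr => b _.
  by rewrite /lift_level; case: ifP.
by rewrite pair_bigA; apply: eq_bigr => -[u u'] _; rewrite mulnC.
Qed.

Lemma lift_circ i tau x z : 0 < \sum_p z p ->
  (forall u, \sum_(p | p.1 == u) z p = \sum_(p | p.2 == u) z p) ->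
  (forall p, 0 < z p -> p \in Ustp i tau x) -> circ i tau x (lift_level x.2 z).
Proof.
move=> z0 bal HU; split; last first.
- move=> [a m] [b m']; rewrite /lift_level /=; case: ifP => // /andP[/eqP -> /eqP ->] /HU.
  by rewrite inE /= => /and3P[].
- by rewrite lift_fsum.
move=> [u m].
have HF (F : V -> nat) c : \sum_(b : X) (if c && (b.2 == x.2) then F b.1 else 0) = if c then \sum_u' F u' else 0.
  case: c => /=; last by rewrite big1.
  transitivity (\sum_u' \sum_m' (if m' == x.2 then F u' else 0)).
    by rewrite pair_bigA; apply: eq_bigr => -[].
  by apply: eq_bigr => u' _; rewrite (bigD1 x.2) //= eqxx big1 ?addn0 // => m' /negbTE ->.
rewrite /lift_level /= (HF (fun u' => z (u, u'))).
under [in RHS]eq_bigr do rewrite andbC.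
rewrite (HF (fun u' => z (u', u))); case: ifP => // _.
have := bal u.
under eq_bigr do rewrite [X in z X]surjective_pairing.
rewrite (big_fst _ u (fun a b => z (a, b))) => ->.
under eq_bigr do rewrite [X in z X]surjective_pairing.
by rewrite (big_snd _ u (fun a b => z (a, b))).
Qed.

Lemma circ_move i tau x y f : connect (@stp G i tau) x y -> connect (@stp G i tau) y x ->
  circ i tau y f -> circ i tau x f.
Proof.
move=> xy yx [h1 h2 h3]; split=> // a b /h3[s1 s2 s3]; split=> //.
  exact: connect_trans s2.
exact: connect_trans yx.
Qed.

Section Real.
Local Open Scope ring_scope.
Let DlR : 0 < Dl%:R :> RR. Proof. by rewrite ltr0n. Qed.

Lemma ravg_scale i tau x g j : rcirc (Ustp i tau x) g ->
  \sum_(p : V * V) (Rn j p.1 p.2)%:R * g p.1 p.2 = Dl%:R * (ravg g j + K%:R).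
Proof.
move=> [_ g2 _ g4].
transitivity (\sum_u \sum_u' (Rn j u u')%:R * g u u'); first by rewrite pair_bigA.
have -> : K%:R = (\sum_u \sum_u' g u u') * K%:R :> RR by rewrite g4 mul1r.
rewrite mulr_suml /ravg -big_split mulr_sumr; apply: eq_bigr => u _ /=.
rewrite mulr_suml -big_split mulr_sumr; apply: eq_bigr => u' _ /=.
case: (boolP ((u, u') \in Ustp i tau x)) => [|/g2 ->]; last by rewrite !mulr0 !mul0r addr0 mulr0.
rewrite inE => /and3P[/stp_edge /= He _ _]; rewrite scaleR //.
by field; rewrite gt_eqF.
Qed.

Variables (lam : V -> RR).
Let eps : RR := E%:R / Dl%:R.
(** The unknowns of the linear system are nonnegative. Scaled payoffs are nonnegative too, so
    raising a negative requirement to 0 preserves all lower bounds. *)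
Definition La v : RR := Num.max 0 (Dl%:R * (lam v + K%:R)).

Lemma La_ge v : Dl%:R * (lam v + K%:R) <= La v.
Proof. by rewrite /La le_max lexx orbT. Qed.

Lemma rcirc_joint i tau x g : rcirc (Ustp i tau x) g -> [/\ forall p : V * V, 0 <= g p.1 p.2,
  forall p, p \notin Ustp i tau x -> g p.1 p.2 = 0,
  forall u, \sum_(p : V * V | p.1 == u) g p.1 p.2 = \sum_(p : V * V | p.2 == u) g p.1 p.2 &
  \sum_(p : V * V) g p.1 p.2 = 1].
Proof.
move=> [g1 g2 g3 g4]; split=> //.
- by move=> [u u'] /= /g2.
- by move=> u; rewrite (big_fst _ u g) (big_snd _ u g).
- by rewrite -g4 pair_bigA.
Qed.

Lemma low_joint i tau x g e u : rcirc (Ustp i tau x) g ->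
  lam u - eps - e / Dl%:R <= ravg g (own G u) -> 0 < e ->
  La u - E%:R - e <= \sum_(p : V * V) (Rn (own G u) p.1 p.2)%:R * g p.1 p.2.
Proof.
move=> Hg Hl e0; have Hs := ravg_scale (own G u) Hg.
have S0 : 0 <= \sum_(p : V * V) (Rn (own G u) p.1 p.2)%:R * g p.1 p.2.
  by apply: sumr_ge0 => p _; apply: mulr_ge0 => //; case: Hg.
have E0 : 0 <= E%:R :> RR by [].
rewrite -addrA -opprD lerBlDr ge_max; apply/andP; split; first by rewrite !addr_ge0 // ltW.
rewrite Hs; have : Dl%:R * (lam u - eps - e / Dl%:R) <= Dl%:R * ravg g (own G u) by rewrite ler_pM2l.
have -> : Dl%:R * (lam u - eps - e / Dl%:R) = Dl%:R * lam u - E%:R - e.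
  by rewrite /eps; field; rewrite gt_eqF.
lra.
Qed.

Lemma cert_complete :
  (forall v, connect (edge G) v0 v -> forall tau d, 0 < d -> exists xs : nat -> X,
  [/\ xs 0%N = (v, zM G), forall k, @stp G (own G v) tau (xs k) (xs k.+1),
   infle (psum (wX (own G v)) xs) (lam v + d)%R &
   infoft (fun k => (xs k).2 == 0%N :> nat) \/ exists S : MS, [/\ S != 0%N :> nat,
     exists N, forall k, (N <= k)%N -> (xs k).2 = S &
     forall u : V, inS S u -> lowC (psum (wX (own G u)) xs) (lam u - eps)%R]]) ->
  (exists xs : nat -> X,
  [/\ xs 0%N = (v0, zM G), forall k, @stp G (np G) (tau0 (G := G)) (xs k) (xs k.+1),
    forall j, infle (psum (wX j) xs) ((Yb j)%:R / Dl%:R - K%:R),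
    forall j, lowC (psum (wX j) xs) ((Xb j)%:R / Dl%:R - K%:R) &
    exists S : MS, [/\ S != 0%N :> nat,
     exists N, forall k, (N <= k)%N -> (xs k).2 = S &
     forall u : V, inS S u -> lowC (psum (wX (own G u)) xs) (lam u - eps)%R]]) ->
  cert v0 Rn E Xb Yb cbound.
Proof.
move=> Hdev [xs [xs0 xss xup xlo [Sb [Sb0 [N HN] Hlow]]]].
have HB j : exists x, [/\ x.2 = Sb, infoft (fun k => xs k == x) & forall e, 0 < e -> exists g,
    [/\ rcirc (Ustp (np G) (tau0 (G := G)) x) g, ravg g j <= (Yb j)%:R / Dl%:R - K%:R + e,
    (forall u : V, inS Sb u -> lam u - eps - e <= ravg g (own G u)) &
     forall j', (Xb j')%:R / Dl%:R - K%:R - e <= ravg g j']].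
  have [|x [xS xi Hx]] := @play_circ G (np G) (tau0 (G := G)) xs Sb N j _ ({u : V | inS Sb u} + P)%type
    (fun t => match t with inl u => own G (val u) | inr j => j end)
    (fun t => match t with inl u => lam (val u) - eps | inr j => (Xb j)%:R / Dl%:R - K%:R end) xss HN (xup j).
    by case=> [u|j'] //; apply: Hlow; exact: valP u.
  exists x; split=> // e e0; have [g [g1 g2 g3]] := Hx e e0; exists g; split=> //.
    by move=> u Hu; exact: (g3 (inl (Sub u Hu))).
  by move=> j'; exact: (g3 (inr j')).
(* These positions may differ from player to player, but all of them recur in [xs] and hence lie in
   one component, where their circulations can be moved to a common base. *)
pose xb j := projT1 (cid (HB j)).
have xbP j : [/\ (xb j).2 = Sb, infoft (fun k => xs k == xb j) & forall e, 0 < e -> exists g,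
    [/\ rcirc (Ustp (np G) (tau0 (G := G)) (xb j)) g, ravg g j <= (Yb j)%:R / Dl%:R - K%:R + e,
    (forall u : V, inS Sb u -> lam u - eps - e <= ravg g (own G u)) &
     forall j', (Xb j')%:R / Dl%:R - K%:R - e <= ravg g j']].
  by rewrite /xb; case: cid.
pose PA v (tau : Y -> T) y f := [/\ connect (@stp G (own G v) tau) (v, zM G) y, circ (own G v) tau y f,
    (fsum f <= #|{: X}|)%N, devscc (own G v) tau y & rsum f (wX (own G v)) <= lam v * (fsum f)%:R].
pose PB v (tau : Y -> T) x := forall e, 0 < e -> exists g,
    [/\ rcirc (Ustp (own G v) tau x) g, ravg g (own G v) <= lam v + e &
     forall u : V, inS x.2 u -> lam u - eps - e <= ravg g (own G u)].
(* The opponents who can be answered in a component with deviations; one bounded circulation is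
   fixed for each of them. *)
pose QA v (t : {ffun Y -> T}) := `[< exists y f, PA v t y f >].
have HfA v t : exists f, QA v t -> exists y, PA v t y f.
  case: (pselect (QA v t)) => [/asboolP[y [f H]]|n]; last by exists (fun _ _ => 0%N).
  by exists f => _; exists y.
pose fA v t := projT1 (cid (HfA v t)).
have fAP v t : QA v t -> exists y, PA v t y (fA v t) by rewrite /fA; case: cid.
have Hm v : exists ab : nat * nat, ((ab.1 = 0 /\ ab.2 = 0 \/ exists2 t, QA v t &
      ab.1 = fR Rn (own G v) (fA v t) /\ ab.2 = fsum (fA v t)))%N /\
    forall q L, (q * ab.1 <= L * ab.2)%N -> forall t, QA v t ->
      (q * fR Rn (own G v) (fA v t) <= L * fsum (fA v t))%N.
  have [|a [b H]] := @max_ratio _ (QA v) (fun t => fR Rn (own G v) (fA v t)) (fun t => fsum (fA v t)).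
    by move=> t /fAP[y [_ [_ + _] _ _ _]].
  by exists (a, b).
pose wt v := (projT1 (cid (Hm v))).1; pose len v := (projT1 (cid (Hm v))).2.
have wlP v : (wt v = 0 /\ len v = 0 \/ exists2 t, QA v t &
      wt v = fR Rn (own G v) (fA v t) /\ len v = fsum (fA v t))%N by rewrite /wt /len; case: cid => ? [].
have wlA v q L : (q * wt v <= L * len v)%N -> forall t, QA v t ->
      (q * fR Rn (own G v) (fA v t) <= L * fsum (fA v t))%N.
  by rewrite /wt /len; case: cid => ? [_ H] /=; exact: H.
(* Opponents against whom a promise is kept enter only through the vertex, the promise and the set
   of usable edges, so many of them share one circulation. *)
pose act (k : KT) := match k with
  | inl (v, m, U) => `[< exists tau x, [/\ x.2 = m, U = Ustp (own G v) tau x & PB v tau x] >]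
  | inr j => true
  end.
pose pl (k : KT) : P := match k with inl (v, _, _) => own G v | inr j => j end.
pose ub (k : KT) : option V := match k with inl (v, _, _) => Some v | inr j => None end.
pose low (k : KT) : pred V := fun u => match k with inl (_, m, _) => inS m u | inr _ => inS Sb u end.
pose UU (k : KT) : {set V * V} := match k with inl (_, _, U) => U | inr j => Ustp (np G) (tau0 (G := G)) (xb j) end.
have X0 : (0 < #|{: X}|)%N by apply/card_gt0P; exists (v0, zM G).
have Mle n : (n <= M0)%N -> (n <= #|{: X}| * M0)%N by move=> H; apply: leq_trans H _; exact: leq_pmull.
have fRle j f : (fR Rn j f <= fsum f * M0)%N.
  rewrite /fR /fsum big_distrl; apply: leq_sum => a _; rewrite big_distrl; apply: leq_sum => b _.
  by rewrite leq_mul2l RnM orbT.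
have F1 : (#|{: X}| * M0 <= cbound)%N.
  rewrite /cbound; have RT0 : (0 < #|{: RT}|)%N by apply/card_gt0P; exists (inl v0).
  apply: leq_trans (leq_pmull _ (fact_gt0 _)).
  by rewrite -{1}(expn1 (_ * M0)%N); apply: leq_pexp2l => //; rewrite muln_gt0 X0.
have [||||||||||q [L [z [q0 LF zF HA HK]]]] := @joint_solution V P KT (own G) (fun j p => Rn j p.1 p.2) E Xb Yb
  len wt act pl ub low UU RR (#|{: X}| * M0)%N La.
- by rewrite muln_gt0 X0.
- by move=> j p; apply: Mle.
- exact: Mle.
- by move=> j; apply: Mle.
- by move=> j; apply: Mle.
- move=> v; case: (wlP v) => [[_ ->]|[t /fAP[y [_ _ H _ _]] [_ ->]]] //.
  by apply: leq_trans H _; exact: leq_pmulr.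
- move=> v; case: (wlP v) => [[-> _]|[t /fAP[y [_ _ H _ _]] [-> _]]] //.
  by apply: leq_trans (fRle _ _) _; rewrite leq_mul2r H orbT.
- by move=> v; rewrite /La le_max lexx.
- move=> v; case: (wlP v) => [[-> ->]|[t /fAP[y [_ Hc _ _ H]] [-> ->]]]; first by rewrite mulr0.
  rewrite (rsum_scale scaleR _ Hc) in H.
  apply: le_trans (_ : Dl%:R * (lam v + K%:R) * (fsum (fA v t))%:R <= _); last first.
    by rewrite ler_wpM2r // La_ge.
  have {}H : Dl%:R * ((fR Rn (own G v) (fA v t))%:R / Dl%:R) <= Dl%:R * ((lam v + K%:R) * (fsum (fA v t))%:R).
    by rewrite ler_pM2l //; lra.
  by rewrite mulrCA divff ?mulr1 ?gt_eqF // mulrA in H.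
- move=> k ak e e0; have e1 : 0 < e / Dl%:R by rewrite divr_gt0.
  have upc i tau x g j (b : RR) : rcirc (Ustp i tau x) g -> ravg g j <= b + e / Dl%:R ->
      \sum_(p : V * V) (Rn j p.1 p.2)%:R * g p.1 p.2 <= Dl%:R * (b + K%:R) + e.
    move=> Hg Hb; rewrite (ravg_scale j Hg).
    have : Dl%:R * ravg g j <= Dl%:R * (b + e / Dl%:R) by rewrite ler_pM2l.
    have -> : Dl%:R * (b + e / Dl%:R) = Dl%:R * b + e by field; rewrite gt_eqF.
    lra.
  case: k ak => [[[v S] U]|j] /=.
    move=> /asboolP[tau [x [xS -> Hx]]]; have [g [g1 g2 g3]] := Hx _ e1.
    have [j1 j2 j3 j4] := rcirc_joint g1; exists (fun p => g p.1 p.2); split=> //.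
      by apply: le_trans (upc _ _ _ _ _ _ g1 g2) _; rewrite lerD2r La_ge.
    split=> // u; rewrite -xS => Hu; exact: low_joint g1 (g3 u Hu) e0.
  have [xS _ Hx] := xbP j; move=> _; have [g [g1 g2 g3 g4]] := Hx _ e1.
  have [j1 j2 j3 j4] := rcirc_joint g1; exists (fun p => g p.1 p.2); split=> //.
    apply: le_trans (upc _ _ _ _ _ _ g1 g2) _; rewrite lerD2r subrK mulrCA divff ?mulr1 //.
    by rewrite gt_eqF.
  split; first by move=> u Hu; exact: low_joint g1 (g3 u Hu) e0.
  move=> _ j'; rewrite (ravg_scale j' g1).
  have : Dl%:R * ((Xb j')%:R / Dl%:R - K%:R - e / Dl%:R) <= Dl%:R * ravg g j' by rewrite ler_pM2l.
  have -> : Dl%:R * ((Xb j')%:R / Dl%:R - K%:R - e / Dl%:R) = (Xb j')%:R - Dl%:R * K%:R - e :> RR.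
    by field; rewrite gt_eqF.
  lra.
have q1 : (0 < q)%N by case/andP: q0.
have liftF k S a b : (lift_level S (z k) a b <= cbound)%N by rewrite /lift_level; case: ifP => // _; exact: zF.
exists q, L, (connect (edge G) v0); split=> //.
- by split=> [|u w Du Euw]; [exact: connect0 | exact: connect_trans Du (connect1 Euw)].
- move=> v Dv tau; pose t : {ffun Y -> T} := [ffun y => tau y].
  have Et : (t : Y -> T) = tau by apply/funext => y; rewrite ffunE.
  case: (dev_choice (Hdev v Dv tau)) => [[y [f H]]|[x [cx Hx]]].
    have Qt : QA v t by apply/asboolP; exists y, f; rewrite Et.
    have [y' []] := fAP v t Qt; rewrite Et => h1 h2 h3 h4 h5.
    exists y', (fA v t); split=> //; [|exact: wlA|by left].
    move=> a b; apply: leq_trans F1; apply: leq_trans (leq_pmulr _ M00); apply: leq_trans h3.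
    by rewrite /fsum (bigD1 a) //= (bigD1 b) //= -addnA leq_addr.
  have Ak : act (inl (v, x.2, Ustp (own G v) tau x)) by apply/asboolP; exists tau, x.
  have [k1 k2 k3 k4 [k5 _]] := HK _ Ak; set k := inl _ in Ak k1 k2 k3 k4 k5.
  exists x, (lift_level x.2 (z k)); split=> //.
  + by apply: lift_circ => //; rewrite k3.
  + by rewrite lift_fsum lift_fR k3 mulnC leq_mul2r k4 orbT.
  right=> u Hu; rewrite lift_fsum lift_fR k3.
  by have := k5 u Hu; rewrite -(leq_pmul2r q1) mulnDl [X in (_ <= X + _)%N -> _]mulnC.
have [_ xi0 _] := xbP (own G v0).
exists (xb (own G v0)); split.
  by have [n _ /eqP <-] := xi0 0%N; rewrite -xs0; exact: infoft_connect.
move=> j; have [k1 k2 k3 k4 [k5 k6]] := HK (inr j) isT.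
have [xS0 _ _] := xbP (own G v0).
have [xS xi _] := xbP j.
have conn x y : infoft (fun k => xs k == x) -> infoft (fun k => xs k == y) ->
    connect (@stp G (np G) (tau0 (G := G))) x y.
  move=> Hx Hy; have [n _ /eqP <-] := Hx 0%N; have [m nm /eqP <-] := Hy n.
  exact: infoft_connect.
exists (lift_level (xb j).2 (z (inr j))); split=> //.
- by apply: (circ_move (y := xb j)); [exact: conn | exact: conn | apply: lift_circ; rewrite ?k3].
- by rewrite lift_fsum lift_fR k3 mulnC.
- by move=> j'; rewrite lift_fsum lift_fR k3 mulnC; exact: k6.
move=> u; rewrite xS0 => Hu; rewrite lift_fsum lift_fR k3.
by have := k5 u Hu; rewrite -(leq_pmul2r q1) mulnDl [X in (_ <= X + _)%N -> _]mulnC.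
Qed.

End Real.

End CertComplete.

(** * Thresholds and certificates of a scaled instance *)

Section Threshold.
Variable I : instance.
Let G := igame I.
Let v0 : 'I_(nv G) := iv0 I.
Hypothesis HI : valid_instance I.
Variables (Rn : 'I_(np G) -> 'I_(nv G) -> 'I_(nv G) -> nat) (E : nat) (Xb Yb : 'I_(np G) -> nat) (Dl K M0 : nat).
Hypothesis Dl0 : 0 < Dl.
Hypothesis scaleR : forall j u v, edge G u v -> rw j u v = ((Rn j u v)%:R / Dl%:R - K%:R)%R.
Hypothesis epsE : ratr (ieps I) = (E%:R / Dl%:R)%R :> RR.
Hypothesis xE : forall j, ratr (ix I j) = ((Xb j)%:R / Dl%:R - K%:R)%R :> RR.
Hypothesis yE : forall j, ratr (iy I j) = ((Yb j)%:R / Dl%:R - K%:R)%R :> RR.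

Lemma threshold_cert : 0 < M0 -> (forall j u v, Rn j u v <= M0) -> E <= M0 ->
  (forall j, Xb j <= M0) -> (forall j, Yb j <= M0) ->
  threshold_yes I -> cert v0 Rn E Xb Yb (cbound G M0).
Proof.
move=> M00 RM EM XM YM [sg [Hs Hb]]; have [sV sD] := spe_complete HI.2 Hs.
set s := fun h => _ in sV sD.
apply: (@cert_complete G v0 Rn E Xb Yb Dl K M0 Dl0 scaleR M00 RM EM XM YM
  (lamv v0 (ratr (ieps I)) s)).
  by move=> v Dv tau d d0; rewrite -epsE; exact: arena_dev.
have [xs [x1 x2 x3 x4]] := arena_box (ratr (ieps I)) sV (tau0 (G := G)).
have pE j : psum (wX j) xs = pay j (outcome sg v0).
  rewrite pay_xs; congr pay; apply/funext => k; rewrite x3.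
  have <- : subprofile sg [:: v0] = sg by [].
  by rewrite (sub_outcome (v0 := v0)) //= eqxx.
exists xs; split=> //.
- by move=> j; rewrite pE -yE; apply/mp_le; have [] := Hb j.
- by move=> j; rewrite pE -xE; apply/mp_ge; have [] := Hb j.
by rewrite -epsE.
Qed.

Lemma cert_threshold F : cert v0 Rn E Xb Yb F -> threshold_yes I.
Proof.
move=> [q [L [D [/andP[q0 _] _ [D0 Dc] HD HB]]]].
have np0 : 0 < np G by exact: leq_ltn_trans (ltn_ord (own G v0)).
have [rho [r0 rE rC rX rY]] := cert_box_play Dl0 scaleR q0 np0 HB.
have HW v : D v -> exists sv, Pwin (lamq Dl K q L) (epsq E Dl) (own G v) (lamq Dl K q L v) (v, zM G) sv.
  by move=> Dv; apply: Pwin_exists => tau; exact: (cert_dev_win Dl0 scaleR q0 (HD v Dv tau)).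
have HW' v : exists sv, D v -> Pwin (lamq Dl K q L) (epsq E Dl) (own G v) (lamq Dl K q L v) (v, zM G) sv.
  case: (boolP (D v)) => [/HW[sv H]|_]; first by exists sv.
  by exists (fun=> (v, zM G, v)).
pose sA v := projT1 (cid (HW' v)).
have sAP v : D v -> Pwin (lamq Dl K q L) (epsq E Dl) (own G v) (lamq Dl K q L v) (v, zM G) (sA v).
  by rewrite /sA; case: cid.
have e0 : (0 <= epsq E Dl)%R by rewrite /epsq divr_ge0.
pose s := ss (lamq Dl K q L) sA rho.
have sV : valid_s v0 s by exact: (ss_valid D0 Dc sAP).
exists (fun=> s); split.
  apply: spe_sound => // h Hh i r Hc; rewrite epsE.
  exact: (no_profit D0 Dc sAP r0 rE rC e0 Hh Hc).
have oE : outcome (fun=> s) v0 = rho.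
  apply/funext => k; rewrite -(hout_init D0 Dc sAP r0 rE k).
  have E1 : subprofile (fun=> s : strategy G) [:: v0] = (fun=> s) by [].
  by rewrite -[in LHS]E1 (sub_outcome (v0 := v0)) //= eqxx.
move=> j; rewrite oE xE yE mpE !lee_fin; split; [exact: rX | exact: rY].
Qed.

End Threshold.

(** * Arithmetical form of the certificates *)

Definition nsum m (F : nat -> nat) := \sum_(a < m) F a.

Section Checker.
Variables (B n p v0 M2 : nat) (ow : nat -> nat) (ed : nat -> nat -> bool) (R : nat -> nat -> nat -> nat).
Variables (E : nat) (Xb Yb : nat -> nat).

(* The position [(u, S)] is coded by [S * n + u], the memoryless response [tau] by its digits in
   base [n.+1], where the digit [n] stands for [None]. *)
Definition nxN i t a s u := let d := dig n.+1 t ((s * n + a %% n) * n + u) in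
  if (d < n) && ((ow (a %% n) == i) && ed (a %% n) d) then d else s * n + u.

Definition stpN i t a c := exists s, s < M2 /\ exists u, u < n /\
  ((a %/ n = 0 \/ s = a %/ n) /\ (inS s (a %% n) /\ (inS s u /\ (ed (a %% n) u /\ c = nxN i t a s u)))).

(** Reachability is membership in every closed set containing [x]. Sets are numbers below [B], so no
    path has to be encoded. *)
Definition connN i t x y := forall Z, Z < B -> inS Z x ->
  (forall a, a < M2 * n -> inS Z a -> forall c, c < M2 * n -> stpN i t a c -> inS Z c) -> inS Z y.

Definition fdig b f a c := dig b f (a * (M2 * n) + c).
Definition fsumN b f := nsum (M2 * n) (fun a => nsum (M2 * n) (fun c => fdig b f a c)).
Definition fRN b f j := nsum (M2 * n) (fun a => nsum (M2 * n) (fun c => fdig b f a c * R j (a %% n) (c %% n))).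

Definition circN b i t x f :=
  (forall a, a < M2 * n -> nsum (M2 * n) (fun c => fdig b f a c) = nsum (M2 * n) (fun c => fdig b f c a)) /\
  (0 < fsumN b f /\ forall a, a < M2 * n -> forall c, c < M2 * n -> 0 < fdig b f a c ->
    stpN i t a c /\ (connN i t x a /\ connN i t c x)).

Definition lowN b q L S f := forall u, u < n -> inS S u ->
  dig b L u * fsumN b f <= q * fRN b f (ow u) + q * E * fsumN b f.

Definition devN i t x := exists a, a < M2 * n /\ exists c, c < M2 * n /\
  (stpN i t a c /\ (connN i t x a /\ (connN i t c x /\ c %/ n = 0))).

Definition cdevN b q L v t := exists x, x < M2 * n /\ exists f, f < B /\
  (connN (ow v) t v x /\ (circN b (ow v) t x f /\
   (q * fRN b f (ow v) <= dig b L v * fsumN b f /\ (devN (ow v) t x \/ lowN b q L (x %/ n) f)))).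

Definition cboxN b q L := exists x, x < M2 * n /\ (connN p 0 v0 x /\ forall j, j < p ->
  exists f, f < B /\ (circN b p 0 x f /\ (fRN b f j <= Yb j * fsumN b f /\
    ((forall j', j' < p -> Xb j' * fsumN b f <= fRN b f j') /\ lowN b q L (x %/ n) f)))).

(** The base [b] of the digit expansions is guessed as well: every positive base gives a sound
    certificate, and [F.+1] accommodates all numbers of a given one. *)
Definition chk := exists b, b < B /\ exists q, q < B /\ exists L, L < B /\ exists D, D < B /\
  (0 < b /\ (0 < q /\ (inS D v0 /\
  ((forall u, u < n -> inS D u -> forall w, w < n -> ed u w -> inS D w) /\
  ((forall v, v < n -> inS D v -> forall t, t < B -> cdevN b q L v t) /\ cboxN b q L))))).

End Checker.

(** * Agreement of the arithmetical and the graph-theoretic certificates *)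

Section CheckerCorrect.
Variable G : game.
Local Notation V := 'I_(nv G).
Local Notation P := 'I_(np G).
Local Notation MS := 'I_(2 ^ nv G).
Local Notation X := (V * MS)%type.
Local Notation Y := (V * MS * V)%type.
Local Notation T := (option V).
Local Notation n := (nv G).
Variables (v0 : V) (Rn : P -> V -> V -> nat) (E : nat) (Xb Yb : P -> nat).
Variables (B : nat) (ow : nat -> nat) (ed : nat -> nat -> bool) (RN : nat -> nat -> nat -> nat).
Variables (XN YN : nat -> nat).
Hypothesis owE : forall v : V, ow v = own G v.
Hypothesis edE : forall u v : V, ed u v = edge G u v.
Hypothesis RE : forall (j : P) (u v : V), RN j u v = Rn j u v.
Hypothesis XE : forall j : P, XN j = Xb j.
Hypothesis YE : forall j : P, YN j = Yb j.
Local Notation N := (2 ^ n * n).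
(** Every set of positions and every memoryless opponent must have a code below [B]. *)
Hypothesis B1 : 2 ^ N <= B.
Hypothesis B2 : n.+1 ^ (N * n) <= B.

Definition ncode (x : X) : nat := x.2 * n + x.1.

Let n0 : 0 < n. Proof. exact: leq_ltn_trans (ltn_ord v0). Qed.

Lemma ncode_lt x : ncode x < N.
Proof. by case: x => u S; rewrite /ncode /=; have := ltn_ord u; have := ltn_ord S; nia. Qed.

Lemma ncode_mod x : ncode x %% n = x.1.
Proof. by rewrite /ncode modnMDl modn_small. Qed.

Lemma ncode_div x : ncode x %/ n = x.2.
Proof. by rewrite /ncode divnMDl // divn_small // addn0. Qed.

Lemma ncode_inj : injective ncode.
Proof.
move=> x y Exy; have := ncode_mod x; have := ncode_div x; rewrite Exy ncode_mod ncode_div.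
by case: x y {Exy} => [u S] [u' S'] /= /val_inj -> /val_inj ->.
Qed.

Lemma ncode_ex a : a < N -> exists x, ncode x = a.
Proof.
move=> Ha; have H1 : a %% n < n by rewrite ltn_mod.
have H2 : a %/ n < 2 ^ n by rewrite ltn_divLR.
by exists (Ordinal H1, Ordinal H2); rewrite /ncode /= -divn_eq.
Qed.

Lemma sum_ncode (F : nat -> nat) : nsum N F = \sum_(x : X) F (ncode x).
Proof.
rewrite /nsum (reindex (fun x : X => Ordinal (ncode_lt x))) //.
apply: onW_bij; apply: inj_card_bij; last first.
  by rewrite card_ord card_prod !card_ord mulnC.
by move=> x y /(congr1 val) /= /ncode_inj.
Qed.

Definition tdec (t : nat) (y : Y) : T := insub (dig n.+1 t (ncode y.1 * n + y.2)).

Lemma tdec_ex (tau : Y -> T) : exists2 t, t < B & tdec t = tau.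
Proof.
pose g a := if [pick y : Y | ncode y.1 * n + y.2 == a] is Some y then
  (if tau y is Some w then val w else n) else 0.
have gE (y : Y) : g (ncode y.1 * n + y.2) = if tau y is Some w then val w else n.
  rewrite /g; case: pickP => [y' /eqP Ey|/(_ y)]; last by rewrite eqxx.
  suff -> : y' = y by [].
  have E1 : y'.2 = y.2 by apply/val_inj; have := congr1 (modn^~ n) Ey; rewrite !modnMDl !modn_small.
  have E2 : y'.1 = y.1 by apply: ncode_inj; move: Ey; rewrite E1 => /addIn /eqP; rewrite eqn_pmul2r // => /eqP.
  by rewrite (surjective_pairing y') E1 E2 -surjective_pairing.
have [|t tB Ht] := @dig_exists n.+1 (N * n) g isT.
  by move=> a _; rewrite /g; case: pickP => // y _; case: (tau y) => // w; apply: ltnW; rewrite ltnS; exact: ltn_ord.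
exists t; first exact: leq_trans tB B2.
apply/funext => y; rewrite /tdec Ht.
have -> : ncode y.1 * n + y.2 < N * n by have := ncode_lt y.1; have := ltn_ord y.2; nia.
rewrite gE; case: (tau y) => [w|]; first by rewrite valK.
by rewrite insubF // ltnn.
Qed.

Lemma nxNE i t (a : X) (S : MS) (u : V) :
  nxN n ow ed i t (ncode a) S u = ncode (nx i (a.1, S, u) (tdec t (a.1, S, u))).
Proof.
rewrite /nxN /nx ncode_mod /tdec /=; set d := dig _ _ _.
case: insubP => [w wn wd|/negbTE ->] //=.
by rewrite -wd ltn_ord /= owE edE; case: ifP.
Qed.

Lemma stpNE i t a c : stpN n (2 ^ n) ow ed i t (ncode a) (ncode c) <-> @stp G i (tdec t) a c.
Proof.
split.
  move=> [s [Hs [u [Hu [H1 [H2 [H3 [H4 H5]]]]]]]].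
  apply/existsP; exists (a.1, Ordinal Hs, Ordinal Hu); apply/andP; split; last first.
    by apply/eqP/ncode_inj; rewrite H5 -(nxNE i t a (Ordinal Hs) (Ordinal Hu)).
  rewrite ncode_div ncode_mod in H1 H2 H4.
  rewrite /Amv /= eqxx /= H2 H3 -edE H4 !andbT.
  by case: H1 => [->|E1] //; apply/orP; right; apply/eqP/val_inj.
move=> /existsP[[[u' S] u] /andP[/and5P[/= /eqP E1 H1 H2 H3 H4] /eqP ->]]; rewrite {}E1 in H2 *.
exists S; split; first exact: ltn_ord.
exists u; split; first exact: ltn_ord.
rewrite ncode_div ncode_mod nxNE edE; split; last by [].
by case/orP: H1 => [/eqP ->|/eqP <-]; [left | right].
Qed.

Lemma mask_ncode (Q : pred X) : exists2 Z, Z < B & forall x, inS Z (ncode x) = Q x.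
Proof.
have [S HS] := @mask_exists N (fun a => [exists x, (ncode x == a) && Q x]).
exists S; first exact: leq_trans (ltn_ord S) B1.
move=> x; rewrite (HS (Ordinal (ncode_lt x))); apply/existsP/idP => [[y /andP[/eqP /ncode_inj -> //]]|Qx].
by exists x; rewrite eqxx.
Qed.

Lemma connNE i t x y : connN B n (2 ^ n) ow ed i t (ncode x) (ncode y) <-> connect (@stp G i (tdec t)) x y.
Proof.
split.
  move=> H; have [Z ZB HZ] := mask_ncode (connect (@stp G i (tdec t)) x).
  rewrite -HZ; apply: H => //; first by rewrite HZ connect0.
  move=> a /ncode_ex[a' <-]; rewrite HZ => Ha c /ncode_ex[c' <-] /stpNE Hs.
  by rewrite HZ; apply: connect_trans Ha (connect1 Hs).
move=> /connectP[q qp ->] Z _ Zx HZ; elim: q x qp Zx => [|z q IH] x //= /andP[s1 s2] Zx.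
apply: IH => //; apply: (HZ (ncode x)) => //; [exact: ncode_lt | exact: ncode_lt | exact/stpNE].
Qed.

Section Digits.
Variables (b f : nat) (F : X -> X -> nat).
Hypothesis fE : forall a c, fdig n (2 ^ n) b f (ncode a) (ncode c) = F a c.

Lemma fsumNE : fsumN n (2 ^ n) b f = fsum F.
Proof.
rewrite /fsumN sum_ncode.
by apply: eq_bigr => a _; rewrite sum_ncode; apply: eq_bigr => c _; rewrite fE.
Qed.

Lemma fRNE (j : P) : fRN n (2 ^ n) RN b f j = fR Rn j F.
Proof.
rewrite /fRN sum_ncode; apply: eq_bigr => a _; rewrite sum_ncode.
by apply: eq_bigr => c _; rewrite fE !ncode_mod RE.
Qed.

Lemma frowE a : nsum N (fun c => fdig n (2 ^ n) b f (ncode a) c) = \sum_c F a c.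
Proof. by rewrite sum_ncode; apply: eq_bigr => c _; rewrite fE. Qed.

Lemma fcolE a : nsum N (fun c => fdig n (2 ^ n) b f c (ncode a)) = \sum_c F c a.
Proof.
rewrite sum_ncode.
by apply: eq_bigr => c _; rewrite fE.
Qed.

Lemma circNE i t x : circN B n (2 ^ n) ow ed b i t (ncode x) f <-> circ i (tdec t) x F.
Proof.
split.
  move=> [H1 [H2 H3]]; split.
  - by move=> a; have := H1 _ (ncode_lt a); rewrite frowE fcolE.
  - by rewrite -fsumNE.
  move=> a c pos; have [|/stpNE h1 [/connNE h2 /connNE h3]] := H3 _ (ncode_lt a) _ (ncode_lt c) => //.
  by rewrite fE.
move=> [H1 H2 H3]; split.
  by move=> a /ncode_ex[a' <-]; rewrite frowE fcolE.
split; first by rewrite fsumNE.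
move=> a /ncode_ex[a' <-] c /ncode_ex[c' <-]; rewrite fE => /H3[h1 h2 h3].
by split; [exact/stpNE | split; exact/connNE].
Qed.

Lemma lowNE q L (La : V -> nat) (S : MS) : (forall u : V, dig b L u = La u) ->
  lowN n (2 ^ n) ow RN E b q L S f <-> lowq Rn E q La S F.
Proof.
move=> LE; split=> [H u Hu|H u un Hu].
  by have := H u (ltn_ord u) Hu; rewrite LE fsumNE owE fRNE.
by have := H (Ordinal un) Hu; rewrite -LE -fsumNE -fRNE -owE.
Qed.

End Digits.

Lemma devNE i t x : devN B n (2 ^ n) ow ed i t (ncode x) <-> devscc i (tdec t) x.
Proof.
split.
  move=> [a [/ncode_ex[a' <-] [c [/ncode_ex[c' <-] [/stpNE h1 [/connNE h2 [/connNE h3 h4]]]]]]].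
  by exists a', c'; split=> //; rewrite -ncode_div h4.
move=> [a [c [h1 h2 h3 /eqP h4]]]; exists (ncode a); split; first exact: ncode_lt.
exists (ncode c); split; first exact: ncode_lt.
by split; [exact/stpNE | split; [exact/connNE | split; [exact/connNE | rewrite ncode_div]]].
Qed.

(** With [np G] as deviator all opponents yield the same graph, which allows the opponent of code 0
    in [cboxN]. *)
Lemma stp_np tau tau' : @stp G (np G) tau = @stp G (np G) tau'.
Proof.
have E1 t (y : Y) : nx (np G) y t = (y.2, y.1.2).
  case: (nx_cases (np G) y t) => [//|[w [_ Eo _]]].
  by have := ltn_ord (own G y.1.1); rewrite Eo ltnn.
by apply/funext => a; apply/funext => c; rewrite /stp; under eq_existsb do rewrite E1;
  under [in RHS]eq_existsb do rewrite E1.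
Qed.

Lemma circ_np tau tau' x F : @circ G (np G) tau x F -> @circ G (np G) tau' x F.
Proof. by rewrite /circ (stp_np tau tau'). Qed.

Lemma chk_cert : chk B n (np G) v0 (2 ^ n) ow ed RN E XN YN -> cert v0 Rn E Xb Yb B.
Proof.
move=> [b [bB [q [qB [L [LB [D [DB [b0 [q0 [D0 [Dc [Hd Hx]]]]]]]]]]]]].
have LE (u : V) : dig b L u = (fun u : V => dig b L u) u by [].
have dB c i : dig b c i <= B by apply: ltnW; apply: ltn_trans (dig_lt _ _ b0) bB.
exists q, (fun u => dig b L u), (fun u : V => inS D u); split=> //.
- by rewrite q0 ltnW.
- split=> // u w Du Ew; apply: (Dc u (ltn_ord u) Du w (ltn_ord w)); by rewrite edE.
- move=> v Dv tau; have [t tB <-] := tdec_ex tau.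
  have [x [/ncode_ex[x' <-] [f [fB [H1 [H2 [H3 H4]]]]]]] := Hd v (ltn_ord v) Dv t tB.
  have fE a c : fdig n (2 ^ n) b f (ncode a) (ncode c) = (fun a c => fdig n (2 ^ n) b f (ncode a) (ncode c)) a c by [].
  have Ev : val v = ncode (v, zM G) by rewrite /ncode.
  rewrite owE in H1 H2 H3 H4; exists x', (fun a c => fdig n (2 ^ n) b f (ncode a) (ncode c)); split=> //.
  + by apply/connNE; rewrite -Ev.
  + exact/(circNE fE).
  + by move=> a c; exact: dB.
  + by rewrite -(fRNE fE) -(fsumNE fE).
  by case: H4 => [/devNE|H4]; [left | right; apply/(lowNE fE _ _ LE); rewrite -ncode_div].
move: Hx => [x [/ncode_ex[x' <-] [H1 H2]]]; exists x'; split.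
  by rewrite (stp_np _ (tdec 0)); apply/connNE; have -> : ncode (v0, zM G) = v0 by rewrite /ncode.
move=> j; have [f [fB [h1 [h2 [h3 h4]]]]] := H2 j (ltn_ord j).
have fE a c : fdig n (2 ^ n) b f (ncode a) (ncode c) = (fun a c => fdig n (2 ^ n) b f (ncode a) (ncode c)) a c by [].
exists (fun a c => fdig n (2 ^ n) b f (ncode a) (ncode c)); split=> //.
- by apply: (@circ_np (tdec 0)); exact/(circNE fE).
- by move=> a c; exact: dB.
- by rewrite -(fRNE fE) -(fsumNE fE) -YE.
- by move=> j'; rewrite -(fRNE fE) -(fsumNE fE) -XE; exact: h3.
by apply/(lowNE fE _ _ LE); rewrite -ncode_div.
Qed.

Lemma cert_chk F : F.+1 < B -> F.+1 ^ (N * N) <= B -> F.+1 ^ n <= B ->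
  cert v0 Rn E Xb Yb F -> chk B n (np G) v0 (2 ^ n) ow ed RN E XN YN.
Proof.
move=> FB FN Fn [q [L [D [/andP[q0 qF] LF [D0 Dc] Hd Hx]]]].
have [|Lc LcB HL] := @dig_exists F.+1 n (fun u => if insub u is Some v then L v else 0) isT.
  by move=> u _; case: insubP => // v _ _; exact: LF.
have LE (u : V) : dig F.+1 Lc u = L u by rewrite HL ltn_ord valK.
have [Dm HD] := @mask_exists n D.
have codef (f : X -> X -> nat) : (forall a c, f a c <= F) -> exists2 c, c < B &
    forall a a', fdig n (2 ^ n) F.+1 c (ncode a) (ncode a') = f a a'.
  move=> fF; pose g k := if [pick ac : X * X | ncode ac.1 * N + ncode ac.2 == k] is Some ac then f ac.1 ac.2 else 0.
  have [|c cB Hc] := @dig_exists F.+1 (N * N) g isT.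
    by move=> k _; rewrite /g; case: pickP => // ac _; exact: fF.
  exists c; first exact: leq_trans cB FN.
  move=> a a'; rewrite /fdig Hc.
  have -> : ncode a * N + ncode a' < N * N by have := ncode_lt a; have := ncode_lt a'; nia.
  rewrite /g; case: pickP => [[d d'] /= /eqP Ed|/(_ (a, a'))]; last by rewrite /= eqxx.
  have E1 : d' = a'.
    by apply: ncode_inj; have := congr1 (modn^~ N) Ed; rewrite !modnMDl !modn_small ?ncode_lt.
  have E2 : d = a.
    by apply: ncode_inj; move: Ed; rewrite E1 => /addIn /eqP; rewrite eqn_pmul2r ?muln_gt0 ?expn_gt0 // => /eqP.
  by rewrite E1 E2.
exists F.+1; split=> //; exists q; split; first exact: leq_ltn_trans qF (ltnW FB).
exists Lc; split; first exact: leq_trans LcB Fn.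
exists Dm; split.
  apply: leq_trans (ltn_ord Dm) _; apply: leq_trans B1; rewrite leq_exp2l //.
  by apply: leq_pmull; rewrite expn_gt0.
split=> //; split=> //; split; first by rewrite HD.
split.
  move=> u un; rewrite (HD (Ordinal un)) => Du w wn; rewrite (edE (Ordinal un) (Ordinal wn)) => Ew.
  by rewrite (HD (Ordinal wn)); exact: Dc Du Ew.
split.
  move=> v vn; rewrite (HD (Ordinal vn)) => Dv t tB.
  have [x [f [H1 H2 H3 H4 H5]]] := Hd _ Dv (tdec t).
  have [c cB fE] := codef f H3.
  exists (ncode x); split; first exact: ncode_lt.
  exists c; split=> //; rewrite (owE (Ordinal vn)).
  have Ev : v = ncode (Ordinal vn, zM G) by rewrite /ncode.
  split; first by rewrite {2}Ev; exact/connNE.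
  split; first exact/(circNE fE).
  split; first by rewrite (fRNE fE) (fsumNE fE) (LE (Ordinal vn)).
  by case: H5 => [/devNE|H5]; [left | right; rewrite ncode_div; apply/(lowNE fE _ _ LE)].
move: Hx => [x [H1 H2]]; exists (ncode x); split; first exact: ncode_lt.
split.
  have -> : val v0 = ncode (v0, zM G) by rewrite /ncode.
  by apply/connNE; rewrite (stp_np _ (tau0 (G := G))).
move=> j jp; have [f [h1 h2 h3 h4 h5]] := H2 (Ordinal jp).
have [c cB fE] := codef f h2; exists c; split=> //.
split; first by apply/(circNE fE); exact: circ_np h1.
split; first by rewrite (fRNE fE (Ordinal jp)) (fsumNE fE) (YE (Ordinal jp)).
split; last by rewrite ncode_div; apply/(lowNE fE _ _ LE).
by move=> j' jp'; rewrite (fRNE fE (Ordinal jp')) (fsumNE fE) (XE (Ordinal jp')).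
Qed.

End CheckerCorrect.

(** * Reading an encoded instance *)

(* A word is given by its length [l] and its value [W] in base two; [npairs], [valN] and [nxt] read
   the number encoded at position [s], whose powers of two are truncated at [B]. *)
Definition bt l W i := dig 2 W (l.-1 - i) == 1.
Definition npairs l W s := rc l 0 (fun _ a => if bt l W (s + 2 * a) then a.+1 else a).
Definition nxt l W s := s + 2 * npairs l W s + 2.
Definition valN B l W s := nsum (npairs l W s) (fun k => bt l W (s + 2 * k + 1) * minn (2 ^ k) B).
Definition skN l W s k := rc k s (fun _ a => nxt l W a).
Definition skQ1 l W s := nxt l W (nxt l W s.+1).+1.
Definition skQ l W s k := rc k s (fun _ a => skQ1 l W a).

Definition dp B l W := valN B l W 0.
Definition dn B l W := valN B l W (nxt l W 0).
Definition dv0 B l W := valN B l W (nxt l W (nxt l W 0)).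
(* Starting positions of the segments of [enc]: [s3] for epsilon, [s4] for the owners, [s5] for the
   edges, [s6] for the rewards and [s7] for the thresholds. *)
Definition s3 l W := nxt l W (nxt l W (nxt l W 0)).
Definition s4 l W := skQ1 l W (s3 l W).
Definition dow B l W v := valN B l W (skN l W (s4 l W) v).
Definition s5 B l W := skN l W (s4 l W) (dn B l W).
Definition ded B l W u v := bt l W (s5 B l W + (u * dn B l W + v)).
Definition s6 B l W := s5 B l W + dn B l W * dn B l W.
(** Rewards are written for edges only, so the position of a reward depends on the number of edges
    that precede it. *)
Definition ecount B l W m := nsum m (fun i => bt l W (s5 B l W + i)).
Definition rpos B l W j u v := skQ l W (s6 B l W) (ecount B l W (u * dn B l W + v) * dp B l W + j).
Definition s7 B l W := skQ l W (s6 B l W) (ecount B l W (dn B l W * dn B l W) * dp B l W).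
Definition qnum B l W s := valN B l W s.+1.
Definition qden B l W s := valN B l W (nxt l W s.+1).+1.
Definition qabs B l W Dl s := Dl %/ qden B l W s * qnum B l W s.
(** With [K = 2 ^ l] the shift exceeds the absolute value of every encoded rational, so the
    truncated subtraction is exact and all scaled values are naturals. *)
Definition qscale B l W Dl K s :=
  if bt l W s then Dl * K - qabs B l W Dl s else Dl * K + qabs B l W Dl s.
Definition dR B l W Dl K j u v := if ded B l W u v then qscale B l W Dl K (rpos B l W j u v) else 0.
Definition dX B l W Dl K j := qscale B l W Dl K (skQ l W (s7 B l W) (2 * j)).
Definition dY B l W Dl K j := qscale B l W Dl K (skQ l W (s7 B l W) (2 * j).+1).

(* [Dl] is a common multiple of all denominators, which are below [2 ^ l]. *)
Definition answer l W B := exists Dl, Dl < B /\ (0 < Dl /\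
  ((forall i, i < minn (2 ^ l) B -> Dl %% i.+1 = 0) /\
   chk B (dn B l W) (dp B l W) (dv0 B l W) (minn (2 ^ dn B l W) B) (dow B l W) (ded B l W)
     (dR B l W Dl (minn (2 ^ l) B)) (qabs B l W Dl (s3 l W))
     (dX B l W Dl (minn (2 ^ l) B)) (dY B l W Dl (minn (2 ^ l) B)))).

(** * Computability of the reader and of the certificate check *)

Lemma comp_andb k (P Q : Env k -> bool) : comp (fun e => P e : nat) -> comp (fun e => Q e : nat) ->
  comp (fun e => P e && Q e : nat).
Proof. by move=> HP HQ; apply: (comp_eq _ (comp_mul HP HQ)) => e; rewrite mulnb. Qed.

Lemma comp_nsum k (c : Env k -> nat) (h : Env k -> nat -> nat) : comp c ->
  comp (fun e : Env k.+1 => h e.1 e.2) -> comp (fun e => nsum (c e) (fun x => h e x)).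
Proof. by move=> Hc Hh; exact: (@comp_sum k c (fun e => h e.1 e.2)). Qed.

Ltac chyp := match goal with
  | H : comp _ |- _ => first [exact H | exact (comp_fst H) | exact (comp_fst (comp_fst H))]
  end.
Ltac cvar := first [cget 0 | cget 1 | cget 2 | cget 3 | cget 4 | cget 5 | cget 6 | cget 7 | cget 8
  | cget 9 | cget 10 | cget 11 | cget 12 | cget 13 | cget 14 | cget 15 | cget 16 | cget 17 | cget 18].
Ltac cuser := fail.
Ltac cstep := lazymatch goal with
  | |- cdec (fun e => @?P e /\ @?Q e) => apply (@cdec_and _ P Q)
  | |- cdec (fun e => @?P e \/ @?Q e) => apply (@cdec_or _ P Q)
  | |- cdec (fun e => exists x, is_true (leq (S x) (@?c e)) /\ @?P e x) => apply (@cdec_ex _ c P)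
  | |- cdec (fun e => forall x : nat, is_true (leq (S x) (@?c e)) -> @?P e x) => apply (@cdec_all _ c P)
  | |- cdec (fun e => @?P e -> @?Q e) => apply (@cdec_imp _ P Q)
  | |- cdec (fun e => is_true (@?b e)) => apply (@cdec_bool _ b)
  | |- cdec (fun e => @?f e = @?g e) => apply (@cdec_nateq _ f g)
  | |- comp (fun e => nat_of_bool (@?P e && @?Q e)) => apply (@comp_andb _ P Q)
  | |- comp (fun e => nat_of_bool (@?f e <= @?g e)) => apply (@comp_leq _ f g)
  | |- comp (fun e => nat_of_bool (@?f e == @?g e)) => apply (@comp_eqn _ f g)
  | |- comp (fun e => minn (2 ^ @?f e) (@?B e)) =>
      apply (@comp_tpow _ B (fun=> 2) f); [| exact: comp_const |]
  | |- comp (fun e => (@?f e).+1) => apply (@comp_succ _ f)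
  | |- comp (fun e => (@?f e).-1) => apply (@comp_pred _ f)
  | |- comp (fun e => @?f e + @?g e) => apply (@comp_add _ f g)
  | |- comp (fun e => @?f e * @?g e) => apply (@comp_mul _ f g)
  | |- comp (fun e => @?f e - @?g e) => apply (@comp_sub _ f g)
  | |- comp (fun e => @?f e %/ @?g e) => apply (@comp_div _ f g)
  | |- comp (fun e => @?f e %% @?g e) => apply (@comp_mod _ f g)
  | |- comp (fun e => dig (@?b e) (@?c e) (@?i e)) => apply (@comp_dig _ b c i)
  | |- comp (fun e => nsum (@?c e) (fun x => @?h e x)) => apply (@comp_nsum _ c h)
  | |- comp (fun e => snd _) => cvar
  | |- comp snd => cget 0
  | |- comp (fun _ => ?c) => exact (@comp_const _ c)
  | |- _ => first [chyp | cuser | simple apply comp_if]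
  end; cbv beta.
Ltac cauto := repeat cstep.

Section ParserComp.
Variable k : nat.
Variables (B l W s : Env k -> nat).
Hypothesis (HB : comp B) (Hl : comp l) (HW : comp W) (Hs : comp s).

Lemma comp_bt : comp (fun e => bt (l e) (W e) (s e) : nat).
Proof. by rewrite /bt; cauto. Qed.

End ParserComp.

Ltac cread1 := lazymatch goal with
  | |- comp (fun e => nat_of_bool (bt (@?l e) (@?W e) (@?s e))) => apply (@comp_bt _ l W s)
  end.
Ltac cuser ::= cread1.

Lemma npairs_le l W s j : rc j 0 (fun _ a => if bt l W (s + 2 * a) then a.+1 else a) <= j.
Proof. by elim: j => //= j IH; case: ifP => _; lia. Qed.

Section ParserComp2.
Variable k : nat.
Variables (B l W s m : Env k -> nat).
Hypothesis (HB : comp B) (Hl : comp l) (HW : comp W) (Hs : comp s) (Hm : comp m).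

Lemma comp_npairs : comp (fun e => npairs (l e) (W e) (s e)).
Proof.
apply: (@comp_rec k l (fun=> 0) l (fun e => if bt (l e.1.1) (W e.1.1) (s e.1.1 + 2 * e.2) then e.2.+1 else e.2)).
- exact: Hl.
- exact: comp_const.
- by cauto.
- exact: comp_pb.
- by move=> e j Hj; exact: leq_trans (npairs_le (l e) (W e) (s e) j) Hj.
Qed.

Lemma comp_nxt : comp (fun e => nxt (l e) (W e) (s e)).
Proof. by rewrite /nxt; have := comp_npairs => Hc; cauto. Qed.

Lemma comp_valN : comp (fun e => valN (B e) (l e) (W e) (s e)).
Proof. by rewrite /valN; have := comp_npairs => Hc; cauto. Qed.

End ParserComp2.

Ltac cread2 := lazymatch goal with
  | |- comp (fun e => nxt (@?l e) (@?W e) (@?s e)) => apply (@comp_nxt _ l W s)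
  | |- comp (fun e => valN (@?B e) (@?l e) (@?W e) (@?s e)) => apply (@comp_valN _ B l W s)
  end.
Ltac cuser ::= first [cread1 | cread2].

(** Limited recursion requires bounds of this kind on all arguments, including words that encode no
    instance. *)
Lemma nxt_le l W s : nxt l W s <= s + 2 * l + 2.
Proof. by rewrite /nxt !leq_add2r leq_add2l leq_mul2l; exact: npairs_le. Qed.

Lemma skN_le l W s j : skN l W s j <= s + j * (2 * l + 2).
Proof.
elim: j => [|j IH]; first by rewrite addn0.
have -> : skN l W s j.+1 = nxt l W (skN l W s j) by [].
by apply: leq_trans (nxt_le _ _ _) _; lia.
Qed.

Lemma skQ_le l W s j : skQ l W s j <= s + j * (4 * l + 6).
Proof.
elim: j => [|j IH]; first by rewrite addn0.
have -> : skQ l W s j.+1 = nxt l W (nxt l W (skQ l W s j).+1).+1 by [].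
have := nxt_le l W (nxt l W (skQ l W s j).+1).+1; have := nxt_le l W (skQ l W s j).+1; lia.
Qed.

Section ParserComp3.
Variable k : nat.
Variables (B l W s m : Env k -> nat).
Hypothesis (HB : comp B) (Hl : comp l) (HW : comp W) (Hs : comp s) (Hm : comp m).

Lemma comp_skN : comp (fun e => skN (l e) (W e) (s e) (m e)).
Proof.
apply: (@comp_rec k m s (fun e => s e + m e * (2 * l e + 2)) (fun e => nxt (l e.1.1) (W e.1.1) e.2)).
- exact: Hm.
- exact: Hs.
- by cauto.
- by apply: comp_pb; cauto.
move=> e j Hj; apply: leq_trans (_ : s e + j * (2 * l e + 2) <= _); last by rewrite leq_add2l leq_mul2r Hj orbT.
exact: (skN_le (l e) (W e)).
Qed.

Lemma comp_skQ : comp (fun e => skQ (l e) (W e) (s e) (m e)).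
Proof.
apply: (@comp_rec k m s (fun e => s e + m e * (4 * l e + 6)) (fun e => skQ1 (l e.1.1) (W e.1.1) e.2)).
- exact: Hm.
- exact: Hs.
- by rewrite /skQ1; cauto.
- by apply: comp_pb; cauto.
move=> e j Hj; apply: leq_trans (_ : s e + j * (4 * l e + 6) <= _); last by rewrite leq_add2l leq_mul2r Hj orbT.
exact: (skQ_le (l e) (W e)).
Qed.

End ParserComp3.

Ltac cread3 := lazymatch goal with
  | |- comp (fun e => skN (@?l e) (@?W e) (@?s e) (@?m e)) => apply (@comp_skN _ l W s m)
  | |- comp (fun e => skQ (@?l e) (@?W e) (@?s e) (@?m e)) => apply (@comp_skQ _ l W s m)
  end.
Ltac cuser ::= first [cread1 | cread2 | cread3].

Section ParserComp4.
Variable k : nat.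
Variables (B l W s Dl K j u v : Env k -> nat).
Hypothesis (HB : comp B) (Hl : comp l) (HW : comp W) (Hs : comp s) (HDl : comp Dl) (HK : comp K)
  (Hj : comp j) (Hu : comp u) (Hv : comp v).

Lemma comp_dp : comp (fun e => dp (B e) (l e) (W e)).
Proof. by rewrite /dp; cauto. Qed.

Lemma comp_dn : comp (fun e => dn (B e) (l e) (W e)).
Proof. by rewrite /dn; cauto. Qed.

Lemma comp_dv0 : comp (fun e => dv0 (B e) (l e) (W e)).
Proof. by rewrite /dv0; cauto. Qed.

Lemma comp_s3 : comp (fun e => s3 (l e) (W e)).
Proof. by rewrite /s3; cauto. Qed.

Lemma comp_dow : comp (fun e => dow (B e) (l e) (W e) (u e)).
Proof. by rewrite /dow /s4 /s3 /skQ1; cauto. Qed.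

Lemma comp_s5 : comp (fun e => s5 (B e) (l e) (W e)).
Proof. by rewrite /s5 /s4 /s3 /skQ1; have := comp_dn => H; cauto. Qed.

Lemma comp_ded : comp (fun e => ded (B e) (l e) (W e) (u e) (v e) : nat).
Proof. by rewrite /ded; have := comp_dn => H; have := comp_s5 => H5; cauto. Qed.

Lemma comp_ecount : comp (fun e => ecount (B e) (l e) (W e) (u e)).
Proof. by rewrite /ecount; have := comp_s5 => H5; cauto. Qed.

Lemma comp_qabs : comp (fun e => qabs (B e) (l e) (W e) (Dl e) (s e)).
Proof. by rewrite /qabs /qden /qnum; cauto. Qed.

Lemma comp_qscale : comp (fun e => qscale (B e) (l e) (W e) (Dl e) (K e) (s e)).
Proof. by rewrite /qscale; have := comp_qabs => H; cauto. Qed.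

End ParserComp4.

Ltac cread4 := lazymatch goal with
  | |- comp (fun e => dp (@?B e) (@?l e) (@?W e)) => apply (@comp_dp _ B l W)
  | |- comp (fun e => dn (@?B e) (@?l e) (@?W e)) => apply (@comp_dn _ B l W)
  | |- comp (fun e => dv0 (@?B e) (@?l e) (@?W e)) => apply (@comp_dv0 _ B l W)
  | |- comp (fun e => s3 (@?l e) (@?W e)) => apply (@comp_s3 _ l W)
  | |- comp (fun e => s5 (@?B e) (@?l e) (@?W e)) => apply (@comp_s5 _ B l W)
  | |- comp (fun e => dow (@?B e) (@?l e) (@?W e) (@?u e)) => apply (@comp_dow _ B l W u)
  | |- comp (fun e => nat_of_bool (ded (@?B e) (@?l e) (@?W e) (@?u e) (@?v e))) =>
      apply (@comp_ded _ B l W u v)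
  | |- comp (fun e => ecount (@?B e) (@?l e) (@?W e) (@?u e)) => apply (@comp_ecount _ B l W u)
  | |- comp (fun e => qabs (@?B e) (@?l e) (@?W e) (@?D e) (@?s e)) => apply (@comp_qabs _ B l W s D)
  | |- comp (fun e => qscale (@?B e) (@?l e) (@?W e) (@?D e) (@?K e) (@?s e)) =>
      apply (@comp_qscale _ B l W s D K)
  end.
Ltac cuser ::= first [cread1 | cread2 | cread3 | cread4].

Section ParserComp5.
Variable k : nat.
Variables (B l W s Dl K j u v : Env k -> nat).
Hypothesis (HB : comp B) (Hl : comp l) (HW : comp W) (HDl : comp Dl) (HK : comp K)
  (Hj : comp j) (Hu : comp u) (Hv : comp v).

Lemma comp_dR : comp (fun e => dR (B e) (l e) (W e) (Dl e) (K e) (j e) (u e) (v e)).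
Proof. by rewrite /dR /rpos /s6; cauto. Qed.

Lemma comp_dX : comp (fun e => dX (B e) (l e) (W e) (Dl e) (K e) (j e)).
Proof. by rewrite /dX /s7 /s6; cauto. Qed.

Lemma comp_dY : comp (fun e => dY (B e) (l e) (W e) (Dl e) (K e) (j e)).
Proof. by rewrite /dY /s7 /s6; cauto. Qed.

End ParserComp5.

Ltac cread5 := lazymatch goal with
  | |- comp (fun e => dR (@?B e) (@?l e) (@?W e) (@?D e) (@?K e) (@?j e) (@?u e) (@?v e)) =>
      apply (@comp_dR _ B l W D K j u v)
  | |- comp (fun e => dX (@?B e) (@?l e) (@?W e) (@?D e) (@?K e) (@?j e)) => apply (@comp_dX _ B l W D K j)
  | |- comp (fun e => dY (@?B e) (@?l e) (@?W e) (@?D e) (@?K e) (@?j e)) => apply (@comp_dY _ B l W D K j)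
  end.
Ltac cuser ::= first [cread1 | cread2 | cread3 | cread4 | cread5].

(** Once unfolded, the formula is a tree of connectives and quantifiers below computable bounds over
    computable terms, so the closure rules apply node by node. *)
Lemma cdec_answer : cdec (fun e : Env 3 => answer e.1.1.2 e.1.2 e.2).
Proof.
rewrite /answer /chk /cboxN /cdevN /devN /lowN /circN /fRN /fsumN /fdig /connN /stpN /nxN /inS; cbv zeta.
by cauto.
Qed.

(** * Correctness of the reader *)

Lemma dig2_0 v (b : bool) : dig 2 (2 * v + b) 0 = b.
Proof. by rewrite /dig expn0 divn1 mulnC modnMDl; case: b. Qed.

Lemma dig2_S v (b : bool) j : dig 2 (2 * v + b) j.+1 = dig 2 v j.
Proof.
have E : (2 * v + b) %/ 2 = v by case: b; lia.
by rewrite /dig expnS divnMA E.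
Qed.

Lemma bt_nth w i : i < size w -> bt (size w) (wval 0 w) i = nth false w i.
Proof.
elim/last_ind: w => [|w b IH] //; rewrite size_rcons ltnS => Hi.
have -> : wval 0 (rcons w b) = 2 * wval 0 w + b by rewrite /wval -cats1 foldl_cat.
rewrite /bt /= nth_rcons; case: ltngtP Hi => // [Hi|->] _; last by rewrite subnn dig2_0; case: b.
rewrite -IH // /bt; have -> : size w - i = ((size w).-1 - i).+1 by lia.
by rewrite dig2_S.
Qed.

Lemma sum_bits (bs : seq bool) :
  \sum_(k < size bs) nth false bs k * 2 ^ k = foldr (fun (b : bool) x => b + 2 * x) 0 bs.
Proof.
elim: bs => [|b bs IH]; first by rewrite big_ord0.
rewrite /= big_ord_recl expn0 muln1 -IH big_distrr; congr (_ + _); apply: eq_bigr => k _.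
by rewrite /= expnS mulnCA.
Qed.

Lemma bin_value m : foldr (fun (b : bool) x => b + 2 * x) 0 (bin m) = m.
Proof.
have H f : forall m, m <= f -> foldr (fun (b : bool) x => b + 2 * x) 0 (binrec f m) = m.
  elim: f => [|f IH] [|k] //= Hk; rewrite IH; last by have := odd_double_half k.+1; rewrite /= -muln2; lia.
  by have := odd_double_half k.+1; rewrite -muln2 /= mulnC; lia.
exact: H.
Qed.

Definition encB (bs : seq bool) := flatten [seq [:: true; b] | b <- bs] ++ [:: false; false].

Lemma encB_spec bs r : [/\ size (encB bs ++ r) = 2 * size bs + 2 + size r,
  forall k, k < size bs -> nth false (encB bs ++ r) (2 * k) = true /\
     nth false (encB bs ++ r) (2 * k + 1) = nth false bs k,
  nth false (encB bs ++ r) (2 * size bs) = false & drop (2 * size bs + 2) (encB bs ++ r) = r].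
Proof.
elim: bs => [|b bs [h1 h2 h3 h4]]; first by rewrite /= drop0.
have E : encB (b :: bs) ++ r = [:: true, b & encB bs ++ r] by [].
rewrite E; split.
- by rewrite /= h1; lia.
- case=> [|k] //; rewrite [size _]/= ltnS => /h2[g1 g2].
  have -> : 2 * k.+1 + 1 = (2 * k + 1).+2 by lia.
  by have -> : 2 * k.+1 = (2 * k).+2 by lia.
- have -> : 2 * size (b :: bs) = (2 * size bs).+2 by rewrite /=; lia.
  by rewrite /= h3.
have -> : 2 * size (b :: bs) + 2 = (2 * size bs + 2).+2 by rewrite /=; lia.
by rewrite /= h4.
Qed.

Section Reading.
Variables (w : seq bool) (B : nat).
Local Notation l := (size w).
Local Notation W := (wval 0 w).

Lemma bt_drop s r i : drop s w = r -> i < size r -> bt l W (s + i) = nth false r i.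
Proof.
move=> <-; rewrite size_drop => Hi; rewrite nth_drop bt_nth //; lia.
Qed.

Lemma drop_cat_size s (r1 r2 : seq bool) : drop s w = r1 ++ r2 -> drop (s + size r1) w = r2.
Proof. by move=> H; rewrite addnC -drop_drop H drop_size_cat. Qed.

Hypothesis HB : 2 ^ l <= B.

Lemma encN_parse s m r : drop s w = encN m ++ r ->
  [/\ valN B l W s = m, drop (nxt l W s) w = r & m < 2 ^ l].
Proof.
have -> : encN m = encB (bin m) by [].
move=> Hd; have [h1 h2 h3 h4] := encB_spec (bin m) r; set bs := bin m in Hd h1 h2 h3 h4.
have bl : 2 * size bs + 2 <= l.
  have : size (drop s w) <= l by rewrite size_drop leq_subr.
  by rewrite Hd h1; lia.
(* At the terminator the test fails and the counter stops; all later rounds repeat the same failing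
   test, so running more rounds than there are pairs is harmless. *)
have cE j : rc j 0 (fun _ a => if bt l W (s + 2 * a) then a.+1 else a) = minn j (size bs).
  elim: j => [|j IH]; first by rewrite min0n.
  rewrite /= IH (bt_drop Hd) ?h1; last by lia.
  case: (ltnP j (size bs)) => Hj.
    by have [-> _] := h2 _ Hj; lia.
  by rewrite h3; lia.
have cntE : npairs l W s = size bs by rewrite /npairs cE; lia.
have vE : valN B l W s = m.
  rewrite /valN cntE -[RHS]bin_value -sum_bits; apply: eq_bigr => k _.
  have Hk := ltn_ord k; rewrite -addnA (bt_drop Hd) ?h1; last by lia.
  have [_ ->] := h2 _ Hk; congr (_ * _); apply/minn_idPl; apply: leq_trans HB.
  by rewrite leq_exp2l //; rewrite -/bs in Hk; lia.
split=> //.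
  by rewrite /nxt cntE -addnA -h4 -Hd drop_drop addnC.
rewrite -[m]bin_value -sum_bits -/bs; apply: (@leq_trans (2 ^ size bs)); last by rewrite leq_exp2l //; lia.
elim: (size bs) => [|k IH]; first by rewrite big_ord0.
rewrite big_ord_recr /= expnS; move: IH; move: (\sum_(i < k) _) (2 ^ k) => a c.
by case: (nth false bs k); rewrite ?mul1n ?mul0n; lia.
Qed.

Lemma encQ_parse s q r : drop s w = encQ q ++ r ->
  [/\ bt l W s = (numq q < 0)%R, qnum B l W s = `|numq q|%N, qden B l W s = `|denq q|%N,
      drop (skQ1 l W s) w = r & (`|numq q| < 2 ^ l)%N /\ (`|denq q| < 2 ^ l)%N].
Proof.
rewrite /encQ /encZ -catA => Hd.
have H1 : drop s.+1 w = encN `|numq q| ++ ((denq q < 0)%R :: encN `|denq q|) ++ r.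
  by rewrite -addn1; apply: (drop_cat_size (r1 := [:: (numq q < 0)%R])).
have [v1 d1 b1] := encN_parse H1.
have H2 : drop (nxt l W s.+1).+1 w = encN `|denq q| ++ r.
  by rewrite -addn1; apply: (drop_cat_size (r1 := [:: (denq q < 0)%R])).
have [v2 d2 b2] := encN_parse H2.
by split=> //; rewrite -[s in LHS]addn0 (bt_drop Hd).
Qed.

Lemma skN_parse s ms r k : drop s w = flatten (map encN ms) ++ r -> k <= size ms ->
  drop (skN l W s k) w = flatten (map encN (drop k ms)) ++ r.
Proof.
move=> Hd; elim: k => [|k IH] Hk; first by rewrite drop0.
have := IH (ltnW Hk); rewrite (drop_nth 0 Hk) /= -catA => /encN_parse[_ H _].
by rewrite -H.
Qed.

Lemma skN_val s ms r k : drop s w = flatten (map encN ms) ++ r -> k < size ms ->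
  valN B l W (skN l W s k) = nth 0 ms k.
Proof.
move=> Hd Hk; have := skN_parse Hd (ltnW Hk).
by rewrite (drop_nth 0 Hk) /= -catA => /encN_parse[].
Qed.

Lemma skQ_parse s qs r k : drop s w = flatten (map encQ qs) ++ r -> k <= size qs ->
  drop (skQ l W s k) w = flatten (map encQ (drop k qs)) ++ r.
Proof.
move=> Hd; elim: k => [|k IH] Hk; first by rewrite drop0.
have := IH (ltnW Hk); rewrite (drop_nth 0%R Hk) /= -catA => /encQ_parse[_ _ _ H _].
by rewrite -H.
Qed.

Lemma skQ_val s qs r k : drop s w = flatten (map encQ qs) ++ r -> k < size qs ->
  exists r', drop (skQ l W s k) w = encQ (nth 0%R qs k) ++ r'.
Proof.
move=> Hd Hk; have := skQ_parse Hd (ltnW Hk).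
by rewrite (drop_nth 0%R Hk) /= -catA; eexists; eauto.
Qed.

End Reading.

Lemma nth_pairs (S T : Type) (x0 : S) (y0 : T) s t i j : i < size s -> j < size t ->
  nth (x0, y0) [seq (x, y) | x <- s, y <- t] (i * size t + j) = (nth x0 s i, nth y0 t j).
Proof.
elim: s i => [|x s IH] [|i] //= Hi Hj; rewrite nth_cat size_map.
  by rewrite mul0n add0n Hj (nth_map y0).
by rewrite mulSn -addnA ltnNge leq_addr /= addKn IH.
Qed.

Lemma count_sum (es : seq bool) m : m <= size es ->
  \sum_(i < m) nth false es i = count id (take m es).
Proof.
elim: m => [|m IH] Hm; first by rewrite big_ord0 take0.
by rewrite big_ord_recr /= (IH (ltnW Hm)) (take_nth false Hm) -cats1 count_cat /= addn0.
Qed.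

Lemma flatten_encQ (T : Type) (f : T -> seq rat) s :
  flatten [seq flatten (map encQ (f x)) | x <- s] = flatten (map encQ (flatten (map f s))).
Proof. by elim: s => //= x s ->; rewrite map_cat flatten_cat. Qed.

Lemma size_flatten_encN (s : seq nat) : 2 * size s <= size (flatten (map encN s)).
Proof.
elim: s => // m s IH; have -> : flatten (map encN (m :: s)) = encN m ++ flatten (map encN s) by [].
have : 2 <= size (encN m) by rewrite /encN size_cat leq_addl.
by rewrite size_cat [size (m :: s)]/=; lia.
Qed.

Lemma size_flatten_encQ (s : seq rat) : size s <= size (flatten (map encQ s)).
Proof.
elim: s => // q s IH; have -> : flatten (map encQ (q :: s)) = encQ q ++ flatten (map encQ s) by [].
have : 0 < size (encQ q) by [].
by rewrite size_cat [size (q :: s)]/=; lia.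
Qed.

Section ReadInstance.
Variables (I : instance) (B : nat).
Local Notation G := (igame I).
Local Notation n := (nv G).
Local Notation p := (np G).
Local Notation w := (enc I).
Local Notation l := (size w).
Local Notation W := (wval 0 w).
Hypothesis HB : 2 ^ l <= B.

Let pl := [seq (u, v) | u <- enum 'I_n, v <- enum 'I_n].
Let es := [seq edge G pr.1 pr.2 | pr <- pl].
Let rl1 (pr : 'I_n * 'I_n) := if edge G pr.1 pr.2 then [seq rew G j pr.1 pr.2 | j <- enum 'I_p] else [::].
Let rl := flatten (map rl1 pl).
Let xl := flatten [seq [:: ix I j; iy I j] | j <- enum 'I_p].
Let ms := [seq val (own G v) | v <- enum 'I_n].

Lemma encE : w = encN p ++ encN n ++ encN (iv0 I) ++ encQ (ieps I) ++ flatten (map encN ms) ++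
  es ++ flatten (map encQ rl) ++ flatten (map encQ xl).
Proof.
rewrite /enc; congr (_ ++ (_ ++ (_ ++ (_ ++ (_ ++ (_ ++ (_ ++ _))))))).
- by rewrite /ms -map_comp.
- by rewrite /es /pl map_allpairs.
- rewrite /rl -flatten_encQ /pl map_allpairs; congr flatten.
  apply: eq_allpairs => u v; rewrite /rl1 /=.
  by case: (edge G u v) => //; rewrite -map_comp.
by rewrite /xl -flatten_encQ; congr flatten; apply: eq_map => j /=; rewrite cats0.
Qed.

Lemma size_pl : size pl = n * n.
Proof. by rewrite size_allpairs size_enum_ord. Qed.

Lemma size_ms : size ms = n.
Proof. by rewrite /ms size_map size_enum_ord. Qed.

Lemma nth_pl (u v : 'I_n) : nth (u, v) pl (u * n + v) = (u, v).
Proof.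
by have := @nth_pairs _ _ u v (enum 'I_n) (enum 'I_n) u v; rewrite !size_enum_ord !nth_ord_enum; apply.
Qed.

Lemma read_prefix : [/\ dp B l W = p, dn B l W = n, dv0 B l W = iv0 I,
    drop (s3 l W) w = encQ (ieps I) ++ flatten (map encN ms) ++
      es ++ flatten (map encQ rl) ++ flatten (map encQ xl) &
    drop (s4 l W) w = flatten (map encN ms) ++ es ++ flatten (map encQ rl) ++ flatten (map encQ xl)].
Proof.
have H0 : drop 0 w = w by rewrite drop0.
rewrite [RHS]encE in H0; have [e1 H1 _] := encN_parse HB H0; have [e2 H2 _] := encN_parse HB H1.
have [e3 H3 _] := encN_parse HB H2; have [_ _ _ H4 _] := encQ_parse HB H3.
by split.
Qed.

Let dnE : dn B l W = n. Proof. by have [] := read_prefix. Qed.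
Let dpE : dp B l W = p. Proof. by have [] := read_prefix. Qed.

Lemma read_own (v : 'I_n) : dow B l W v = own G v.
Proof.
have [_ _ _ _ H4] := read_prefix.
rewrite /dow (skN_val HB H4) ?size_ms //.
by rewrite (nth_map v) ?size_enum_ord // nth_ord_enum.
Qed.

Lemma drop_s5 : drop (s5 B l W) w = es ++ flatten (map encQ rl) ++ flatten (map encQ xl).
Proof.
have [_ _ _ _ H4] := read_prefix; rewrite /s5 dnE (skN_parse HB H4) ?size_ms //.
by rewrite drop_oversize // size_ms.
Qed.

Lemma drop_s6 : drop (s6 B l W) w = flatten (map encQ rl) ++ flatten (map encQ xl).
Proof.
by rewrite /s6 dnE; have := drop_cat_size drop_s5; rewrite size_map size_pl.
Qed.

Lemma read_edge (u v : 'I_n) : ded B l W u v = edge G u v.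
Proof.
have Hi : u * n + v < n * n by have := ltn_ord u; have := ltn_ord v; nia.
rewrite /ded dnE (bt_drop drop_s5); last by rewrite size_cat size_map size_pl; lia.
by rewrite nth_cat size_map size_pl Hi (nth_map (u, v)) ?size_pl // nth_pl.
Qed.

Lemma ecountE m : m <= n * n -> ecount B l W m = count id (take m es).
Proof.
move=> Hm; rewrite -count_sum ?size_map ?size_pl //; apply: eq_bigr => i _; congr nat_of_bool.
have Hi : i < n * n by apply: leq_trans (ltn_ord i) Hm.
rewrite (bt_drop drop_s5); last by rewrite size_cat size_map size_pl; lia.
by rewrite nth_cat size_map size_pl Hi.
Qed.

Lemma size_rl (s : seq ('I_n * 'I_n)) :
  size (flatten (map rl1 s)) = count id [seq edge G pr.1 pr.2 | pr <- s] * p.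
Proof.
elim: s => //= pr s IH; rewrite size_cat IH /rl1 mulnDl; congr (_ + _).
by case: (edge G pr.1 pr.2); rewrite ?mul1n ?mul0n // size_map size_enum_ord.
Qed.

Lemma read_rew (j : 'I_p) (u v : 'I_n) : edge G u v ->
  exists r, drop (rpos B l W j u v) w = encQ (rew G j u v) ++ r.
Proof.
move=> Euv; have Hi : u * n + v < n * n by have := ltn_ord u; have := ltn_ord v; nia.
(* Every edge before the pair contributes one reward per player, which gives the number of rationals
   to skip. *)
rewrite /rpos dnE dpE ecountE ?(ltnW Hi) // -map_take -size_rl.
set m := u * n + v in Hi *.
have rE : rl = flatten (map rl1 (take m pl)) ++ [seq rew G j u v | j <- enum 'I_p] ++
    flatten (map rl1 (drop m.+1 pl)).
  rewrite /rl -{1}(cat_take_drop m pl) map_cat flatten_cat; congr (_ ++ _).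
  by rewrite (drop_nth (u, v)) ?size_pl //= nth_pl /rl1 /= Euv.
have jp : j < size [seq rew G j u v | j <- enum 'I_p] by rewrite size_map size_enum_ord.
have [|r] := skQ_val HB drop_s6 (k := size (flatten (map rl1 (take m pl))) + j).
  by rewrite rE !size_cat; lia.
rewrite {1}rE nth_cat ltnNge leq_addr /= addKn nth_cat jp (nth_map j) ?size_enum_ord // nth_ord_enum.
by exists r.
Qed.

Lemma size_xl (s : seq 'I_p) : size (flatten [seq [:: ix I j; iy I j] | j <- s]) = 2 * size s.
Proof. by elim: s => //= j s ->; lia. Qed.

Lemma drop_s7 : drop (s7 B l W) w = flatten (map encQ xl).
Proof.
rewrite /s7 dnE dpE ecountE //.
have -> : take (n * n) es = es by rewrite take_oversize // size_map size_pl.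
have szE : count id es * p = size rl by rewrite /rl size_rl.
by rewrite szE (skQ_parse HB drop_s6) // drop_oversize.
Qed.

Lemma nth_xl (s : seq 'I_p) k : k < size s -> forall j0,
  nth 0%R (flatten [seq [:: ix I j; iy I j] | j <- s]) (2 * k) = ix I (nth j0 s k) /\
  nth 0%R (flatten [seq [:: ix I j; iy I j] | j <- s]) (2 * k).+1 = iy I (nth j0 s k).
Proof.
elim: s k => [|j s IH] [|k] // Hk j0.
have -> : 2 * k.+1 = (2 * k).+2 by lia.
exact: (IH k Hk j0).
Qed.

Lemma read_xy (j : 'I_p) :
  (exists r, drop (skQ l W (s7 B l W) (2 * j)) w = encQ (ix I j) ++ r) /\
  (exists r, drop (skQ l W (s7 B l W) (2 * j).+1) w = encQ (iy I j) ++ r).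
Proof.
have H7 : drop (s7 B l W) w = flatten (map encQ xl) ++ [::] by rewrite cats0 drop_s7.
have js : j < size (enum 'I_p) by rewrite size_enum_ord.
have [E1 E2] := nth_xl js j; rewrite nth_ord_enum in E1 E2; have Hj := ltn_ord j.
split.
  have [|r] := skQ_val HB H7 (k := 2 * j); first by rewrite size_xl size_enum_ord; lia.
  by rewrite E1; exists r.
have [|r] := skQ_val HB H7 (k := (2 * j).+1); first by rewrite size_xl size_enum_ord; lia.
by rewrite E2; exists r.
Qed.

Lemma enc_size : n <= l /\ p <= l.
Proof.
have H1 := size_flatten_encN ms; rewrite size_ms in H1.
have H2 := size_flatten_encQ xl; rewrite size_xl size_enum_ord in H2.
rewrite [in size _]encE !(size_cat (encN _)) size_cat (size_cat (flatten _)) (size_cat es) (size_cat (flatten _)).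
move: H1 H2; move: (size (flatten _)) (size (flatten _)) => c d; lia.
Qed.

End ReadInstance.

(** * Scaling and bounds *)

Section Scaling.
Variables (w : seq bool) (B Dl : nat).
Local Notation l := (size w).
Local Notation W := (wval 0 w).
Hypothesis HB : 2 ^ l <= B.
Hypothesis Dl0 : 0 < Dl.
Hypothesis Dldvd : forall i, i < 2 ^ l -> Dl %% i.+1 = 0.

Lemma den_dvd (d : nat) : 0 < d -> d < 2 ^ l -> Dl = Dl %/ d * d.
Proof.
move=> d0 dl; have dE : d.-1.+1 = d by rewrite prednK.
by rewrite {1}(divn_eq Dl d) -{3}dE Dldvd ?addn0 //; apply: leq_ltn_trans dl; exact: leq_pred.
Qed.

Lemma qabs_spec s q r : drop s w = encQ q ++ r ->
  qabs B l W Dl s <= Dl * 2 ^ l /\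
  (`|ratr q : RR| = (qabs B l W Dl s)%:R / Dl%:R)%R.
Proof.
move=> /(encQ_parse HB)[_ e1 e2 _ [b1 b2]]; rewrite /qabs e1 e2; split.
  by apply: leq_mul; [exact: leq_div | exact: ltnW].
have d0 : 0 < `|denq q|%N by rewrite absz_gt0 denq_neq0.
have DE := den_dvd d0 b2.
have dR : (0 < (`|denq q|%N)%:R :> RR)%R by rewrite ltr0n.
have DR : (0 < (Dl %/ `|denq q|)%:R :> RR)%R.
  by rewrite ltr0n lt0n; apply/eqP => E0; move: Dl0; rewrite DE E0.
rewrite {2}DE !natrM /ratr normrM normfV -!intr_norm -!abszE -!pmulrn.
by field; rewrite !gt_eqF.
Qed.

Lemma qscale_spec s q r : drop s w = encQ q ++ r ->
  qscale B l W Dl (2 ^ l) s <= 2 * Dl * 2 ^ l /\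
  (ratr q = (qscale B l W Dl (2 ^ l) s)%:R / Dl%:R - (2 ^ l)%:R :> RR)%R.
Proof.
move=> Hd; have [h1 h2] := qabs_spec Hd; have [e0 _ _ _ _] := encQ_parse HB Hd.
have DR : (0 < Dl%:R :> RR)%R by rewrite ltr0n.
rewrite /qscale e0; case: ifP => sg; split.
- by lia.
- rewrite natrB // natrM mulrBl -h2 mulrAC divff ?gt_eqF // mul1r addrC addKr.
  by rewrite ler0_norm ?opprK // ltW // ltrq0 -numq_lt0.
- by lia.
- rewrite natrD natrM mulrDl -h2 mulrAC divff ?gt_eqF // mul1r addrC addKr.
  by rewrite ger0_norm // ler0q -numq_ge0 leNgt sg.
Qed.

End Scaling.

Lemma fact_expn m : m`! <= m ^ m.
Proof.
elim: m => // m IH; rewrite factS expnS leq_mul2l /=; apply: leq_trans IH _.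
by case: m => // m; rewrite leq_exp2r.
Qed.

(** The bounds below have the form [2 ^ 2 ^ a] with [a] at most this quadratic expression in [t];
    hence the exponent 6 in the search bound. *)
Lemma exponent_lt l (t := l.+2) : t * t + 6 * t + 3 < t ^ 6.
Proof.
have t2 : 2 <= t by [].
clearbody t.
have -> : t ^ 6 = t * t * (t * t) * (t * t) by rewrite !expnS expn0; lia.
have : 4 <= t * t by nia.
have : t <= t * t by nia.
move: (t * t) => x tx x4; have : 16 * x <= x * x * x by nia.
by lia.
Qed.

Section Bounds.
Variables (G : game) (l : nat).
Hypothesis nl : nv G <= l.
Hypothesis pl : np G <= l.
Hypothesis n0 : 0 < nv G.
Local Notation n := (nv G).
Local Notation t := l.+2.
Local Notation N := (2 ^ n * n).
Local Notation Dl := ((2 ^ l)`!).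
Local Notation M0 := (2 * Dl * 2 ^ l).
Local Notation e2 a := (2 ^ (2 ^ a)).

Lemma n_exp : n <= 2 ^ l. Proof. by apply: leq_trans nl _; apply: ltnW; exact: ltn_exp2. Qed.

Lemma N_bound : N <= 2 ^ (2 * l).
Proof. by rewrite mul2n -addnn expnD; apply: leq_mul; [rewrite leq_exp2l | exact: n_exp]. Qed.

Lemma mask_bound : 2 ^ N <= e2 (2 * l).
Proof. by rewrite leq_exp2l // N_bound. Qed.

Lemma tau_bound : n.+1 ^ (N * n) <= e2 (4 * l).
Proof.
apply: leq_trans (_ : (2 ^ n) ^ (N * n) <= _).
  by rewrite leq_exp2r ?muln_gt0 ?expn_gt0 ?n0 //; exact: ltn_exp2.
rewrite -expnM leq_exp2l //; apply: leq_trans (_ : 2 ^ l * (2 ^ (2 * l) * 2 ^ l) <= _).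
  by apply: leq_mul n_exp _; apply: leq_mul N_bound n_exp.
by rewrite -!expnD leq_exp2l //; lia.
Qed.

Lemma Dl_bound : Dl <= e2 (2 * l).
Proof.
apply: leq_trans (fact_expn _) _; rewrite -expnM leq_exp2l // mul2n -addnn expnD leq_mul2r.
by rewrite (ltnW (ltn_exp2 l)) orbT.
Qed.

Lemma M0_bound : M0 <= e2 (2 * t).
Proof.
apply: leq_trans (_ : 2 ^ 1 * e2 (2 * l) * 2 ^ l <= _).
  by apply: leq_mul => //; apply: leq_mul => //; exact: Dl_bound.
rewrite -!expnD leq_exp2l //.
have -> : 2 * t = 2 * l + 4 by lia.
rewrite [2 ^ (_ + 4)]expnD; have := ltn_exp2 l; have : 2 ^ l <= 2 ^ (2 * l) by rewrite leq_exp2l //; lia.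
by lia.
Qed.

(** The sets of vertex pairs dominate with [2 ^ (n * n)]; the number of rows stays exponential
    because blocks are indexed by such sets and not by opponents. *)
Lemma RT_bound (V := 'I_n) (P := 'I_(np G)) (MS := 'I_(2 ^ n)) :
  #|{: (V + ((V * MS * {set V * V}) + P) * (((bool * bool) + (bool * V)) + V + P))%type}| <= 2 ^ (t * t).
Proof.
have cs : #|{: {set V * V}}| = 2 ^ (n * n).
  by rewrite -cardsT -powersetT card_powerset cardsT card_prod !card_ord.
rewrite !(card_sum, card_prod, card_bool, card_ord) cs.
have H1 : n * 2 ^ n * 2 ^ (n * n) + np G <= 2 ^ (l * l + 2 * l + 1).
  rewrite !addn1 expnS mul2n -addnn; apply: leq_add.
    have -> : l * l + 2 * l = l + l + l * l by lia.
    rewrite !expnD; apply: leq_mul; first by apply: leq_mul; [exact: n_exp | rewrite leq_exp2l].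
    by rewrite leq_exp2l // leq_mul.
  by apply: leq_trans pl _; apply: leq_trans (ltnW (ltn_exp2 l)) _; rewrite leq_exp2l //; lia.
have H2 : 2 * 2 + 2 * n + n + np G <= 2 ^ (l + 2).
  by rewrite expnD; have := ltn_exp2 l; lia.
apply: leq_trans (_ : 2 ^ l + 2 ^ (l * l + 2 * l + 1) * 2 ^ (l + 2) <= _).
  by apply: leq_add; [exact: n_exp | exact: leq_mul].
rewrite -expnD; apply: leq_trans (_ : 2 ^ (l * l + 2 * l + 1 + (l + 2)).+1 <= _).
  have : 2 ^ l <= 2 ^ (l * l + 2 * l + 1 + (l + 2)) by rewrite leq_exp2l //; lia.
  by rewrite [2 ^ _.+1]expnS; lia.
by rewrite leq_exp2l //; lia.
Qed.

Lemma cbound_le : (cbound G M0).+1 <= e2 (t * t + 2 * t + 3).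
Proof.
rewrite /cbound; set m := #|_|; have Hm : m <= 2 ^ (t * t) := RT_bound.
have HX : #|{: 'I_n * 'I_(2 ^ n)}| <= 2 ^ (2 * l) by rewrite card_prod !card_ord mulnC N_bound.
have H : m`! * (#|{: 'I_n * 'I_(2 ^ n)}| * M0) ^ m <= e2 (t * t + 2 * t + 2).
  apply: leq_trans (_ : (2 ^ (t * t)) ^ m * (2 ^ (2 * l) * e2 (2 * t)) ^ m <= _).
    apply: leq_mul.
      by apply: leq_trans (fact_expn _) _; case: (m) Hm => // m' Hm; rewrite leq_exp2r.
    by case: (m) => // m'; rewrite leq_exp2r //; apply: leq_mul HX M0_bound.
  rewrite -expnMn -!expnD -expnM leq_exp2l //.
  have -> : t * t + 2 * t + 2 = (2 * t + 2) + t * t by lia.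
  rewrite [2 ^ (_ + t * t)]expnD; apply: leq_mul => //.
  rewrite [2 ^ (_ + 2)]expnD; have : 2 * l < 2 ^ (2 * t) by apply: leq_ltn_trans (ltn_exp2 _); lia.
  have : t * t <= 2 ^ (2 * t) by rewrite mul2n -addnn expnD; apply: leq_mul; apply: ltnW; exact: ltn_exp2.
  by lia.
apply: leq_ltn_trans H _; rewrite !ltn_exp2l //; lia.
Qed.

Lemma digits_bound : (cbound G M0).+1 ^ (N * N) <= e2 (t * t + 6 * t + 3).
Proof.
apply: leq_trans (_ : e2 (t * t + 2 * t + 3) ^ (2 ^ (2 * l) * 2 ^ (2 * l)) <= _).
  apply: leq_trans (_ : e2 (t * t + 2 * t + 3) ^ (N * N) <= _).
    by rewrite leq_exp2r ?cbound_le // !muln_gt0 expn_gt0 n0.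
  by rewrite leq_pexp2l ?expn_gt0 //; apply: leq_mul; exact: N_bound.
by rewrite -expnM -!expnD !leq_exp2l //; lia.
Qed.

End Bounds.

Lemma answer_correct (I : instance) (l := size (enc I)) : valid_instance I ->
  answer l (wval 0 (enc I)) (2 ^ (2 ^ (l.+2 ^ 6))) <-> threshold_yes I.
Proof.
move=> HI; set W := wval 0 (enc I); set B := 2 ^ _; pose G := igame I.
have n0 : 0 < nv G by exact: leq_ltn_trans (ltn_ord (iv0 I)).
have HlE := exponent_lt l.
have eB a : a <= l.+2 * l.+2 + 6 * l.+2 + 3 -> 2 ^ (2 ^ a) < B.
  by move=> Ha; rewrite /B !ltn_exp2l //; exact: leq_ltn_trans HlE.
have lB : 2 ^ l <= B.
  apply: leq_trans (ltnW (eB (2 * l) _)); last by lia.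
  by rewrite leq_exp2l //; apply: leq_trans (ltnW (ltn_exp2 l)) _; rewrite leq_exp2l //; lia.
have [nl pl] := enc_size lB; rewrite -/l in nl pl.
have [dpE dnE dvE H3 _] := read_prefix lB; rewrite -/l -/W in dpE dnE dvE H3.
have B1 : 2 ^ (2 ^ nv G * nv G) <= B.
  by apply: leq_trans (mask_bound nl) (ltnW (eB _ _)); lia.
have B2 : (nv G).+1 ^ (2 ^ nv G * nv G * nv G) <= B.
  by apply: leq_trans (tau_bound nl pl n0) (ltnW (eB _ _)); lia.
have KE : minn (2 ^ l) B = 2 ^ l by apply/minn_idPl.
have M2E : minn (2 ^ nv G) B = 2 ^ nv G.
  by apply/minn_idPl; apply: leq_trans lB; rewrite leq_exp2l.
have owE (v : 'I_(nv G)) : dow B l W v = own G v by exact: read_own.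
have edE (u v : 'I_(nv G)) : ded B l W u v = edge G u v by exact: read_edge.
pose Rn Dl (j : 'I_(np G)) (u v : 'I_(nv G)) := dR B l W Dl (2 ^ l) j u v.
pose Xb Dl (j : 'I_(np G)) := dX B l W Dl (2 ^ l) j.
pose Yb Dl (j : 'I_(np G)) := dY B l W Dl (2 ^ l) j.
pose E Dl := qabs B l W Dl (s3 l W).
have spec Dl : 0 < Dl -> (forall i, i < 2 ^ l -> Dl %% i.+1 = 0) ->
  [/\ forall j u v, Rn Dl j u v <= 2 * Dl * 2 ^ l /\
      (edge G u v -> rw j u v = ((Rn Dl j u v)%:R / Dl%:R - (2 ^ l)%:R)%R),
    E Dl <= 2 * Dl * 2 ^ l /\ (ratr (ieps I) = (E Dl)%:R / Dl%:R :> RR)%R,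
    forall j, Xb Dl j <= 2 * Dl * 2 ^ l /\ (ratr (ix I j) = (Xb Dl j)%:R / Dl%:R - (2 ^ l)%:R :> RR)%R &
    forall j, Yb Dl j <= 2 * Dl * 2 ^ l /\ (ratr (iy I j) = (Yb Dl j)%:R / Dl%:R - (2 ^ l)%:R :> RR)%R].
  move=> Dl0 Dd; split.
  - move=> j u v; rewrite /Rn /dR edE; case: ifP => // Euv.
    have [r Hr] := read_rew lB j Euv.
    by have [h1 h2] := qscale_spec lB Dl0 Dd Hr; split=> // _; rewrite /rw h2.
  - have [h1 h2] := qabs_spec lB Dl0 Dd H3; split; first by apply: leq_trans h1 _; rewrite -mulnA leq_pmull.
    by rewrite -h2 ger0_norm // ler0q; have [] := HI.
  - by move=> j; have [[r Hr] _] := read_xy lB j; exact: (qscale_spec lB Dl0 Dd Hr).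
  by move=> j; have [_ [r Hr]] := read_xy lB j; exact: (qscale_spec lB Dl0 Dd Hr).
rewrite /answer KE dpE dnE dvE M2E; split.
  move=> [Dl [_ [Dl0 [Dd Hc]]]]; have [sR [_ sE] sX sY] := spec Dl Dl0 Dd.
  apply: (@cert_threshold I (Rn Dl) (E Dl) (Xb Dl) (Yb Dl) Dl (2 ^ l) Dl0 _ sE _ _ B).
  - by move=> j u v; have [_] := sR j u v.
  - by move=> j; have [] := sX j.
  - by move=> j; have [] := sY j.
  exact: (chk_cert owE edE _ _ _ B1 B2 Hc).
(* The factorial is divisible by all numbers up to [2 ^ l], in particular by every denominator that
   fits into the word. *)
move=> Hy; pose Dl := (2 ^ l)`!.
have Dl0 : 0 < Dl by exact: fact_gt0.
have Dd i : i < 2 ^ l -> Dl %% i.+1 = 0 by move=> Hi; apply/eqP; rewrite -/(dvdn _ _) dvdn_fact.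
have [sR [EM sE] sX sY] := spec Dl Dl0 Dd.
exists Dl; split; first by apply: leq_ltn_trans (Dl_bound l) (eB _ _); lia.
split=> //; split=> //.
have M00 : 0 < 2 * Dl * 2 ^ l by rewrite !muln_gt0 Dl0 expn_gt0.
have cF := cbound_le nl pl n0; have dF := digits_bound nl pl n0.
have Hc : cert (iv0 I) (Rn Dl) (E Dl) (Xb Dl) (Yb Dl) (cbound G (2 * Dl * 2 ^ l)).
  apply: (@threshold_cert I HI (Rn Dl) (E Dl) (Xb Dl) (Yb Dl) Dl (2 ^ l)) => //.
  - by move=> j u v; have [_] := sR j u v.
  - by move=> j; have [] := sX j.
  - by move=> j; have [] := sY j.
  - by move=> j u v; have [] := sR j u v.
  - by move=> j; have [] := sX j.
  - by move=> j; have [] := sY j.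
apply: (@cert_chk G (iv0 I) (Rn Dl) (E Dl) (Xb Dl) (Yb Dl) B) Hc => //.
- by apply: leq_ltn_trans cF (eB _ _); lia.
- by apply: leq_trans dF (ltnW (eB _ _)).
apply: leq_trans (ltnW (eB _ (leqnn _))); apply: leq_trans dF; rewrite leq_pexp2l //.
have x0 : 0 < 2 ^ nv G by rewrite expn_gt0.
have xn : 0 < 2 ^ nv G * nv G by rewrite muln_gt0 x0.
exact: leq_trans (leq_pmull (nv G) x0) (leq_pmulr _ xn).
Qed.

(* The epsilon-SPE threshold problem is decided by a (single-tape, binary)
   Turing machine in time 2^(2^poly(n)) on binary-encoded legal instances. *)
Theorem mainTheorem12 :
  exists (M : TM) (k : nat),
    forall I : instance, valid_instance I ->
      decides_within M (enc I) (2 ^ (2 ^ ((size (enc I)).+1 ^ k)))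
                     (threshold_yes I).
Proof.
have [M [k HM]] := cdec_tm 6 cdec_answer.
exists M, k => I HI; have [|m [c [h1 [h2 [h3 h4]]]]] := HM (enc I).
  by rewrite /enc size_cat ltn_addr // /encN size_cat addn2.
exists m, c; split=> //; split=> //; split=> //.
exact: iff_trans h4 (answer_correct HI).
Qed.
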